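(* Let $m\ge0$ be an integer and let $\mathbf{x}_0:[0,\infty)\to\mathbb{R}^3$, $\mathbf{x}_0=(x_0^1,x_0^2,x_0^3)$, satisfy $\partial_s^2\mathbf{x}_0\in H^{2+m}(\mathbb{R}_+)$, $|\partial_s\mathbf{x}_0(s)|=1$ for all $s\ge0$, $x_0^3(0)=0$, and suppose that $\mathbf{v}_0:=\partial_s\mathbf{x}_0$ satisfies the compatibility condition $(A)_{[(2+m)/2]}$. Then there exists a unique solution $\mathbf{x}(s,t)$ of \[ \mathbf{x}_t=\mathbf{x}_s\times\mathbf{x}_{ss}\ (s>0,\ t>0),\qquad \mathbf{x}(s,0)=\mathbf{x}_0(s)\ (s>0),\qquad \mathbf{x}_s(0,t)=\mathbf{e}_3\ (t>0) \] such that \[ \mathbf{x}-\mathbf{x}_0\in C\bigl([0,\infty);H^{4+m}(\mathbb{R}_+)\bigr)\cap C^1\bigl([0,\infty);H^{2+m}(\mathbb{R}_+)\bigr), \] and $|\mathbf{x}_s|\equiv1$.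
   Context: $\mathbb{R}_+=\{s>0\}$; $H^k(\mathbb{R}_+)$ is the $L^2$-Sobolev space of order $k$; $C^j([0,\infty);X)$ denotes $j$ times continuously differentiable functions of $t$ with values in the Banach space $X$; vector-valued functions belong to a function space if each component does. $\mathbf{e}_3=(0,0,1)$, $\times$ is the cross product in $\mathbb{R}^3$, subscripts denote partial derivatives. $[r]$ is the largest integer not exceeding $r$. For $n\in\{0,1,2,\dots\}$, a function $\mathbf{v}_0:[0,\infty)\to\mathbb{R}^3$ satisfies the compatibility condition $(A)_n$ if for every $0\le k\le n$: when $k=0$, $\mathbf{v}_0(0)=\mathbf{e}_3$; when $k\ge1$, $\bigl(\mathbf{v}_0\times\partial_s^{2k}\mathbf{v}_0\bigr)\big|_{s=0}=\mathbf{0}$ (traces at $s=0$). *)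

(* Defs.v *)
From HB Require Import structures.
From mathcomp Require Import all_boot all_order all_algebra.
From mathcomp Require Import all_classical all_reals all_analysis.
Set Implicit Arguments. Unset Strict Implicit. Unset Printing Implicit Defensive.
Import Order.TTheory GRing.Theory Num.Theory.
Import numFieldNormedType.Exports.
Local Open Scope classical_set_scope.
Local Open Scope ring_scope.

Section Defs.
Variable R : realType.

Definition vec := (R * R * R)%type.
Definition vc (i : nat) (v : vec) : R :=
  match i with 0 => v.1.1 | 1 => v.1.2 | _ => v.2 end.
Definition e3 : vec := (0, 0, 1).
Definition cross (a b : vec) : vec :=
  (vc 1 a * vc 2 b - vc 2 a * vc 1 b,
   vc 2 a * vc 0 b - vc 0 a * vc 2 b,
   vc 0 a * vc 1 b - vc 1 a * vc 0 b).
Definition vnorm (a : vec) : R :=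
  Num.sqrt (vc 0 a ^+ 2 + vc 1 a ^+ 2 + vc 2 a ^+ 2).

Definition Rpos : set R := [set x | 0 < x].

Definition L2 (f : R -> R) : Prop :=
  measurable_fun Rpos f /\
  (\int[@lebesgue_measure R]_(x in Rpos) ((f x) ^+ 2)%:E < +oo)%E.

Definition test_fun (phi : R -> R) : Prop :=
  (forall n x, derivable (derive1n n phi) x 1) /\
  exists a b, 0 < a /\ a < b /\ forall x, (x < a \/ b < x) -> phi x = 0.

Definition is_weak_deriv (f g : R -> R) : Prop :=
  forall phi, test_fun phi ->
  (\int[@lebesgue_measure R]_(x in Rpos) (f x * (derive1 phi) x)%:E
   = - \int[@lebesgue_measure R]_(x in Rpos) (g x * phi x)%:E)%E.

Definition weak_chain (k : nat) (f : R -> R) (g : nat -> R -> R) : Prop :=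
  g 0%N = f /\ (forall j, (j <= k)%N -> L2 (g j)) /\
  (forall j, (j < k)%N -> is_weak_deriv (g j) (g j.+1)).

Definition Hk_sq_le (k : nat) (f : R -> R) (e : R) : Prop :=
  exists g, weak_chain k f g /\
  (\sum_(j < k.+1) \int[@lebesgue_measure R]_(x in Rpos) ((g j x) ^+ 2)%:E
     <= e%:E)%E.

Definition inH (k : nat) (f : R -> R) : Prop := exists e, Hk_sq_le k f e.

Definition CH (k : nat) (u : R -> R -> R) : Prop :=
  (forall t, 0 <= t -> inH k (u t)) /\
  forall t0, 0 <= t0 -> forall e, 0 < e -> exists d, 0 < d /\
    forall t, 0 <= t -> `|t - t0| < d -> Hk_sq_le k (fun s => u t s - u t0 s) e.

Definition C1H (k : nat) (u : R -> R -> R) : Prop :=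
  exists w, CH k u /\ CH k w /\
  forall t0, 0 <= t0 -> forall e, 0 < e -> exists d, 0 < d /\
    forall t, 0 <= t -> t != t0 -> `|t - t0| < d ->
      Hk_sq_le k (fun s => (u t s - u t0 s) / (t - t0) - w t0 s) e.

Definition trace0 (f : R -> R) (c : R) : Prop :=
  exists h : R -> R, (forall x, 0 < x -> {for x, continuous h}) /\
    h x @[x --> 0^'+] --> c /\
    {ae @lebesgue_measure R, forall x, Rpos x -> h x = f x}.

Definition wtrace (j : nat) (f : R -> R) (c : R) : Prop :=
  exists g, weak_chain j f g /\ trace0 (g j) c.

Definition sderiv (f : R -> R) (s l : R) : Prop :=
  (0 < s /\ (fun h => h^-1 * (f (s + h) - f s)) @ 0^' --> l) \/
  (s = 0 /\ (fun h => h^-1 * (f (s + h) - f s)) @ 0^'+ --> l).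
Definition vsderiv (f : R -> vec) (s : R) (l : vec) : Prop :=
  forall i, (i < 3)%N -> sderiv (fun r => vc i (f r)) s (vc i l).

Definition vtderiv (f : R -> vec) (t : R) (l : vec) : Prop :=
  forall i, (i < 3)%N ->
    (fun h => h^-1 * (vc i (f (t + h)) - vc i (f t))) @ 0^' --> vc i l.

(* compatibility condition (A)_n for v0, given a0 = d_s v0;
   d_s^{2k} v0 = d_s^{2k-1} a0 *)
Definition compatA (n : nat) (v0 a0 : R -> vec) : Prop :=
  v0 0 = e3 /\
  forall k, (1 <= k <= n)%N -> exists c : vec,
    (forall i, (i < 3)%N -> wtrace (k.*2 - 1) (fun s => vc i (a0 s)) (vc i c)) /\
    cross (v0 0) c = (0, 0, 0).

Definition Sol (m : nat) (x0 : R -> vec) (x xs xss : R -> R -> vec) : Prop :=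
  (forall s t, 0 <= s -> 0 <= t ->
     vsderiv (fun r => x r t) s (xs s t) /\ vsderiv (fun r => xs r t) s (xss s t)) /\
  (forall s t, 0 < s -> 0 < t ->
     vtderiv (fun tau => x s tau) t (cross (xs s t) (xss s t))) /\
  (forall s, 0 < s -> x s 0 = x0 s) /\
  (forall t, 0 < t -> xs 0 t = e3) /\
  (forall i, (i < 3)%N ->
     CH (4 + m) (fun t s => vc i (x s t) - vc i (x0 s)) /\
     C1H (2 + m) (fun t s => vc i (x s t) - vc i (x0 s))).

End Defs.

(* Main.v *)
Require Import Defs.
From HB Require Import structures.
From mathcomp Require Import all_boot all_order all_algebra.
From mathcomp Require Import all_classical all_reals all_analysis.
From mathcomp Require Import measurable_realfun.
From mathcomp Require Import ring lra zify.
Set Implicit Arguments. Unset Strict Implicit. Unset Printing Implicit Defensive.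
Import Order.TTheory GRing.Theory Num.Theory.
Import numFieldNormedType.Exports.
Local Open Scope classical_set_scope.
Local Open Scope ring_scope.

(* The curvatures (k, l) of the tangent field v = x_s in a rotation-free frame solve the cubic Schroedinger equation
   u_t = J (u_ss + |u|^2 u / 2). By the compatibility conditions the even extension of the initial curvatures to the
   line stays in H^k, and the flow preserves evenness. On the line the equation is the limit of explicit schemes for
   Steklov-regularised Hamiltonian systems: mass and energy bound the H^1 norm globally, tame estimates propagate the
   higher norms, and the schemes at successive scales are Cauchy. Integrating the frame equations in s gives back v,
   and integration in t gives x. For uniqueness, the difference d of two tangent fields has the energy |d|^2 + |d_s|^2,
   whose derivative contains the top order derivatives of d only through vanishing triple products. *)

(** Only bounded operators enter the time stepping: second derivatives become squared difference
    quotients of radius r, and the nonlinearity is averaged at scale r. Explicit steps conserve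
    neither mass nor energy; the errors per step are of order h^2 r^-8 at worst, so the step h = r^8
    keeps them O(h), hence bounded on finite time intervals. With r = 2^-n one coarse step is 256
    fine ones. A Sobolev function is represented by a chain of genuine functions, each a pointwise
    antiderivative of the next, so that products, traces and uniqueness are elementary; weak
    derivatives occur only where the statement is met. Evolution equations are kept as mean value
    inequalities, which survive uniform limits. Evenness gives k_s = l_s = 0 at the origin, so the
    frame there only rotates about e_3: this keeps the boundary tangent fixed. The pointwise
    derivatives of the statement are a priori tied to the Sobolev ones almost everywhere only; the
    gap is closed by the fact that a function differentiable everywhere, with zero derivative almost
    everywhere, is constant. *)

Local Notation leT := le_trans.

Lemma eqW (disp : Order.disp_t) (T : porderType disp) (x y : T) : x = y -> (x <= y)%O.
by move=> ->. Qed.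

(** * Pointwise evaluation of operations on functions *)

Section FunE.
Variables (T : Type) (R : realType).
Implicit Types f g : T -> R.
Lemma addfE f g x : (f + g) x = f x + g x. by []. Qed.
Lemma mulfE f g x : (f * g) x = f x * g x. by []. Qed.
Lemma oppfE f x : (- f) x = - f x. by []. Qed.
Lemma subfE f g x : (f - g) x = f x - g x. by []. Qed.
Lemma scalefE (c : R) f x : (c *: f) x = c * f x. by []. Qed.
Lemma zerofE x : (0 : T -> R) x = 0. by []. Qed.
Definition fE:= (addfE, mulfE, subfE, oppfE, scalefE, zerofE).
End FunE.

(** * Square integrable functions on the line and on the half-line *)

Section L2layer.
Variable R : realType.
Local Notation mu:= (@lebesgue_measure R).

(** One flag treats both domains at once: the Schroedinger flow lives on the whole line ([true]),
    the frames and the curve on the closed half-line ([false]). Functions are never identified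
    modulo null sets, so values at the end point make sense. *)
Definition dom (b : bool) : set R:= if b then setT else `[0, +oo[%classic.

Lemma mdom b : measurable (dom b).
by case: b => /=;[exact: measurableT|exact: measurable_itv]. Qed.

Variable b : bool.
Local Notation D:= (dom b).

Definition l2 (f : R -> R) : Prop :=
 measurable_fun D f /\ (\int[mu]_(x in D) ((f x) ^+ 2)%:E < +oo)%E.
(* Sealed constants: conversion and unification would otherwise unfold the integrals. *)
Lemma ip_seal : {F : (R -> R) -> (R -> R) -> R | forall f g, F f g = \int[mu]_(x in D) (f x * g x)}.
by exists (fun f g => \int[mu]_(x in D) (f x * g x)). Qed.
Definition ip:= sval ip_seal.
Lemma ipE f g : ip f g = \int[mu]_(x in D) (f x * g x).
exact: (svalP ip_seal). Qed.
Lemma nrm_seal : {F : (R -> R) -> R | forall f, F f = Num.sqrt (ip f f)}.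
by exists (fun f => Num.sqrt (ip f f)). Qed.
Definition nrm:= sval nrm_seal.
Lemma nrmE f : nrm f = Num.sqrt (ip f f).
exact: (svalP nrm_seal). Qed.

Lemma l2_meas f : l2 f -> measurable_fun D f. by case. Qed.

Lemma l2_sq (f : R -> R) : l2 f -> mu.-integrable D (EFin \o (fun x => f x ^+ 2)).
case=> mf fi;apply/integrableP;split.
 by apply/measurable_EFinP;apply: measurable_funX.
apply: le_lt_trans fi;apply: eqW.
by apply: eq_integral => x _ /=;rewrite ger0_norm ?sqr_ge0.
Qed.

Lemma l2_of_sq (f : R -> R) : measurable_fun D f ->
 mu.-integrable D (EFin \o (fun x => f x ^+ 2)) -> l2 f.
by move=> mf /integrable_lty h;split => //;apply: h;exact: mdom. Qed.

Lemma l2_le (f g : R -> R) (c : R) : measurable_fun D f -> l2 g ->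
 (forall x, D x -> `|f x| <= c * `|g x|) -> l2 f.
move=> mf lg h;apply: l2_of_sq => //.
apply: (@le_integrable _ _ _ mu D (mdom b) _ (EFin \o (fun x => c ^+ 2 * g x ^+ 2))).
- by apply/measurable_EFinP;apply: measurable_funX.
- move=> x Dx /=;rewrite lee_fin ger0_norm ?sqr_ge0// ger0_norm;last first.
  by rewrite mulr_ge0 ?sqr_ge0.
 rewrite -exprMn -(real_normK (num_real (f x))) -(real_normK (num_real (c * g x))).
 have h1:= h x Dx;rewrite ler_pXn2r ?nnegrE//.
 rewrite normrM;apply: (leT h1);rewrite ler_wpM2r//;exact: ler_norm.
- rewrite (_ : _ \o _ = (fun x => (c ^+ 2)%:E * (g x ^+ 2)%:E)%E)//.
 by apply: integrableZl;[exact: mdom|exact: l2_sq].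
Qed.

Lemma l2_int (f g : R -> R) : l2 f -> l2 g -> mu.-integrable D (EFin \o (fun x => f x * g x)).
move=> lf lg.
apply: (@le_integrable _ _ _ mu D (mdom b) _ (EFin \o (fun x => f x ^+ 2 + g x ^+ 2))).
- apply/measurable_EFinP;apply: measurable_funM;exact: l2_meas.
- move=> x Dx /=;rewrite lee_fin [leRHS]ger0_norm ?addr_ge0 ?sqr_ge0//.
 rewrite ler_norml;apply/andP;split;rewrite -subr_ge0.
  have -> : f x * g x - - (f x ^+ 2 + g x ^+ 2) =
   2^-1 * ((f x + g x) ^+ 2 + f x ^+ 2 + g x ^+ 2) by field.
  by rewrite mulr_ge0 ?invr_ge0 ?addr_ge0 ?sqr_ge0.
 have -> : f x ^+ 2 + g x ^+ 2 - f x * g x =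
   2^-1 * ((f x - g x) ^+ 2 + f x ^+ 2 + g x ^+ 2) by field.
 by rewrite mulr_ge0 ?invr_ge0 ?addr_ge0 ?sqr_ge0.
- by apply: (@integrableD _ _ _ mu D (mdom b) (EFin \o (fun x => f x ^+ 2)) (EFin \o (fun x => g x ^+ 2)));exact: l2_sq.
Qed.

Lemma intD (f g : R -> R) : mu.-integrable D (EFin \o f) -> mu.-integrable D (EFin \o g) ->
 mu.-integrable D (EFin \o (fun x => f x + g x)).
by move=> hf hg;exact: (@integrableD _ _ _ mu D (mdom b) _ _ hf hg). Qed.

Lemma l2D f g : l2 f -> l2 g -> l2 (f + g).
move=> lf lg;apply: l2_of_sq.
 apply: measurable_funD;exact: l2_meas.
have -> : (fun x => (f + g) x ^+ 2) =
 (fun x => (f x ^+ 2 + f x * g x) + (f x * g x + g x ^+ 2)).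
 by apply/funext => x;rewrite fE;ring.
apply: intD;apply: intD;do ?[exact: l2_sq|exact: l2_int].
Qed.

Lemma l2Z (c : R) f : l2 f -> l2 (c *: f).
move=> lf;apply: (@l2_le _ f `|c|) => //.
 rewrite (_ : c *: f = (fun x => c * f x))//.
 by apply: measurable_funM => //;exact: l2_meas.
by move=> x _;rewrite [(c *: f) x]/(c * f x) normrM.
Qed.

Lemma l2N f : l2 f -> l2 (- f).
by move=> /(l2Z (-1));rewrite scaleN1r. Qed.
Lemma l2B f g : l2 f -> l2 g -> l2 (f - g).
by move=> lf lg;apply: l2D => //;apply: l2N. Qed.
Lemma l20 : l2 0.
split;first exact: measurable_cst.
rewrite (eq_integral (fun=> 0%E)) ?integral0// => x _.
by rewrite [(0 : R -> R) x]/(0 : R) expr0n.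
Qed.

Lemma l2_sum (I : Type) (r : seq I) (F : I -> R -> R) :
 (forall i, l2 (F i)) -> l2 (\sum_(i <- r) F i).
by move=> h;elim/big_rec: _ => [|i x _];[exact: l20|exact: l2D]. Qed.

Lemma l2M (f g : R -> R) (c : R) : measurable_fun D g -> (forall x, D x -> `|g x| <= c) ->
 l2 f -> l2 (g * f).
move=> mg gc lf;apply: (l2_le (g:= f) (c:= c)) => //.
 by apply: measurable_funM => //;exact: l2_meas.
by move=> x Dx;rewrite [(g * f) x]/(g x * f x) normrM ler_wpM2r// gc.
Qed.

Lemma l2_eq (f g : R -> R) : (forall x, D x -> f x = g x) -> l2 f -> l2 g.
move=> e lf;apply: (l2_le (g:= f) (c:= 1)) => //.
 apply: (eq_measurable_fun f);last exact: l2_meas.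
 by move=> x;rewrite inE => Dx;apply: e.
by move=> x Dx;rewrite mul1r e.
Qed.

Lemma ip_eq (f f' g g' : R -> R) : (forall x, D x -> f x * g x = f' x * g' x) -> ip f g = ip f' g'.
by move=> h;rewrite !ipE;apply: eq_Rintegral => x;rewrite inE => /h. Qed.
Lemma ipC f g : ip f g = ip g f.
by apply: ip_eq => x _;rewrite mulrC. Qed.
Lemma ipDl f g h : l2 f -> l2 g -> l2 h -> ip (f + g) h = ip f h + ip g h.
move=> lf lg lh;rewrite !ipE -RintegralD;[|exact: mdom|exact: l2_int|exact: l2_int].
by apply: eq_Rintegral => x _;rewrite [(f + g) x]/(f x + g x) mulrDl.
Qed.
Lemma ipZl c f h : l2 f -> l2 h -> ip (c *: f) h = c * ip f h.
move=> lf lh;rewrite !ipE -RintegralZl;[|exact: mdom|exact: l2_int].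
by apply: eq_Rintegral => x _;rewrite [(c *: f) x]/(c * f x) mulrA.
Qed.
Lemma ipNl f h : l2 f -> l2 h -> ip (- f) h = - ip f h.
by move=> lf lh;rewrite -scaleN1r ipZl// mulN1r. Qed.
Lemma ipBl f g h : l2 f -> l2 g -> l2 h -> ip (f - g) h = ip f h - ip g h.
by move=> lf lg lh;rewrite ipDl ?ipNl//;exact: l2N. Qed.
Lemma ipDr f g h : l2 f -> l2 g -> l2 h -> ip h (f + g) = ip h f + ip h g.
by move=> *;rewrite ipC ipDl// ipC [X in _ + X]ipC. Qed.
Lemma ipZr c f h : l2 f -> l2 h -> ip h (c *: f) = c * ip h f.
by move=> *;rewrite ipC ipZl// ipC. Qed.
Lemma ipNr f h : l2 f -> l2 h -> ip h (- f) = - ip h f.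
by move=> *;rewrite ipC ipNl// ipC. Qed.
Lemma ipBr f g h : l2 f -> l2 g -> l2 h -> ip h (f - g) = ip h f - ip h g.
by move=> *;rewrite ipC ipBl// ipC [X in _ - X]ipC. Qed.
Lemma ip0l h : ip 0 h = 0.
rewrite ipE (@eq_Rintegral _ _ _ _ _ (fun=> 0));last first.
 by move=> x _;rewrite [(0 : R -> R) x]/(0 : R) mul0r.
by rewrite /Rintegral integral0.
Qed.
Lemma ip_ge0 f : 0 <= ip f f.
by rewrite ipE;apply: Rintegral_ge0 => x _;rewrite -expr2 sqr_ge0. Qed.
Lemma ip_le (f g f' g' : R -> R) : l2 f -> l2 g -> l2 f' -> l2 g' ->
 (forall x, D x -> f x * g x <= f' x * g' x) -> ip f g <= ip f' g'.
move=> lf lg lf' lg' h;rewrite !ipE;apply: le_Rintegral;[exact: mdom|exact: l2_int|exact: l2_int|].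
by move=> x Dx;apply: h.
Qed.

Lemma nrm_ge0 f : 0 <= nrm f. by rewrite nrmE sqrtr_ge0. Qed.
Lemma nrm_sq f : nrm f ^+ 2 = ip f f. by rewrite nrmE sqr_sqrtr ?ip_ge0. Qed.

Lemma ip_sq f : l2 f -> (\int[mu]_(x in D) ((f x) ^+ 2)%:E)%E = (nrm f ^+ 2)%:E.
move=> lf;rewrite nrm_sq ipE /Rintegral fineK.
 by apply: eq_integral => x _;rewrite expr2.
by apply: integrable_fin_num;[exact: mdom|exact: l2_int].
Qed.

Lemma l2_of_le (f : R -> R) (c : R) : measurable_fun D f ->
 (\int[mu]_(x in D) ((f x) ^+ 2)%:E <= (c ^+ 2)%:E)%E -> 0 <= c -> l2 f /\ nrm f <= c.
move=> mf h c0;have lf : l2 f by split => //;apply: (le_lt_trans h);exact: ltry.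
split => //;move: h;rewrite ip_sq// lee_fin.
by rewrite ler_pXn2r// nnegrE nrm_ge0.
Qed.

Lemma CS f g : l2 f -> l2 g -> `|ip f g| <= nrm f * nrm g.
move=> lf lg.
have key t : 0 <= nrm f ^+ 2 - t * 2 * ip f g + t ^+ 2 * nrm g ^+ 2.
 have:= ip_ge0 (f - t *: g).
 rewrite ipBl ?ipBr ?ipZl ?ipZr//;try by do ?[apply: l2Z|apply: l2B].
 rewrite !nrm_sq (ipC g f) => h;apply: (leT h);rewrite le_eqVlt;apply/orP;left.
 by apply/eqP;ring.
have h2 : ip f g ^+ 2 <= (nrm f * nrm g) ^+ 2.
 have [g0|g0]:= eqVneq (nrm g) 0.
  rewrite g0 mulr0 expr0n /=.
  suff -> : ip f g = 0 by rewrite expr0n.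
  apply/eqP/negPn/negP => i0.
  (* When |g| = 0 the quadratic polynomial is affine in t, and at this t it would equal -1. *)
  have:= key ((nrm f ^+ 2 + 1) / (2 * ip f g)).
  rewrite g0 expr0n mulr0 addr0 (_ : _ / _ * 2 * _ = nrm f ^+ 2 + 1);last first.
   by field.
  by lra.
 have:= key (ip f g / nrm g ^+ 2).
 have g2 : 0 < nrm g ^+ 2 by rewrite exprn_gt0// lt_def g0 nrm_ge0.
 rewrite (_ : _ + _ = nrm f ^+ 2 - ip f g ^+ 2 / nrm g ^+ 2);last by field.
 by rewrite subr_ge0 ler_pdivrMr// exprMn.
by rewrite -ler_sqr ?nnegrE ?mulr_ge0 ?nrm_ge0// real_normK ?num_real.
Qed.

Lemma nrmD f g : l2 f -> l2 g -> nrm (f + g) <= nrm f + nrm g.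
move=> lf lg;rewrite -ler_sqr ?nnegrE ?addr_ge0 ?nrm_ge0//.
rewrite nrm_sq ipDl ?ipDr//;try exact: l2D.
rewrite -!nrm_sq (ipC g f).
have:= CS lf lg;rewrite ler_norml => /andP[_ h];rewrite sqrrD.
by lra.
Qed.
Lemma nrmZ c f : l2 f -> nrm (c *: f) = `|c| * nrm f.
move=> lf;rewrite !nrmE ipZl ?ipZr//;last exact: l2Z.
by rewrite mulrA -expr2 sqrtrM ?sqr_ge0// sqrtr_sqr.
Qed.
Lemma nrmN f : nrm (- f) = nrm f.
rewrite !nrmE;congr Num.sqrt;apply: ip_eq => x _.
by rewrite [(- f) x]/(- f x) mulrNN.
Qed.
Lemma nrmB f g : l2 f -> l2 g -> nrm (f - g) <= nrm f + nrm g.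
by move=> lf lg;rewrite -(nrmN g);apply: nrmD => //;exact: l2N. Qed.
Lemma nrm_distC f g : nrm (f - g) = nrm (g - f).
by rewrite -nrmN opprB. Qed.
Lemma nrm0 : nrm 0 = 0. by rewrite nrmE ip0l sqrtr0. Qed.
Lemma nrm_eq (f g : R -> R) : (forall x, D x -> f x = g x) -> nrm f = nrm g.
by move=> h;rewrite !nrmE;congr Num.sqrt;apply: ip_eq => x Dx;rewrite h. Qed.

Lemma nrm_le (f g : R -> R) : l2 f -> l2 g -> (forall x, D x -> `|f x| <= `|g x|) -> nrm f <= nrm g.
move=> lf lg h;rewrite !nrmE ler_sqrt ?ip_ge0//;apply: ip_le => // x Dx.
rewrite -!expr2 -(real_normK (num_real (f x))) -(real_normK (num_real (g x))).
by rewrite ler_pXn2r ?nnegrE//;exact: h.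
Qed.

Lemma nrmM (f g : R -> R) (c : R) : measurable_fun D g -> (forall x, D x -> `|g x| <= c) ->
 0 <= c -> l2 f -> nrm (g * f) <= c * nrm f.
move=> mg gc c0 lf;have -> : c * nrm f = nrm (c *: f) by rewrite nrmZ// ger0_norm.
apply: nrm_le.
- exact: l2M gc _.
- exact: l2Z.
move=> x Dx;rewrite [(g * f) x]/(g x * f x) [(c *: f) x]/(c * f x) !normrM.
by rewrite ler_wpM2r// (ger0_norm c0) gc.
Qed.

Lemma nrm_sum (I : Type) (r : seq I) (F : I -> R -> R) :
 (forall i, l2 (F i)) -> nrm (\sum_(i <- r) F i) <= \sum_(i <- r) nrm (F i).
move=> lF;elim: r => [|i r IH];first by rewrite !big_nil nrm0.
rewrite !big_cons;apply: leT (nrmD _ _) _ => //;first exact: l2_sum.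
by rewrite lerD2l.
Qed.

End L2layer.

(** * Fatou, completeness and strong convergence in L2 *)

Section Completeness.
Variable R : realType.
Local Notation mu:= (@lebesgue_measure R).
Variable b : bool.
Local Notation D:= (@dom R b).
Local Notation l2:= (@l2 R b).
Local Notation nrm:= (@nrm R b).

Lemma integral_ip (f g : R -> R) : l2 f -> l2 g ->
 (\int[mu]_(x in D) (f x * g x)%:E = (ip b f g)%:E)%E.
move=> lf lg;rewrite ipE /Rintegral fineK//.
by apply: integrable_fin_num;[exact: mdom|exact: l2_int].
Qed.

Lemma aeS (P Q : R -> Prop) : (forall x, P x -> Q x) ->
 {ae mu, forall x, P x} -> {ae mu, forall x, Q x}.
by move=> PQ;apply: negligibleS => x;apply: contra_not;exact: PQ. Qed.

Lemma aeS2 (P Q S : R -> Prop) : (forall x, P x -> Q x -> S x) ->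
 {ae mu, forall x, P x} -> {ae mu, forall x, Q x} -> {ae mu, forall x, S x}.
move=> PQ hP hQ;have:= negligibleU hP hQ;apply: negligibleS => x /= nS.
by have [Px|]:= pselect (P x);[right|left] => //;move=> Qx;apply: nS;exact: PQ.
Qed.

Lemma nrm_sqD (f g : R -> R) : l2 f -> l2 g ->
 nrm (f + g) ^+ 2 = nrm f ^+ 2 + 2 * ip b f g + nrm g ^+ 2.
move=> lf lg;have lfg:= l2D lf lg;rewrite !nrm_sq ipDl// [ip b f (f + g)]ipDr//.
by rewrite [ip b g (f + g)]ipDr// (ipC b g f);ring.
Qed.

Lemma nrm_sqB (f g : R -> R) : l2 f -> l2 g ->
 nrm (f - g) ^+ 2 = nrm f ^+ 2 - 2 * ip b f g + nrm g ^+ 2.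
by move=> lf lg;rewrite nrm_sqD ?nrmN ?ipNr//;[ring|exact: l2N]. Qed.

(** Fatou's lemma for the squares. The same inequality puts the limit in L2, which is how limits
    below are shown to be square integrable. *)
Lemma l2_fatou (F : nat -> R -> R) (f : R -> R) (c : R) :
 (forall n, l2 (F n)) -> (forall n, nrm (F n) <= c) -> measurable_fun D f ->
 {ae mu, forall x, D x -> F n x @[n --> \oo] --> f x} -> l2 f /\ nrm f <= c.
move=> lF Fc mf Ff;have c0 : 0 <= c by apply: leT (Fc 0%N);exact: nrm_ge0.
pose h n (x : R):= ((F n x) ^+ 2)%:E.
have mh n : measurable_fun D (h n).
 by apply/measurable_EFinP;apply: measurable_funX;exact: l2_meas.
have h0 n x : D x -> (0 <= h n x)%E by move=> _;rewrite lee_fin sqr_ge0.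
have H:= @fatou _ _ R mu _ (@mdom R b) _ mh h0.
apply: l2_of_le => //.
have -> : (\int[mu]_(x in D) ((f x) ^+ 2)%:E = \int[mu]_(x in D) limn_einf (h^~ x))%E.
 apply: ge0_ae_eq_integral;first exact: mdom.
 - by apply/measurable_EFinP;apply: measurable_funX.
 - rewrite (_ : (fun x => _) = (fun x => - limn_esup ((fun n x => - h n x)%E^~ x))%E);last first.
   by apply/funext => x;rewrite -[in LHS](oppeK (limn_einf _)) -limn_esupN.
  apply: measurableT_comp => //;apply: measurable_fun_limn_esup => n.
  rewrite (_ : (\- h n)%E = (EFin \o (fun x => 0 - F n x ^+ 2)));last first.
   by apply/funext => x /=;rewrite /h sub0r.
  apply/measurable_EFinP;apply: measurable_funB => //;apply: measurable_funX;exact: l2_meas.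
 - by move=> x _;rewrite lee_fin sqr_ge0.
 - move=> x Dx;rewrite limn_einf_lim;apply: lime_ge;first exact: is_cvg_einfs.
  by apply: nearW => n;apply: le_ereal_inf_tmp => _ [k _ <-];exact: h0.
 - apply: (aeS _ Ff) => x /= Fx Dx.
  have hc : h n x @[n --> \oo] --> ((f x) ^+ 2)%:E.
   apply: cvg_EFin;first exact: nearW.
   by have:= Fx Dx => cc;rewrite expr2;exact: (cvgM cc cc).
  have -> : limn_einf (h^~ x) = limn (h^~ x) by apply: is_cvg_limn_einfE;apply/cvg_ex;eexists;exact: hc.
  by apply/esym/cvg_lim.
apply: (leT H);rewrite limn_einf_lim;apply: lime_le;first exact: is_cvg_einfs.
apply: nearW => n;apply: (@leT _ _ (\int[mu]_(x in D) h n x)%E).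
 by apply: ereal_inf_lbound;exists n => //=.
by rewrite /h ip_sq// lee_fin ler_pXn2r// nnegrE nrm_ge0.
Qed.

Lemma l2_fatouT (F : nat -> R -> R) (f : R -> R) (c : R) :
 (forall n, l2 (F n)) -> (forall n, nrm (F n) <= c) ->
 (forall x, D x -> F n x @[n --> \oo] --> f x) -> l2 f /\ nrm f <= c.
move=> lF Fc Ff;apply: (l2_fatou lF Fc).
 by apply: (measurable_fun_cvg (h:= F)) => // n;exact: l2_meas.
by apply: aeW => x;exact: Ff.
Qed.

Lemma nrm_telescope (F : nat -> R -> R) (e : nat -> R) n k :
 (forall n, l2 (F n)) -> (forall n, nrm (F n.+1 - F n) <= e n) ->
 nrm (F (k + n)%N - F n) <= \sum_(i < k) e (i + n)%N.
move=> lF h;elim: k => [|k IH];first by rewrite big_ord0 subrr nrm0.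
rewrite big_ord_recr /= addSn.
have -> : F (k + n).+1 - F n = (F (k + n)%N - F n) + (F (k + n).+1 - F (k + n)%N).
 by rewrite [RHS]addrC addrA subrK.
apply: leT (nrmD _ _) _;do ?exact: l2B.
by apply: lerD.
Qed.

Lemma geo_sum_le (C : R) n k : 0 <= C -> \sum_(i < k) (C * 2^-1 ^+ (i + n)) <= 2 * C * 2^-1 ^+ n.
move=> C0.
suff -> : \sum_(i < k) (C * 2^-1 ^+ (i + n)) = 2 * C * 2^-1 ^+ n - 2 * C * 2^-1 ^+ (k + n).
 by rewrite gerBl !mulr_ge0 ?exprn_ge0 ?invr_ge0.
elim: k => [|k IH];first by rewrite big_ord0 subrr.
by rewrite big_ord_recr /= IH addSn exprS;field.
Qed.

(** Riesz-Fischer for geometric increments: the sum of their absolute values has finite L2 norm by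
    monotone convergence, hence is finite almost everywhere, so the sequence converges almost
    everywhere; Fatou then bounds the remainder. *)
Lemma l2_complete (F : nat -> R -> R) (C : R) : (forall n, l2 (F n)) ->
 (forall n, nrm (F n.+1 - F n) <= C * 2^-1 ^+ n) ->
 exists2 f, l2 f & forall n, nrm (F n - f) <= 2 * C * 2^-1 ^+ n.
move=> lF h.
have C0 : 0 <= C by have:= h 0%N;rewrite expr0 mulr1;apply: leT;exact: nrm_ge0.
pose G n (x : R) : R:= \sum_(i < n) `|F i.+1 x - F i x|.
have labs i : l2 (fun x => `|F i.+1 x - F i x|).
 apply: (l2_le (g:= F i.+1 - F i) (c:= 1));last 2 first.
 - exact: l2B.
 - by move=> x _;rewrite mul1r normr_id.
 - by apply: measurableT_comp => //;apply: (@l2_meas _ b);exact: l2B.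
have GE n : G n = \sum_(i < n) (fun x => `|F i.+1 x - F i x|).
 by apply/funext => x;rewrite fct_sumE.
have lG n : l2 (G n) by rewrite GE;exact: l2_sum.
have nG n : nrm (G n) <= 2 * C.
 rewrite GE;apply: leT (nrm_sum _ _) _ => //.
 apply: leT (_ : \sum_(i < n) C * 2^-1 ^+ (i + 0) <= _).
  apply: ler_sum => i _;rewrite addn0;apply: leT (h i).
  apply: nrm_le => //;first exact: l2B.
  by move=> x _;rewrite normr_id.
 by apply: leT (geo_sum_le _ _ C0) _;rewrite expr0 mulr1.
pose g n (x : R):= ((G n x) ^+ 2)%:E.
have mg n : measurable_fun D (g n).
 by apply/measurable_EFinP;apply: measurable_funX;exact: l2_meas.
have g0 n x : D x -> (0 <= g n x)%E by move=> _;rewrite lee_fin sqr_ge0.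
have G0 n x : 0 <= G n x by apply: sumr_ge0.
have homG x n m : (n <= m)%N -> G n x <= G m x.
 move=> /subnKC <-;elim: (m - n)%N => [|k IH];first by rewrite addn0.
 by rewrite addnS /G big_ord_recr /=;apply: (leT IH);rewrite lerDl.
have gh x : D x -> {homo g ^~ x : n m / (n <= m)%N >-> (n <= m)%E}.
 move=> _ n m nm;rewrite lee_fin ler_pXn2r ?nnegrE//;exact: homG.
have mono:= @cvg_monotone_convergence _ _ R mu _ (@mdom R b) _ mg g0 gh.
have ilim : (\int[mu]_(x in D) limn (g ^~ x) < +oo)%E.
 rewrite -(cvg_lim _ mono)//;apply: (@le_lt_trans _ _ (((2 * C) ^+ 2)%:E));last exact: ltry.
 apply: lime_le;first by apply/cvg_ex;eexists;exact: mono.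
 apply: nearW => n;rewrite /g ip_sq// lee_fin ler_pXn2r// nnegrE ?nrm_ge0//.
 by rewrite mulr_ge0.
have gcv x : D x -> cvgn (g ^~ x).
 by move=> Dx;apply: ereal_nondecreasing_is_cvgn;exact: gh.
have mlim : measurable_fun D (fun x => limn (g ^~ x)).
 apply: (emeasurable_fun_cvg g) => // x Dx;exact: gcv.
have alim : {ae mu, forall x, D x -> (limn (g^~ x) \is a fin_num)}.
 apply: integrable_ae;first exact: mdom.
 apply/integrableP;split => //;apply: le_lt_trans ilim.
 apply: eqW;apply: eq_integral => x;rewrite inE => Dx.
 rewrite gee0_abs//;apply: lime_ge;first exact: gcv.
 by apply: nearW => n;apply: g0.
have aF : {ae mu, forall x, D x -> cvgn (F ^~ x)}.
 apply: (aeS _ alim) => x /= fx Dx.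
 have {}fx:= fx Dx.
 have bG n : G n x <= fine (limn (g^~ x)) + 1.
  have le1 : (g n x <= limn (g^~ x))%E.
   apply: lime_ge;first exact: gcv.
   by exists n => // m /= nm;exact: gh.
  have : G n x ^+ 2 <= fine (limn (g^~ x)) by rewrite -lee_fin fineK.
  move=> h1;have:= sqr_ge0 (G n x - 2^-1);rewrite sqrrB -mulr_natr => h2.
  have h3 : (2^-1 : R) ^+ 2 = 4^-1 by rewrite expr2 -invfM;congr (_ ^-1);ring.
  by rewrite h3 in h2;lra.
 pose u i : R:= F i.+1 x - F i x.
 have uG : [normed series u] = G ^~ x.
  by apply/funext => n;rewrite /G (_ : [normed series u] n = \sum_(0 <= i < n) `|u i|)// big_mkord.
 have cu : cvgn (series u).
  apply: normed_cvg;apply: nondecreasing_is_cvgn.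
   by move=> n m nm;rewrite uG;exact: homG.
  by exists (fine (limn (g^~ x)) + 1) => _ [n _ <-];rewrite uG;exact: bG.
 have -> : F ^~ x = (fun n => F 0%N x + series u n).
  apply/funext => n;rewrite /series /= telescope_sumr//.
  by rewrite addrC subrK.
 apply: is_cvgD => //;exact: is_cvg_cst.
(* The upper limit is measurable whether or not the sequence converges, and equals the limit where
   it does; [fine] supplies an arbitrary value at infinite ones. *)
pose f (x : R) : R:= fine (limn_esup (fun n => (F n x)%:E)).
have mf : measurable_fun D f.
 apply: (measurableT_comp (fine_measurable measurableT)).
 apply: (measurable_fun_limn_esup (f:= fun n x => (F n x)%:E)) => n.
 by apply/measurable_EFinP;exact: l2_meas.
have cf : {ae mu, forall x, D x -> F n x @[n --> \oo] --> f x}.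
 apply: (aeS _ aF) => x /= cx Dx;have {}cx:= cx Dx.
 have ec : (F n x)%:E @[n --> \oo] --> (limn (F ^~ x))%:E by apply: cvg_EFin => //;exact: nearW.
 rewrite /f is_cvg_limn_esupE;last by apply/cvg_ex;eexists;exact: ec.
 by rewrite (cvg_lim _ ec).
have key n : l2 (f - F n) /\ nrm (f - F n) <= 2 * C * 2^-1 ^+ n.
 apply: (l2_fatou (F:= fun k => F (k + n)%N - F n)).
 - by move=> k;exact: l2B.
 - move=> k;apply: leT (nrm_telescope _ _ lF h) _;exact: geo_sum_le.
 - by apply: measurable_funB => //;exact: l2_meas.
 apply: (aeS _ cf) => x /= cx Dx;apply: (@cvgB _ R^o);last exact: cvg_cst.
 by move: (cx Dx);rewrite -(cvg_shiftn n).
exists f;last by move=> n;rewrite nrm_distC;exact: (key n).2.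
by have:= l2D (key 0%N).1 (lF 0%N);rewrite subrK.
Qed.

(** If some subsequence stayed at distance e, the parallelogram law would bound |F + f|^2 by 4 |f|^2
    - e^2, while Fatou passes this bound to the limit 2 f. *)
Lemma l2_strong (F : nat -> R -> R) (f : R -> R) :
 (forall n, l2 (F n)) -> l2 f -> (forall n, nrm (F n) <= nrm f) ->
 {ae mu, forall x, D x -> F n x @[n --> \oo] --> f x} ->
 nrm (F n - f) @[n --> \oo] --> 0.
move=> lF lf Fc Ff;apply/cvgrPdist_lt => e e0.
apply: contrapT => nn.
have /choice[k kP] : forall n, exists k, (n <= k)%N /\ e <= nrm (F k - f).
 move=> n;apply: contrapT => hn0;have /forallNP hn:= hn0;apply: nn;exists n => // i /= ni.
 have:= hn i => /not_andP[//|/negP];rewrite -ltNge sub0r normrN ger0_norm ?nrm_ge0//.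
have par n : nrm (F (k n) + f) ^+ 2 <= 4 * nrm f ^+ 2 - e ^+ 2.
 have [_ h1]:= kP n.
 have h2 : e ^+ 2 <= nrm (F (k n) - f) ^+ 2 by rewrite ler_pXn2r ?nnegrE ?nrm_ge0// ltW.
 have h3 : nrm (F (k n)) ^+ 2 <= nrm f ^+ 2 by rewrite ler_pXn2r ?nnegrE ?nrm_ge0.
 rewrite nrm_sqD//;rewrite nrm_sqB// in h2.
 by lra.
pose c:= Num.sqrt (4 * nrm f ^+ 2 - e ^+ 2).
have c2 : c ^+ 2 = 4 * nrm f ^+ 2 - e ^+ 2.
 by rewrite sqr_sqrtr// (leT (sqr_ge0 _) (par 0%N)).
have []:= @l2_fatou (fun n => F (k n) + f) (f + f) c.
- by move=> n;exact: l2D.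
- by move=> n;rewrite -ler_sqr ?nnegrE ?sqrtr_ge0 ?nrm_ge0// c2 par.
- by apply: measurable_funD;exact: (@l2_meas _ b).
- apply: (aeS _ Ff) => x /= cx Dx;apply: (@cvgD _ R^o);last exact: cvg_cst.
 apply: cvg_comp (cx Dx) => A [n0 _ nA];exists n0 => // m /= nm;apply: nA => /=.
 exact: leq_trans (kP m).1.
move=> _;rewrite -ler_sqr ?nnegrE ?sqrtr_ge0 ?nrm_ge0// c2.
rewrite nrm_sqD// -nrm_sq => h;have : 0 < e ^+ 2 by rewrite exprn_gt0.
by lra.
Qed.

End Completeness.

(** * Antiderivatives of square integrable functions *)

Section Primitives.
Variable R : realType.

Lemma sqrt_le (x c : R) : 0 <= c -> x <= c ^+ 2 -> Num.sqrt x <= c.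
by move=> c0 h;rewrite -(ger0_norm c0) -sqrtr_sqr;exact: ler_wsqrtr. Qed.

Lemma mul_le_sqrD (x y : R) : x * y <= x ^+ 2 + y ^+ 2.
rewrite -subr_ge0;have -> : x ^+ 2 + y ^+ 2 - x * y = 2^-1 * ((x - y) ^+ 2 + x ^+ 2 + y ^+ 2) by field.
by rewrite mulr_ge0 ?invr_ge0// !addr_ge0 ?sqr_ge0.
Qed.

Lemma nrm_le_scale b (f g : R -> R) (c : R) : measurable_fun (dom b) f -> l2 b g -> 0 <= c ->
 (forall x, dom b x -> `|f x| <= c * `|g x|) -> l2 b f /\ nrm b f <= c * nrm b g.
move=> mf lg c0 h;have lf : l2 b f by exact: l2_le h.
split => //;rewrite -(ger0_norm c0) -nrmZ//;apply: nrm_le => //;first exact: l2Z.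
by move=> x Dx;rewrite [X in _ <= `|X|]fE normrM (ger0_norm c0);exact: h.
Qed.

Local Notation mu:= (@lebesgue_measure R).

(** Summation over a fine subdivision gives |H y - H x| <= e (G y - G x) for every e > 0. It stands
    in for a vanishing derivative in the product rule, where increments are controlled through
    integrals only. *)
Lemma small_increments (H G : R -> R) (x y : R) : x <= y ->
 (forall e, 0 < e -> exists2 d, 0 < d & forall u v, x <= u -> u <= v -> v <= y ->
   v - u <= d -> `|H v - H u| <= e * (G v - G u)) -> H y = H x.
move=> xy h;apply/eqP;rewrite -subr_eq0 -normr_eq0 eq_le normr_ge0 andbT.
have {h} key e : 0 < e -> `|H y - H x| <= e * (G y - G x).
 move=> e0;have [d d0 hd]:= h e e0.
 pose n:= (Num.trunc ((y - x) / d)).+1.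
 have n0 : 0 < n%:R :> R by rewrite ltr0n.
 have nd : (y - x) / n%:R <= d.
  rewrite ler_pdivrMr// mulrC -ler_pdivrMr//;apply/ltW.
  by have:= @Num.Theory.truncnS_gt R ((y - x) / d).
 pose p k:= x + k%:R * ((y - x) / n%:R).
 have st : 0 <= (y - x) / n%:R by rewrite divr_ge0 ?subr_ge0// ltW.
 have pS k : p k.+1 = p k + (y - x) / n%:R by rewrite /p -natr1;ring.
 have pn : p n = y by rewrite /p;field;rewrite gt_eqF.
 have pk k : (k <= n)%N -> p k <= y.
  move=> kn;rewrite -pn /p lerD2l ler_wpM2r// ler_nat//.
 have px k : x <= p k by rewrite /p lerDl mulr_ge0.
 have ind k : (k <= n)%N -> `|H (p k) - H x| <= e * (G (p k) - G x).
  elim: k => [|k IH] kn.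
   by rewrite /p mul0r addr0 !subrr normr0 mulr0.
  have:= IH (ltnW kn).
  have : `|H (p k.+1) - H (p k)| <= e * (G (p k.+1) - G (p k)).
   by apply: hd;rewrite ?pk// pS;[rewrite lerDl|rewrite addrAC subrr add0r].
  move=> h1 h2;have -> : H (p k.+1) - H x = (H (p k.+1) - H (p k)) + (H (p k) - H x) by ring.
  by apply: leT (ler_normD _ _) _;lra.
 by have:= ind n (leqnn n);rewrite pn.
have k1:= key 1 ltr01;rewrite leNgt;apply/negP => c0.
have g0 : 0 < G y - G x by lra.
have:= key (`|H y - H x| / (2 * (G y - G x))).
rewrite divr_gt0 ?mulr_gt0// => /(_ isT).
rewrite (_ : _ / _ * _ = `|H y - H x| / 2);last by field;rewrite gt_eqF.
by lra.
Qed.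

(* signed indicator, so that [ip b g (ind x y)] is the oriented integral of [g] from [x] to [y] *)
Fact ind_key : unit. exact: tt. Qed.
Definition ind : R -> R -> R -> R:= locked_with ind_key
 (fun x y => \1_(`]x, y]%classic) - \1_(`]y, x]%classic)).

Lemma ind_unlock x y : ind x y = \1_(`]x, y]%classic) - \1_(`]y, x]%classic).
by rewrite /ind unlock. Qed.

Lemma indE x y z : ind x y z = (x < z <= y)%R%:R - (y < z <= x)%R%:R.
rewrite ind_unlock fE !indicE;congr (_%:R - _%:R);congr nat_of_bool;
 by apply/idP/idP => [/set_mem|h];[|apply/mem_set];rewrite /= in_itv. Qed.

Lemma ind_le x y z : x <= y -> ind x y z = (x < z <= y)%R%:R.
move=> xy;rewrite indE (_ : (y < z <= x) = false) ?subr0//.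
by apply/negP => /andP[h1 h2];have:= lt_le_trans h1 h2;rewrite ltNge xy.
Qed.

Lemma ind_opp x y : ind y x = - ind x y.
by rewrite !ind_unlock opprB. Qed.

Lemma ind_chasles x y z : ind x y + ind y z = ind x z.
apply/funext => t;rewrite fE !indE.
by case: (ltrP x t);case: (lerP t x);case: (ltrP y t);case: (lerP t y);
 case: (ltrP z t);case: (lerP t z) => //=;rewrite ?subr0 ?sub0r ?addr0 ?add0r ?subrr ?addNr//;lra.
Qed.

Lemma ind_norm1 x y z : `|ind x y z| <= 1.
by rewrite indE;case: (_ && _);case: (_ && _);
 rewrite ?subrr ?subr0 ?sub0r ?normrN ?normr1 ?normr0.
Qed.

Lemma measurable_ind (A : set R) x y : measurable_fun A (ind x y).
by rewrite ind_unlock;apply: measurable_funB;exact: measurable_indic. Qed.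

Variable b : bool.
Local Notation D:= (@dom R b).
Local Notation l2:= (@l2 R b).
Local Notation nrm:= (@nrm R b).
Local Notation ip:= (@ip R b).

Lemma domP x y : D x -> x <= y -> D y.
by case: b => //=;rewrite !in_itv/= !andbT;exact: leT. Qed.

Lemma ind_int x y : D x -> x <= y -> (\int[mu]_(z in D) ((ind x y z) ^+ 2)%:E = (y - x)%:E)%E.
move=> Dx xy.
pose A:= `]x, y]%classic.
transitivity (\int[mu]_(z in D) (\1_A z)%:E)%E.
 apply: eq_integral => z _;rewrite ind_le// indicE.
 have -> : (z \in A) = (x < z <= y).
  by apply/idP/idP => [/set_mem|h];[|apply/mem_set];rewrite /A /= in_itv.
 by case: (_ && _);rewrite ?expr1n ?expr0n.
rewrite integral_indic//;try exact: mdom.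
rewrite (_ : _ `&` _ = `]x, y]%classic);last first.
 apply/seteqP;split => [z []//|z /= zxy];split => //.
 by move: zxy;rewrite in_itv/= => /andP[/ltW xz _];exact: domP Dx xz.
have:= lebesgue_measure_itv (Interval (BRight x) (BRight y));rewrite /= lte_fin => ->.
 by move: xy;rewrite le_eqVlt => /orP[/eqP->|xy];[rewrite ltxx subrr|rewrite xy EFinB].
exact: measurable_itv.
Qed.

Lemma l2_ind x y : D x -> D y -> l2 (ind x y).
wlog xy : x y / x <= y => [wl Dx Dy|].
 have [xy|/ltW yx]:= leP x y;first exact: wl.
 by rewrite ind_opp;apply: l2N;exact: wl.
move=> Dx Dy;split;first exact: measurable_ind.
by rewrite ind_int// ltry.
Qed.

Lemma ip_ind x y : D x -> x <= y -> ip (ind x y) (ind x y) = y - x.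
move=> Dx xy;by rewrite -nrm_sq;have:= ip_sq (l2_ind Dx (domP Dx xy));rewrite ind_int// => -[->].
Qed.

Lemma nrm_ind x y : D x -> D y -> nrm (ind x y) = Num.sqrt `|y - x|.
wlog xy : x y / x <= y => [wl Dx Dy|].
 have [xy|/ltW yx]:= leP x y;first exact: wl.
 by rewrite ind_opp nrmN distrC;exact: wl.
by move=> Dx Dy;rewrite nrmE ip_ind// ger0_norm ?subr_ge0.
Qed.

Lemma ip_mulA f g h : ip (f * g) h = ip f (g * h).
by apply: ip_eq => x _;rewrite !fE mulrA. Qed.

Lemma l2_indM f x y : l2 f -> l2 (ind x y * f).
by move=> lf;apply: (l2M (c:= 1)) => //;[exact: measurable_ind|move=> *;exact: ind_norm1]. Qed.

Lemma nrm_indM f x y : l2 f -> nrm (ind x y * f) <= nrm f.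
move=> lf;rewrite -[leRHS]mul1r;apply: nrmM => //;first exact: measurable_ind.
by move=> *;exact: ind_norm1.
Qed.

(** First order Sobolev regularity with the continuous representative: [f] is absolutely continuous
    with density [g] in L2. No decay of [f] is imposed, and on the half-line the identity includes
    the end point 0. *)
Definition prim (f g : R -> R) : Prop :=
 l2 g /\ forall x y, D x -> D y -> f y - f x = ip g (ind x y).

Lemma prim_l2 f g : prim f g -> l2 g. by case. Qed.

Lemma primD f f' g g' : prim f f' -> prim g g' -> prim (f + g) (f' + g').
move=> [lf pf] [lg pg];split;first exact: l2D.
move=> x y Dx Dy;rewrite ipDl//;last exact: l2_ind.
by rewrite -pf// -pg// !fE;ring.
Qed.
Lemma primZ c f f' : prim f f' -> prim (c *: f) (c *: f').
move=> [lf pf];split;first exact: l2Z.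
move=> x y Dx Dy;rewrite ipZl//;last exact: l2_ind.
by rewrite -pf// !fE;ring.
Qed.
Lemma primN f f' : prim f f' -> prim (- f) (- f').
by move=> /(primZ (-1));rewrite !scaleN1r. Qed.
Lemma primB f f' g g' : prim f f' -> prim g g' -> prim (f - g) (f' - g').
by move=> h1 h2;apply: primD => //;exact: primN. Qed.
Lemma prim_cst c : prim (fun=> c) 0.
by split;[exact: l20|move=> *;rewrite subrr ip0l]. Qed.
Lemma prim0 : prim 0 0. exact: (prim_cst 0). Qed.
Lemma prim_eq f f' g g' : (forall x, D x -> f x = g x) -> (forall x, D x -> f' x = g' x) ->
 prim f f' -> prim g g'.
move=> e e' [lf pf];split;first exact: l2_eq e' lf.
move=> x y Dx Dy;rewrite -!e// pf//;apply: ip_eq => z Dz;by rewrite e'.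
Qed.

Lemma prim_holder f f' x y : prim f f' -> D x -> D y ->
 `|f y - f x| <= nrm f' * Num.sqrt `|y - x|.
by move=> [lf pf] Dx Dy;rewrite pf// -nrm_ind//;apply: CS => //;exact: l2_ind. Qed.

(** Retraction onto the domain. Composition with it extends a function continuously to the line,
    from which measurability on the domain follows. *)
Definition clamp (x : R) : R:= if b then x else Num.max 0 x.

Lemma clampD x : D (clamp x).
by rewrite /clamp;case: b => //=;rewrite in_itv/= andbT le_max lexx. Qed.
Lemma clampE x : D x -> clamp x = x.
by rewrite /clamp;case: b => //=;rewrite in_itv/= andbT => /max_idPr. Qed.
Lemma clamp_lip x y : `|clamp x - clamp y| <= `|x - y|.
rewrite /clamp;case: b => //=.
by case: (lerP 0 x) => hx;case: (lerP 0 y) => hy;rewrite ?subrr ?normr0 ?subr0 ?sub0r//;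
 rewrite ler_norml;apply/andP;split;
 [case: (lerP 0 (x - y))| case: (lerP 0 (x - y))|case: (lerP 0 (x-y))|case: (lerP 0 (x - y))] => h;
 rewrite ?(ger0_norm h) ?(ltr0_norm h) ?normrN ?(ger0_norm hx) ?(ger0_norm hy);lra.
Qed.

Lemma prim_continuous f f' : prim f f' -> continuous (f \o clamp).
move=> pf x;apply/cvgrPdist_le => e e0.
have n0 : 0 < nrm f' + 1 by rewrite ltr_wpDl ?nrm_ge0.
apply/nbhs_ballP;exists ((e / (nrm f' + 1)) ^+ 2) => /=.
 by rewrite exprn_gt0// divr_gt0.
move=> y;rewrite /ball /= => xy.
apply: leT (prim_holder pf (clampD _) (clampD _)) _.
apply: (@leT _ _ ((nrm f' + 1) * Num.sqrt `|x - y|)).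
 apply: ler_pM;rewrite ?nrm_ge0 ?sqrtr_ge0 ?lerDl//.
 by apply: ler_wsqrtr;exact: clamp_lip.
rewrite mulrC -ler_pdivlMr//;apply: sqrt_le;last exact: ltW.
by rewrite divr_ge0 ?ltW.
Qed.

Lemma prim_meas f f' : prim f f' -> measurable_fun D f.
move=> pf;apply: (eq_measurable_fun (f \o clamp)).
 by move=> x;rewrite inE => Dx /=;rewrite clampE.
apply: measurable_funTS;apply: continuous_measurable_fun;exact: prim_continuous pf.
Qed.

(** Average over (x, x + l^2], which stays in the domain: f(x) l^2 is the integral of f plus that of
    f(x) - f, and the latter is handled by Cauchy-Schwarz. The free length [l] becomes a weight in
    the energy estimate; the localised norms give decay at infinity. *)
Lemma prim_sup_local f f' x l : prim f f' -> l2 f -> D x -> 0 < l ->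
 `|f x| * l <= nrm (ind x (x + l ^+ 2) * f) + l ^+ 2 * nrm (ind x (x + l ^+ 2) * f').
move=> pf lf Dx l0;have [lf' ef]:= pf.
have l20 : 0 <= l ^+ 2 by rewrite sqr_ge0.
have xl : x <= x + l ^+ 2 by rewrite lerDl.
have Dxl:= domP Dx xl.
pose I:= ind x (x + l ^+ 2).
have lI : l2 I by exact: l2_ind.
have nI : nrm I = l.
 by rewrite /I nrm_ind// addrAC subrr add0r (ger0_norm l20) sqrtr_sqr ger0_norm ?ltW.
have bI z : D z -> `|((fun=> f x) - f) z * I z| <= nrm (I * f') * l * `|I z|.
 move=> Dz;rewrite normrM;rewrite /I ind_le//.
 case: (boolP (x < z <= _)) => [/andP[xz zl]|];last by rewrite normr0 !mulr0.
 have -> : `|((fun=> f x) - f) z| = `|ip (I * f') (ind x z)|.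
  rewrite fE distrC ef//;congr (`|_|);apply: ip_eq => w _;rewrite fE /I !ind_le// ?(ltW xz)//.
  case: (boolP (x < w <= z)) => [/andP[h1 h2]|];last by rewrite !mulr0.
  by rewrite h1 (leT h2 zl) mul1r.
 rewrite normr1 !mulr1;apply: leT (CS (l2_indM _ _ lf') (l2_ind Dx Dz)) _;rewrite nrm_ind//.
 rewrite ler_wpM2l ?nrm_ge0//;apply: sqrt_le;first exact: ltW.
 by rewrite ger0_norm;lra.
have mI : measurable_fun D (((fun=> f x) - f) * I).
 apply: measurable_funM;last exact: (@l2_meas _ b).
 by apply: measurable_funB => //;exact: prim_meas pf.
have c0 : 0 <= nrm (I * f') * l by rewrite mulr_ge0 ?nrm_ge0// ltW.
have [lJ]:= nrm_le_scale mI lI c0 bI;rewrite nI => nJ.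
have e : f x * l ^+ 2 = ip f I + ip (((fun=> f x) - f) * I) I.
 have <- : ip (f x *: I) I = f x * l ^+ 2 by rewrite ipZl// -nrm_sq nI.
 have -> : f x *: I = f * I + ((fun=> f x) - f) * I by apply/funext => z;rewrite !fE;ring.
 rewrite ipDl//;last by rewrite mulrC;exact: l2_indM.
 congr (_ + _);apply: ip_eq => z _;rewrite !fE /I ind_le//.
 by case: (_ && _);rewrite /= ?mulr1 ?mulr0.
have h1 : `|ip f I| <= nrm (I * f) * l.
 rewrite -[X in _ <= _ * X]nI;have -> : ip f I = ip (I * f) I.
  by apply: ip_eq => z _;rewrite fE /I ind_le//;case: (_ && _);rewrite /= ?mulr1 ?mul1r ?mulr0.
 by apply: CS => //;exact: l2_indM.
have h2 : `|ip (((fun=> f x) - f) * I) I| <= nrm (I * f') * l * l * l.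
 apply: leT (CS _ _) _ => //;rewrite nI ler_wpM2r// ltW//.
have : `|f x| * l ^+ 2 <= (nrm (I * f) + l ^+ 2 * nrm (I * f')) * l.
 rewrite -[X in _ * X <= _](ger0_norm l20) -normrM e.
 apply: leT (ler_normD _ _) _;apply: leT (lerD h1 h2) _.
 by apply: eqW;ring.
by rewrite expr2 mulrA ler_pM2r.
Qed.

Lemma prim_sup_scaled f f' x l : prim f f' -> l2 f -> D x -> 0 < l ->
 `|f x| * l <= nrm f + l ^+ 2 * nrm f'.
move=> pf lf Dx l0;apply: leT (prim_sup_local pf lf Dx l0) _.
have lf':= prim_l2 pf.
by apply: lerD;[exact: nrm_indM|rewrite ler_wpM2l ?sqr_ge0// nrm_indM].
Qed.

Lemma prim_sup f f' x : prim f f' -> l2 f -> D x -> `|f x| <= nrm f + nrm f'.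
by move=> pf lf Dx;have:= prim_sup_scaled pf lf Dx ltr01;rewrite expr1n !mulr1 mul1r. Qed.

(** The difference H between f g and the integral of its expected derivative has increments over
    [u, v] of size sqrt (v - u) times the increment of G, where G integrates f'^2 + g'^2 + 1. *)
Lemma prim_mul f f' g g' A B : prim f f' -> prim g g' ->
 (forall x, D x -> `|f x| <= A) -> (forall x, D x -> `|g x| <= B) ->
 prim (f * g) (f' * g + f * g').
move=> pf pg fA gB.
have [lf' ef]:= pf;have [lg' eg]:= pg.
have mf:= prim_meas pf;have mg:= prim_meas pg.
have l1 : l2 (f' * g) by rewrite mulrC;exact: l2M gB lf'.
have l22 : l2 (f * g') by exact: l2M fA lg'.
have lT : l2 (f' * g + f * g') by exact: l2D.
split => // x y.
wlog xy : x y / x <= y => [wl Dx Dy|Dx Dy].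
 have [xy|/ltW yx]:= leP x y;first exact: wl.
 by rewrite ind_opp ipNr//;[rewrite -wl// opprB|exact: l2_ind].
pose H u:= f u * g u - ip (f' * g + f * g') (ind x u).
pose P (h : R -> R) u:= ip (ind x u * h) h.
pose G u:= P f' u + P g' u + u.
suff : H y = H x.
 rewrite /H => h;rewrite !fE.
 have i0 : ip (f' * g + f * g') (ind x x) = 0.
  by have -> : ind x x = 0 by [rewrite ind_unlock subrr];rewrite ipC ip0l.
 by rewrite i0 in h;lra.
have dP h u v : l2 h -> x <= u -> u <= v -> v <= y -> P h v - P h u = nrm (ind u v * h) ^+ 2.
 move=> lh xu uv vy;have Du:= domP Dx xu;have Dv:= domP Du uv.
 rewrite /P -(ind_chasles x u v) mulrDl ipDl//;try exact: l2_indM.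
 rewrite addrAC subrr add0r nrm_sq;apply: ip_eq => z _;rewrite !fE.
 rewrite ind_le//;case: (_ && _) => /=;rewrite ?mul1r ?mul0r//.
have key h h' k k' c u v : prim h h' -> prim k k' -> x <= u -> u <= v -> v <= y -> c = u \/ c = v ->
 `|ip h' (((fun=> k c) - k) * ind u v)| <=
  nrm k' * Num.sqrt (v - u) * (P h' v - P h' u + (v - u)).
 move=> ph pk xu uv vy cuv;have Du:= domP Dx xu;have Dv:= domP Du uv.
 have lh':= prim_l2 ph;have lI:= l2_ind Du Dv.
 have vu0 : 0 <= v - u by rewrite subr_ge0.
 have Dc : D c by case: cuv => ->.
 have bd z : D z -> `|(((fun=> k c) - k) * ind u v) z| <= nrm k' * Num.sqrt (v - u) * `|ind u v z|.
  move=> Dz;rewrite fE normrM ind_le//.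
  case: (boolP (u < z <= v)) => [/andP[uz zv]|];last by rewrite normr0 !mulr0.
  rewrite normr1 !mulr1 fE distrC;apply: leT (prim_holder pk Dc Dz) _.
  rewrite ler_wpM2l ?nrm_ge0// ler_sqrt//.
  by case: cuv => ->;rewrite ler_norml;apply/andP;split;lra.
 have mJ : measurable_fun D (((fun=> k c) - k) * ind u v).
  apply: measurable_funM;last exact: measurable_ind.
  by apply: measurable_funB => //;exact: prim_meas pk.
 have c0 : 0 <= nrm k' * Num.sqrt (v - u) by rewrite mulr_ge0 ?nrm_ge0 ?sqrtr_ge0.
 have [lJ nJ]:= nrm_le_scale mJ lI c0 bd.
 rewrite nrm_ind// ger0_norm// in nJ.
 have -> : ip h' (((fun=> k c) - k) * ind u v) = ip (ind u v * h') (((fun=> k c) - k) * ind u v).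
  apply: ip_eq => z _;rewrite !fE ind_le//.
  by case: (_ && _);rewrite /= ?mulr1 ?mul1r ?mulr0.
 apply: leT (CS _ lJ) _;first exact: l2_indM.
 apply: leT (ler_wpM2l (nrm_ge0 _ _) nJ) _.
 rewrite mulrCA ler_wpM2l// dP//.
 set s:= Num.sqrt (v - u);have -> : v - u = s ^+ 2 by rewrite sqr_sqrtr.
 exact: mul_le_sqrD.
apply: (small_increments (G:= G) xy) => e e0.
pose c:= nrm f' + nrm g' + 1.
have c0 : 0 < c by rewrite ltr_wpDl ?addr_ge0 ?nrm_ge0.
exists ((e / (2 * c)) ^+ 2);first by rewrite exprn_gt0// divr_gt0// mulr_gt0.
move=> u v xu uv vy vud.
have Du:= domP Dx xu;have Dv:= domP Du uv.
have lI:= l2_ind Du Dv.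
(* The increment of the product is written (f v - f u) g v + f u (g v - g u): [g] is frozen at the
   right end, [f] at the left. *)
have -> : H v - H u = ip f' (((fun=> g v) - g) * ind u v) + ip g' (((fun=> f u) - f) * ind u v).
 have -> : H v - H u = (f v - f u) * g v + f u * (g v - g u) - ip (f' * g + f * g') (ind u v).
  rewrite /H -(ind_chasles x u v) ipDr//;[by ring|exact: l2_ind].
 have E1 h k q : l2 k -> l2 (h * ind u v) ->
   ip k (((fun=> q) - h) * ind u v) = q * ip k (ind u v) - ip (k * h) (ind u v).
  move=> lk lh;have -> : ((fun=> q) - h) * ind u v = q *: ind u v - h * ind u v.
   by apply/funext => z;rewrite !fE mulrBl.
  by rewrite ipBr ?ipZr ?ip_mulA//;exact: l2Z.
 have lga : l2 (g * ind u v) by exact: l2M gB lI.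
 have lfa : l2 (f * ind u v) by exact: l2M fA lI.
 by rewrite ef// eg// ipDl// !E1// (mulrC f g');ring.
apply: leT (ler_normD _ _) _.
have s0 : Num.sqrt (v - u) <= e / (2 * c).
 have ed : 0 <= e / (2 * c) by rewrite divr_ge0 ?mulr_ge0 ?ltW.
 exact: sqrt_le.
have h1:= key f f' g g' v u v pf pg xu uv vy (or_intror erefl).
have h2:= key g g' f f' u u v pg pf xu uv vy (or_introl erefl).
have a1 : 0 <= P f' v - P f' u by rewrite dP// sqr_ge0.
have a2 : 0 <= P g' v - P g' u by rewrite dP// sqr_ge0.
have vu : 0 <= v - u by rewrite subr_ge0.
have cc (n : R) : 0 <= n -> n <= c -> n * Num.sqrt (v - u) <= e / 2.
 move=> n0 nc;apply: leT (ler_pM n0 (sqrtr_ge0 _) nc s0) _.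
 by apply: eqW;field;rewrite gt_eqF.
have n1:= nrm_ge0 b f';have n2:= nrm_ge0 b g'.
have b1 : nrm g' * Num.sqrt (v - u) * (P f' v - P f' u + (v - u)) <= e / 2 * (P f' v - P f' u + (v - u)).
 by apply: ler_wpM2r;[exact: addr_ge0|apply: cc => //;rewrite /c;lra].
have b2 : nrm f' * Num.sqrt (v - u) * (P g' v - P g' u + (v - u)) <= e / 2 * (P g' v - P g' u + (v - u)).
 by apply: ler_wpM2r;[exact: addr_ge0|apply: cc => //;rewrite /c;lra].
have m1:= mulr_ge0 (ltW e0) a1;have m2:= mulr_ge0 (ltW e0) a2.
apply: leT (lerD (leT h1 b1) (leT h2 b2)) _.
rewrite /G;lra.
Qed.

End Primitives.

(** * Integration by parts on the line and on the half-line *)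

Section IntegrationByParts.
Variable R : realType.
Local Notation mu:= (@lebesgue_measure R).
Variable b : bool.
Local Notation D:= (@dom R b).
Local Notation l2:= (@l2 R b).
Local Notation nrm:= (@nrm R b).
Local Notation ip:= (@ip R b).
Local Notation prim:= (@prim R b).

(** Left end of the n-th truncation window: it tends to minus infinity on the line and stays at the
    boundary point on the half-line. *)
Definition lo (n : nat) : R:= if b then - n%:R else 0.

Lemma lo_dom n : D (lo n).
by rewrite /lo;case: b => //=;rewrite in_itv/= lexx. Qed.
Lemma lo_le n : lo n <= n%:R.
by rewrite /lo;case: b;rewrite ?ler0n// lerNl (leT (_ : _ <= 0)) ?oppr_le0 ?ler0n. Qed.
Lemma nat_dom n : D n%:R.
by case: b => //=;rewrite in_itv/= andbT. Qed.

Definition cutoff n (f : R -> R):= ind (lo n) n%:R * f.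

Lemma l2_cutoff n f : l2 f -> l2 (cutoff n f). exact: l2_indM. Qed.

Lemma cutoff_cvg f : l2 f -> nrm (cutoff n f - f) @[n --> \oo] --> 0.
move=> lf;apply: l2_strong => //.
- by move=> n;exact: l2_cutoff.
- by move=> n;exact: nrm_indM.
have n0 : {ae mu, forall x : R, x != 0}.
 exists [set 0];split;[exact: measurable_set1|exact: lebesgue_measure_set1|].
 by move=> x /= /negP;rewrite negbK => /eqP.
apply: (aeS _ n0) => x x0 Dx;apply/cvgrPdist_lt => e e0.
exists (Num.truncn `|x|).+1 => //= n hn;rewrite /cutoff fE ind_le ?lo_le//.
have xn : `|x| < n%:R by apply: lt_le_trans (truncnS_gt _) _;rewrite ler_nat.
rewrite (_ : (_ && _) = true) ?mul1r ?subrr ?normr0//.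
move: xn;rewrite ltr_norml => /andP[h1 /ltW h2];rewrite h2 andbT /lo.
by move: Dx;rewrite /lo;case: b => //=;rewrite in_itv/= andbT lt_def x0.
Qed.

Lemma cvg0_le (u v : nat -> R) : (forall n, `|u n| <= v n) ->
 v n @[n --> \oo] --> 0 -> u n @[n --> \oo] --> 0.
move=> uv /cvgrPdist_lt v0;apply/cvgrPdist_lt => e e0;apply: filterS (v0 e e0) => n.
by rewrite !sub0r !normrN => h;apply: le_lt_trans (uv n) _;apply: le_lt_trans h;exact: ler_norm.
Qed.

Lemma ip_cutoff_cvg f g : l2 f -> l2 g -> ip (cutoff n f) g @[n --> \oo] --> ip f g.
move=> lf lg;apply/subr_cvg0.
apply: (@cvg0_le _ (fun n => nrm (cutoff n f - f) * nrm g)) => [n|].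
 rewrite -ipBl//;last exact: l2_cutoff.
 by apply: CS => //;apply: l2B => //;exact: l2_cutoff.
by rewrite -[X in _ --> X](mul0r (nrm g));apply: cvgM;[exact: cutoff_cvg|exact: cvg_cst].
Qed.

(** The unit interval to the right of [x] lies outside the n-th window, so the local sup bound
    involves tails of the norms only. Boundary terms at infinity vanish for this reason. *)
Lemma prim_tail f f' n x : prim f f' -> l2 f -> x = lo n.+1 \/ x = n.+1%:R -> b \/ x = n.+1%:R ->
 `|f x| <= nrm (cutoff n f - f) + nrm (cutoff n f' - f').
move=> pf lf hx hb;have lf':= prim_l2 pf.
have Dx : D x by case: hx => ->;[exact: lo_dom|exact: nat_dom].
have:= prim_sup_local pf lf Dx ltr01;rewrite expr1n mulr1 mul1r => /leT;apply.
have bd h : l2 h -> nrm (ind x (x + 1) * h) <= nrm (cutoff n h - h).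
 move=> lh;apply: nrm_le;[exact: l2_indM|by apply: l2B => //;exact: l2_cutoff|].
 move=> z _;rewrite /cutoff !fE !ind_le ?lo_le ?lerDl//.
 case: (boolP (x < z <= x + 1)) => [/andP[h1 h2]|_];last by rewrite mul0r normr0.
 rewrite mul1r (_ : (lo n < z <= n%:R) = false) ?mul0r ?sub0r ?normrN//.
 apply/negP => /andP[h3 h4];case: hb => [hb|ex];last first.
  by move: h1;rewrite ex -natr1;lra.
 case: hx => ex;last by move: h1;rewrite ex -natr1;lra.
 by move: h2 h3;rewrite ex /lo hb -natr1;lra.
by apply: lerD;exact: bd.
Qed.

(** The product rule on growing windows. The right boundary term tends to zero; the left one does so
    on the line, and on the half-line it is the value at 0. *)
Lemma ibp f f' g g' : prim f f' -> prim g g' -> l2 f -> l2 g ->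
 ip f' g + ip f g' = if b then 0 else - (f 0 * g 0).
move=> pf pg lf lg;have lf':= prim_l2 pf;have lg':= prim_l2 pg.
have pfg:= prim_mul pf pg (fun x => prim_sup pf lf) (fun x => prim_sup pg lg).
have [lfg efg]:= pfg.
pose T (h : R -> R) n:= nrm (cutoff n h - h).
have cT h : l2 h -> T h n @[n --> \oo] --> 0 by exact: cutoff_cvg.
have cS : (T f n + T f' n) * (T g n + T g' n) @[n --> \oo] --> 0.
 rewrite -[X in _ --> X](mulr0 (0 + 0)) -{3}(addr0 0).
 by apply: cvgM;apply: cvgD;exact: cT.
have bd x n : x = lo n.+1 \/ x = n.+1%:R -> b \/ x = n.+1%:R ->
  `|f x * g x| <= (T f n + T f' n) * (T g n + T g' n).
 by move=> h1 h2;rewrite normrM;apply: ler_pM => //;exact: prim_tail h1 h2.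
have c1 : f n.+1%:R * g n.+1%:R @[n --> \oo] --> 0.
 by apply: cvg0_le cS => n;apply: bd;right.
have c2 : f (lo n.+1) * g (lo n.+1) @[n --> \oo] --> (if b then 0 else f 0 * g 0).
 have [hb|hb]:= boolP b;first by apply: cvg0_le cS => n;apply: bd;left.
 by rewrite /lo (negbTE hb);exact: cvg_cst.
have c3 : ip (cutoff n.+1 f') g + ip (cutoff n.+1 f) g' @[n --> \oo] --> ip f' g + ip f g'.
 by apply: cvgD;rewrite (@cvg_shiftS _ (fun n => ip (cutoff n _) _));exact: ip_cutoff_cvg.
have e n : ip (cutoff n.+1 f') g + ip (cutoff n.+1 f) g' =
  f n.+1%:R * g n.+1%:R - f (lo n.+1) * g (lo n.+1).
 have:= efg (lo n.+1) n.+1%:R (lo_dom _) (nat_dom _);rewrite !mulfE => ->.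
 rewrite ipDl;last exact: l2_ind (lo_dom _) (nat_dom _).
 - by congr (_ + _);apply: ip_eq => z _;rewrite /cutoff !fE;ring.
 - rewrite mulrC;apply: l2M lf';[exact: prim_meas pg|move=> x;exact: prim_sup pg lg].
 - by apply: l2M lg';[exact: prim_meas pf|move=> x;exact: prim_sup pf lf].
rewrite (funext e) in c3.
have c4 : f n.+1%:R * g n.+1%:R - f (lo n.+1) * g (lo n.+1) @[n --> \oo] -->
  0 - (if b then 0 else f 0 * g 0) by exact: cvgB.
by rewrite -(cvg_lim (@Rhausdorff R) c3) (cvg_lim (@Rhausdorff R) c4);case: b;rewrite sub0r ?oppr0.
Qed.

End IntegrationByParts.

(** * Measure preserving maps: translations and the reflection *)

Section Translation.
Variable R : realType.
Local Notation mu:= (@lebesgue_measure R).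
Local Notation l2:= (@l2 R true).
Local Notation nrm:= (@nrm R true).
Local Notation ip:= (@ip R true).

(** Lebesgue measure is determined by its values on half-open intervals, so their preservation is
    enough. *)
Lemma integral_preserving (phi : R -> R) (f : R -> \bar R) :
 measurable_fun setT phi ->
 (forall x y : R, x <= y -> mu (phi @^-1` `]x, y]) = (y - x)%:E) ->
 measurable_fun setT f -> (forall x, (0 <= f x)%E) ->
 (\int[mu]_x f (phi x) = \int[mu]_x f x)%E.
move=> mphi hphi mf f0.
pose M:= isMeasurableFun.Build _ _ (measurableTypeR R) (measurableTypeR R) phi mphi.
pose phi' : {mfun measurableTypeR R >-> measurableTypeR R}:= HB.pack phi M.
have <- : (\int[pushforward mu phi']_x f x = \int[mu]_x f x)%E.
 apply: eq_measure_integral => A mA _;apply/esym.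
 apply: (@lebesgue_measure_unique R (pushforward mu phi')) => // X [[x y]] /= _ <-.
 have [xy|yx]:= leP x y;last by rewrite set_itv_ge ?measure0// bnd_simp -leNgt ltW.
 rewrite /pushforward hphi//.
 have:= lebesgue_measure_itv (Interval (BRight x) (BRight y));rewrite /= lte_fin => ->.
 by move: xy;rewrite le_eqVlt => /orP[/eqP->|xy];[rewrite ltxx subrr|rewrite xy EFinB].
by rewrite ge0_integral_pushforward.
Qed.

Definition preserving (phi : R -> R):= measurable_fun setT phi /\
 forall x y : R, x <= y -> mu (phi @^-1` `]x, y]) = (y - x)%:E.

Lemma l2_comp phi f : preserving phi -> l2 f -> l2 (f \o phi) /\ nrm (f \o phi) = nrm f.
move=> [mphi hphi] lf;have mf:= l2_meas lf.
have e : (\int[mu]_x (((f \o phi) x) ^+ 2)%:E = \int[mu]_x ((f x) ^+ 2)%:E)%E.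
 apply: (integral_preserving (f:= fun x => ((f x) ^+ 2)%:E)) => //.
 - by apply/measurable_EFinP;apply: measurable_funX.
 - by move=> x;rewrite lee_fin sqr_ge0.
have lfp : l2 (f \o phi).
 split;first exact: measurableT_comp.
 by rewrite e;case: lf.
split => //;apply/eqP;rewrite -(eqrXn2 (n:= 2)) ?nrm_ge0//;apply/eqP.
by have:= ip_sq lfp;rewrite /= e (ip_sq lf) => -[].
Qed.

(** Polarisation: the norms of f, g and f + g are preserved. *)
Lemma ip_comp phi f g : preserving phi -> l2 f -> l2 g -> ip (f \o phi) (g \o phi) = ip f g.
move=> hp lf lg;have [lfp nf]:= l2_comp hp lf;have [lgp ng]:= l2_comp hp lg.
have [_]:= l2_comp hp (l2D lf lg).
move=> /(congr1 (fun z => z ^+ 2));rewrite (nrm_sqD lf lg).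
rewrite (_ : (f + g) \o phi = (f \o phi) + (g \o phi))//.
have ->:= nrm_sqD lfp lgp;rewrite nf ng.
by lra.
Qed.

Definition tr (c : R) (f : R -> R) : R -> R:= f \o (fun x => x + c).
Definition refl (f : R -> R) : R -> R:= f \o -%R.

Lemma preserving_tr c : preserving (fun x => x + c).
split;first by apply: measurable_funD.
move=> x y xy;rewrite (_ : _ @^-1` _ = `]x - c, y - c]%classic);last first.
 by apply/seteqP;split => z /=;rewrite !in_itv/= => /andP[h1 h2];apply/andP;split;lra.
have:= lebesgue_measure_itv (Interval (BRight (x - c)) (BRight (y - c)));rewrite /= lte_fin => ->.
case: ltrP => h;first by rewrite -EFinB;congr (_%:E);ring.
by have -> : x = y;[lra|rewrite subrr].
Qed.

Lemma preserving_refl : preserving -%R.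
split;first exact: oppr_measurable.
move=> x y xy;rewrite (_ : _ @^-1` _ = `[- y, - x[%classic);last first.
 by apply/seteqP;split => z /=;rewrite !in_itv/= => /andP[h1 h2];apply/andP;split;lra.
have:= lebesgue_measure_itv (Interval (BLeft (- y)) (BLeft (- x)));rewrite /= lte_fin => ->.
case: ltrP => h;first by rewrite -EFinB;congr (_%:E);ring.
by have -> : x = y;[lra|rewrite subrr].
Qed.

Lemma l2_tr c f : l2 f -> l2 (tr c f).
by move=> /(l2_comp (preserving_tr c)) []. Qed.
Lemma nrm_tr c f : l2 f -> nrm (tr c f) = nrm f.
by move=> /(l2_comp (preserving_tr c)) []. Qed.
Lemma tr_tr c d f : tr c (tr d f) = tr (c + d) f.
by apply/funext => x;rewrite /tr /= addrA. Qed.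
Lemma tr0 f : tr 0 f = f.
by apply/funext => x;rewrite /tr /= addr0. Qed.
Lemma ip_tr c f g : l2 f -> l2 g -> ip (tr c f) g = ip f (tr (- c) g).
move=> lf lg;rewrite -(ip_comp (preserving_tr c) lf (l2_tr _ lg)).
by congr (ip _ _);rewrite -/(tr _ _) tr_tr subrr tr0.
Qed.
Lemma tr_ind c x y : tr c (ind x y) = ind (x - c) (y - c).
by apply/funext => z;rewrite /tr /= !indE !ltrBlDr !lerBrDr. Qed.

End Translation.

(** * Steklov means and centred difference quotients *)

Section Steklov.
Variable R : realType.
Local Notation mu:= (@lebesgue_measure R).
Local Notation l2:= (@l2 R true).
Local Notation nrm:= (@nrm R true).
Local Notation ip:= (@ip R true).
Local Notation prim:= (@prim R true).

Lemma ae_neq2 (x y : R) : {ae mu, forall z : R, z != x /\ z != y}.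
have h (w : R) : {ae mu, forall z : R, z != w}.
 exists [set w];split;[exact: measurable_set1|exact: lebesgue_measure_set1|].
 by move=> z /= /negP;rewrite negbK => /eqP.
by apply: (aeS2 _ (h x) (h y)).
Qed.

Lemma ip_ae (f g h : R -> R) : l2 f -> l2 g -> l2 h -> {ae mu, forall x, f x = g x} -> ip f h = ip g h.
move=> lf lg lh fg;rewrite !ipE /Rintegral;congr fine;apply: ae_eq_integral.
- exact: mdom.
- by apply/measurable_EFinP;apply: measurable_funM;exact: (@l2_meas _ true).
- by apply/measurable_EFinP;apply: measurable_funM;exact: (@l2_meas _ true).
- by apply: (aeS _ fg) => x /= -> _.
Qed.

Lemma l2_indT x y : l2 (ind x y). exact: l2_ind. Qed.

Variable r : R.
Hypothesis r0 : 0 < r.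

(** [stek] averages over the window of radius r, and [dq] below is the centred difference quotient
    of the same radius. The two are matched: the derivative of a mean and the mean of a derivative
    are both the quotient. Thus [dq] is a bounded skew substitute for differentiation and [stek] a
    bounded symmetric smoothing. *)
Lemma stek_seal : {F : (R -> R) -> R -> R | forall f s, F f s = (2 * r)^-1 * ip f (ind (s - r) (s + r))}.
by exists (fun f s => (2 * r)^-1 * ip f (ind (s - r) (s + r))). Qed.
Definition stek:= sval stek_seal.
Lemma stekE f s : stek f s = (2 * r)^-1 * ip f (ind (s - r) (s + r)).
exact: (svalP stek_seal). Qed.
Lemma dq_seal : {F : (R -> R) -> R -> R | forall f, F f = (2 * r)^-1 *: (tr r f - tr (- r) f)}.
by exists (fun f => (2 * r)^-1 *: (tr r f - tr (- r) f)). Qed.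
Definition dq:= sval dq_seal.
Lemma dqE f : dq f = (2 * r)^-1 *: (tr r f - tr (- r) f).
exact: (svalP dq_seal). Qed.

Let rr0 : 0 < 2 * r. by rewrite mulr_gt0. Qed.
Let ir0 : 0 < (2 * r)^-1. by rewrite invr_gt0. Qed.

Lemma l2_dq f : l2 f -> l2 (dq f).
by move=> lf;rewrite dqE;apply: l2Z;apply: l2B;exact: l2_tr. Qed.

Lemma nrm_dq f : l2 f -> nrm (dq f) <= r^-1 * nrm f.
move=> lf;rewrite !dqE nrmZ;last by apply: l2B;exact: l2_tr.
rewrite gtr0_norm//;apply: leT (_ : (2 * r)^-1 * (nrm f + nrm f) <= _).
 have h:= nrmB (l2_tr r lf) (l2_tr (- r) lf);rewrite !nrm_tr// in h.
 by apply: ler_wpM2l;[exact: ltW|].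
by apply: eqW;field;rewrite gt_eqF.
Qed.

Lemma ip_dq f g : l2 f -> l2 g -> ip (dq f) g = - ip f (dq g).
move=> lf lg;have l1:= l2_tr r lf;have l3:= l2_tr (- r) lf.
have l4:= l2_tr r lg;have l5:= l2_tr (- r) lg.
rewrite !dqE ipZl//;last exact: l2B.
rewrite ipZr//;last exact: l2B.
rewrite ipBl// ipBr// !ip_tr// opprK;ring.
Qed.

Lemma dqD f g : dq (f + g) = dq f + dq g.
by apply/funext => x;rewrite !dqE !fE /tr /= !fE;ring. Qed.
Lemma dqZ c f : dq (c *: f) = c *: dq f.
by apply/funext => x;rewrite !dqE !fE /tr /= !fE;ring. Qed.

Lemma stekD f g : l2 f -> l2 g -> stek (f + g) = stek f + stek g.
by move=> lf lg;apply/funext => s;rewrite fE !stekE ipDl ?mulrDr//;exact: l2_indT. Qed.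
Lemma stekZ c f : l2 f -> stek (c *: f) = c *: stek f.
by move=> lf;apply/funext => s;rewrite fE !stekE ipZl 1?mulrCA//;exact: l2_indT. Qed.

Lemma prim_stek f : l2 f -> prim (stek f) (dq f).
move=> lf;split;first exact: l2_dq.
move=> x y _ _;rewrite !dqE ipZl;[|by apply: l2B;exact: l2_tr|exact: l2_indT].
rewrite ipBl;try exact: l2_tr;try exact: l2_indT.
rewrite !ip_tr ?opprK//;try exact: l2_indT.
rewrite !tr_ind opprK !stekE -mulrBr;congr (_ * _).
have c1:= ind_chasles (x - r) (x + r) (y + r).
have c2:= ind_chasles (x - r) (y - r) (y + r).
have c3 : ip f (ind (x - r) (x + r)) + ip f (ind (x + r) (y + r)) =
     ip f (ind (x - r) (y - r)) + ip f (ind (y - r) (y + r)).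
 by rewrite -!ipDr ?c1 ?c2//;exact: l2_indT.
by lra.
Qed.

Lemma stek_of_prim f f' : prim f f' -> stek f' = dq f.
by move=> [_ e];apply/funext => s;rewrite !stekE -e// dqE !fE. Qed.

Lemma ind_center s z : ind (s - r) (s + r) z = ind (- r) r (z - s).
by rewrite !indE;congr (_%:R - _%:R);congr nat_of_bool;congr andb;lra. Qed.

Let le_sr s : s - r <= s + r. by have:= r0;lra. Qed.

Lemma nrm_ind_center s : nrm (ind (s - r) (s + r)) ^+ 2 = 2 * r.
by rewrite nrm_sq ip_ind//;ring. Qed.

Lemma ip_ind_local f s : l2 f -> ip f (ind (s - r) (s + r)) = ip (ind (s - r) (s + r) * f) (ind (s - r) (s + r)).
by move=> lf;apply: ip_eq => z _;rewrite fE ind_le//;case: (_ && _);rewrite /= ?mulr1 ?mul1r ?mulr0.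
Qed.

Lemma stek_sq f s : l2 f ->
 (stek f s) ^+ 2 <= (2 * r)^-1 * ip (ind (s - r) (s + r) * f) f.
move=> lf;rewrite !stekE.
have -> (X : R) : ((2 * r)^-1 * X) ^+ 2 = (2 * r)^-1 * ((2 * r)^-1 * X ^+ 2) by ring.
apply: ler_wpM2l;first exact: ltW.
rewrite ler_pdivrMl//.
rewrite ip_ind_local//;set I:= ind _ _.
have lI : l2 I by exact: l2_indT.
have lIf : l2 (I * f) by exact: l2_indM.
have -> : ip (I * f) f = nrm (I * f) ^+ 2.
 rewrite nrm_sq;apply: ip_eq => z _;rewrite !fE /I ind_le//.
 by case: (_ && _);rewrite /= ?mul1r ?mul0r.
rewrite -(nrm_ind_center s) -/I -exprMn [X in _ <= X ^+ 2]mulrC.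
by rewrite -(real_normK (num_real (ip _ _))) ler_pXn2r ?nnegrE// ?mulr_ge0 ?nrm_ge0//;exact: CS.
Qed.

Lemma kernel_int z (c : R) : 0 <= c ->
 (\int[mu]_s (ind (s - r) (s + r) z * c)%:E = (2 * r * c)%:E)%E.
move=> c0;pose A:= `[z - r, z + r[%classic.
transitivity (\int[mu]_s (c%:E * (\1_A s)%:E))%E.
 apply: eq_integral => s _;rewrite -EFinM;congr (_%:E);rewrite mulrC ind_le// indicE;congr (_ * _).
 congr (_%:R);congr nat_of_bool;apply/idP/idP => [/andP[h1 h2]|/set_mem].
  by apply/mem_set;rewrite /A /= in_itv /=;apply/andP;split;lra.
 by rewrite /A /= in_itv /= => /andP[h1 h2];apply/andP;split;lra.
have mA : measurable A by exact: measurable_itv.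
rewrite ge0_integralZl//;last first.
 by apply/measurable_EFinP;exact: measurable_indic.
rewrite integral_indic// setIT.
have:= lebesgue_measure_itv (Interval (BLeft (z - r)) (BLeft (z + r)));rewrite /= lte_fin => ->.
by rewrite ifT;[rewrite -EFinB -EFinM;congr (_%:E);ring|have:= r0;lra].
Qed.

Lemma measurable_kernel : measurable_fun setT (fun z : R * R => ind (z.1 - r) (z.1 + r) z.2).
rewrite (_ : (fun _ => _) = ind (- r) r \o (fun z : R * R => z.2 - z.1));last first.
 by apply/funext => z /=;rewrite ind_center.
apply: measurableT_comp;first exact: measurable_ind.
by apply: measurable_funB;[exact: measurable_snd|exact: measurable_fst].
Qed.

(** Pointwise Cauchy-Schwarz, then Tonelli: every point z is covered by windows of total weight
    one. *)
Lemma stek_l2_nrm f : l2 f -> l2 (stek f) /\ nrm (stek f) <= nrm f.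
move=> lf;have mf:= l2_meas lf.
have mS : measurable_fun setT (stek f) by exact: prim_meas (prim_stek lf).
apply: l2_of_le => //;last exact: nrm_ge0.
pose F (z : R * R):= (ind (z.1 - r) (z.1 + r) z.2 * (f z.2) ^+ 2)%:E.
have mF : measurable_fun setT F.
 apply/measurable_EFinP;apply: measurable_funM;first exact: measurable_kernel.
 by apply: measurable_funX;apply: measurableT_comp => //;exact: measurable_snd.
have F0 z : (0 <= F z)%E.
 by rewrite lee_fin mulr_ge0 ?sqr_ge0// ind_le.
have lI s : l2 (ind (s - r) (s + r) * f) by exact: l2_indM.
have e1 s : (\int[mu]_z F (s, z))%E = (ip (ind (s - r) (s + r) * f) f)%:E.
 rewrite -(integral_ip (lI s) lf).
 by apply: eq_integral => z _;rewrite /F /= fE -mulrA expr2.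
have mI : measurable_fun [set: measurableTypeR R] (fun x => \int[mu]_z F (x, z))%E.
 by apply: measurable_fun_fubini_tonelli_F.
apply: (@leT _ _ (\int[mu]_s ((2 * r)^-1%:E * \int[mu]_z F (s, z)))%E).
 apply: ge0_le_integral => //=.
 - by move=> x _;rewrite lee_fin sqr_ge0.
 - by apply/measurable_EFinP;exact: measurable_funX.
 - exact: measurable_funeM.
 - by move=> s _;rewrite e1 -EFinM lee_fin;exact: stek_sq.
rewrite ge0_integralZl//;last 2 first.
- by move=> s _;apply: integral_ge0 => z _.
- by rewrite lee_fin ltW.
rewrite [X in (_ * X <= _)%E](_ : _ = (2 * r)%:E * \int[mu]_y ((f y) ^+ 2)%:E)%E;last first.
 transitivity (\int[mu]_y \int[mu]_x F (x, y))%E;first exact: fubini_tonelli.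
 rewrite -ge0_integralZl//;last 3 first.
 - by apply/measurable_EFinP;exact: measurable_funX.
 - by move=> s _;rewrite lee_fin sqr_ge0.
 - by rewrite lee_fin ltW.
 by apply: eq_integral => z _;rewrite -EFinM;exact: (kernel_int z (sqr_ge0 (f z))).
rewrite (ip_sq lf) -!EFinM lee_fin mulrA mulVf ?gt_eqF// mul1r//.
Qed.

Lemma l2_stek f : l2 f -> l2 (stek f). by move=> /stek_l2_nrm []. Qed.
Lemma nrm_stek f : l2 f -> nrm (stek f) <= nrm f. by move=> /stek_l2_nrm []. Qed.

Lemma l2_norm f : l2 f -> l2 (fun x => `|f x|) /\ nrm (fun x => `|f x|) = nrm f.
move=> lf;have la : l2 (fun x => `|f x|).
 apply: (l2_le (g:= f) (c:= 1)) => //;last by move=> x _;rewrite mul1r normr_id.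
 by apply: measurableT_comp => //;exact: l2_meas lf.
split => //;apply/eqP;rewrite eq_le !nrm_le// => x _;by rewrite normr_id.
Qed.

(** Fubini with a symmetric kernel. Since the windows are half-open, the symmetry fails at the two
    points z - r and z + r, whence the comparison almost everywhere. *)
Lemma ip_stek f g : l2 f -> l2 g -> ip (stek f) g = ip f (stek g).
move=> lf lg;have mf:= l2_meas lf;have mg:= l2_meas lg.
pose F (z : measurableTypeR R * measurableTypeR R) :=
 (ind (z.1 - r) (z.1 + r) z.2 * f z.2 * g z.1)%:E.
have mF : measurable_fun [set: measurableTypeR R * measurableTypeR R] F.
 apply/measurable_EFinP;apply: measurable_funM;last first.
  by apply: measurableT_comp => //;exact: measurable_fst.
 apply: measurable_funM;first exact: measurable_kernel.
 by apply: measurableT_comp => //;exact: measurable_snd.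
have inner h c s : l2 h -> (\int[mu]_z (ind (s - r) (s + r) z * h z * c)%:E = (2 * r * stek h s * c)%:E)%E.
 move=> lh;transitivity (\int[mu]_z (((c *: h) z) * ind (s - r) (s + r) z)%:E)%E.
  by apply: eq_integral => z _;congr (_%:E);rewrite fE;ring.
 rewrite (@integral_ip R true);[|exact: l2Z|exact: l2_indT].
 rewrite ipZl//;last exact: l2_indT.
 by congr (_%:E);rewrite !stekE;field;rewrite gt_eqF.
have l2r h k : l2 h -> l2 k -> (\int[mu]_s (2 * r * stek h s * k s)%:E = (2 * r * ip (stek h) k)%:E)%E.
 move=> lh lk;rewrite -ipZl//;last exact: l2_stek.
 rewrite -(@integral_ip R true)//;last by apply: l2Z;exact: l2_stek.
have [laf _]:= l2_norm lf;have [lag _]:= l2_norm lg.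
have iF : (mu \x mu)%E.-integrable setT F.
 apply/(@integrable12ltyP _ _ _ _ R mu mu F mF).
 have -> : (\int[mu]_x \int[mu]_y `|F (x, y)| =
   \int[mu]_s (2 * r * stek (fun x => `|f x|) s * `|g s|)%:E)%E.
  apply: eq_integral => s _;rewrite -(inner _ _ _ laf);apply: eq_integral => z _.
  rewrite /F /= !normrM;congr ((_ * _ * _)%:E);rewrite ind_le//.
  by rewrite ger0_norm.
 by rewrite l2r// ltry.
have:= @Fubini _ _ _ _ R mu mu F iF.
have -> : (\int[mu]_x \int[mu]_y F (x, y) = \int[mu]_s (2 * r * stek f s * g s)%:E)%E.
 by apply: eq_integral => s _;rewrite -(inner _ _ _ lf).
have -> : (\int[mu]_y \int[mu]_x F (x, y) = \int[mu]_s (2 * r * stek g s * f s)%:E)%E.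
 apply: eq_integral => z _;rewrite -(inner _ _ _ lg);apply: ae_eq_integral => //.
 - rewrite /F /=;apply/measurable_EFinP;apply: measurable_funM => //;apply: measurable_funM => //.
  rewrite (_ : (fun _ => _) = ind (- r) r \o (fun s => z - s));last first.
   by apply/funext => s /=;rewrite ind_center.
  apply: measurableT_comp;first exact: measurable_ind.
  exact: measurable_funB.
 - apply/measurable_EFinP;apply: measurable_funM => //;apply: measurable_funM => //.
  exact: measurable_ind.
 - apply: (aeS _ (ae_neq2 (z - r) (z + r))) => s [s1 s2] _;congr (_%:E).
  rewrite !ind_le// [RHS]mulrAC;congr (_ * _ * _);congr (_%:R);congr nat_of_bool.
  move: s1 s2;rewrite /= !neq_lt => /orP[s1|s1] /orP[s2|s2];apply/idP/idP => /andP[h1 h2];apply/andP;split;lra.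
rewrite !l2r// => -[] /(mulfI _) ->;first exact: ipC.
by rewrite gt_eqF.
Qed.

Lemma ip_norm_le f g h k : l2 f -> l2 g -> l2 h -> l2 k ->
 (forall x, `|f x * g x| <= h x * k x) -> `|ip f g| <= ip h k.
move=> lf lg lh lk hl;rewrite ler_norml;apply/andP;split.
 rewrite lerNl -ipNl//;apply: ip_le => //;first exact: l2N.
 by move=> x _;rewrite fE mulNr;apply: leT (hl x);rewrite -normrN;exact: ler_norm.
by apply: ip_le => // x _;apply: leT (hl x);exact: ler_norm.
Qed.

(** For z in the window, |f z - f s| is at most the integral of |f'| over the whole window, that is,
    2 r times its mean. *)
Lemma stek_close_pt f f' s : prim f f' -> l2 f -> `|stek f s - f s| <= 2 * r * stek (fun x => `|f' x|) s.
move=> pf lf;have [lf' ef]:= pf;have [la _]:= l2_norm lf'.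
set I:= ind (s - r) (s + r);have lI : l2 I by exact: l2_indT.
have lIf : l2 (I * f) by exact: l2_indM.
pose M:= ip (fun x => `|f' x|) I.
have -> : 2 * r * stek (fun x => `|f' x|) s = M by rewrite !stekE mulrA divff ?mul1r// gt_eqF.
have I01 z : I z = (s - r < z <= s + r)%R%:R by rewrite /I ind_le.
have M0 : 0 <= M.
 by rewrite /M ipE;apply: Rintegral_ge0 => x _;rewrite mulr_ge0// I01.
pose X:= I * f - f s *: I.
have lX : l2 X by apply: l2B => //;exact: l2Z.
have bX z : `|X z| <= M * `|I z|.
 rewrite /X !fE I01;case: (boolP (_ && _)) => [/andP[h1 h2]|_];last first.
  by rewrite mul0r !mulr0 subrr normr0 mulr0.
 rewrite mul1r !mulr1 normr1 mulr1 ef//;apply: ip_norm_le => //;first exact: l2_indT.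
 move=> x;rewrite normrM ler_wpM2l// indE I01.
 have:= le_sr s => h3;case: (boolP (s < x <= z)) => [/andP[h4 h5]|_];
  case: (boolP (z < x <= s)) => [/andP[h6 h7]|_];rewrite ?subrr ?subr0 ?sub0r ?normrN ?normr0 ?normr1 ?ler0n//;
  rewrite (_ : (_ && _) = true)//;apply/andP;split;have:= r0;lra.
have [_ nX]:= nrm_le_scale (b:= true) (l2_meas lX) lI M0 (fun z _ => bX z).
have -> : stek f s - f s = (2 * r)^-1 * ip X I.
 rewrite /X ipBl//;last exact: l2Z.
 rewrite ipZl// -nrm_sq nrm_ind_center stekE (ip_ind_local _ lf);field;by rewrite gt_eqF.
rewrite normrM gtr0_norm// ler_pdivrMl//;apply: leT (CS lX lI) _.
apply: leT (ler_wpM2r (nrm_ge0 _ _) nX) _.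
by rewrite -mulrA -expr2 nrm_ind_center mulrC.
Qed.

Lemma stek_close f f' : prim f f' -> l2 f -> nrm (stek f - f) <= 2 * r * nrm f'.
move=> pf lf;have [lf' ef]:= pf;have [la na]:= l2_norm lf'.
have lS:= l2_stek la.
apply: leT (_ : 2 * r * nrm (stek (fun x => `|f' x|)) <= _);last first.
 by rewrite ler_pM2l// -na;exact: nrm_stek.
have l1 : l2 (stek f - f):= l2B (l2_stek lf) lf.
apply: (nrm_le_scale (b:= true) (l2_meas l1) lS (ltW rr0) _).2 => x _.
by apply: leT (stek_close_pt x pf lf) _;rewrite ler_pM2l//;exact: ler_norm.
Qed.

Lemma ip_refl f x y : l2 f -> ip (refl f) (ind x y) = ip f (ind (- y) (- x)).
move=> lf;have [lrf _]:= l2_comp (preserving_refl R) lf.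
have lI:= l2_indT x y;have [lrI _]:= l2_comp (preserving_refl R) lI.
rewrite -(ip_comp (preserving_refl R) lrf lI) (_ : refl f \o -%R = f);last first.
 by apply/funext => z;rewrite /refl /= opprK.
rewrite ipC [RHS]ipC;apply: ip_ae => //;first exact: l2_indT.
apply: (aeS _ (ae_neq2 (- x) (- y))) => z [z1 z2] /=.
rewrite !indE [RHS](_ : _ = (x < - z <= y)%R%:R - (y < - z <= x)%R%:R)//.
congr (_%:R - _%:R);congr nat_of_bool;
 move: z1 z2;rewrite !neq_lt => /orP[z1|z1] /orP[z2|z2];apply/idP/idP => /andP[h1 h2];apply/andP;split;lra.
Qed.

Lemma stek_even f : l2 f -> (forall x, f (- x) = f x) -> forall x, stek f (- x) = stek f x.
move=> lf ev x;rewrite !stekE;have <- : refl f = f by apply/funext => z;rewrite /refl /= ev.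
have lr : l2 (refl f) by case: (l2_comp (preserving_refl R) lf).
rewrite ip_refl// [in RHS](_ : refl f = f);last by apply/funext => z;rewrite /refl /= ev.
by congr (_ * ip _ (ind _ _));ring.
Qed.

End Steklov.

(** * Sobolev functions as chains of successive derivatives *)

Section Chains.
Variable R : realType.
Variable b : bool.
Local Notation D:= (@dom R b).
Local Notation l2:= (@l2 R b).
Local Notation nrm:= (@nrm R b).
Local Notation ip:= (@ip R b).
Local Notation prim:= (@prim R b).
Implicit Types (f g h : nat -> R -> R) (k n : nat).

(* [f j] plays the role of the j-th derivative of [f 0] *)
Definition isH k f : Prop :=
 (forall j, (j <= k)%N -> l2 (f j)) /\ (forall j, (j < k)%N -> prim (f j) (f j.+1)).
(** On chains, this shift is differentiation. *)
Definition csh f : nat -> R -> R:= fun n => f n.+1.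
Definition NH k f : R:= \sum_(j < k.+1) nrm (f j).

Lemma isH_l2 k f j : isH k f -> (j <= k)%N -> l2 (f j). by case=> h _ /h. Qed.
Lemma isH_prim k f j : isH k f -> (j < k)%N -> prim (f j) (f j.+1). by case=> _ h /h. Qed.
Lemma isH_le k l f : (l <= k)%N -> isH k f -> isH l f.
move=> lk [h1 h2];split => j jl;[exact: h1 (leq_trans jl lk)|exact: h2 (leq_trans jl lk)].
Qed.
Lemma isH_csh k f : isH k.+1 f -> isH k (csh f).
by move=> [h1 h2];split => j jk;[exact: h1|exact: h2]. Qed.
Lemma isH_S k f : l2 (f 0%N) -> prim (f 0%N) (f 1%N) -> isH k (csh f) -> isH k.+1 f.
move=> l0 p0 [h1 h2];split => -[|j] jk //;[exact: h1|exact: h2].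
Qed.
Lemma isH0 k : isH k 0. by split => j _;[exact: l20|exact: prim0]. Qed.
Lemma isHD k f g : isH k f -> isH k g -> isH k (f + g).
move=> [h1 h2] [h3 h4];split => j jk;[exact: l2D (h1 _ jk) (h3 _ jk)|exact: primD (h2 _ jk) (h4 _ jk)].
Qed.
Lemma isHZ k (c : R) f : isH k f -> isH k (c *: f).
by move=> [h1 h2];split => j jk;[exact: l2Z (h1 _ jk)|exact: primZ (h2 _ jk)]. Qed.
Lemma isHN k f : isH k f -> isH k (- f).
by move=> [h1 h2];split => j jk;[exact: l2N (h1 _ jk)|exact: primN (h2 _ jk)]. Qed.
Lemma isHB k f g : isH k f -> isH k g -> isH k (f - g).
by move=> hf hg;exact: isHD hf (isHN hg). Qed.

Lemma cshD f g : csh (f + g) = csh f + csh g. by []. Qed.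
Lemma cshZ (c : R) f : csh (c *: f) = c *: csh f. by []. Qed.

Lemma NH_ge0 k f : 0 <= NH k f. by apply: sumr_ge0 => j _;exact: nrm_ge0. Qed.
Lemma NH_nrm k f j : (j <= k)%N -> nrm (f j) <= NH k f.
move=> jk;have jk' : (j < k.+1)%N by [].
rewrite /NH (bigD1 (Ordinal jk'))//= lerDl;apply: sumr_ge0 => i _;exact: nrm_ge0.
Qed.
Lemma NH_le k l f : (k <= l)%N -> NH k f <= NH l f.
move=> /subnKC <-;elim: (l - k)%N => [|n IH];first by rewrite addn0.
by rewrite addnS;apply: leT IH _;rewrite /NH [leRHS]big_ord_recr /= lerDl nrm_ge0.
Qed.
Lemma NH_csh k f : NH k.+1 f = nrm (f 0%N) + NH k (csh f).
by rewrite /NH big_ord_recl. Qed.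
Lemma NH_csh_le k f : NH k (csh f) <= NH k.+1 f.
by rewrite NH_csh lerDr nrm_ge0. Qed.
Lemma NH_bound k f (c : R) : (forall j, (j <= k)%N -> nrm (f j) <= c) -> NH k f <= k.+1%:R * c.
move=> h;apply: leT (_ : \sum_(j < k.+1) c <= _).
 by apply: ler_sum => j _;apply: h;rewrite -ltnS.
by rewrite sumr_const card_ord -[leLHS]mulr_natl.
Qed.
Lemma NH0 k : NH k 0 = 0. by rewrite /NH big1// => j _;exact: nrm0. Qed.
Lemma NHD k f g : isH k f -> isH k g -> NH k (f + g) <= NH k f + NH k g.
move=> hf hg;rewrite /NH -big_split /=;apply: ler_sum => j _.
by apply: nrmD;[exact: isH_l2 hf (ltn_ord j)|exact: isH_l2 hg (ltn_ord j)].
Qed.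
Lemma NHZ k (c : R) f : isH k f -> NH k (c *: f) = `|c| * NH k f.
move=> hf;rewrite /NH mulr_sumr;apply: eq_bigr => j _;apply: nrmZ;exact: isH_l2 hf (ltn_ord j).
Qed.
Lemma NHN k f : NH k (- f) = NH k f.
by rewrite /NH;apply: eq_bigr => j _;exact: nrmN. Qed.
Lemma NHB k f g : isH k f -> isH k g -> NH k (f - g) <= NH k f + NH k g.
by move=> hf hg;rewrite -(NHN k g);apply: NHD => //;exact: isHN. Qed.

Lemma isH_sup k f j x : isH k f -> (j < k)%N -> D x -> `|f j x| <= NH j.+1 f.
move=> hf jk Dx;apply: leT (prim_sup (isH_prim hf jk) (isH_l2 hf (ltnW jk)) Dx) _.
by rewrite /NH !big_ord_recr /= -addrA lerDr;apply: sumr_ge0 => i _;exact: nrm_ge0.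
Qed.
Lemma isH_meas k f j : isH k f -> (j < k)%N -> measurable_fun D (f j).
by move=> hf jk;exact: prim_meas (isH_prim hf jk). Qed.

(** The Leibniz rule unfolded recursively: level n is a sum of 2^n products, the origin of the
    factors 2^n below. The recursion makes bilinearity and commutativity provable level by level
    without binomial coefficients. *)
Fixpoint cprod f g n : R -> R :=
 if n is n'.+1 then cprod (csh f) g n' + cprod f (csh g) n' else f 0%N * g 0%N.

Lemma cprodDl f g h : cprod (f + g) h = cprod f h + cprod g h.
apply/funext => n;elim: n f g h => [|n IH] f g h /=;first exact: mulrDl.
rewrite cshD !IH;rewrite -[(cprod f h + cprod g h) n.+1]/(cprod f h n.+1 + cprod g h n.+1) /=.
rewrite -[(cprod (csh f) h + cprod (csh g) h) n]/(cprod (csh f) h n + cprod (csh g) h n).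
by rewrite -[(cprod f (csh h) + cprod g (csh h)) n]/(cprod f (csh h) n + cprod g (csh h) n) addrACA.
Qed.
Lemma cprodC f g : cprod f g = cprod g f.
apply/funext => n;elim: n f g => [|n IH] f g /=;first exact: mulrC.
by rewrite IH [X in _ + X]IH addrC.
Qed.
Lemma cprodZl (c : R) f g : cprod (c *: f) g = c *: cprod f g.
apply/funext => n;elim: n f g => [|n IH] f g /=.
 by apply/funext => x;rewrite -[(c *: cprod f g) 0%N x]/(c * (f 0%N x * g 0%N x)) mulrA.
by rewrite cshZ !IH -[(c *: cprod f g) n.+1]/(c *: (cprod (csh f) g n + cprod f (csh g) n)) scalerDr.
Qed.
Lemma cprodBl f g h : cprod (f - g) h = cprod f h - cprod g h.
by rewrite cprodDl -[- g]scaleN1r cprodZl scaleN1r. Qed.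
Lemma cprodBr f g h : cprod h (f - g) = cprod h f - cprod h g.
by rewrite cprodC cprodBl !(cprodC _ h). Qed.

(* levels (i, j) with i + j <= n must be controlled *)
Lemma cprod_l2 f g n (B : R) :
 (forall i j, (i + j = n)%N -> l2 (f i * g j) /\ nrm (f i * g j) <= B) ->
 l2 (cprod f g n) /\ nrm (cprod f g n) <= 2 ^+ n * B.
elim: n f g => [|n IH] f g h /=;first by rewrite expr0 mul1r;apply: h.
have [l1 n1] : l2 (cprod (csh f) g n) /\ nrm (cprod (csh f) g n) <= 2 ^+ n * B.
 by apply: IH => i j ij;apply: h;rewrite addSn ij.
have [l2' n2] : l2 (cprod f (csh g) n) /\ nrm (cprod f (csh g) n) <= 2 ^+ n * B.
 by apply: IH => i j ij;apply: h;rewrite addnS ij.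
split;first exact: l2D.
by apply: leT (nrmD l1 l2') _;rewrite exprS;lra.
Qed.

Lemma cprod_prim f g n :
 (forall i j, (i + j = n)%N -> prim (f i * g j) (f i.+1 * g j + f i * g j.+1)) ->
 prim (cprod f g n) (cprod f g n.+1).
elim: n f g => [|n IH] f g h;first exact: h.
have h1 : prim (cprod (csh f) g n) (cprod (csh f) g n.+1).
 by apply: IH => i j ij;apply: (h i.+1 j);rewrite addSn ij.
have h2 : prim (cprod f (csh g) n) (cprod f (csh g) n.+1).
 by apply: IH => i j ij;apply: (h i j.+1);rewrite addnS ij.
exact: primD h1 h2.
Qed.

Lemma prim_mulH k f g i j : isH k f -> isH k g -> (i < k)%N -> (j < k)%N ->
 prim (f i * g j) (f i.+1 * g j + f i * g j.+1).
move=> hf hg ik jk;apply: (prim_mul (A:= NH i.+1 f) (B:= NH j.+1 g)).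
- exact: isH_prim hf ik.
- exact: isH_prim hg jk.
- by move=> x;exact: isH_sup hf ik.
- by move=> x;exact: isH_sup hg jk.
Qed.

Lemma mul_supl k f (h : R -> R) i : isH k f -> (i < k)%N -> l2 h ->
 l2 (f i * h) /\ nrm (f i * h) <= NH i.+1 f * nrm h.
move=> hf ik lh;have mf:= isH_meas hf ik.
have sf x : D x -> `|f i x| <= NH i.+1 f by exact: isH_sup hf ik.
by split;[exact: l2M sf lh|apply: nrmM sf _ lh => //;exact: NH_ge0].
Qed.

Lemma cprod_levelr k f g i j : isH k f -> isH k g -> (i < k)%N -> (j <= k)%N ->
 l2 (f i * g j) /\ nrm (f i * g j) <= NH i.+1 f * NH j g.
move=> hf hg ik jk;have [l1 n1]:= mul_supl hf ik (isH_l2 hg jk).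
by split => //;apply: leT n1 _;apply: ler_wpM2l;[exact: NH_ge0|exact: NH_nrm].
Qed.

Lemma cprod_levell k f g i j : isH k f -> isH k g -> (i <= k)%N -> (j < k)%N ->
 l2 (f i * g j) /\ nrm (f i * g j) <= NH i f * NH j.+1 g.
by move=> hf hg ik jk;rewrite mulrC [X in _ <= X]mulrC;exact: cprod_levelr hg hf jk ik. Qed.

Lemma NHM k l k' l' f g : (k <= k')%N -> (l <= l')%N -> NH k f * NH l g <= NH k' f * NH l' g.
by move=> h1 h2;apply: ler_pM;rewrite ?NH_ge0 ?NH_le. Qed.

(** When i + j <= k + 1, at least one of the two factors lies strictly below the top level and is
    bounded, while the other is in L2. *)
Lemma cprod_level k f g n : isH k.+1 f -> isH k.+1 g -> (n <= k.+1)%N ->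
 l2 (cprod f g n) /\ nrm (cprod f g n) <= 2 ^+ n * (NH k.+1 f * NH k.+1 g).
move=> hf hg nk;apply: cprod_l2 => i j ij.
have [ik|ik]:= ltnP i k.+1.
 have [h1 h2]:= cprod_levelr (j:= j) hf hg ik ltac:(lia).
 by split => //;apply: leT h2 _;apply: NHM;lia.
have [h1 h2]:= cprod_levell (i:= i) (j:= j) hf hg ltac:(lia) ltac:(lia).
by split => //;apply: leT h2 _;apply: NHM;lia.
Qed.

Lemma isH_cprod k f g : isH k.+1 f -> isH k.+1 g -> isH k.+1 (cprod f g).
move=> hf hg;split => n nk;first by have []:= cprod_level hf hg nk.
by apply: cprod_prim => i j ij;apply: prim_mulH hf hg _ _;lia.
Qed.

Lemma exp2_le (n k : nat) (x : R) : 0 <= x -> (n <= k)%N -> 2 ^+ n * x <= 2 ^+ k * x.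
by move=> x0 nk;apply: ler_wpM2r => //;rewrite ler_weXn2l// ler1n. Qed.

Lemma NH_cprod k f g : isH k.+1 f -> isH k.+1 g ->
 NH k.+1 (cprod f g) <= (k.+2%:R * 2 ^+ k.+1) * (NH k.+1 f * NH k.+1 g).
move=> hf hg;rewrite -mulrA;apply: NH_bound => j jk.
have [_ h]:= cprod_level hf hg jk;apply: leT h _.
by apply: exp2_le => //;rewrite mulr_ge0 ?NH_ge0.
Qed.

(* tame estimate: the top norm enters linearly *)
Lemma NH_cprod_tame k f g : isH k.+2 f -> isH k.+2 g ->
 NH k.+2 (cprod f g) <= (k.+3%:R * 2 ^+ k.+2) * (NH k.+2 f * NH k.+1 g + NH k.+1 f * NH k.+2 g).
move=> hf hg;rewrite -mulrA;apply: NH_bound => n nk.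
set T:= NH k.+2 f * _ + _.
have T0 : 0 <= T by rewrite addr_ge0 ?mulr_ge0 ?NH_ge0.
apply: leT (_ : 2 ^+ n * T <= _);last exact: exp2_le.
have T1 (x : R) : x <= NH k.+2 f * NH k.+1 g -> x <= T.
 by move=> h;apply: leT h _;rewrite lerDl mulr_ge0 ?NH_ge0.
have T2 (x : R) : x <= NH k.+1 f * NH k.+2 g -> x <= T.
 by move=> h;apply: leT h _;rewrite lerDr mulr_ge0 ?NH_ge0.
suff [] : l2 (cprod f g n) /\ nrm (cprod f g n) <= 2 ^+ n * T by [].
apply: cprod_l2 => i j ij;have [i0|i0]:= posnP i.
 have [h1 h2]:= cprod_levelr (i:= i) (j:= j) hf hg ltac:(lia) ltac:(lia).
 by split => //;apply: T2;apply: leT h2 _;apply: NHM;lia.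
have [j0|j0]:= posnP j.
 have [h1 h2]:= cprod_levell (i:= i) (j:= j) hf hg ltac:(lia) ltac:(lia).
 by split => //;apply: T1;apply: leT h2 _;apply: NHM;lia.
have [h1 h2]:= cprod_levelr (i:= i) (j:= j) hf hg ltac:(lia) ltac:(lia).
by split => //;apply: T1;apply: leT h2 _;apply: NHM;lia.
Qed.

(** Increments are inner products of the derivative with indicators, so L2 convergence of the
    derivatives and pointwise convergence of the functions are enough. *)
Lemma prim_closed (F F' : nat -> R -> R) (f f' : R -> R) :
 (forall n, prim (F n) (F' n)) -> l2 f' -> nrm (F' n - f') @[n --> \oo] --> 0 ->
 (forall x, D x -> F n x @[n --> \oo] --> f x) -> prim f f'.
move=> pF lf' cF' cF;split => // x y Dx Dy;have lI:= l2_ind Dx Dy.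
have c1 : ip (F' n) (ind x y) @[n --> \oo] --> ip f' (ind x y).
 apply/subr_cvg0;apply: (@cvg0_le _ _ (fun n => nrm (F' n - f') * nrm (ind x y))) => [n|].
  by rewrite -ipBl//;[apply: CS => //;apply: l2B => //|];exact: prim_l2 (pF n).
 by rewrite -[X in _ --> X](mul0r (nrm (ind x y)));apply: cvgM;[exact: cF'|exact: cvg_cst].
have c2 : F n y - F n x @[n --> \oo] --> f y - f x by apply: cvgB;exact: cF.
have e : (fun n => F n y - F n x) = (fun n => ip (F' n) (ind x y)).
 by apply/funext => n;case: (pF n) => _ ->.
by rewrite e in c2;rewrite -(cvg_lim (@Rhausdorff R) c1) (cvg_lim (@Rhausdorff R) c2).
Qed.

Lemma geo_cvg0 (C : R) (u : nat -> R) : (forall n, `|u n| <= C * 2^-1 ^+ n) -> u n @[n --> \oo] --> 0.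
move=> h;apply: cvg0_le h _;rewrite -[X in _ --> X](mulr0 C).
apply: cvgM;first exact: cvg_cst.
by apply: (@cvg_expr R (2^-1));rewrite gtr0_norm ?invr_gt0// invf_lt1// ltr1n.
Qed.

Lemma isH_complete k (F : nat -> nat -> R -> R) (C : R) : (forall n, isH k (F n)) ->
 (forall n, NH k (F n.+1 - F n) <= C * 2^-1 ^+ n) ->
 exists2 f, isH k f & forall n, NH k (F n - f) <= k.+1%:R * (2 * C) * 2^-1 ^+ n.
move=> hF hC.
have [g gP] : exists g : nat -> R -> R, forall j, (j <= k)%N ->
  l2 (g j) /\ forall n, nrm (F n j - g j) <= 2 * C * 2^-1 ^+ n.
 have /choice[g gP] : forall j, exists g : R -> R, (j <= k)%N ->
   l2 g /\ forall n, nrm (F n j - g) <= 2 * C * 2^-1 ^+ n.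
  move=> j;have [jk|jk]:= leqP j k;last by exists 0.
  have [|n|g lg ng]:= @l2_complete _ b (F ^~ j) C;last by exists g.
  - by move=> n;exact: isH_l2 (hF n) jk.
  - by apply: leT (hC n);exact: (NH_nrm (F n.+1 - F n) jk).
 by exists g.
have C0 : 0 <= C by have:= hC 0%N;rewrite expr0 mulr1;apply: leT;exact: NH_ge0.
have cauchy j x : (j < k)%N -> D x -> cvgn (fun n => F n j x).
 move=> jk Dx.
 pose u i:= F i.+1 j x - F i j x.
 have bu i : `|u i| <= C * 2^-1 ^+ i.
  apply: leT (hC i);have h:= isHB (hF i.+1) (hF i).
  by apply: leT (isH_sup h jk Dx) _;exact: NH_le.
 have cu : cvgn (series u).
  apply: normed_cvg;apply: (@series_le_cvg _ _ (fun i => C * 2^-1 ^+ i)) => //.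
  - by move=> i;exact: normr_ge0.
  - by move=> i;rewrite mulr_ge0 ?exprn_ge0 ?invr_ge0.
  - by apply: is_cvg_geometric_series;rewrite gtr0_norm ?invr_gt0// invf_lt1// ltr1n.
 have -> : (fun n => F n j x) = (fun n => F 0%N j x + series u n).
  by apply/funext => n;rewrite /series /= telescope_sumr// addrC subrK.
 by apply: is_cvgD => //;exact: is_cvg_cst.
(* Below the top level the pointwise limit is the continuous representative; at level k only the L2
   limit is available. *)
pose f j : R -> R:= if (j < k)%N then fun x => lim (F n j x @[n --> \oo]) else g j.
have fP j : (j <= k)%N -> l2 (f j) /\ forall n, nrm (F n j - f j) <= 2 * C * 2^-1 ^+ n.
 move=> jk;rewrite /f;case: ifP => jk';last exact: gP.
 have key n : l2 ((fun x => lim (F n j x @[n --> \oo])) - F n j) /\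
   nrm ((fun x => lim (F n j x @[n --> \oo])) - F n j) <= 2 * C * 2^-1 ^+ n.
  apply: (l2_fatouT (F:= fun m => F (m + n)%N j - F n j)).
  - by move=> m;apply: l2B;[exact: isH_l2 (hF _) jk|exact: isH_l2 (hF _) jk].
  - move=> m;apply: leT (nrm_telescope (F:= fun n => F n j) (e:= fun i => C * 2^-1 ^+ i) _ _ _ _) _.
   + by move=> i;exact: isH_l2 (hF _) jk.
   + by move=> i;apply: leT (hC i);exact: (NH_nrm (F i.+1 - F i) jk).
   + exact: geo_sum_le.
  - move=> x Dx;apply: cvgB;last exact: cvg_cst.
   by rewrite (cvg_shiftn n (fun m => F m j x));exact: cauchy.
 split;last by move=> n;rewrite nrm_distC;exact: (key n).2.
 by have:= l2D (key 0%N).1 (isH_l2 (hF 0%N) jk);rewrite subrK.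
exists f;last first.
 by move=> n;rewrite -mulrA;apply: NH_bound => j jk;case: (fP j jk) => _;exact.
split => j jk;first by case: (fP j jk).
have [lf' nf']:= fP j.+1 jk.
apply: (prim_closed (F:= fun n => F n j) (F':= fun n => F n j.+1)) => //.
- by move=> n;exact: isH_prim (hF n) jk.
- by apply: (@geo_cvg0 (2 * C)) => n;rewrite ger0_norm ?nrm_ge0.
- by move=> x Dx;rewrite /f jk;exact: cauchy.
Qed.

End Chains.

Module WholeLine.
Notation l2:= (@l2 _ true).
Notation nrm:= (@nrm _ true).
Notation ip:= (@ip _ true).
Notation prim:= (@prim _ true).
Notation isH:= (@isH _ true).
Notation NH:= (@NH _ true).
End WholeLine.

Module HalfLine.
Notation l2T:= (@l2 _ true).
Notation nrmT:= (@nrm _ true).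
Notation ipT:= (@ip _ true).
Notation primT:= (@prim _ true).
Notation isHT:= (@isH _ true).
Notation l2:= (@l2 _ false).
Notation nrm:= (@nrm _ false).
Notation ip:= (@ip _ false).
Notation prim:= (@prim _ false).
Notation isH:= (@isH _ false).
Notation NH:= (@NH _ false).
End HalfLine.

(** * Pairs of chains and the cubic Schroedinger field *)

Section Pairs.
Variable R : realType.
Import WholeLine.
Local Notation chain:= (nat -> R -> R).

Lemma hyp_seal : {F : (R) -> (R) -> R | forall x y, F x y = Num.sqrt (x ^+ 2 + y ^+ 2)}.
by exists (fun x y => Num.sqrt (x ^+ 2 + y ^+ 2)). Qed.
Definition hyp:= sval hyp_seal.
Lemma hypE x y : hyp x y = Num.sqrt (x ^+ 2 + y ^+ 2).
exact: (svalP hyp_seal). Qed.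

Lemma hyp_ge0 x y : 0 <= hyp x y. by rewrite hypE sqrtr_ge0. Qed.
Lemma hyp_sq x y : hyp x y ^+ 2 = x ^+ 2 + y ^+ 2.
by rewrite hypE sqr_sqrtr// addr_ge0 ?sqr_ge0. Qed.
Lemma hyp_le x y c : 0 <= c -> x ^+ 2 + y ^+ 2 <= c ^+ 2 -> hyp x y <= c.
by rewrite hypE;exact: sqrt_le. Qed.
Lemma hyp_mono x y x' y' : 0 <= x -> x <= x' -> 0 <= y -> y <= y' -> hyp x y <= hyp x' y'.
move=> x0 xx y0 yy;apply: hyp_le;first exact: hyp_ge0.
have x'0:= leT x0 xx;have y'0:= leT y0 yy.
by rewrite hyp_sq;apply: lerD;rewrite ler_pXn2r ?nnegrE.
Qed.
Lemma hypD x y x' y' : hyp (x + x') (y + y') <= hyp x y + hyp x' y'.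
apply: hyp_le;first by rewrite addr_ge0 ?hyp_ge0.
rewrite [leRHS]sqrrD !hyp_sq.
suff : x * x' + y * y' <= hyp x y * hyp x' y' 
 by move: (hyp x y * hyp x' y') => z h;rewrite !sqrrD !mulr2n;lra.
have [h|h]:= lerP (x * x' + y * y') 0;first by apply: leT h _;rewrite mulr_ge0 ?hyp_ge0.
rewrite -ler_sqr ?nnegrE ?mulr_ge0 ?hyp_ge0//;last exact: ltW.
rewrite exprMn !hyp_sq -subr_ge0.
have -> : (x ^+ 2 + y ^+ 2) * (x' ^+ 2 + y' ^+ 2) - (x * x' + y * y') ^+ 2 = (x * y' - y * x') ^+ 2 by ring.
exact: sqr_ge0.
Qed.
Lemma hyp_sum x y : 0 <= x -> 0 <= y -> hyp x y <= x + y.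
by move=> x0 y0;apply: hyp_le;rewrite ?addr_ge0// sqrrD lerD2r lerDl mulrn_wge0// mulr_ge0. Qed.
Lemma hyp_l x y : 0 <= x -> x <= hyp x y.
by move=> x0;rewrite -ler_sqr ?nnegrE ?hyp_ge0// hyp_sq lerDl sqr_ge0. Qed.
Lemma hyp_r x y : 0 <= y -> y <= hyp x y.
by move=> x0;rewrite -ler_sqr ?nnegrE ?hyp_ge0// hyp_sq lerDr sqr_ge0. Qed.
Lemma hypZ c x y : hyp (c * x) (c * y) = `|c| * hyp x y.
by rewrite !hypE !exprMn -mulrDr sqrtrM ?sqr_ge0// sqrtr_sqr. Qed.

Lemma hypC x y : hyp x y = hyp y x. by rewrite !hypE addrC. Qed.
Lemma hyp0 : hyp 0 0 = 0. by rewrite hypE expr0n addr0 sqrtr0. Qed.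

Local Notation V:= (chain * chain)%type.
Implicit Types (u v w : V) (k : nat).

Definition HP k u:= isH k u.1 /\ isH k u.2.
(** The two components are combined in Euclidean fashion because the linear part of a step is skew,
    and its cross terms cancel in the sum of squares. *)
Definition np (j : nat) u : R:= hyp (nrm (u.1 j)) (nrm (u.2 j)).
Definition NP k u : R:= \sum_(j < k.+1) np j u.

Lemma HPD k u v : HP k u -> HP k v -> HP k (u + v).
by move=> [a b] [c d];split;[exact: (isHD a c)|exact: (isHD b d)]. Qed.
Lemma HPZ k (c : R) u : HP k u -> HP k (c *: u).
by move=> [a b];split;[exact: (isHZ c a)|exact: (isHZ c b)]. Qed.
Lemma HPB k u v : HP k u -> HP k v -> HP k (u - v).
by move=> [a b] [c d];split;[exact: (isHB a c)|exact: (isHB b d)]. Qed.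
Lemma HP0 k : HP k 0. by split;exact: isH0. Qed.
Lemma HP_le k l u : (l <= k)%N -> HP k u -> HP l u.
by move=> lk [a b];split;exact: isH_le lk _. Qed.

Lemma np_ge0 j u : 0 <= np j u. exact: hyp_ge0. Qed.
Lemma NP_ge0 k u : 0 <= NP k u. by apply: sumr_ge0 => j _;exact: np_ge0. Qed.
Lemma NP_np k u j : (j <= k)%N -> np j u <= NP k u.
move=> jk;have jk' : (j < k.+1)%N by [].
rewrite /NP (bigD1 (Ordinal jk'))//= lerDl;apply: sumr_ge0 => i _;exact: np_ge0.
Qed.
Lemma NP_le k l u : (k <= l)%N -> NP k u <= NP l u.
move=> /subnKC <-;elim: (l - k)%N => [|n IH];first by rewrite addn0.
by rewrite addnS;apply: leT IH _;rewrite /NP [leRHS]big_ord_recr /= lerDl np_ge0.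
Qed.
Lemma npD j u v : l2 (u.1 j) -> l2 (u.2 j) -> l2 (v.1 j) -> l2 (v.2 j) ->
 np j (u + v) <= np j u + np j v.
move=> a b c d;apply: leT (hypD _ _ _ _).
by apply: hyp_mono;rewrite ?nrm_ge0//;exact: nrmD.
Qed.
Lemma NPD k u v : HP k u -> HP k v -> NP k (u + v) <= NP k u + NP k v.
move=> [a b] [c d];rewrite /NP -big_split /=;apply: ler_sum => j _;have jk:= ltn_ord j.
by apply: npD;[exact: isH_l2 a jk|exact: isH_l2 b jk|exact: isH_l2 c jk|exact: isH_l2 d jk].
Qed.
Lemma NPZ k (c : R) u : HP k u -> NP k (c *: u) = `|c| * NP k u.
move=> [a b];rewrite /NP mulr_sumr;apply: eq_bigr => j _;have jk:= ltn_ord j.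
have e1 : nrm ((c *: u).1 j) = `|c| * nrm (u.1 j):= nrmZ c (isH_l2 a jk).
have e2 : nrm ((c *: u).2 j) = `|c| * nrm (u.2 j):= nrmZ c (isH_l2 b jk).
have -> : np j (c *: u) = hyp (`|c| * nrm (u.1 j)) (`|c| * nrm (u.2 j)) by rewrite -e1 -e2.
by rewrite hypZ ger0_norm.
Qed.
Lemma NPN k u : NP k (- u) = NP k u.
by apply: eq_bigr => j _;rewrite /np (nrmN true (u.1 j)) (nrmN true (u.2 j)). Qed.
Lemma NPB k u v : HP k u -> HP k v -> NP k (u - v) <= NP k u + NP k v.
by move=> hu hv;rewrite -(NPN k v);apply: NPD => //;rewrite -scaleN1r;exact: HPZ.
Qed.
Lemma NP_distC k u v : NP k (u - v) = NP k (v - u).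
by rewrite -NPN opprB. Qed.
Lemma NP0 k : NP k 0 = 0.
by rewrite /NP big1// => j _;rewrite /np !nrm0 hyp0. Qed.
Lemma NP_dist k u v w : HP k u -> HP k v -> HP k w -> NP k (u - w) <= NP k (u - v) + NP k (v - w).
move=> hu hv hw;have -> : u - w = (u - v) + (v - w) by rewrite addrA subrK.
by apply: NPD;exact: HPB.
Qed.

Lemma NH_NP1 k u : NH k u.1 <= NP k u.
by apply: ler_sum => j _;apply: hyp_l;exact: nrm_ge0. Qed.
Lemma NH_NP2 k u : NH k u.2 <= NP k u.
by apply: ler_sum => j _;apply: hyp_r;exact: nrm_ge0. Qed.
Lemma NP_NH k u : NP k u <= NH k u.1 + NH k u.2.
by rewrite /NH -big_split /=;apply: ler_sum => j _;apply: hyp_sum;exact: nrm_ge0. Qed.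

(** Multiplication by i, a pair being a complex function. *)
Definition JP u : V:= (- u.2, u.1).
Lemma HP_JP k u : HP k u -> HP k (JP u).
by move=> [a b];split => //;exact: isHN. Qed.
Lemma NP_JP k u : NP k (JP u) = NP k u.
apply: eq_bigr => j _;rewrite /np /= (nrmN true (u.2 j)).
by rewrite hypC.
Qed.
Lemma JPB u v : JP (u - v) = JP u - JP v.
have e : - (u.2 - v.2) = - u.2 - (- v.2) by rewrite opprB opprK addrC.
by rewrite /JP [in LHS]/= e.
Qed.

Definition lap u : V:= (csh (csh u.1), csh (csh u.2)).
Lemma HP_lap k u : HP k.+2 u -> HP k (lap u).
by move=> [a b];split;do 2 apply: isH_csh. Qed.
Lemma NP_lap k u : NP k (lap u) <= NP k.+2 u.
have -> : NP k.+2 u = np 0 u + (np 1 u + NP k (lap u)) by rewrite /NP !big_ord_recl.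
by rewrite addrA lerDr addr_ge0 ?np_ge0.
Qed.

Definition tri (f g h : chain) : chain:= cprod (cprod f g) h.

Lemma isH_tri k f g h : isH k.+1 f -> isH k.+1 g -> isH k.+1 h -> isH k.+1 (tri f g h).
by move=> hf hg hh;apply: isH_cprod => //;exact: isH_cprod. Qed.

(** Constant of the product estimate in the Sobolev algebra of order k + 1. *)
Definition algc k : R:= k.+2%:R * 2 ^+ k.+1.
Lemma algc_ge0 k : 0 <= algc k. by rewrite mulr_ge0 ?exprn_ge0. Qed.

Lemma NH_tri k f g h : isH k.+1 f -> isH k.+1 g -> isH k.+1 h ->
 NH k.+1 (tri f g h) <= algc k ^+ 2 * (NH k.+1 f * NH k.+1 g * NH k.+1 h).
move=> hf hg hh;apply: leT (NH_cprod (isH_cprod hf hg) hh) _.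
rewrite expr2 -[leRHS]mulrA ler_wpM2l ?algc_ge0//.
rewrite [leRHS]mulrA ler_wpM2r ?NH_ge0//;exact: NH_cprod.
Qed.

Lemma NH_tri_le k f g h (x y z : R) : isH k.+1 f -> isH k.+1 g -> isH k.+1 h ->
 NH k.+1 f <= x -> NH k.+1 g <= y -> NH k.+1 h <= z ->
 NH k.+1 (tri f g h) <= algc k ^+ 2 * (x * y * z).
move=> hf hg hh fx gy hz;apply: leT (NH_tri hf hg hh) _.
rewrite ler_wpM2l ?exprn_ge0 ?algc_ge0//.
by apply: ler_pM;rewrite ?mulr_ge0 ?NH_ge0//;apply: ler_pM;rewrite ?NH_ge0.
Qed.

Lemma NH_tri_tame k f g h (x y : R) : isH k.+2 f -> isH k.+2 g -> isH k.+2 h ->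
 NH k.+1 f <= x -> NH k.+1 g <= x -> NH k.+1 h <= x ->
 NH k.+2 f <= y -> NH k.+2 g <= y -> NH k.+2 h <= y ->
 NH k.+2 (tri f g h) <= 3 * algc k.+1 ^+ 2 * (x ^+ 2 * y).
move=> hf hg hh f1 g1 h1 f2 g2 h2.
have hfg:= isH_cprod hf hg;have leS : (k.+1 <= k.+2)%N by [].
have x0 : 0 <= x by apply: leT f1;exact: NH_ge0.
have y0 : 0 <= y by apply: leT f2;exact: NH_ge0.
have A0:= algc_ge0 k.+1.
have AA : algc k <= algc k.+1.
 by apply: ler_pM;rewrite ?exprn_ge0 ?ler0n ?ler_nat// ler_weXn2l ?ler1n.
have n2 : NH k.+2 (cprod f g) <= algc k.+1 * (2 * (y * x)).
 apply: leT (NH_cprod_tame hf hg) _;apply: ler_wpM2l => //.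
 have a1 : NH k.+2 f * NH k.+1 g <= y * x by apply: ler_pM;rewrite ?NH_ge0.
 have a2 : NH k.+1 f * NH k.+2 g <= x * y by apply: ler_pM;rewrite ?NH_ge0.
 by lra.
have n1 : NH k.+1 (cprod f g) <= algc k.+1 * (x * x).
 apply: leT (NH_cprod (isH_le leS hf) (isH_le leS hg)) _.
 by apply: ler_pM;rewrite ?mulr_ge0 ?NH_ge0 ?algc_ge0//;apply: ler_pM;rewrite ?NH_ge0.
apply: leT (NH_cprod_tame hfg hh) _;rewrite -/(algc k.+1).
have b1 : NH k.+2 (cprod f g) * NH k.+1 h <= algc k.+1 * (2 * (y * x)) * x by apply: ler_pM;rewrite ?NH_ge0.
have b2 : NH k.+1 (cprod f g) * NH k.+2 h <= algc k.+1 * (x * x) * y by apply: ler_pM;rewrite ?NH_ge0.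
apply: leT (ler_wpM2l A0 (lerD b1 b2)) _.
by apply: eqW;ring.
Qed.

Lemma tri_diff f g h f' g' h' : tri f g h - tri f' g' h' =
 tri (f - f') g h + tri f' (g - g') h + tri f' g' (h - h').
rewrite /tri !cprodBl !cprodBr !cprodBl.
by rewrite -!addrA;congr (_ + _);rewrite addKr addKr.
Qed.

Lemma NH_tri_lip k f g h f' g' h' (M d : R) :
 isH k.+1 f -> isH k.+1 g -> isH k.+1 h -> isH k.+1 f' -> isH k.+1 g' -> isH k.+1 h' ->
 NH k.+1 g <= M -> NH k.+1 h <= M -> NH k.+1 f' <= M -> NH k.+1 g' <= M ->
 NH k.+1 (f - f') <= d -> NH k.+1 (g - g') <= d -> NH k.+1 (h - h') <= d ->
 NH k.+1 (tri f g h - tri f' g' h') <= 3 * algc k ^+ 2 * (M ^+ 2 * d).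
move=> hf hg hh hf' hg' hh' gM hM fM' gM' df dg dh;rewrite tri_diff.
have t1:= isH_tri (isHB hf hf') hg hh;have t2:= isH_tri hf' (isHB hg hg') hh.
have t3:= isH_tri hf' hg' (isHB hh hh').
apply: leT (NHD (isHD t1 t2) t3) _.
have n12:= NHD t1 t2.
have n1:= NH_tri_le (isHB hf hf') hg hh df gM hM.
have n2:= NH_tri_le hf' (isHB hg hg') hh fM' dg hM.
have n3:= NH_tri_le hf' hg' (isHB hh hh') fM' gM' dh.
have -> : 3 * algc k ^+ 2 * (M ^+ 2 * d) =
  algc k ^+ 2 * (d * M * M) + algc k ^+ 2 * (M * d * M) + algc k ^+ 2 * (M * M * d) by ring.
by lra.
Qed.

Definition cubN u : V :=
 (2^-1 *: (tri u.1 u.1 u.1 + tri u.2 u.2 u.1), 2^-1 *: (tri u.1 u.1 u.2 + tri u.2 u.2 u.2)).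

Lemma HP_cubN k u : HP k.+1 u -> HP k.+1 (cubN u).
by move=> [a b];split;apply: isHZ;apply: isHD;exact: isH_tri. Qed.

Let half_sum k (f g : chain) (B : R) : isH k f -> isH k g -> NH k f <= B -> NH k g <= B ->
 NH k (2^-1 *: (f + g)) <= B.
move=> hf hg fB gB;rewrite NHZ;last exact: isHD.
by rewrite gtr0_norm ?invr_gt0//;have:= NHD hf hg;lra.
Qed.

Lemma NP_cubN_tame k u : HP k.+2 u ->
 NP k.+2 (cubN u) <= 6 * algc k.+1 ^+ 2 * (NP k.+1 u ^+ 2 * NP k.+2 u).
move=> [a b];apply: leT (NP_NH _ _) _.
have a1:= NH_NP1 k.+1 u;have a2:= NH_NP1 k.+2 u.
have b1:= NH_NP2 k.+1 u;have b2:= NH_NP2 k.+2 u.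
have h1 : NH k.+2 (cubN u).1 <= 3 * algc k.+1 ^+ 2 * (NP k.+1 u ^+ 2 * NP k.+2 u).
 by apply: half_sum;[exact: isH_tri|exact: isH_tri|exact: NH_tri_tame|exact: NH_tri_tame].
have h2 : NH k.+2 (cubN u).2 <= 3 * algc k.+1 ^+ 2 * (NP k.+1 u ^+ 2 * NP k.+2 u).
 by apply: half_sum;[exact: isH_tri|exact: isH_tri|exact: NH_tri_tame|exact: NH_tri_tame].
by lra.
Qed.

Lemma NP_cubN_lip k u v (M : R) : HP k.+1 u -> HP k.+1 v -> NP k.+1 u <= M -> NP k.+1 v <= M ->
 NP k.+1 (cubN u - cubN v) <= 6 * algc k ^+ 2 * (M ^+ 2 * NP k.+1 (u - v)).
move=> [a b] [c d] uM vM;apply: leT (NP_NH _ _) _.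
have a1:= leT (NH_NP1 k.+1 u) uM;have a2:= leT (NH_NP2 k.+1 u) uM.
have b1:= leT (NH_NP1 k.+1 v) vM;have b2:= leT (NH_NP2 k.+1 v) vM.
have d1:= NH_NP1 k.+1 (u - v);have d2:= NH_NP2 k.+1 (u - v).
have e1 : (cubN u - cubN v).1 = 2^-1 *: ((tri u.1 u.1 u.1 - tri v.1 v.1 v.1) + (tri u.2 u.2 u.1 - tri v.2 v.2 v.1)).
 by rewrite [LHS]/= -scalerBr;congr (_ *: _);rewrite opprD addrACA.
have e2 : (cubN u - cubN v).2 = 2^-1 *: ((tri u.1 u.1 u.2 - tri v.1 v.1 v.2) + (tri u.2 u.2 u.2 - tri v.2 v.2 v.2)).
 by rewrite [LHS]/= -scalerBr;congr (_ *: _);rewrite opprD addrACA.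
have h1 : NH k.+1 (cubN u - cubN v).1 <= 3 * algc k ^+ 2 * (M ^+ 2 * NP k.+1 (u - v)).
 by rewrite e1;apply: half_sum;[apply: isHB;exact: isH_tri|apply: isHB;exact: isH_tri|exact: NH_tri_lip|exact: NH_tri_lip].
have h2 : NH k.+1 (cubN u - cubN v).2 <= 3 * algc k ^+ 2 * (M ^+ 2 * NP k.+1 (u - v)).
 by rewrite e2;apply: half_sum;[apply: isHB;exact: isH_tri|apply: isHB;exact: isH_tri|exact: NH_tri_lip|exact: NH_tri_lip].
apply: leT (lerD h1 h2) _;apply: eqW;ring.
Qed.

Lemma cubN0 : cubN 0 = 0.
have h (f : chain) : cprod 0 f = 0 by rewrite -[X in cprod X](scale0r (0 : chain)) cprodZl scale0r.
by rewrite /cubN /tri /= !h addr0 scaler0.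
Qed.

Lemma NP_cubN k u (M : R) : HP k.+1 u -> NP k.+1 u <= M ->
 NP k.+1 (cubN u) <= 6 * algc k ^+ 2 * M ^+ 3.
move=> hu uM;have M0 : 0 <= M by apply: leT uM;exact: NP_ge0.
have:= NP_cubN_lip hu (HP0 k.+1) uM;rewrite NP0 cubN0 !subr0 => /(_ M0) /leT;apply.
rewrite (exprSr M 2) ler_wpM2l ?mulr_ge0 ?exprn_ge0 ?algc_ge0// ler_wpM2l ?exprn_ge0//.
Qed.

(* u_t = J (u_ss + |u|^2 u / 2) *)
Definition field u : V:= JP (lap u + cubN u).

Lemma HP_field k u : HP k.+2 u -> HP k (field u).
move=> hu;apply: HP_JP;apply: HPD;first exact: HP_lap.
apply: (HP_le (k:= k.+1)) => //;apply: HP_cubN;apply: HP_le hu;lia.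
Qed.

Lemma lapB u v : lap (u - v) = lap u - lap v. by []. Qed.

Lemma NP_field_lip k u v (M : R) : HP k.+2 u -> HP k.+2 v -> NP k.+1 u <= M -> NP k.+1 v <= M ->
 NP k (field u - field v) <= (1 + 6 * algc k ^+ 2 * M ^+ 2) * NP k.+2 (u - v).
move=> hu hv uM vM;rewrite /field -JPB NP_JP.
have hu1 : HP k.+1 u by apply: HP_le hu;lia.
have hv1 : HP k.+1 v by apply: HP_le hv;lia.
have -> : lap u + cubN u - (lap v + cubN v) = lap (u - v) + (cubN u - cubN v).
 by rewrite lapB opprD addrACA.
have huv:= HPB hu hv;have hc:= HPB (HP_cubN hu1) (HP_cubN hv1).
apply: leT (NPD (HP_lap huv) (HP_le (leqnSn k) hc)) _.
rewrite mulrDl mul1r;apply: lerD;first exact: NP_lap.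
apply: leT (NP_le _ (leqnSn k)) _.
apply: leT (NP_cubN_lip hu1 hv1 uM vM) _.
have M0 : 0 <= M by apply: leT uM;exact: NP_ge0.
rewrite -[leRHS]mulrA;apply: ler_wpM2l;first by rewrite mulr_ge0// exprn_ge0// algc_ge0.
apply: ler_wpM2l;first exact: exprn_ge0.
by apply: NP_le;lia.
Qed.

Lemma field_zero : field 0 = 0.
by rewrite /field cubN0 addr0 /lap /JP /= oppr0. Qed.

Lemma NP_field k u (M : R) : HP k.+2 u -> NP k.+1 u <= M ->
 NP k (field u) <= (1 + 6 * algc k ^+ 2 * M ^+ 2) * NP k.+2 u.
move=> hu uM;have M0 : 0 <= M by apply: leT uM;exact: NP_ge0.
by have:= NP_field_lip hu (HP0 k.+2) uM;rewrite NP0 field_zero !subr0;apply.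
Qed.

End Pairs.

(** * One explicit step: mass, energy and the linear part *)

Section SchemeStep.
Variable R : realType.
Import WholeLine.
Variable r : R.
Hypothesis r0 : 0 < r.
Local Notation S:= (stek r).
Local Notation Dq:= (dq r).
Implicit Types (a b f g : R -> R).

Local Notation fn:= (R -> R).

Lemma dens_seal : {F : fn -> fn -> fn | forall a b, F a b = S a * S a + S b * S b}.
by exists (fun a b => S a * S a + S b * S b). Qed.
Definition dens:= sval dens_seal.
Lemma dens_def a b : dens a b = S a * S a + S b * S b.
exact: (svalP dens_seal). Qed.
Lemma densE a b x : dens a b x = S a x * S a x + S b x * S b x.
by rewrite dens_def. Qed.

(* the two components of u_ss + |u|^2 u / 2, regularised so that the scheme is Hamiltonian *)
Lemma gradL_seal : {F : fn -> fn -> fn | forall a b, F a b = Dq (Dq a) + 2^-1 *: S (dens a b * S a)}.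
by exists (fun a b => Dq (Dq a) + 2^-1 *: S (dens a b * S a)). Qed.
Definition gradL:= sval gradL_seal.
Lemma gradLE a b : gradL a b = Dq (Dq a) + 2^-1 *: S (dens a b * S a).
exact: (svalP gradL_seal). Qed.
Lemma gradR_seal : {F : fn -> fn -> fn | forall a b, F a b = Dq (Dq b) + 2^-1 *: S (dens a b * S b)}.
by exists (fun a b => Dq (Dq b) + 2^-1 *: S (dens a b * S b)). Qed.
Definition gradR:= sval gradR_seal.
Lemma gradRE a b : gradR a b = Dq (Dq b) + 2^-1 *: S (dens a b * S b).
exact: (svalP gradR_seal). Qed.

Lemma stek_meas a : l2 a -> measurable_fun (dom true) (S a).
by move=> la;exact: prim_meas (prim_stek r la). Qed.

Lemma stek_sup a x : l2 a -> `|S a x| <= nrm a + nrm (Dq a).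
move=> la;have:= prim_sup (x:= x) (prim_stek r la) (l2_stek r0 la) I => /leT;apply.
by rewrite lerD2r;exact: nrm_stek.
Qed.

Lemma stek_sup_scaled a x l : l2 a -> 0 < l -> `|S a x| * l <= nrm a + l ^+ 2 * nrm (Dq a).
move=> la l0;have:= prim_sup_scaled (x:= x) (prim_stek r la) (l2_stek r0 la) I l0 => /leT;apply.
by rewrite lerD2r;exact: nrm_stek.
Qed.

Lemma dens_meas a b : l2 a -> l2 b -> measurable_fun (dom true) (dens a b).
move=> la lb;rewrite dens_def;apply: measurable_funD;apply: measurable_funM;exact: stek_meas.
Qed.

Lemma dens_ge0 a b x : 0 <= dens a b x.
by rewrite densE addr_ge0// -expr2 sqr_ge0. Qed.

(* energy-friendly sup bound (l small) and crude sup bound (l = 1) *)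
Lemma dens_sup a b x l : l2 a -> l2 b -> 0 < l ->
 dens a b x * l ^+ 2 <= 2 * (nrm a ^+ 2 + nrm b ^+ 2) + 2 * l ^+ 4 * (nrm (Dq a) ^+ 2 + nrm (Dq b) ^+ 2).
move=> la lb l0.
have h c : l2 c -> (S c x * S c x) * l ^+ 2 <= 2 * nrm c ^+ 2 + 2 * l ^+ 4 * nrm (Dq c) ^+ 2.
 move=> lc;have h1:= stek_sup_scaled x lc l0.
 have -> : (S c x * S c x) * l ^+ 2 = (`|S c x| * l) ^+ 2.
  by rewrite exprMn real_normK ?num_real// expr2.
 apply: leT (_ : (nrm c + l ^+ 2 * nrm (Dq c)) ^+ 2 <= _).
  have q1 : 0 <= `|S c x| * l by rewrite mulr_ge0// ltW.
  by rewrite ler_pXn2r// nnegrE// (leT q1).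
 rewrite -subr_ge0.
 have -> : 2 * nrm c ^+ 2 + 2 * l ^+ 4 * nrm (Dq c) ^+ 2 - (nrm c + l ^+ 2 * nrm (Dq c)) ^+ 2 =
  (nrm c - l ^+ 2 * nrm (Dq c)) ^+ 2 by ring.
 exact: sqr_ge0.
have:= h a la;have:= h b lb;rewrite densE mulrDl;lra.
Qed.

Lemma dens_bound a b : l2 a -> l2 b ->
 exists2 c, 0 <= c & forall x, dens a b x <= c.
move=> la lb;exists (2 * (nrm a ^+ 2 + nrm b ^+ 2) + 2 * (nrm (Dq a) ^+ 2 + nrm (Dq b) ^+ 2)).
 by rewrite addr_ge0// mulr_ge0// addr_ge0// sqr_ge0.
by move=> x;have:= dens_sup x la lb ltr01;rewrite !expr1n !mulr1.
Qed.

Lemma dens_norm a b x : `|dens a b x| = dens a b x.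
by rewrite ger0_norm ?dens_ge0. Qed.

Lemma dens_mul c a b g : l2 a -> l2 b -> l2 g -> 0 <= c -> (forall x, dens a b x <= c) ->
 l2 (dens a b * g) /\ nrm (dens a b * g) <= c * nrm g.
move=> la lb lg c0 h;split.
 by apply: (l2M (c:= c) (dens_meas la lb)) => // x _;rewrite dens_norm.
by apply: nrmM => //;[exact: dens_meas|move=> x _;rewrite dens_norm].
Qed.

Lemma l2_dens_mul a b g : l2 a -> l2 b -> l2 g -> l2 (dens a b * g).
by move=> la lb lg;have [c c0 h]:= dens_bound la lb;case: (dens_mul la lb lg c0 h).
Qed.

Lemma l2_dens a b : l2 a -> l2 b -> l2 (dens a b).
have h c : l2 c -> l2 (S c * S c).
 move=> lc;apply: (l2M (c:= nrm c + nrm (Dq c)) (stek_meas lc));last exact: l2_stek.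
 by move=> x _;exact: stek_sup.
by move=> la lb;rewrite dens_def;apply: l2D;exact: h.
Qed.

Lemma l2_grad a b : l2 a -> l2 b -> l2 (gradL a b) /\ l2 (gradR a b).
move=> la lb;rewrite gradLE gradRE;split;(apply: l2D;[by do 2 apply: l2_dq|apply: l2Z;apply: l2_stek => //]);
 by apply: l2_dens_mul => //;exact: l2_stek.
Qed.

Variable h : R.
Lemma stepL_seal : {F : fn -> fn -> fn | forall a b, F a b = a - h *: gradR a b}.
by exists (fun a b => a - h *: gradR a b). Qed.
Definition stepL:= sval stepL_seal.
Lemma stepLE a b : stepL a b = a - h *: gradR a b.
exact: (svalP stepL_seal). Qed.
Lemma stepR_seal : {F : fn -> fn -> fn | forall a b, F a b = b + h *: gradL a b}.
by exists (fun a b => b + h *: gradL a b). Qed.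
Definition stepR:= sval stepR_seal.
Lemma stepRE a b : stepR a b = b + h *: gradL a b.
exact: (svalP stepR_seal). Qed.

(** Gauge invariance: the first order terms are the pairings of a with [gradR] and of b with
    [gradL], with opposite signs. They cancel since the square of a skew operator and the averaging
    are symmetric; only the quadratic error is left. *)
Lemma mass_step a b : l2 a -> l2 b ->
 nrm (stepL a b) ^+ 2 + nrm (stepR a b) ^+ 2 =
 nrm a ^+ 2 + nrm b ^+ 2 + h ^+ 2 * (nrm (gradL a b) ^+ 2 + nrm (gradR a b) ^+ 2).
move=> la lb;have [lL lR]:= l2_grad la lb.
have lSa:= l2_stek r0 la;have lSb:= l2_stek r0 lb.
have lda:= l2_dens_mul la lb lSa;have ldb:= l2_dens_mul la lb lSb.
have lDa:= l2_dq r (l2_dq r la);have lDb:= l2_dq r (l2_dq r lb).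
have lqa:= l2_stek r0 lda;have lqb:= l2_stek r0 ldb.
rewrite stepLE stepRE (nrm_sqB la (l2Z h lR)) (nrm_sqD lb (l2Z h lL)).
rewrite (nrmZ h lR) (nrmZ h lL) (ipZr h lR la) (ipZr h lL lb) !exprMn real_normK ?num_real//.
suff -> : ip a (gradR a b) = ip b (gradL a b) by ring.
rewrite gradLE gradRE (ipDr lDb (l2Z _ lqb) la) (ipDr lDa (l2Z _ lqa) lb) (ipZr _ lqb la) (ipZr _ lqa lb).
congr (_ + _ * _).
 rewrite ipC (ip_dq r (l2_dq r lb) la) [RHS]ipC (ip_dq r (l2_dq r la) lb).
 by rewrite (ipC _ (Dq b)).
rewrite -(ip_stek r0 la ldb) -(ip_stek r0 lb lda);apply: ip_eq => x _;rewrite !mulfE;ring.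
Qed.

(** The gradient of this functional is -2 times ([gradL], [gradR]), so that the continuous
    regularised flow conserves it. *)
Definition energy a b:= nrm (Dq a) ^+ 2 + nrm (Dq b) ^+ 2 - 4^-1 * nrm (dens a b) ^+ 2.

(** At first order nothing changes, since the step moves along J times the gradient. At second order
    the quartic part enters with a minus sign and |S u|^2 is convex, so it only helps; the quadratic
    error of the kinetic part remains. *)
Lemma energy_step a b : 0 <= h -> l2 a -> l2 b ->
 energy (stepL a b) (stepR a b) <=
 energy a b + h ^+ 2 * (nrm (Dq (gradL a b)) ^+ 2 + nrm (Dq (gradR a b)) ^+ 2).
move=> h0 la lb;have [lL lR]:= l2_grad la lb.
have lSa:= l2_stek r0 la;have lSb:= l2_stek r0 lb.
have lda:= l2_dens_mul la lb lSa;have ldb:= l2_dens_mul la lb lSb.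
have lDa:= l2_dq r la;have lDb:= l2_dq r lb.
have lDDa:= l2_dq r lDa;have lDDb:= l2_dq r lDb.
have lDL:= l2_dq r lL;have lDR:= l2_dq r lR.
have lqa:= l2_stek r0 lda;have lqb:= l2_stek r0 ldb.
have lSL:= l2_stek r0 lL;have lSR:= l2_stek r0 lR.
have l1 : l2 (stepL a b) by rewrite stepLE;exact: l2B la (l2Z h lR).
have l2' : l2 (stepR a b) by rewrite stepRE;exact: l2D lb (l2Z h lL).
have ld:= l2_dens la lb;have ld':= l2_dens l1 l2'.
have eL : Dq (stepL a b) = Dq a - h *: Dq (gradR a b).
 by rewrite stepLE -scaleNr dqD dqZ scaleNr.
have eR : Dq (stepR a b) = Dq b + h *: Dq (gradL a b) by rewrite stepRE dqD dqZ.
have cross : 4^-1 * nrm (dens (stepL a b) (stepR a b)) ^+ 2 >=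
  4^-1 * nrm (dens a b) ^+ 2 + h * (ip (dens a b * S b) (S (gradL a b)) - ip (dens a b * S a) (S (gradR a b))).
 pose m:= dens (stepL a b) (stepR a b) - dens a b.
 have lm : l2 m by exact: l2B.
 have -> : nrm (dens (stepL a b) (stepR a b)) ^+ 2 =
   nrm (dens a b) ^+ 2 + 2 * ip (dens a b) m + nrm m ^+ 2.
  by rewrite -(nrm_sqD ld lm) /m addrC subrK.
 have k1 : 2 * h * (ip (dens a b * S b) (S (gradL a b)) - ip (dens a b * S a) (S (gradR a b))) <= ip (dens a b) m.
  have lz : l2 ((2 * h) *: (dens a b * S b)) by exact: l2Z.
  pose c:= nrm (gradL a b) + nrm (Dq (gradL a b)).
  have lt1 : l2 (S (gradL a b) * S b).
   by apply: (l2M (c:= c) (stek_meas lL)) => // x _;exact: stek_sup.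
  pose c':= nrm (gradR a b) + nrm (Dq (gradR a b)).
  have lt2 : l2 (S (gradR a b) * S a).
   by apply: (l2M (c:= c') (stek_meas lR)) => // x _;exact: stek_sup.
  have -> : ip (dens a b * S b) (S (gradL a b)) = ip (dens a b) (S (gradL a b) * S b).
   by apply: ip_eq => x _;rewrite !fE;ring.
  have -> : ip (dens a b * S a) (S (gradR a b)) = ip (dens a b) (S (gradR a b) * S a).
   by apply: ip_eq => x _;rewrite !fE;ring.
  rewrite -(ipBr lt1 lt2 ld) -(ipZr (2 * h) (l2B lt1 lt2) ld).
  apply: (ip_le ld (l2Z _ (l2B lt1 lt2)) ld lm).
  move=> x _;apply: ler_wpM2l;first exact: dens_ge0.
  have sL : S (stepL a b) x = S a x - h * S (gradR a b) x.
   by rewrite stepLE -scaleNr (stekD r la (l2Z (- h) lR)) (stekZ r (- h) lR) addfE scalefE mulNr.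
  have sR : S (stepR a b) x = S b x + h * S (gradL a b) x.
   by rewrite stepRE (stekD r lb (l2Z h lL)) (stekZ r h lL).
  rewrite /m subfE !densE sL sR scalefE subfE !mulfE -subr_ge0.
  set p:= S a x;set q:= S b x;set y:= S (gradR a b) x;set z:= S (gradL a b) x.
  have -> : (p - h * y) * (p - h * y) + (q + h * z) * (q + h * z) - (p * p + q * q) -
    2 * h * (z * q - y * p) = (h * y) ^+ 2 + (h * z) ^+ 2 by ring.
  by rewrite addr_ge0 ?sqr_ge0.
 have:= sqr_ge0 (nrm m);move: k1;clear;set X:= ip _ m;set Y:= ip _ _ - _;set N:= nrm m ^+ 2;set N2:= nrm (dens a b) ^+ 2.
 by lra.
rewrite /energy eL eR (nrm_sqB lDa (l2Z h lDR)) (nrm_sqD lDb (l2Z h lDL)).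
rewrite (nrmZ h lDR) (nrmZ h lDL) (ipZr h lDR lDa) (ipZr h lDL lDb) !exprMn real_normK ?num_real//.
have i1 : 2 * ip (Dq a) (Dq (gradR a b)) = - 2 * ip (gradL a b) (gradR a b) + ip (dens a b * S a) (S (gradR a b)).
 have -> : ip (Dq a) (Dq (gradR a b)) = - ip (Dq (Dq a)) (gradR a b) by rewrite (ip_dq r lDa lR) opprK.
 have -> : ip (gradL a b) (gradR a b) = ip (Dq (Dq a)) (gradR a b) + 2^-1 * ip (dens a b * S a) (S (gradR a b)).
  by rewrite {1}gradLE (ipDl lDDa (l2Z _ lqa) lR) (ipZl _ lqa lR) (ip_stek r0 lda lR).
 by field.
have i2 : 2 * ip (Dq b) (Dq (gradL a b)) = - 2 * ip (gradL a b) (gradR a b) + ip (dens a b * S b) (S (gradL a b)).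
 have -> : ip (Dq b) (Dq (gradL a b)) = - ip (Dq (Dq b)) (gradL a b) by rewrite (ip_dq r lDb lL) opprK.
 have -> : ip (gradL a b) (gradR a b) = ip (Dq (Dq b)) (gradL a b) + 2^-1 * ip (dens a b * S b) (S (gradL a b)).
  by rewrite ipC {1}gradRE (ipDl lDDb (l2Z _ lqb) lL) (ipZl _ lqb lL) (ip_stek r0 ldb lL).
 by field.
move: cross i1 i2;clear.
set E:= nrm (dens (stepL a b) _) ^+ 2;set E0:= nrm (dens a b) ^+ 2.
set p:= ip (dens a b * S b) _;set q:= ip (dens a b * S a) _;set x:= ip (Dq a) _;set y:= ip (Dq b) _.
set z:= ip (gradL a b) _;set n1:= nrm (Dq a) ^+ 2;set n2:= nrm (Dq b) ^+ 2.
set m1:= nrm _ ^+ 2;set m2:= nrm _ ^+ 2 => c i1 i2.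
have -> : n1 - 2 * (h * x) + h ^+ 2 * m2 + (n2 + 2 * (h * y) + h ^+ 2 * m1) - 4^-1 * E =
 n1 + n2 + h * (2 * y - 2 * x) + h ^+ 2 * (m1 + m2) - 4^-1 * E by ring.
rewrite i1 i2;have -> : - 2 * z + p - (- 2 * z + q) = p - q by ring.
by lra.
Qed.

(* One explicit step costs a factor 1 + h when h <= r^4. *)
Lemma lin_step a b : 0 <= h -> h <= r ^+ 4 -> l2 a -> l2 b ->
 hyp (nrm (a - h *: Dq (Dq b))) (nrm (b + h *: Dq (Dq a))) <= (1 + h) * hyp (nrm a) (nrm b).
move=> h0 hr la lb.
have lDDa:= l2_dq r (l2_dq r la);have lDDb:= l2_dq r (l2_dq r lb).
have bd c : l2 c -> h ^+ 2 * nrm (Dq (Dq c)) ^+ 2 <= h * nrm c ^+ 2.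
 move=> lc;have n1:= nrm_dq r0 (l2_dq r lc);have n2:= nrm_dq r0 lc.
 have ri : 0 <= r^-1 by rewrite invr_ge0 ltW.
 have n3 : nrm (Dq (Dq c)) <= r ^- 2 * nrm c.
  apply: leT n1 _;rewrite -exprVn expr2 -mulrA;exact: ler_wpM2l.
 have n4 : nrm (Dq (Dq c)) ^+ 2 <= r ^- (2 * 2) * nrm c ^+ 2.
  have -> : r ^- (2 * 2) * nrm c ^+ 2 = (r ^- 2 * nrm c) ^+ 2 by rewrite exprMn exprVn -exprM.
  by rewrite ler_pXn2r// nnegrE ?nrm_ge0// (leT _ n3)// nrm_ge0.
 rewrite expr2 -mulrA;apply: ler_wpM2l => //.
 apply: leT (ler_wpM2l h0 n4) _;rewrite mulrA -[leRHS]mul1r;apply: ler_wpM2r;first exact: sqr_ge0.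
 by rewrite ler_pdivrMr ?exprn_gt0// mul1r.
apply: hyp_le;first by rewrite mulr_ge0 ?hyp_ge0// addr_ge0.
rewrite (nrm_sqB la (l2Z h lDDb)) (nrm_sqD lb (l2Z h lDDa)).
rewrite (nrmZ h lDDb) (nrmZ h lDDa) (ipZr h lDDb la) (ipZr h lDDa lb) !exprMn real_normK ?num_real// hyp_sq.
have -> : ip a (Dq (Dq b)) = ip b (Dq (Dq a)).
 rewrite ipC (ip_dq r (l2_dq r lb) la) [RHS]ipC (ip_dq r (l2_dq r la) lb).
 by rewrite (ipC _ (Dq b)).
have ba:= bd a la;have bb:= bd b lb.
have:= mulr_ge0 h0 (sqr_ge0 (nrm a));have:= mulr_ge0 h0 (sqr_ge0 (nrm b)).
have:= mulr_ge0 (sqr_ge0 h) (sqr_ge0 (nrm a));have:= mulr_ge0 (sqr_ge0 h) (sqr_ge0 (nrm b)).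
move: ba bb;clear;set x:= ip _ _;set A:= nrm a ^+ 2;set B:= nrm b ^+ 2.
set A2:= nrm (Dq _) ^+ 2;set B2:= nrm (Dq _) ^+ 2 => *.
have -> : (1 + h) ^+ 2 * (A + B) = (A + B) + 2 * (h * A + h * B) + (h ^+ 2 * A + h ^+ 2 * B) by ring.
lra.
Qed.

End SchemeStep.

(** * The scheme on Sobolev chains: consistency and stability *)

Section SchemeOps.
Variable R : realType.
Import WholeLine.
Local Notation fn:= (R -> R).
Local Notation algc:= (@algc R).
Local Notation chain:= (nat -> R -> R).
Local Notation V:= (chain * chain)%type.
Implicit Types (u v : V) (k n j : nat) (c : chain).

Definition mapc (F : fn -> fn) c : chain:= fun j => F (c j).

Lemma prim_tr (x : R) (f f' : fn) : prim f f' -> prim (tr x f) (tr x f').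
move=> [lf' ef];split;first exact: l2_tr.
move=> y z _ _;rewrite ip_tr//;last exact: l2_indT.
by rewrite tr_ind opprK /tr /= ef.
Qed.
Lemma prim_dq r (f f' : fn) : prim f f' -> prim (dq r f) (dq r f').
by move=> pf;rewrite !dqE;apply: primZ;apply: primB;exact: prim_tr. Qed.

Variable r : R.
Hypothesis r0 : 0 < r.

Lemma isH_stek k c : isH k c -> isH k (mapc (stek r) c).
move=> hc;split => j jk;first exact: l2_stek (isH_l2 hc jk).
by rewrite /mapc (stek_of_prim r (isH_prim hc jk));exact: prim_stek (isH_l2 hc (ltnW jk)).
Qed.
Lemma isH_dq k c : isH k c -> isH k (mapc (dq r) c).
move=> hc;split => j jk;first exact: l2_dq (isH_l2 hc jk).
exact: prim_dq (isH_prim hc jk).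
Qed.

Definition SP u : V:= (mapc (stek r) u.1, mapc (stek r) u.2).
Definition DDP u : V:= (mapc (dq r) (mapc (dq r) u.1), mapc (dq r) (mapc (dq r) u.2)).
(** The regularised field at scale [r]. The cubic term is averaged both inside and outside, which
    makes it the gradient of a quartic energy. *)
Definition Fr u : V:= JP (DDP u + SP (cubN (SP u))).
Definition stepP (h : R) u : V:= u + h *: Fr u.

Lemma HP_SP k u : HP k u -> HP k (SP u).
by move=> [a b];split;exact: isH_stek. Qed.
Lemma HP_DDP k u : HP k u -> HP k (DDP u).
by move=> [a b];split;do 2 apply: isH_dq. Qed.
Lemma HP_Fr k u : HP k.+1 u -> HP k.+1 (Fr u).
move=> hu;apply: HP_JP;apply: HPD;first exact: HP_DDP.
by apply: HP_SP;apply: HP_cubN;exact: HP_SP.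
Qed.
Lemma HP_stepP k h u : HP k.+1 u -> HP k.+1 (stepP h u).
by move=> hu;apply: HPD => //;apply: HPZ;exact: HP_Fr. Qed.

Lemma HP_l2 k u j : HP k u -> (j <= k)%N -> l2 (u.1 j) /\ l2 (u.2 j).
by move=> [a b] jk;split;[exact: isH_l2 a jk|exact: isH_l2 b jk]. Qed.

Lemma NP_mono k u v : (forall j, (j <= k)%N -> np j u <= np j v) -> NP k u <= NP k v.
by move=> h;apply: ler_sum => j _;apply: h;rewrite -ltnS. Qed.
Lemma NP_eq k u v : (forall j, (j <= k)%N -> u.1 j = v.1 j /\ u.2 j = v.2 j) -> NP k u = NP k v.
by move=> h;apply: eq_bigr => j _;rewrite /np;case: (h j) => [|-> ->] //;rewrite -ltnS.
Qed.

Lemma NP_SP k u : HP k u -> NP k (SP u) <= NP k u.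
move=> hu;apply: NP_mono => j jk;have [la lb]:= HP_l2 hu jk.
by apply: hyp_mono;rewrite ?nrm_ge0//;exact: nrm_stek.
Qed.

Lemma stekB (f g : fn) : l2 f -> l2 g -> stek r (f - g) = stek r f - stek r g.
by move=> lf lg;rewrite -[- g]scaleN1r (stekD r lf (l2Z (-1) lg)) (stekZ r (-1) lg) scaleN1r.
Qed.

Lemma SPB k u v : HP k u -> HP k v -> NP k (SP u - SP v) = NP k (SP (u - v)).
move=> hu hv;apply: NP_eq => j jk.
have [la lb]:= HP_l2 hu jk;have [lc ld]:= HP_l2 hv jk.
by split;[exact/esym/stekB|exact/esym/stekB].
Qed.

Lemma NP_SP_lip k u v : HP k u -> HP k v -> NP k (SP u - SP v) <= NP k (u - v).
by move=> hu hv;rewrite (SPB hu hv);apply: NP_SP;exact: HPB. Qed.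

Lemma NP_SP_close k u : HP k.+1 u -> NP k (SP u - u) <= 2 * r * NP k.+1 u.
move=> [a b];have rr : 0 <= 2 * r by rewrite mulr_ge0// ltW.
apply: (@leT _ _ (\sum_(j < k.+1) (2 * r) * np j.+1 u)).
 apply: ler_sum => j _;have jk : (j < k.+1)%N:= ltn_ord j.
 have n1:= stek_close r0 (isH_prim a jk) (isH_l2 a (ltnW jk)).
 have n2:= stek_close r0 (isH_prim b jk) (isH_l2 b (ltnW jk)).
 rewrite -[X in _ <= X * _](ger0_norm rr) -hypZ.
 by apply: hyp_mono;rewrite ?nrm_ge0.
rewrite -mulr_sumr;apply: ler_wpM2l => //.
have -> : NP k.+1 u = np 0 u + \sum_(j < k.+1) np j.+1 u by rewrite /NP big_ord_recl.
by rewrite lerDr np_ge0.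
Qed.

(** The squared difference quotient of a function with two derivatives is the double mean of its
    second derivative; consistency of the linear part thus reduces to closeness of means. *)
Lemma NP_DDP k u v : HP k.+2 u -> HP k v -> NP k (DDP u - v) = NP k (SP (SP (lap u)) - v).
move=> [a b] _;apply: NP_eq => j jk.
have e c : isH k.+2 c -> dq r (dq r (c j)) = stek r (stek r (c j.+2)).
 move=> hc;rewrite (stek_of_prim r (isH_prim (isH_stek hc) (j:= j.+1) _));last by lia.
 by rewrite /mapc (stek_of_prim r (isH_prim hc (j:= j) _))//;lia.
by split;rewrite -[LHS]/(dq r (dq r (_ j)) - _) e.
Qed.

(** Every replacement of a mean by the function itself costs a factor 2 r and one derivative. There
    are two of them in the linear part and two in the cubic part. *)
Lemma NP_Fr_close k u (M : R) : HP k.+4 u -> NP k.+4 u <= M -> 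
 NP k.+1 (Fr u - field u) <= r * (4 * M + 24 * algc k.+1 ^+ 2 * M ^+ 3).
move=> hu uM;have rr : 0 <= 2 * r by rewrite mulr_ge0// ltW.
have M0 : 0 <= M by apply: leT uM;exact: NP_ge0.
have hS:= HP_SP hu.
have h1 : HP k.+1 u by apply: HP_le hu;lia.
have h2 : HP k.+2 u by apply: HP_le hu;lia.
have h3 : HP k.+3 u by apply: HP_le hu;lia.
have hS1:= HP_SP h1;have hS2:= HP_SP h2.
have hl : HP k.+2 (lap u):= HP_lap hu.
have hl1 : HP k.+1 (lap u):= HP_lap h3.
have hSl:= HP_SP hl;have hSl1:= HP_SP hl1.
have n2 : NP k.+2 u <= M by apply: leT (NP_le u _) uM;lia.
have n1 : NP k.+1 u <= M by apply: leT (NP_le u _) uM;lia.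
have A0 : algc k ^+ 2 <= algc k.+1 ^+ 2.
 rewrite ler_pXn2r// ?nnegrE ?algc_ge0//.
 by apply: ler_pM;rewrite ?exprn_ge0 ?ler0n ?ler_nat// ler_weXn2l ?ler1n.
rewrite /Fr /field -JPB NP_JP opprD addrACA.
have hc:= HP_cubN hS1;have hc2:= HP_cubN hS2;have hcu:= HP_cubN h1.
apply: leT (NPD (HPB (HP_DDP h1) hl1) (HPB (HP_SP hc) hcu)) _.
have b1 : NP k.+1 (DDP u - lap u) <= 2 * r * (2 * M).
 rewrite (NP_DDP h3 hl1).
 apply: leT (NP_dist (HP_SP hSl1) hSl1 hl1) _.
 have c1:= NP_SP_close hSl;have c2:= NP_SP_close hl.
 have c3 : NP k.+2 (SP (lap u)) <= M by apply: leT (NP_SP hl) _;apply: leT (NP_lap _ _) uM.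
 have c4 : NP k.+2 (lap u) <= M by apply: leT (NP_lap _ _) uM.
 have:= ler_wpM2l rr c3;have:= ler_wpM2l rr c4;lra.
have b2 : NP k.+1 (SP (cubN (SP u)) - cubN u) <= 2 * r * (12 * algc k.+1 ^+ 2 * M ^+ 3).
 apply: leT (NP_dist (HP_SP hc) hc hcu) _.
 have c1:= NP_SP_close hc2.
 have c2:= NP_cubN hS2 (leT (NP_SP h2) n2).
 have c3:= NP_cubN_lip hS1 h1 (leT (NP_SP h1) n1) n1.
 have c4:= NP_SP_close h2.
 have c5 : 6 * algc k ^+ 2 * (M ^+ 2 * NP k.+1 (SP u - u)) <= 6 * algc k.+1 ^+ 2 * (M ^+ 2 * (2 * r * M)).
  apply: ler_pM;rewrite ?mulr_ge0 ?exprn_ge0 ?NP_ge0 ?algc_ge0//.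
   exact: ler_wpM2l.
  apply: ler_wpM2l;first exact: exprn_ge0.
  by apply: leT c4 _;exact: ler_wpM2l.
 have c6:= ler_wpM2l rr c2.
 apply: leT (lerD (leT c1 c6) (leT c3 c5)) _.
 by apply: eqW;ring.
by apply: leT (lerD b1 b2) _;apply: eqW;ring.
Qed.

Variable h : R.
Hypotheses (h0 : 0 <= h) (hr : h <= r ^+ 4).

Lemma NP_lin_step k u : HP k u -> NP k (u + h *: JP (DDP u)) <= (1 + h) * NP k u.
move=> hu;rewrite [X in _ <= _ * X]/NP mulr_sumr;apply: ler_sum => j _.
have [la lb]:= HP_l2 hu (ltn_ord j : (j <= k)%N).
have e : (u + h *: JP (DDP u)).1 j = u.1 j - h *: dq r (dq r (u.2 j)).
 by rewrite -[LHS]/(u.1 j + h *: (- dq r (dq r (u.2 j)))) scalerN.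
by rewrite /np e;exact: lin_step.
Qed.

Lemma stepP_split u : stepP h u = (u + h *: JP (DDP u)) + h *: JP (SP (cubN (SP u))).
rewrite /stepP /Fr -addrA -scalerDr;congr (_ + _ *: _).
by rewrite /JP;congr (_, _);rewrite -[LHS]/(- (_ + _)) opprD.
Qed.

(** The linear part grows by at most 1 + h, and the averaged cubic term is a perturbation of size h,
    averaging being a contraction. *)
Lemma NP_stepP k u : HP k.+1 u ->
 NP k.+1 (stepP h u) <= (1 + h) * NP k.+1 u + h * NP k.+1 (cubN (SP u)).
move=> hu;have hS:= HP_SP hu;have hc:= HP_cubN hS;have hSc:= HP_SP hc.
have hJ:= HP_JP hSc;have hL : HP k.+1 (u + h *: JP (DDP u)).
 by apply: HPD => //;apply: HPZ;apply: HP_JP;exact: HP_DDP.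
rewrite stepP_split;apply: leT (NPD hL (HPZ h hJ)) _.
apply: lerD;first exact: NP_lin_step.
by rewrite (NPZ h hJ) NP_JP ger0_norm//;apply: ler_wpM2l => //;exact: NP_SP.
Qed.

Lemma NP_stepP_lip k u v (M : R) : HP k.+1 u -> HP k.+1 v -> NP k.+1 u <= M -> NP k.+1 v <= M ->
 NP k.+1 (stepP h u - stepP h v) <= (1 + h * (1 + 6 * algc k ^+ 2 * M ^+ 2)) * NP k.+1 (u - v).
move=> hu hv uM vM;have hS:= HP_SP hu;have hc:= HP_cubN hS;have hSc:= HP_SP hc.
have hS':= HP_SP hv;have hc':= HP_cubN hS';have hSc':= HP_SP hc'.
have hJ:= HP_JP (HPB hSc hSc');have huv:= HPB hu hv.
have M0 : 0 <= M by apply: leT uM;exact: NP_ge0.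
have hL w : HP k.+1 w -> HP k.+1 (w + h *: JP (DDP w)).
 by move=> hw;apply: HPD => //;apply: HPZ;apply: HP_JP;exact: HP_DDP.
have e : NP k.+1 (stepP h u - stepP h v) =
  NP k.+1 (((u - v) + h *: JP (DDP (u - v))) + h *: JP (SP (cubN (SP u)) - SP (cubN (SP v)))).
 congr (NP _ _);rewrite !stepP_split JPB scalerBr.
 have -> : JP (DDP (u - v)) = JP (DDP u) - JP (DDP v).
  rewrite -JPB;congr JP;rewrite /DDP /=.
  have dB (f g : fn) : dq r (f - g) = dq r f - dq r g by rewrite -scaleN1r dqD dqZ scaleN1r.
  congr (_, _);apply/funext => j.
   by rewrite -[LHS]/(dq r (dq r (u.1 j - v.1 j))) !dB.
  by rewrite -[LHS]/(dq r (dq r (u.2 j - v.2 j))) !dB.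
 by rewrite scalerBr opprD addrACA;congr (_ + _);rewrite opprD addrACA.
rewrite e;apply: leT (NPD (hL _ huv) (HPZ h hJ)) _.
rewrite (NPZ h hJ) NP_JP ger0_norm//.
have n1:= NP_lin_step huv.
have n2:= NP_SP_lip hc hc'.
have n3:= NP_cubN_lip hS hS' (leT (NP_SP hu) uM) (leT (NP_SP hv) vM).
have n4 : 6 * algc k ^+ 2 * (M ^+ 2 * NP k.+1 (SP u - SP v)) <= 6 * algc k ^+ 2 * (M ^+ 2 * NP k.+1 (u - v)).
 apply: ler_wpM2l;first by rewrite mulr_ge0// exprn_ge0// algc_ge0.
 by apply: ler_wpM2l;[exact: exprn_ge0|exact: NP_SP_lip].
have n5:= ler_wpM2l h0 (leT n2 (leT n3 n4)).
apply: leT (lerD n1 n5) _.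
by apply: eqW;ring.
Qed.

End SchemeOps.

(** * Control of mass and energy, and coercivity of the energy *)

Section H1Control.
Variable R : realType.
Import WholeLine.
Local Notation fn:= (R -> R).
Local Notation chain:= (nat -> R -> R).
Local Notation V:= (chain * chain)%type.
Local Notation algc:= (@algc R).
Implicit Types (u v : V) (k n j : nat).

Lemma discrete_gronwall (x : nat -> R) (h c d : R) (m : nat) : 0 <= h -> 0 <= c -> 0 <= d ->
 (forall j, (j < m)%N -> x j.+1 <= (1 + h * c) * x j + h * d) -> 0 <= x 0%N ->
 forall j, (j <= m)%N -> x j <= expR (c * (h * j%:R)) * (x 0%N + h * j%:R * d).
move=> h0 c0 d0 st x0;have hc : 0 <= h * c by exact: mulr_ge0.
have q0 : 0 <= 1 + h * c by rewrite addr_ge0.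
have key j : (j <= m)%N -> x j <= (1 + h * c) ^+ j * (x 0%N + h * j%:R * d).
 elim: j => [|j IH] jm;first by rewrite expr0 mul1r mulr0 mul0r addr0.
 apply: leT (st j jm) _.
 have h1:= ler_wpM2l q0 (IH (ltnW jm)).
 have h2 : h * d <= (1 + h * c) ^+ j.+1 * (h * d).
  by rewrite -[leLHS]mul1r;apply: ler_wpM2r;[exact: mulr_ge0|rewrite exprn_ege1// lerDl].
 apply: leT (lerD h1 h2) _.
 by apply: eqW;rewrite exprS -natr1;ring.
move=> j jm;apply: leT (key j jm) _;apply: ler_wpM2r.
 by rewrite addr_ge0// !mulr_ge0.
have -> : c * (h * j%:R) = (h * c) *+ j by rewrite -mulr_natr;ring.
rewrite -mulr_natr expRM_natr;apply: lerXn2r;rewrite ?nnegrE ?expR_ge0//;exact: expR_ge1Dx.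
Qed.

Variable r : R.
Hypotheses (r0 : 0 < r) (r1 : r <= 1).
Local Notation S:= (stek r).
Local Notation Dq:= (dq r).

Let ri1 : 1 <= r^-1. by rewrite invf_ge1. Qed.

Definition mass (a b : fn):= nrm a ^+ 2 + nrm b ^+ 2.
Definition kin (a b : fn):= nrm (Dq a) ^+ 2 + nrm (Dq b) ^+ 2.

Lemma mass_ge0 a b : 0 <= mass a b. by rewrite addr_ge0 ?sqr_ge0. Qed.
Lemma kin_ge0 a b : 0 <= kin a b. by rewrite addr_ge0 ?sqr_ge0. Qed.

Lemma nrm_dq_sq f : l2 f -> nrm (Dq f) ^+ 2 <= r^-1 ^+ 2 * nrm f ^+ 2.
move=> lf;rewrite -exprMn ler_pXn2r ?nnegrE ?nrm_ge0//;first exact: nrm_dq.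
by rewrite mulr_ge0 ?nrm_ge0// invr_ge0 ltW.
Qed.

Lemma dens_le_mass a b x : l2 a -> l2 b -> dens r a b x <= 4 * r^-1 ^+ 2 * mass a b.
move=> la lb;have:= dens_sup r0 x la lb ltr01;rewrite !expr1n !mulr1 => /leT;apply.
have:= nrm_dq_sq la;have:= nrm_dq_sq lb;rewrite /mass.
have : 1 <= r^-1 ^+ 2 by rewrite exprn_ege1.
move: (sqr_ge0 (nrm a)) (sqr_ge0 (nrm b)).
set A:= nrm a ^+ 2;set B:= nrm b ^+ 2;set q:= r^-1 ^+ 2;set A':= nrm (Dq a) ^+ 2;set B':= nrm (Dq b) ^+ 2.
move=> a0 b0 q1 h1 h2.
have p1 : A <= q * A by rewrite -{1}[A]mul1r;exact: ler_wpM2r.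
have p2 : B <= q * B by rewrite -{1}[B]mul1r;exact: ler_wpM2r.
have -> : 4 * q * (A + B) = 4 * (q * A) + 4 * (q * B) by ring.
lra.
Qed.

Lemma grad_bound a b : l2 a -> l2 b ->
 nrm (gradL r a b) <= r^-1 ^+ 2 * (1 + 2 * mass a b) * nrm a /\
 nrm (gradR r a b) <= r^-1 ^+ 2 * (1 + 2 * mass a b) * nrm b.
move=> la lb;have ri0 : 0 <= r^-1 by rewrite invr_ge0 ltW.
have c0 : 0 <= 4 * r^-1 ^+ 2 * mass a b by rewrite !mulr_ge0 ?exprn_ge0 ?mass_ge0.
have aux f : l2 f -> nrm (Dq (Dq f) + 2^-1 *: S (dens r a b * S f)) <= r^-1 ^+ 2 * (1 + 2 * mass a b) * nrm f.
 move=> lf;have lS:= l2_stek r0 lf.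
 have [l1 n1]:= dens_mul la lb lS c0 (fun x => dens_le_mass x la lb).
 apply: leT (nrmD (l2_dq r (l2_dq r lf)) (l2Z _ (l2_stek r0 l1))) _.
 rewrite (nrmZ _ (l2_stek r0 l1)) gtr0_norm ?invr_gt0//.
 have n2:= leT (nrm_stek r0 l1) (leT n1 (ler_wpM2l c0 (nrm_stek r0 lf))).
 have n3:= leT (nrm_dq r0 (l2_dq r lf)) (ler_wpM2l ri0 (nrm_dq r0 lf)).
 have -> : r^-1 ^+ 2 * (1 + 2 * mass a b) * nrm f = r^-1 * (r^-1 * nrm f) + 2^-1 * (4 * r^-1 ^+ 2 * mass a b * nrm f).
  by move: (r^-1) (mass a b) (nrm f) => x y z;field.
 by apply: lerD => //;rewrite ler_pM2l ?invr_gt0.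
by rewrite gradLE gradRE;split;exact: aux.
Qed.

(** The cubic equation is mass-subcritical in one dimension: sup |S u|^2 is at most 2 mass / l^2 + 2
    l^2 kin, and one more factor mass bounds the quartic integral. With l = 1 / (K + 1) one has l^2
    K <= 1, so the quarter of it in the energy absorbs at most half of the kinetic part. *)
Lemma energy_coercive a b (K : R) : l2 a -> l2 b -> 0 <= K -> mass a b <= K ->
 kin a b <= 2 * energy r a b + K ^+ 2 * (K + 1) ^+ 2.
move=> la lb K0 mK;set l:= (K + 1)^-1.
have K1 : 0 < K + 1 by lra.
have l0 : 0 < l by rewrite invr_gt0.
pose c:= 2 * (K + 1) ^+ 2 * mass a b + 2 * l ^+ 2 * kin a b.
have c0 : 0 <= c.
 by rewrite addr_ge0// !mulr_ge0 ?exprn_ge0 ?mass_ge0 ?kin_ge0 ?ltW.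
have ce x : dens r a b x <= c.
 have:= dens_sup r0 x la lb l0;rewrite -/(mass a b) -/(kin a b) => h.
 rewrite -(ler_pM2r (exprn_gt0 2 l0));apply: leT h _.
 apply: eqW;rewrite /c /l;field;by rewrite gt_eqF.
have lSa:= l2_stek r0 la;have lSb:= l2_stek r0 lb.
have [lda nda]:= dens_mul la lb lSa c0 ce;have [ldb ndb]:= dens_mul la lb lSb c0 ce.
have d2 : nrm (dens r a b) ^+ 2 <= c * mass a b.
 have -> : nrm (dens r a b) ^+ 2 = ip (dens r a b * S a) (S a) + ip (dens r a b * S b) (S b).
  have ld:= l2_dens r0 la lb;rewrite nrm_sq.
  have sq f : l2 f -> l2 (S f * S f).
   move=> lf;apply: (l2M (c:= nrm f + nrm (Dq f)) (stek_meas r lf));last exact: l2_stek.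
   by move=> x _;exact: stek_sup.
  rewrite {2}dens_def (ipDr (sq a la) (sq b lb) ld);congr (_ + _);apply: ip_eq => x _;rewrite !mulfE;ring.
 rewrite mulrDr;apply: lerD.
  apply: leT (leT (ler_norm _) (CS lda lSa)) _;rewrite expr2 mulrA.
  apply: ler_pM;rewrite ?nrm_ge0//;last exact: nrm_stek.
  by apply: leT nda _;apply: ler_wpM2l => //;exact: nrm_stek.
 apply: leT (leT (ler_norm _) (CS ldb lSb)) _;rewrite expr2 mulrA.
 apply: ler_pM;rewrite ?nrm_ge0//;last exact: nrm_stek.
 by apply: leT ndb _;apply: ler_wpM2l => //;exact: nrm_stek.
rewrite /energy -/(kin a b).
suff : c * mass a b <= 2 * K ^+ 2 * (K + 1) ^+ 2 + 2 * kin a b.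
 move: d2;set X:= nrm _ ^+ 2;set Y:= c * _;set Z:= kin a b;set W:= K ^+ 2 * _ => d2.
 by rewrite (_ : 2 * K ^+ 2 * _ = 2 * W);[lra|rewrite /W;ring].
rewrite /c mulrDl;apply: lerD.
 have -> : 2 * (K + 1) ^+ 2 * mass a b * mass a b = 2 * mass a b ^+ 2 * (K + 1) ^+ 2 by ring.
 apply: ler_wpM2r;first exact: exprn_ge0 (ltW K1).
 by rewrite ler_pM2l// ler_pXn2r ?nnegrE ?mass_ge0.
rewrite (_ : _ * mass a b = 2 * kin a b * (l ^+ 2 * mass a b));last by ring.
rewrite -[leRHS]mulr1;apply: ler_wpM2l;first by rewrite mulr_ge0 ?kin_ge0.
rewrite /l exprVn mulrC ler_pdivrMr ?exprn_gt0// mul1r.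
by apply: leT mK _;rewrite -subr_ge0 (_ : _ - _ = K ^+ 2 + K + 1) ?addr_ge0 ?exprn_ge0//;ring.
Qed.

Variable h : R.
Hypotheses (h0 : 0 <= h) (hE : h = r ^+ 8).

(** The gradient is at most r^-2 (1 + 2 K) <= r^-3 times the norm, and a further difference quotient
    costs r^-1. The errors h^2 r^-6 and h^2 r^-8 times the mass become at most h times the mass for
    h = r^8: this is where the exponent 8 comes from. *)
Lemma mass_growth a b (K : R) : l2 a -> l2 b -> 0 <= K -> mass a b <= K -> r * (1 + 2 * K) <= 1 ->
 mass (stepL r h a b) (stepR r h a b) <= (1 + h) * mass a b /\
 energy r (stepL r h a b) (stepR r h a b) <= energy r a b + h * K.
move=> la lb K0 mK rK;have [gL gR]:= grad_bound la lb.
have [lL lR]:= l2_grad r0 la lb.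
have ri0 : 0 <= r^-1 by rewrite invr_ge0 ltW.
pose q:= r^-1 ^+ 2 * (1 + 2 * mass a b).
have q0 : 0 <= q by rewrite mulr_ge0 ?exprn_ge0// addr_ge0// mulr_ge0// mass_ge0.
have qr : q <= r^-1 ^+ 3.
 rewrite /q (exprSr _ 2);apply: ler_wpM2l;first exact: exprn_ge0.
 rewrite -[leRHS]mul1r ler_pdivlMr// mulrC;apply: leT rK.
 by rewrite ler_pM2l// lerD2l ler_pM2l.
have sq (x y z : R) : 0 <= x -> 0 <= y -> x <= z * y -> x ^+ 2 <= z ^+ 2 * y ^+ 2.
 by move=> x0 y0 xy;rewrite -exprMn ler_pXn2r ?nnegrE// (leT x0).
have qq : q ^+ 2 <= r^-1 ^+ 6.
 have -> : r^-1 ^+ 6 = (r^-1 ^+ 3) ^+ 2 by rewrite -exprM.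
 by rewrite ler_pXn2r ?nnegrE ?exprn_ge0.
have gsum : nrm (gradL r a b) ^+ 2 + nrm (gradR r a b) ^+ 2 <= q ^+ 2 * mass a b.
 by rewrite /mass mulrDr;apply: lerD;apply: sq;rewrite ?nrm_ge0.
have gsum':= leT gsum (ler_wpM2r (mass_ge0 a b) qq).
have hh (X : R) : 0 <= X -> h ^+ 2 * (r^-1 ^+ 8 * X) <= h * X.
 move=> X0;apply: eqW.
 by rewrite hE exprVn;field;rewrite gt_eqF.
split.
 rewrite /mass (mass_step r0 h la lb) -/(mass a b) mulrDl mul1r lerD2l.
 apply: leT (hh _ (mass_ge0 a b));apply: ler_wpM2l;first exact: exprn_ge0.
 apply: leT gsum' _;apply: ler_wpM2r;first exact: mass_ge0.
 by apply: ler_weXn2l.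
apply: leT (energy_step r0 h0 la lb) _;rewrite lerD2l.
apply: leT (_ : h ^+ 2 * (r^-1 ^+ 8 * mass a b) <= _);last first.
 by apply: leT (hh _ (mass_ge0 a b)) _;exact: ler_wpM2l.
apply: ler_wpM2l;first exact: exprn_ge0.
have:= nrm_dq_sq lL;have:= nrm_dq_sq lR;have:= ler_wpM2l (exprn_ge0 2 ri0) gsum'.
have -> : r^-1 ^+ 2 * (r^-1 ^+ 6 * mass a b) = r^-1 ^+ 8 * mass a b by rewrite mulrA -exprD.
by rewrite mulrDr;lra.
Qed.

(** Transfers the mass and energy estimates, proved for pairs of functions, to the bottom level of
    the scheme on chains. *)
Lemma stepP_level0 u : HP 1 u ->
 (stepP r h u).1 0%N = stepL r h (u.1 0%N) (u.2 0%N) /\ (stepP r h u).2 0%N = stepR r h (u.1 0%N) (u.2 0%N).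
move=> hu;have [la lb]:= HP_l2 hu (leq0n 1).
have ld f : l2 f -> l2 (dens r (u.1 0%N) (u.2 0%N) * S f).
 by move=> lf;apply: l2_dens_mul => //;exact: l2_stek.
have e1 : (cubN (SP r u)).1 0%N = 2^-1 *: (dens r (u.1 0%N) (u.2 0%N) * S (u.1 0%N)).
 by rewrite dens_def mulrDl.
have e2 : (cubN (SP r u)).2 0%N = 2^-1 *: (dens r (u.1 0%N) (u.2 0%N) * S (u.2 0%N)).
 by rewrite dens_def mulrDl.
rewrite stepLE stepRE gradLE gradRE;split.
 rewrite -(stekZ r 2^-1 (ld _ lb)) -e2 -scalerN.
 by [].
by rewrite -(stekZ r 2^-1 (ld _ la)) -e1.
Qed.

End H1Control.

(** * The iterated schemes: bounds independent of the step *)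

Section Scheme.
Variable R : realType.
Import WholeLine.
Local Notation fn:= (R -> R).
Local Notation chain:= (nat -> R -> R).
Local Notation V:= (chain * chain)%type.
Local Notation algc:= (@algc R).
Implicit Types (u v w : V) (k n i j : nat).

(** Dyadic radii. The time steps are their eighth powers, so a step at level n has exactly the
    length of 256 steps at level n + 1. *)
Definition rn n : R:= 2^-1 ^+ n.
Lemma hn_seal : {F : nat -> R | forall n, F n = rn n ^+ 8}.
by exists (fun n => rn n ^+ 8). Qed.
Definition hn:= sval hn_seal.
Lemma hnE n : hn n = rn n ^+ 8. exact: (svalP hn_seal). Qed.
Definition nU n j u : V:= iter j (stepP (rn n) (hn n)) u.

Lemma rn_gt0 n : 0 < rn n. by rewrite exprn_gt0 ?invr_gt0. Qed.
Lemma rn_le1 n : rn n <= 1. by rewrite exprn_ile1 ?invr_ge0// invf_le1// ler1n. Qed.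
Lemma hn_gt0 n : 0 < hn n. by rewrite hnE exprn_gt0 ?rn_gt0. Qed.
Lemma hn_le_pow n i : (i <= 8)%N -> hn n <= rn n ^+ i.
by move=> i8;rewrite hnE;apply: ler_wiXn2l => //;[exact: ltW (rn_gt0 n)|exact: rn_le1]. Qed.
Lemma hn_le_rn n : hn n <= rn n. exact: (hn_le_pow n (i:= 1)). Qed.
Lemma hnS n : 256 * hn n.+1 = hn n.
by rewrite !hnE /rn (exprSr _ n);move: (2^-1 ^+ n) => x;rewrite (_ : (x / 2) ^+ 8 = x ^+ 8 * 2^-1 ^+ 8) ?exprMn// exprVn;field.
Qed.
Lemma rn_small (e : R) : 0 < e -> exists n0, forall n, (n0 <= n)%N -> rn n <= e.
move=> e0;have : rn n @[n --> \oo] --> (0 : R).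
 by apply: (@geo_cvg0 R 1) => n;rewrite mul1r ger0_norm// ltW// rn_gt0.
move=> /cvgrPdist_le/(_ _ e0)[n0 _ h];exists n0 => n nn.
by have:= h n nn;rewrite sub0r normrN ger0_norm// ltW// rn_gt0.
Qed.

Lemma nUS n j u : nU n j.+1 u = stepP (rn n) (hn n) (nU n j u). by []. Qed.
Lemma HP_nU k n j u : HP k.+1 u -> HP k.+1 (nU n j u).
by move=> hu;elim: j => [//|j IH];exact: HP_stepP (rn_gt0 n) _ _ _ IH. Qed.

Lemma step_time (T : R) n j : j.+1%:R * hn n <= T -> j%:R * hn n <= T.
by apply: leT;apply: ler_wpM2r;[exact: ltW (hn_gt0 n)|rewrite ler_nat].
Qed.

(** A bootstrap: as long as the time is at most T, the accumulated factor (1 + h)^j is at most exp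
    T, so the mass stays below K, and this is the assumption under which the next step is
    controlled. *)
Lemma nU_mass_energy n u (T N : R) : 0 <= T -> HP 1 u ->
 mass (u.1 0%N) (u.2 0%N) <= N -> let K:= expR T * N in rn n * (1 + 2 * K) <= 1 ->
 forall j, j%:R * hn n <= T ->
  mass ((nU n j u).1 0%N) ((nU n j u).2 0%N) <= K /\
  energy (rn n) ((nU n j u).1 0%N) ((nU n j u).2 0%N) <= energy (rn n) (u.1 0%N) (u.2 0%N) + T * K.
move=> T0 hu uN K rK;have h0:= ltW (hn_gt0 n).
have N0 : 0 <= N by apply: leT uN;exact: mass_ge0.
have K0 : 0 <= K by rewrite mulr_ge0// expR_ge0.
have key j : j%:R * hn n <= T ->
  mass ((nU n j u).1 0%N) ((nU n j u).2 0%N) <= (1 + hn n) ^+ j * N /\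
  energy (rn n) ((nU n j u).1 0%N) ((nU n j u).2 0%N) <= energy (rn n) (u.1 0%N) (u.2 0%N) + j%:R * hn n * K.
 have ex i : i%:R * hn n <= T -> (1 + hn n) ^+ i * N <= K.
  move=> iT;apply: ler_wpM2r => //.
  apply: leT (_ : expR (i%:R * hn n) <= _);last by rewrite ler_expR.
  rewrite expRM_natl;apply: lerXn2r;rewrite ?nnegrE ?expR_ge0//;first by lra.
  exact: expR_ge1Dx.
 elim: j => [_|j IH jT];first by rewrite expr0 mul1r !mul0r addr0.
 have jT':= step_time jT;have [m1 e1]:= IH jT'.
 have hj : HP 1 (nU n j u) by exact: HP_nU.
 have [lx ly]:= HP_l2 hj (leq0n 1).
 have [m2 e2]:= mass_growth (rn_gt0 n) (rn_le1 n) h0 (hnE n) lx ly K0 (leT m1 (ex j jT')) rK.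
 have [-> ->]:= stepP_level0 (rn_gt0 n) (hn n) hj.
 split.
  apply: leT m2 _;rewrite exprS -mulrA;apply: ler_wpM2l => //;lra.
 by apply: leT e2 _;rewrite -natr1;move: e1;lra.
move=> j jT;have [m e]:= key j jT;split.
 apply: leT m _;apply: ler_wpM2r => //.
 apply: leT (_ : expR (j%:R * hn n) <= _);last by rewrite ler_expR.
 rewrite expRM_natl;apply: lerXn2r;rewrite ?nnegrE ?expR_ge0//;first by lra.
 exact: expR_ge1Dx.
by apply: leT e _;rewrite lerD2l;exact: ler_wpM2r.
Qed.

(** The energy sees difference quotients, and the quotient of u is the derivative of its mean; hence
    the bound concerns the averaged iterate. That is the right quantity, as the nonlinearity acts on
    means. *)
Lemma nU_H1 (N T : R) : 0 <= T -> exists (B : R) n0, forall u n j, HP 1 u -> NP 1 u <= N ->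
 (n0 <= n)%N -> j%:R * hn n <= T -> NP 1 (SP (rn n) (nU n j u)) <= B.
move=> T0;pose K:= expR T * (N ^+ 2).
have K0 : 0 <= K by rewrite mulr_ge0 ?expR_ge0 ?sqr_ge0.
have p0 : 0 < (1 + 2 * K)^-1 by rewrite invr_gt0;lra.
have [n0 hn0]:= rn_small p0.
(* Each of the two levels is bounded by one plus its square: hence 2, plus the bounds for the mass
   and for the kinetic energy. *)
exists (2 + K + (2 * (N ^+ 2 + T * K) + K ^+ 2 * (K + 1) ^+ 2)), n0 => u n j hu uN nn jT.
have rK : rn n * (1 + 2 * K) <= 1.
 by have:= hn0 n nn;rewrite -ler_pdivlMr ?mul1r//;lra.
have N0 : 0 <= N by apply: leT uN;exact: NP_ge0.
have npN i : (i <= 1)%N -> np i u ^+ 2 <= N ^+ 2.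
 move=> i1;rewrite ler_pXn2r ?nnegrE ?np_ge0//;apply: leT uN;exact: NP_np.
have mN : mass (u.1 0%N) (u.2 0%N) <= N ^+ 2 by have:= npN 0%N isT;rewrite /np hyp_sq.
have [m e]:= nU_mass_energy T0 hu mN rK jT.
have hj : HP 1 (nU n j u) by exact: HP_nU.
have [lx ly]:= HP_l2 hj (leq0n 1);have [lx0 ly0]:= HP_l2 hu (leq0n 1).
have E0 : energy (rn n) (u.1 0%N) (u.2 0%N) <= N ^+ 2.
 apply: leT (npN 1%N isT);rewrite /np hyp_sq /energy.
 have [[l1 q1] [l2 q2]]:= hu.
 have b1:= nrm_stek (rn_gt0 n) (l1 1%N isT);have b2:= nrm_stek (rn_gt0 n) (l2 1%N isT).
 rewrite (stek_of_prim (rn n) (q1 0%N isT)) in b1;rewrite (stek_of_prim (rn n) (q2 0%N isT)) in b2.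
 have c1 : nrm (dq (rn n) (u.1 0%N)) ^+ 2 <= nrm (u.1 1%N) ^+ 2 by rewrite ler_pXn2r ?nnegrE ?nrm_ge0.
 have c2 : nrm (dq (rn n) (u.2 0%N)) ^+ 2 <= nrm (u.2 1%N) ^+ 2 by rewrite ler_pXn2r ?nnegrE ?nrm_ge0.
 by have:= sqr_ge0 (nrm (dens (rn n) (u.1 0%N) (u.2 0%N)));move: c1 c2;clear;lra.
have c:= energy_coercive (rn_gt0 n) lx ly K0 m.
have root (x y : R) : x ^+ 2 <= y -> x <= 1 + y.
 move=> xy;have:= sqr_ge0 (x - 1);have:= sqr_ge0 x.
 by rewrite (_ : (x - 1) ^+ 2 = x ^+ 2 - 2 * x + 1);[move: xy;lra|ring].
rewrite /NP big_ord_recr big_ord1 /=.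
have n1 : np 0 (SP (rn n) (nU n j u)) ^+ 2 <= K.
 have q1:= nrm_stek (rn_gt0 n) lx;have q2:= nrm_stek (rn_gt0 n) ly.
 by apply: leT m;rewrite /np hyp_sq /SP /mapc /=;apply: lerD;rewrite ler_pXn2r ?nnegrE ?nrm_ge0.
have n2 : np 1 (SP (rn n) (nU n j u)) ^+ 2 <= 2 * (N ^+ 2 + T * K) + K ^+ 2 * (K + 1) ^+ 2.
 rewrite /np hyp_sq /SP /mapc /=;have [[_ q1] [_ q2]]:= hj.
 rewrite (stek_of_prim (rn n) (q1 0%N isT)) (stek_of_prim (rn n) (q2 0%N isT)).
 rewrite -/K in e;apply: leT c _;move: e E0;clear -K;move: (energy _ _ _) (energy _ _ _) K => e1 e2 K;lra.
by have:= root _ _ n1;have:= root _ _ n2;lra.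
Qed.

(** At order one the cubic term is a bounded source, by the H1 bound on the means. At higher orders
    the tame estimate makes it linear in the top norm, with a coefficient bounded at the preceding
    order, and the discrete Gronwall inequality closes. *)
Lemma nU_bnd k (N T : R) : 0 <= T -> exists (B : R) n0, forall u n j, HP k.+1 u -> NP k.+1 u <= N ->
 (n0 <= n)%N -> j%:R * hn n <= T -> NP k.+1 (nU n j u) <= B.
move=> T0;elim: k => [|k [B [n0 IH]]].
 have [B [n0 IH]]:= nU_H1 N T0.
 pose D:= 6 * algc 0 ^+ 2 * B ^+ 3.
 exists (expR (1 * T) * (N + T * D)), n0 => u n j hu uN nn jT.
 have h0:= ltW (hn_gt0 n).
 have B0 : 0 <= B by apply: leT (IH u n j hu uN nn jT);exact: NP_ge0.
 have D0 : 0 <= D by rewrite mulr_ge0 ?exprn_ge0// mulr_ge0// exprn_ge0// algc_ge0.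
 have N0 : 0 <= N by apply: leT uN;exact: NP_ge0.
 have:= @discrete_gronwall R (fun i => NP 1 (nU n i u)) (hn n) 1 D j h0 ler01 D0 _ (NP_ge0 _ _) j (leqnn j).
 rewrite [hn n * j%:R]mulrC => h.
 apply: leT (h _) _ => [i ij|].
  have iT : i%:R * hn n <= T.
   by apply: leT jT;apply: ler_wpM2r => //;rewrite ler_nat ltnW.
  have hi : HP 1 (nU n i u) by exact: HP_nU.
  have:= NP_stepP (rn_gt0 n) h0 (hn_le_pow n (i:= 4) isT) hi.
  have:= NP_cubN (HP_SP (rn_gt0 n) hi) (IH u n i hu uN nn iT).
  rewrite mulr1 => b1 b2;apply: leT b2 _;rewrite lerD2l;exact: ler_wpM2l.
 apply: ler_pM;rewrite ?expR_ge0//;first by rewrite addr_ge0 ?NP_ge0// mulr_ge0// mulr_ge0.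
  by rewrite ler_expR !mul1r.
 by apply: lerD => //;exact: ler_wpM2r.
pose D:= 6 * algc k.+1 ^+ 2 * B ^+ 2.
exists (expR ((1 + D) * T) * N), n0 => u n j hu uN nn jT.
have h0:= ltW (hn_gt0 n).
have hu1 : HP k.+1 u by apply: HP_le hu;lia.
have uN1 : NP k.+1 u <= N by apply: leT (NP_le u _) uN;lia.
have D0 : 0 <= D by rewrite mulr_ge0 ?exprn_even_ge0// mulr_ge0// exprn_ge0// algc_ge0.
have:= @discrete_gronwall R (fun i => NP k.+2 (nU n i u)) (hn n) (1 + D) 0 j h0 _ (lexx 0) _ (NP_ge0 _ _) j (leqnn j).
rewrite [hn n * j%:R]mulrC !mulr0 !addr0 => h.
apply: leT (h _ _) _ => [|i ij|];first by lra.
 have iT : i%:R * hn n <= T.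
  by apply: leT jT;apply: ler_wpM2r => //;rewrite ler_nat ltnW.
 have hi : HP k.+2 (nU n i u) by exact: HP_nU.
 have hS:= HP_SP (rn_gt0 n) hi.
 have b2:= NP_stepP (rn_gt0 n) h0 (hn_le_pow n (i:= 4) isT) hi.
 have b1:= NP_cubN_tame hS.
 have b3 : NP k.+1 (SP (rn n) (nU n i u)) <= B.
  have hi1 : HP k.+1 (nU n i u) by apply: HP_le hi.
  have q:= NP_SP (rn_gt0 n) hi1;exact: leT q (IH u n i hu1 uN1 nn iT).
 have b4:= NP_SP (rn_gt0 n) hi.
 have b5 : NP k.+2 (cubN (SP (rn n) (nU n i u))) <= D * NP k.+2 (nU n i u).
  apply: leT b1 _;rewrite /D -[leRHS]mulrA;apply: ler_wpM2l;first by rewrite mulr_ge0// exprn_ge0// algc_ge0.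
  apply: ler_pM;rewrite ?exprn_ge0 ?NP_ge0//.
  by rewrite ler_pXn2r ?nnegrE ?NP_ge0// (leT _ b3)// NP_ge0.
 have b6:= ler_wpM2l h0 b5;rewrite addr0.
 by apply: leT b2 _;apply: leT (lerD (lexx _) b6) _;apply: eqW;ring.
apply: ler_pM;rewrite ?expR_ge0 ?NP_ge0//.
by rewrite ler_expR;apply: ler_wpM2l => //;lra.
Qed.

Lemma nU_lip k (N T : R) : 0 <= T -> exists (L : R) n0, forall u v n j, HP k.+1 u -> HP k.+1 v ->
 NP k.+1 u <= N -> NP k.+1 v <= N ->
 (n0 <= n)%N -> j%:R * hn n <= T -> NP k.+1 (nU n j u - nU n j v) <= L * NP k.+1 (u - v).
move=> T0;have [B [n0 bd]]:= nU_bnd k N T0.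
pose c:= 1 + 6 * algc k ^+ 2 * B ^+ 2.
have c0 : 0 <= c by rewrite addr_ge0// mulr_ge0 ?sqr_ge0// mulr_ge0// sqr_ge0.
exists (expR (c * T)), n0 => u v n j hu hv uN vN nn jT;have h0:= ltW (hn_gt0 n).
have:= @discrete_gronwall R (fun i => NP k.+1 (nU n i u - nU n i v)) (hn n) c 0 j h0 c0 (lexx 0) _ (NP_ge0 _ _) j (leqnn j).
rewrite [hn n * j%:R]mulrC !mulr0 !addr0 => h.
apply: leT (h _) _ => [i ij|].
 have iT : i%:R * hn n <= T.
  by apply: leT jT;apply: ler_wpM2r => //;rewrite ler_nat ltnW.
 rewrite addr0;apply: (NP_stepP_lip (rn_gt0 n) h0 (hn_le_pow n (i:= 4) isT));try exact: HP_nU;exact: bd.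
by apply: ler_wpM2r;[exact: NP_ge0|rewrite ler_expR;exact: ler_wpM2l].
Qed.

End Scheme.

(** * Comparison of consecutive schemes *)

Section Refinement.
Variable R : realType.
Import WholeLine.
Local Notation fn:= (R -> R).
Local Notation chain:= (nat -> R -> R).
Local Notation V:= (chain * chain)%type.
Local Notation algc:= (@algc R).
Local Notation rn:= (@rn R).
Local Notation hn:= (@hn R).
Implicit Types (u v w : V) (k n i j : nat).

Lemma NP_Fr_crude (r : R) k u (M : R) : 0 < r -> HP k.+1 u -> NP k.+1 u <= M ->
 NP k.+1 (Fr r u) <= r^-1 ^+ 2 * M + 6 * algc k ^+ 2 * M ^+ 3.
move=> r0 hu uM;have hS:= HP_SP r0 hu;have hc:= HP_cubN hS.
have ri0 : 0 <= r^-1 by rewrite invr_ge0 ltW.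
rewrite /Fr NP_JP;apply: leT (NPD (HP_DDP r hu) (HP_SP r0 hc)) _.
apply: lerD.
 apply: leT (ler_wpM2l (exprn_ge0 2 ri0) uM).
 rewrite /NP mulr_sumr;apply: ler_sum => j _.
 have [la lb]:= HP_l2 hu (ltn_ord j : (j <= k.+1)%N).
 have aux f : l2 f -> nrm (dq r (dq r f)) <= r^-1 ^+ 2 * nrm f.
  move=> lf;apply: leT (nrm_dq r0 (l2_dq r lf)) _;rewrite expr2 -mulrA.
  by apply: ler_wpM2l => //;exact: nrm_dq.
 rewrite /np -[X in X * hyp _ _]ger0_norm ?exprn_ge0// -hypZ.
 by apply: hyp_mono;rewrite ?nrm_ge0//;exact: aux.
have q1:= NP_SP r0 hc;have q2:= NP_cubN hS (leT (NP_SP r0 hu) uM).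
exact: leT q1 q2.
Qed.

Lemma defect_split (s z f g : V) (h : R) : s - (z + h *: g) = (s - (z + h *: f)) + h *: (f - g).
by rewrite scalerBr !opprD !addrA;congr (_ - _);rewrite -!addrA addNr addr0. Qed.
Lemma le_div256 i : (i %/ 256 * 256 <= i)%N. exact: leq_trunc_div. Qed.
Lemma mod256 i : (i %% 256 <= 256)%N. by apply/ltnW/ltn_pmod. Qed.
Lemma div256S i : (i.+1 %/ 256 = i %/ 256 /\ i.+1 %% 256 = (i %% 256).+1)%N \/
 (i.+1 %/ 256 = (i %/ 256).+1 /\ i.+1 %% 256 = 0 /\ i %% 256 = 255)%N.
lia. Qed.

(** The fine scheme is compared with the piecewise linear interpolation [z] of the coarse one. Along
    [z] a fine step has a defect of size h r: both regularised fields are O(r)-close to the true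
    field, and [z] stays O(r)-close to the coarse node. Stability of the fine scheme sums the
    defects. *)
Lemma scheme_compare k (N T : R) : 0 <= T -> exists (C : R) n0, forall u n i, HP k.+4 u -> NP k.+4 u <= N ->
 (n0 <= n)%N -> i%:R * hn n.+1 <= T -> NP k.+1 (nU n.+1 i u - nU n (i %/ 256) u) <= C * rn n.
have k14 : (k.+1 <= k.+4)%N by lia.
have k34 : (k.+3 <= k.+4)%N by lia.
have k24 : (k.+2 <= k.+4)%N by lia.
move=> T0;have [B [n0 bd]]:= nU_bnd k.+3 N T0.
(* r [C1] bounds a coarse step times the regularised field, [M] the fine iterates and the
   interpolation, and r [C3] the defect: two consistency errors [D] and a Lipschitz error of the
   field. *)
pose C1:= B + 6 * algc k.+3 ^+ 2 * B ^+ 3;pose M:= B + C1.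
pose D:= 4 * M + 24 * algc k.+1 ^+ 2 * M ^+ 3.
pose C3:= D + (1 + 6 * algc k.+1 ^+ 2 * M ^+ 2) * C1 + D.
pose c:= 1 + 6 * algc k ^+ 2 * M ^+ 2.
exists (expR (c * T) * (T * C3) + C1), n0 => u n i hu uN nn iT.
have h0:= ltW (hn_gt0 R n);have h'0:= ltW (hn_gt0 R n.+1).
have r0:= rn_gt0 R n;have r'0:= rn_gt0 R n.+1;have rr:= ltW r0.
have r' : rn n.+1 <= rn n by rewrite /rn exprS;have:= r0;rewrite /rn;move: (2^-1 ^+ n) => x;lra.
have hh:= hnS R n.
have tdiv i' : i'%:R * hn n.+1 <= T -> (i' %/ 256)%:R * hn n <= T.
 apply: leT;rewrite -hh mulrA -natrM;apply: (ler_wpM2r h'0).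
 by rewrite ler_nat le_div256.
pose b j:= nU n j u;pose F j:= Fr (rn n) (b j).
have hb j : HP k.+4 (b j) by exact: HP_nU.
have hF j : HP k.+4 (F j) by apply: HP_Fr.
have B0 : 0 <= B.
 by apply: leT (bd u n 0%N hu uN nn _);rewrite ?NP_ge0// mul0r.
have B30 : 0 <= 6 * algc k.+3 ^+ 2 * B ^+ 3.
 by rewrite mulr_ge0 ?exprn_ge0// mulr_ge0// exprn_ge0// algc_ge0.
have C10 : 0 <= C1 by exact: addr_ge0.
have M0 : 0 <= M by exact: addr_ge0.
have BM : B <= M by rewrite lerDl.
have D0 : 0 <= D.
 apply: addr_ge0;first exact: mulr_ge0.
 by rewrite mulr_ge0 ?exprn_ge0// mulr_ge0// exprn_ge0// algc_ge0.
have c0 : 0 <= c.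
 by rewrite addr_ge0// mulr_ge0 ?exprn_ge0// mulr_ge0// exprn_ge0// algc_ge0.
have L0 : 0 <= 1 + 6 * algc k.+1 ^+ 2 * M ^+ 2.
 by rewrite addr_ge0// mulr_ge0 ?exprn_ge0// mulr_ge0// exprn_ge0// algc_ge0.
have C30 : 0 <= C3 by rewrite /C3;apply: addr_ge0 => //;apply: addr_ge0 => //;exact: mulr_ge0.
have bB j : j%:R * hn n <= T -> NP k.+4 (b j) <= B by exact: bd.
have FB j : j%:R * hn n <= T -> hn n * NP k.+4 (F j) <= rn n * C1.
 move=> jT;apply: leT (ler_wpM2l h0 (NP_Fr_crude r0 (hb j) (bB j jT))) _.
 rewrite mulrDr /C1 [leRHS]mulrDr;apply: lerD;last by apply: ler_wpM2r => //;exact: hn_le_rn.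
 rewrite mulrA;apply: ler_wpM2r => //.
 have -> : hn n * (rn n)^-1 ^+ 2 = rn n ^+ 6 by rewrite hnE exprVn;field;rewrite gt_eqF.
 by rewrite -[leRHS]expr1;apply: ler_wiXn2l => //;exact: rn_le1.
pose z i':= b (i' %/ 256)%N + ((i' %% 256)%:R * hn n.+1) *: F (i' %/ 256)%N.
have hz i' : HP k.+4 (z i') by apply: HPD => //;exact: HPZ.
have zb i' : i'%:R * hn n.+1 <= T -> NP k.+4 (z i' - b (i' %/ 256)%N) <= rn n * C1.
 move=> i'T;rewrite /z addrAC subrr add0r (NPZ _ (hF _)) ger0_norm ?mulr_ge0//.
 apply: leT (FB _ (tdiv _ i'T));apply: ler_wpM2r;first exact: NP_ge0.
 rewrite -hh;apply: (ler_wpM2r h'0);by rewrite (ler_nat R _ 256) mod256.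
have zM i' : i'%:R * hn n.+1 <= T -> NP k.+4 (z i') <= M.
 move=> i'T;have -> : z i' = b (i' %/ 256)%N + (z i' - b (i' %/ 256)%N) by rewrite addrC subrK.
 apply: leT (NPD (hb _) (HPB (hz _) (hb _))) _.
 apply: lerD;first exact: bB (tdiv _ i'T).
 apply: leT (zb i' i'T) _;rewrite -[leRHS]mul1r;apply: ler_wpM2r => //;exact: rn_le1.
have zS i' : z i'.+1 = z i' + hn n.+1 *: F (i' %/ 256)%N.
 rewrite /z -addrA -scalerDl.
 have -> : (i' %% 256)%:R * hn n.+1 + hn n.+1 = (i' %% 256).+1%:R * hn n.+1 by rewrite -natr1 mulrDl mul1r.
 (* At the end of a block of 256 fine steps the interpolation reaches the next coarse node. *)
 have [e|e]:= div256S i';first by case: e => -> ->.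
 case: e => -> [-> ->];rewrite mul0r scale0r addr0 /b nUS /stepP -/(b _) -/(F _).
 by congr (_ + _ *: _);rewrite -hh.
have L k1 k2 (x : V) : (k1 <= k2)%N -> HP k2 x -> HP k1 x by exact: HP_le.
have key:= @discrete_gronwall R (fun i' => NP k.+1 (nU n.+1 i' u - z i')) (hn n.+1) c (rn n * C3) i h'0 c0
 (mulr_ge0 rr C30) _ (NP_ge0 _ _) i (leqnn i).
have e0 : NP k.+1 (nU n.+1 0 u - z 0%N) = 0.
 by rewrite /z div0n mod0n mul0r scale0r addr0 subrr NP0.
rewrite e0 add0r [hn n.+1 * i%:R]mulrC in key.
have e1 : NP k.+1 (nU n.+1 i u - z i) <= expR (c * T) * (T * C3) * rn n.
 apply: leT (key _) _ => [i' i'i|].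
  have i'T : i'%:R * hn n.+1 <= T.
   by apply: leT iT;apply: ler_wpM2r => //;rewrite ler_nat ltnW.
  have hv : HP k.+4 (nU n.+1 i' u) by exact: HP_nU.
  have vB : NP k.+4 (nU n.+1 i' u) <= M.
   by apply: leT BM;apply: bd => //;exact: leqW.
  have hv1 : HP k.+1 (nU n.+1 i' u):= L _ _ _ k14 hv.
  have hz1 : HP k.+1 (z i'):= L _ _ _ k14 (hz i').
  have hz3 : HP k.+3 (z i'):= L _ _ _ k34 (hz i').
  have hb3 : HP k.+3 (b (i' %/ 256)%N):= L _ _ _ k34 (hb _).
  have hF1 : HP k.+1 (F (i' %/ 256)%N):= L _ _ _ k14 (hF _).
  have hFz : HP k.+1 (Fr (rn n.+1) (z i')) by exact: HP_Fr.
  have hsv : HP k.+1 (stepP (rn n.+1) (hn n.+1) (nU n.+1 i' u)) by exact: HP_stepP.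
  have hsz : HP k.+1 (stepP (rn n.+1) (hn n.+1) (z i')) by exact: HP_stepP.
  have vM1 : NP k.+1 (nU n.+1 i' u) <= M:= leT (NP_le _ k14) vB.
  have zM1 : NP k.+1 (z i') <= M:= leT (NP_le _ k14) (zM i' i'T).
  have -> : nU n.+1 i'.+1 u - z i'.+1 =
   (stepP (rn n.+1) (hn n.+1) (nU n.+1 i' u) - stepP (rn n.+1) (hn n.+1) (z i')) +
    hn n.+1 *: (Fr (rn n.+1) (z i') - F (i' %/ 256)%N).
   by rewrite nUS zS;exact: defect_split.
  apply: leT (NPD (HPB hsv hsz) (HPZ _ (HPB hFz hF1))) _.
  rewrite (NPZ _ (HPB hFz hF1)) ger0_norm//;apply: lerD.
   exact: (NP_stepP_lip r'0 h'0 (hn_le_pow R n.+1 (i:= 4) isT) hv1 hz1 vM1 zM1).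
  apply: ler_wpM2l => //.
  have bT:= tdiv _ i'T.
  have bM4 : NP k.+4 (b (i' %/ 256)%N) <= M:= leT (bB _ bT) BM.
  have hfz : HP k.+1 (field (z i')) by exact: HP_field.
  have hfb : HP k.+1 (field (b (i' %/ 256)%N)) by exact: HP_field.
  have a1:= NP_Fr_close r'0 (hz i') (zM i' i'T).
  have a2:= NP_Fr_close r0 (hb _) bM4.
  have bM2 : NP k.+2 (b (i' %/ 256)%N) <= M:= leT (NP_le _ k24) bM4.
  have zM2 : NP k.+2 (z i') <= M:= leT (NP_le _ k24) (zM i' i'T).
  have a3:= NP_field_lip hz3 hb3 zM2 bM2.
  have a4 : NP k.+3 (z i' - b (i' %/ 256)%N) <= rn n * C1.
   exact: leT (NP_le _ k34) (zb i' i'T).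
  apply: leT (NP_dist hFz hfz hF1) _.
  have q:= NP_dist hfz hfb hF1;rewrite (NP_distC _ (field (b _))) in q.
  have a5:= ler_wpM2l L0 a4;have a6:= ler_wpM2r D0 r'.
  rewrite -/D in a1;rewrite -/D -/(F _) in a2.
  apply: leT (lerD (leT a1 a6) (leT q (lerD (leT a3 a5) a2))) _.
  by rewrite /C3 le_eqVlt;apply/orP;left;apply/eqP;ring.
 rewrite -[leRHS]mulrA;apply: ler_pM;rewrite ?expR_ge0//;first by rewrite !mulr_ge0.
  by rewrite ler_expR;exact: ler_wpM2l.
 by rewrite -[leRHS]mulrA [C3 * _]mulrC;apply: ler_wpM2r => //;exact: mulr_ge0.
have hv1 : HP k.+1 (nU n.+1 i u) by apply: HP_nU;exact: L _ _ _ k14 hu.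
have hz1 : HP k.+1 (z i):= L _ _ _ k14 (hz i).
have hb1 : HP k.+1 (b (i %/ 256)%N):= L _ _ _ k14 (hb _).
apply: leT (NP_dist hv1 hz1 hb1) _;rewrite mulrDl;apply: lerD => //.
apply: leT (NP_le _ k14) (leT (zb i iT) _).
by rewrite mulrC.
Qed.

(** A discrete mean value inequality: if all the fields used lie within B of G, so does their
    average. *)
Lemma nU_increment (k n j l : nat) u (G : V) (B : R) : HP k u -> HP k G -> (forall i, HP k (nU n i u)) ->
 (forall i, HP k (Fr (rn n) (nU n i u))) ->
 (forall i, (j <= i < j + l)%N -> NP k (Fr (rn n) (nU n i u) - G) <= B) ->
 NP k (nU n (j + l) u - nU n j u - (l%:R * hn n) *: G) <= l%:R * hn n * B.
move=> hu hG hb hF;have h0:= ltW (hn_gt0 R n).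
elim: l => [_|l IH hB];first by rewrite addn0 subrr mul0r scale0r subrr NP0 mul0r.
have h1:= IH (fun i ij => hB i ltac:(lia)).
have h2:= hB (j + l)%N ltac:(lia).
rewrite addnS nUS {1}/stepP.
have -> : nU n (j + l) u + hn n *: Fr (rn n) (nU n (j + l) u) - nU n j u - (l.+1%:R * hn n) *: G =
  (nU n (j + l) u - nU n j u - (l%:R * hn n) *: G) + hn n *: (Fr (rn n) (nU n (j + l) u) - G).
 rewrite -natr1 mulrDl mul1r scalerDl scalerBr opprD !addrA;congr (_ - _).
 by rewrite -!addrA;congr (_ + _);rewrite addrC -!addrA;congr (_ + _).
have hx : HP k (nU n (j + l) u - nU n j u - (l%:R * hn n) *: G).
 by apply: HPB;[exact: HPB|exact: HPZ].
have hy : HP k (Fr (rn n) (nU n (j + l) u) - G) by exact: HPB.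
apply: leT (NPD hx (HPZ _ hy)) _;rewrite (NPZ _ hy) ger0_norm//.
have:= ler_wpM2l h0 h2;rewrite -natr1 !mulrDl mul1r;exact: lerD.
Qed.

Definition idx n (t : R) : nat:= Num.truncn (t / hn n).

Lemma idx_itv n (t : R) : 0 <= t -> (idx n t)%:R * hn n <= t < (idx n t).+1%:R * hn n.
move=> t0;have h0:= hn_gt0 R n.
have : 0 <= t / hn n by rewrite divr_ge0// ltW.
by move=> /truncn_itv/andP[a b];rewrite -ler_pdivlMr// -ltr_pdivrMr//;apply/andP.
Qed.

Lemma idx_unique n j (t : R) : 0 <= t -> j%:R * hn n <= t < j.+1%:R * hn n -> idx n t = j.
move=> t0 /andP[a b];have /andP[c d]:= idx_itv n t0;have h0:= hn_gt0 R n.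
have:= le_lt_trans a d;have:= le_lt_trans c b;rewrite !ltr_pM2r// !ltr_nat;lia.
Qed.

Lemma idxS n (t : R) : 0 <= t -> (idx n.+1 t %/ 256)%N = idx n t.
move=> t0;apply/esym/idx_unique => //;have /andP[a b]:= idx_itv n.+1 t0.
have h0:= ltW (hn_gt0 R n.+1);rewrite -hnS;move: (hn n.+1) h0 a b => y h0 a b;rewrite !mulrA -!natrM;apply/andP;split.
 by apply: leT a;apply: ler_wpM2r => //;rewrite ler_nat;lia.
by apply: lt_le_trans b _;apply: ler_wpM2r => //;rewrite ler_nat;lia.
Qed.

Lemma idx_mono n (t t' : R) : 0 <= t -> t <= t' -> (idx n t <= idx n t')%N.
move=> t0 tt;have /andP[a b]:= idx_itv n t0;have /andP[c d]:= idx_itv n (leT t0 tt).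
have:= le_lt_trans (leT a tt) d;rewrite ltr_pM2r ?hn_gt0// ltr_nat;lia.
Qed.

(** Every step between two times is the current step at some intermediate time, so an estimate for
    the step function at all times is one for all iterates. *)
Lemma idx_cover n (t t' : R) j : 0 <= t -> t <= t' -> (idx n t <= j <= idx n t')%N ->
 exists tau, [/\ t <= tau, tau <= t' & idx n tau = j].
move=> t0 tt /andP[lj jl];have /andP[a b]:= idx_itv n t0;have h0:= hn_gt0 R n.
have /andP[c d]:= idx_itv n (leT t0 tt).
case: (eqVneq j (idx n t)) => [->|ne];first by exists t;split.
have tj : t < j%:R * hn n.
 apply: lt_le_trans b _;apply: ler_wpM2r;first exact: ltW.
 by rewrite ler_nat;lia.
exists (j%:R * hn n);split;first exact: ltW.
 by apply: leT c;apply: ler_wpM2r;[exact: ltW|rewrite ler_nat].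
apply: idx_unique;first by rewrite mulr_ge0// ltW.
by rewrite lexx ltr_pM2r// ltr_nat /=.
Qed.

Lemma idx_diff n (t t' : R) : 0 <= t -> t <= t' ->
 `|(idx n t' - idx n t)%:R * hn n - (t' - t)| <= hn n.
move=> t0 tt;have /andP[a b]:= idx_itv n t0;have /andP[c d]:= idx_itv n (leT t0 tt).
rewrite natrB ?idx_mono// mulrBl ler_norml.
move: a b c d;rewrite -!natr1 !mulrDl !mul1r;lra.
Qed.

End Refinement.

(** * Passage to the limit in the flow *)

Section FlowLimits.
Variable R : realType.
Import WholeLine.
Local Notation fn:= (R -> R).
Local Notation chain:= (nat -> R -> R).
Local Notation V:= (chain * chain)%type.
Local Notation algc:= (@algc R).
Local Notation rn:= (@rn R).
Local Notation hn:= (@hn R).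
Implicit Types (T C e t tau d B M : R) (w G : V) (k n i j : nat) (u : R -> V) (X : nat -> R -> V).

Lemma sub_split (Z : zmodType) (p q x y z : Z) : p - q - z = (x - y - z) + ((p - x) - (q - y)).
by rewrite -{1}(subrK x p) -{1}(subrK y q) opprD addrACA -[LHS]addrA [LHS]addrC. Qed.

(** Removes a slack e K. The restriction e <= 1 allows terms quadratic in e to be absorbed into
    K. *)
Lemma le_eps (x y K : R) : 0 <= K -> (forall e, 0 < e -> e <= 1 -> x <= y + e * K) -> x <= y.
move=> K0 h;apply/ler_addgt0Pr => e e0.
pose d:= Num.min 1 (e / (K + 1)).
have K1 : 0 < K + 1 by lra.
have d0 : 0 < d by rewrite lt_min ltr01 divr_gt0.
have d1 : d <= 1 by rewrite ge_min lexx.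
apply: leT (h d d0 d1) _;rewrite lerD2l.
have de : d * (K + 1) <= e by rewrite -ler_pdivlMr// ge_min lexx orbT.
by apply: leT de;apply: ler_wpM2l;[exact: ltW|lra].
Qed.

Lemma HP_complete k (F : nat -> V) (C : R) : (forall n, HP k (F n)) ->
 (forall n, NP k (F n.+1 - F n) <= C * rn n) ->
 exists2 w, HP k w & forall n, NP k (F n - w) <= 2 * (k.+1%:R * (2 * C)) * rn n.
move=> hF h.
have [c1 h1 q1]:= isH_complete (fun n => (hF n).1) (fun n => leT (NH_NP1 k (F n.+1 - F n)) (h n)).
have [c2 h2 q2]:= isH_complete (fun n => (hF n).2) (fun n => leT (NH_NP2 k (F n.+1 - F n)) (h n)).
exists (c1, c2) => // n;apply: leT (NP_NH _ _) _.
by have:= q1 n;have:= q2 n;rewrite /rn /=;lra.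
Qed.

Definition unif k X u:= forall T e, 0 < e -> exists n0, forall n t, (n0 <= n)%N ->
 0 <= t -> t <= T -> NP k (X n t - u t) <= e.

Lemma unif_complete k X : (forall n t, 0 <= t -> HP k (X n t)) ->
 (forall T, exists C n0, forall n t, (n0 <= n)%N -> 0 <= t -> t <= T -> NP k (X n.+1 t - X n t) <= C * rn n) ->
 exists2 u, (forall t, 0 <= t -> HP k (u t)) & unif k X u.
move=> hX cX.
have loc T : exists C n0, forall t, 0 <= t -> t <= T -> exists2 w, HP k w &
  forall n, (n0 <= n)%N -> NP k (X n t - w) <= C * rn n.
 have [C [n0 h]]:= cX T;exists (2 * (k.+1%:R * (2 * `|C|)) / rn n0), n0 => t t0 tT.
 have hF n : HP k (X (n0 + n)%N t) by exact: hX.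
 have [|w hw q]:= HP_complete hF (C:= `|C|).
  move=> n;rewrite addnS;apply: leT (h _ t _ t0 tT) _;first exact: leq_addr.
  apply: leT (ler_wpM2r (ltW (rn_gt0 R _)) (ler_norm C)) _;apply: ler_wpM2l => //.
  by rewrite /rn;apply: ler_wiXn2l;rewrite ?invr_ge0 ?invf_le1 ?ler1n// leq_addl.
 exists w => // n nn;have:= q (n - n0)%N;rewrite subnKC// => /leT;apply.
 rewrite -[leRHS]mulrA;apply: ler_wpM2l;first by rewrite !mulr_ge0.
 by rewrite ler_pdivlMl ?rn_gt0// /rn -exprD subnKC.
have /choice[u hu] : forall t, exists w, 0 <= t -> HP k w /\ exists C n0, forall n, (n0 <= n)%N -> NP k (X n t - w) <= C * rn n.
 move=> t;have [t0|]:= boolP (0 <= t);last by exists 0.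
 have [C [n0 h]]:= loc t;have [w hw q]:= h t t0 (lexx t).
 by exists w => _;split => //;exists C, n0.
exists u => [t t0|T e e0];first by case: (hu t t0).
have [C [n0 h]]:= loc T.
have e2 : 0 < e / (2 * (`|C| + 1)) by rewrite divr_gt0// mulr_gt0// ltr_pwDr.
have [n1 hn1]:= rn_small e2.
exists (maxn n0 n1) => n t;rewrite geq_max => /andP[nn0 nn1] t0 tT.
have [w hw q]:= h t t0 tT;have [hut [C' [n2 q']]]:= hu t t0.
apply: (@le_eps _ _ (2 * `|C'| + `|C|));first by rewrite addr_ge0// mulr_ge0.
move=> d d0 d1;have [n3 hn3]:= rn_small d0.
(* The limit obtained on [0, T] and the chosen [u t] need not be equal as functions; they are
   compared in norm through a common late iterate. *)
pose m:= maxn n0 (maxn n2 n3).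
have a1:= q n nn0;have a2:= q m (leq_maxl _ _).
have a3:= q' m (leq_trans (leq_maxl _ _) (leq_maxr _ _)).
have rm:= hn3 m (leq_trans (leq_maxr _ _) (leq_maxr _ _)).
have hn':= hX n t t0;have hm:= hX m t t0.
have s1:= NP_dist hn' hw hut;have s2:= NP_dist hw hm hut;rewrite (NP_distC _ w (X m t)) in s2.
have b1 : C * rn n <= e.
 have r1:= hn1 n nn1;have r0:= ltW (rn_gt0 R n).
 apply: leT (ler_wpM2r r0 (ler_norm C)) _.
 have:= ler_wpM2l (normr_ge0 C) r1;move/leT;apply.
 rewrite mulrA ler_pdivrMr ?mulr_gt0 ?ltr_pwDr//.
 by have:= normr_ge0 C;have:= mulr_ge0 (normr_ge0 C) (ltW e0);lra.
have b2 x : x * rn m <= d * `|x|.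
 apply: leT (ler_wpM2r (ltW (rn_gt0 R m)) (ler_norm x)) _.
 by rewrite mulrC;exact: ler_wpM2r.
have:= b2 C;have:= b2 C';have:= mulr_ge0 (ltW d0) (normr_ge0 C');rewrite mulrDr.
move: a1 a2 a3 s1 s2 b1;clear;lra.
Qed.

Section OneLevel.
Variable k : nat.

Definition fbnd u:= forall T, exists M, forall t, 0 <= t -> t <= T -> NP k.+2 (u t) <= M.
Definition fcont u:= forall T e, 0 < e -> exists2 d, 0 < d & forall t t', 0 <= t -> t <= t' -> t' <= T ->
 t' - t <= d -> NP k.+2 (u t' - u t) <= e.
(** The evolution equation as a mean value inequality. It requires neither derivatives nor integrals
    of Banach space valued curves, passes to uniform limits, and with G = [field (u t)] returns the
    derivative at t. *)
Definition fode u:= forall t t' G B, 0 <= t -> t <= t' -> HP k G -> 0 <= B ->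
 (forall tau, t <= tau -> tau <= t' -> NP k (field (u tau) - G) <= B) ->
 NP k (u t' - u t - (t' - t) *: G) <= (t' - t) * B.
Definition nls u:= [/\ forall t, 0 <= t -> HP k.+2 (u t), fbnd u, fcont u & fode u].

(** Asymptotic versions for approximating curves. Bounds and moduli are asked of one late index,
    since uniform convergence transfers them; in [acont] the tolerance is fixed before the index, so
    that step functions with small jumps qualify. *)
Definition abnd X:= forall T N, exists2 n, (N <= n)%N & exists M, forall t, 0 <= t -> t <= T -> NP k.+2 (X n t) <= M.
Definition acont X:= forall T e N, 0 < e -> exists2 n, (N <= n)%N & exists2 d, 0 < d & forall t t', 0 <= t -> t <= t' -> t' <= T ->
 t' - t <= d -> NP k.+2 (X n t' - X n t) <= e.
Definition aode X:= forall T e, 0 < e -> exists n0, forall n t t' G B, (n0 <= n)%N -> 0 <= t -> t <= t' -> t' <= T ->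
 HP k G -> 0 <= B -> (forall tau, t <= tau -> tau <= t' -> NP k (field (X n tau) - G) <= B) ->
 NP k (X n t' - X n t - (t' - t) *: G) <= (t' - t) * B + e * (1 + B + NP k G).

Lemma flow_limit X u : (forall n t, 0 <= t -> HP k.+2 (X n t)) -> (forall t, 0 <= t -> HP k.+2 (u t)) ->
 unif k.+2 X u -> abnd X -> acont X -> aode X -> nls u.
move=> hX hu un ab ac ao.
have hX1 n t : 0 <= t -> HP k.+1 (X n t) by move=> t0;apply: HP_le (hX n t t0).
have hu1 t : 0 <= t -> HP k.+1 (u t) by move=> t0;apply: HP_le (hu t t0).
have k02 : (k <= k.+2)%N by lia.
have fb : fbnd u.
 move=> T;have [n0 h0]:= un T 1 ltr01;have [n nn [M hM]]:= ab T n0.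
 exists (1 + M) => t t0 tT.
 have:= h0 n t nn t0 tT;have:= hM t t0 tT;rewrite NP_distC.
 have:= NPD (HPB (hu t t0) (hX n t t0)) (hX n t t0);rewrite subrK;move=> a b c.
 apply: leT a _;exact: lerD.
split=> //.
 move=> T e e0;have e3 : 0 < e / 3 by rewrite divr_gt0.
 have [n0 h0]:= un T _ e3;have [n nn [d d0 hd]]:= ac T _ n0 e3.
 exists d => // t t' t0 tt tT td;have t'0:= leT t0 tt.
 have a1:= h0 n t nn t0 (leT tt tT);have a2:= h0 n t' nn t'0 tT;have a3:= hd t t' t0 tt tT td.
 have s1:= NP_dist (hu t' t'0) (hX n t' t'0) (hu t t0).
 have s2:= NP_dist (hX n t' t'0) (hX n t t0) (hu t t0).
 rewrite (NP_distC _ (u t') (X n t')) in s1;move: s1 s2 a1 a2 a3;clear;lra.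
move=> t t' G B t0 tt hG B0 h;have t'0:= leT t0 tt.
have [M hM]:= fb t'.
have M0 : 0 <= M by apply: leT (hM t t0 tt);exact: NP_ge0.
pose L:= 1 + 6 * algc k ^+ 2 * (M + 1) ^+ 2.
have L0 : 0 <= L by rewrite addr_ge0// mulr_ge0 ?sqr_ge0// mulr_ge0// sqr_ge0.
have tt0 : 0 <= t' - t by rewrite subr_ge0.
have G0:= NP_ge0 k G.
apply: (@le_eps _ _ ((t' - t) * L + (1 + B + L + NP k G) + 2)).
 apply: addr_ge0 => //;apply: addr_ge0;first exact: mulr_ge0.
 by apply: addr_ge0 => //;apply: addr_ge0 => //;exact: addr_ge0.
move=> e e0 e1;have [n1 h1]:= un t' e e0;have [n2 h2]:= ao t' e e0.
pose n:= maxn n1 n2.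
have nn1 : (n1 <= n)%N:= leq_maxl _ _;have nn2 : (n2 <= n)%N:= leq_maxr _ _.
(* Passing from the limit to the approximation enlarges the radius B by the Lipschitz constant of
   the field times the uniform distance. *)
have hB tau : t <= tau -> tau <= t' -> NP k (field (X n tau) - G) <= B + L * e.
 move=> ta tb;have tau0:= leT t0 ta.
 have q1:= h1 n tau nn1 tau0 tb.
 have k12 : (k.+1 <= k.+2)%N by [].
 have m1 : NP k.+1 (u tau) <= M:= leT (NP_le _ k12) (hM tau tau0 tb).
 have m2 : NP k.+1 (X n tau) <= M + 1.
  have:= NPD (HPB (hX1 n tau tau0) (hu1 tau tau0)) (hu1 tau tau0);rewrite subrK.
  have:= leT (NP_le (X n tau - u tau) k12) q1;move: m1 e1;clear;lra.
 have m1' : NP k.+1 (u tau) <= M + 1 by move: m1;clear;lra.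
 have q2:= NP_field_lip (hX n tau tau0) (hu tau tau0) m2 m1'.
 have q3:= NP_dist (HP_field (hX n tau tau0)) (HP_field (hu tau tau0)) hG.
 have q4:= h tau ta tb;have q5:= ler_wpM2l L0 q1.
 apply: leT q3 _;rewrite addrC;apply: lerD => //;exact: leT q2 q5.
have Le0 : 0 <= L * e by rewrite mulr_ge0// ltW.
have q:= h2 n t t' G _ nn2 t0 tt (lexx _) hG (addr_ge0 B0 Le0) hB.
have a1:= h1 n t nn1 t0 tt;have a2:= h1 n t' nn1 t'0 (lexx _).
have hk s : 0 <= s -> HP k (X n s) by move=> s0;exact: HP_le (hX n s s0).
have hk' s : 0 <= s -> HP k (u s) by move=> s0;exact: HP_le (hu s s0).
have e1' : u t' - u t - (t' - t) *: G = (X n t' - X n t - (t' - t) *: G) + ((u t' - X n t') - (u t - X n t)).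
 exact: sub_split.
rewrite e1'.
apply: leT (NPD (HPB (HPB (hk _ t'0) (hk _ t0)) (HPZ _ hG)) (HPB (HPB (hk' _ t'0) (hk _ t'0)) (HPB (hk' _ t0) (hk _ t0)))) _.
have b1:= NPB (HPB (hk' _ t'0) (hk _ t'0)) (HPB (hk' _ t0) (hk _ t0)).
rewrite (NP_distC _ (u t')) (NP_distC _ (u t)) in b1.
have b2:= leT (NP_le (X n t - u t) k02) a1;have b3:= leT (NP_le (X n t' - u t') k02) a2.
have c1 : e * (L * e) <= e * L.
 by apply: ler_wpM2l;[exact: ltW|rewrite -[leRHS]mulr1;exact: ler_wpM2l].
apply: leT (lerD q (leT b1 (lerD b3 b2))) _.
move: c1;clear;set x:= NP k G;set s:= t' - t;nra.
Qed.

End OneLevel.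

End FlowLimits.

(** * The step functions of the scheme and their limit *)

Section SchemeFlow.
Variable R : realType.
Import WholeLine.
Local Notation fn:= (R -> R).
Local Notation chain:= (nat -> R -> R).
Local Notation V:= (chain * chain)%type.
Local Notation algc:= (@algc R).
Local Notation rn:= (@rn R).
Local Notation hn:= (@hn R).
Implicit Types (T C e t tau d B M : R) (w G : V) (k n i j : nat) (u : R -> V) (X : nat -> R -> V).

Lemma scale_split (v g : V) (a b : R) : v - b *: g = v - a *: g + (a - b) *: g.
by rewrite scalerBl addrA subrK. Qed.

Definition evenP w:= forall s, w.1 0%N (- s) = w.1 0%N s /\ w.2 0%N (- s) = w.2 0%N s.

Lemma dq_parity (r : R) (f : fn) (b : bool) : (forall s, f (- s) = (-1) ^+ b * f s) ->
 forall s, dq r f (- s) = (-1) ^+ (~~ b) * dq r f s.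
move=> h s;rewrite dqE !fE /tr /=.
have -> : - s + r = - (s - r) by ring.
have -> : - s - r = - (s + r) by ring.
by rewrite !h;case: b {h} => /=;rewrite ?expr0 ?expr1;ring.
Qed.

Lemma dqdq_even (r : R) (f : fn) : (forall s, f (- s) = f s) -> forall s, dq r (dq r f) (- s) = dq r (dq r f) s.
move=> h s;have h0 s' : f (- s') = (-1) ^+ false * f s' by rewrite expr0 mul1r.
by have:= dq_parity r (dq_parity r h0) s;rewrite expr0 mul1r.
Qed.

Lemma evenP_step (r h : R) w : 0 < r -> HP 1 w -> evenP w -> evenP (stepP r h w).
move=> r0 hw ew;have [la lb]:= HP_l2 hw (leq0n 1).
have [e1 e2]:= stepP_level0 r0 h hw.
have ea s : w.1 0%N (- s) = w.1 0%N s by case: (ew s).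
have eb s : w.2 0%N (- s) = w.2 0%N s by case: (ew s).
have ed (f : fn) : l2 f -> (forall s, f (- s) = f s) -> forall s,
  stek r (dens r (w.1 0%N) (w.2 0%N) * stek r f) (- s) = stek r (dens r (w.1 0%N) (w.2 0%N) * stek r f) s.
 move=> lf ef;apply: stek_even => [|s].
  by apply: l2_dens_mul => //;exact: l2_stek.
 by rewrite !mulfE !densE !stek_even.
move=> s;rewrite e1 e2 stepLE stepRE gradLE gradRE !fE !dqdq_even// !ed//;split;by rewrite ?ea ?eb.
Qed.

Lemma evenP_nU n j w : HP 1 w -> evenP w -> evenP (nU n j w).
move=> hw ew;elim: j => [//|j IH];rewrite nUS;apply: evenP_step => //;first exact: rn_gt0.
exact: HP_nU.
Qed.

(** Point values are controlled by the H1 norm, so evenness survives approximation. *)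
Lemma evenP_closed w : HP 1 w -> (forall e, 0 < e -> exists x, [/\ HP 1 x, evenP x & NP 1 (x - w) <= e]) -> evenP w.
move=> hw h.
suff key (p : V -> chain) : (forall x y, p (x - y) = p x - p y) -> (forall x, HP 1 x -> isH 1 (p x)) ->
  (forall x, NH 1 (p x) <= NP 1 x) -> (forall x, evenP x -> forall s, p x 0%N (- s) = p x 0%N s) ->
  forall s, p w 0%N (- s) = p w 0%N s.
 move=> s;split.
  apply: (key (fun x => x.1)) => // [x [] //|x|x ex s'];[exact: NH_NP1|by case: (ex s')].
 apply: (key (fun x => x.2)) => // [x [] //|x|x ex s'];[exact: NH_NP2|by case: (ex s')].
move=> pB pH pN pe s;apply/eqP;rewrite -subr_eq0 -normr_le0;apply: (@le_eps _ _ _ 2) => // e e0 _.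
rewrite add0r;have [x [hx ex xe]]:= h e e0.
have hd : isH 1 (p (x - w)) by apply: pH;exact: HPB.
have b y : `|p x 0%N y - p w 0%N y| <= e.
 have -> : p x 0%N y - p w 0%N y = p (x - w) 0%N y by rewrite pB.
 exact: leT (isH_sup (x:= y) hd (ltn0Sn 0) I) (leT (pN _) xe).
have:= b s;have:= b (- s);rewrite (pe _ ex) !ler_norml => /andP[a1 a2] /andP[a3 a4].
by apply/andP;split;move: a1 a2 a3 a4;clear;lra.
Qed.

Definition sU n t w : V:= nU n (idx n t) w.

Lemma HP_sU k n t w : HP k.+1 w -> HP k.+1 (sU n t w). exact: HP_nU. Qed.

Lemma idx_time n t T : 0 <= t -> t <= T -> (idx n t)%:R * hn n <= T.
by move=> t0;have /andP[a _]:= idx_itv n t0;exact: leT. Qed.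

Section OneData.
Variables (k : nat) (w : V).
Hypothesis hw : HP k.+4.+1 w.
Local Notation X:= (fun n t => sU n t w).

Let hw2 : HP k.+2 w. by apply: HP_le hw;lia. Qed.
Let hX5 n t : HP k.+4.+1 (X n t). exact: HP_sU. Qed.
Let hX n t : HP k.+2 (X n t). exact: HP_sU. Qed.
Let k25 : (k.+2 <= k.+4.+1)%N. by lia. Qed.
Let k45 : (k.+4 <= k.+4.+1)%N. by lia. Qed.
Let k35 : (k.+3 <= k.+4.+1)%N. by lia. Qed.
Let k02 : (k <= k.+2)%N. by lia. Qed.

(** The comparison of schemes costs three derivatives: data of order k + 5 give convergence in order
    k + 2, with a rate that is geometric in n. *)
Lemma scheme_limit : exists2 u, (forall t, 0 <= t -> HP k.+2 (u t)) & unif k.+2 X u.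
apply: unif_complete => [n t _|T];first exact: hX.
have [C [n0 h]]:= scheme_compare k.+1 (NP k.+4.+1 w) (normr_ge0 T).
exists C, n0 => n t nn t0 tT;rewrite /sU -(idxS n t0);apply: h => //.
by apply: idx_time => //;exact: leT tT (ler_norm _).
Qed.

Let bnd T : exists2 B, 0 <= B & exists n0, forall n t, (n0 <= n)%N -> 0 <= t -> t <= T -> NP k.+4.+1 (X n t) <= B.
have [B [n0 h]]:= nU_bnd k.+4 (NP k.+4.+1 w) (normr_ge0 T).
exists `|B| => //;exists n0 => n t nn t0 tT;apply: leT (ler_norm B);apply: h => //.
by apply: idx_time => //;exact: leT tT (ler_norm _).
Qed.

Let close T : exists2 C, 0 <= C & exists n0, forall n t, (n0 <= n)%N -> 0 <= t -> t <= T ->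
 NP k.+2 (Fr (rn n) (X n t) - field (X n t)) <= C * rn n /\ NP k.+2 (Fr (rn n) (X n t)) <= C.
have [B B0 [n0 h]]:= bnd T.
pose D:= 4 * B + 24 * algc k.+2 ^+ 2 * B ^+ 3.
have D0 : 0 <= D.
 apply: addr_ge0;first exact: mulr_ge0.
 by rewrite mulr_ge0 ?exprn_ge0// mulr_ge0// exprn_ge0// algc_ge0.
pose L:= 1 + 6 * algc k.+2 ^+ 2 * B ^+ 2.
have L0 : 0 <= L.
 by rewrite addr_ge0// mulr_ge0 ?exprn_ge0// mulr_ge0// exprn_ge0// algc_ge0.
exists (D + L * B);first by rewrite addr_ge0// mulr_ge0.
exists n0 => n t nn t0 tT;have xB:= h n t nn t0 tT.
have r0:= rn_gt0 R n.
have a1:= NP_Fr_close r0 (hX5 n t) xB.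
have hX4 : HP k.+4 (X n t):= HP_le k45 (hX5 n t).
have a2:= NP_field hX4 (leT (NP_le _ k35) xB).
have a3 : NP k.+2 (field (X n t)) <= L * B.
 by apply: leT a2 _;apply: ler_wpM2l => //;exact: leT (NP_le _ k45) xB.
have LB0 : 0 <= L * B by exact: mulr_ge0.
have hF : HP k.+2 (Fr (rn n) (X n t)) by exact: HP_Fr.
rewrite -/D in a1;split.
 by apply: leT a1 _;rewrite mulrC;apply: ler_wpM2r;[exact: ltW|rewrite lerDl].
have:= NPD (HPB hF (HP_field hX4)) (HP_field hX4);rewrite subrK => /leT;apply.
apply: lerD => //;apply: leT a1 _;rewrite -[leRHS]mul1r;apply: ler_wpM2r => //;exact: rn_le1.
Qed.

Let increment k' n t t' G B : (k' <= k.+2)%N -> 0 <= t -> t <= t' -> HP k' G ->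
 (forall tau, t <= tau -> tau <= t' -> NP k' (Fr (rn n) (X n tau) - G) <= B) ->
 NP k' (X n t' - X n t - ((idx n t' - idx n t)%:R * hn n) *: G) <= (idx n t' - idx n t)%:R * hn n * B.
move=> kk t0 tt hG h;have im:= idx_mono n t0 tt.
have e : idx n t' = (idx n t + (idx n t' - idx n t))%N by rewrite subnKC.
rewrite {1}/sU {1}e;apply: nU_increment => // [|i|i|i].
- exact: HP_le kk hw2.
- by apply: HP_le kk _;exact: HP_nU.
- by apply: HP_le kk _;apply: (HP_Fr (rn_gt0 R n));exact: HP_nU.
rewrite -e => /andP[ia ib];have [|tau [ta tb <-]]:= @idx_cover R n t t' i t0 tt;last exact: h.
by rewrite ia ltnW.
Qed.

Lemma scheme_abnd : abnd k X.
move=> T N;have [B B0 [n0 h]]:= bnd T;exists (maxn N n0);first exact: leq_maxl.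
exists B => t t0 tT;apply: leT (NP_le _ k25) _;apply: h => //;exact: leq_maxr.
Qed.

Lemma scheme_acont : acont k X.
move=> T e N e0;have [C C0 [n0 h]]:= close T.
(* Half of the modulus is for the true time increment, half for the length of one step. *)
have e2 : 0 < e / (2 * (C + 1)) by rewrite divr_gt0// mulr_gt0// ltr_pwDr.
have [n1 h1]:= rn_small e2.
pose n:= maxn N (maxn n0 n1);exists n;first exact: leq_maxl.
have nn0 : (n0 <= n)%N:= leq_trans (leq_maxl _ _) (leq_maxr _ _).
have nn1 : (n1 <= n)%N:= leq_trans (leq_maxr _ _) (leq_maxr _ _).
exists (e / (2 * (C + 1))) => // t t' t0 tt tT td.
have:= @increment k.+2 n t t' 0 C (leqnn _) t0 tt (HP0 R _);rewrite scaler0 subr0 => q.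
apply: leT (q _) _.
 by move=> tau ta tb;rewrite subr0;case: (h n tau nn0 (leT t0 ta) (leT tb tT)).
have:= idx_diff n t0 tt;have hr:= leT (hn_le_rn R n) (h1 n nn1).
rewrite ler_norml => /andP[_ d2].
have l : (idx n t' - idx n t)%:R * hn n <= e / (C + 1).
 have : (idx n t' - idx n t)%:R * hn n <= e / (2 * (C + 1)) + e / (2 * (C + 1)) by move: d2 hr td;lra.
 suff -> : e / (2 * (C + 1)) + e / (2 * (C + 1)) = e / (C + 1) by [].
 by field;rewrite gt_eqF ?ltr_pwDr.
apply: leT (ler_wpM2r C0 l) _.
rewrite mulrAC ler_pdivrMr ?ltr_pwDr//;apply: ler_wpM2l;first exact: ltW.
by rewrite lerDl.
Qed.

Lemma scheme_aode : aode k X.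
move=> T e e0;have [C C0 [n0 h]]:= close T.
(* The consistency error is at most (|T| + 1) C r, and the mismatch between t' - t and the total
   length of the steps contributes r (B + |G|); r K <= e covers both. *)
pose K:= 1 + (`|T| + 1) * C.
have K0 : 0 < K by rewrite ltr_pwDl// mulr_ge0// addr_ge0.
have e2 : 0 < e / K by rewrite divr_gt0.
have [n1 h1]:= rn_small e2.
exists (maxn n0 n1) => n t t' G B;rewrite geq_max => /andP[nn0 nn1] t0 tt tT hG B0 hB.
have r0:= ltW (rn_gt0 R n);have Cr : 0 <= C * rn n by exact: mulr_ge0.
have hFr tau : t <= tau -> tau <= t' -> NP k (Fr (rn n) (X n tau) - G) <= B + C * rn n.
 move=> ta tb;have hx4 : HP k.+2 (X n tau) by exact: hX.
 have hF : HP k (Fr (rn n) (X n tau)) by apply: HP_le k02 _;exact: HP_Fr (rn_gt0 R n) _ _ hx4.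
 apply: leT (NP_dist hF (HP_field hx4) hG) _;rewrite addrC;apply: lerD;first exact: hB.
 apply: leT (NP_le _ k02) _.
 by case: (h n tau nn0 (leT t0 ta) (leT tb tT)).
have q:= increment k02 t0 tt hG hFr.
have d:= idx_diff n t0 tt;have hr:= hn_le_rn R n;have h0:= ltW (hn_gt0 R n).
set l:= (idx n t' - idx n t)%:R * hn n in q d *.
have hk s : HP k (X n s):= HP_le k02 (hX n s).
have -> : X n t' - X n t - (t' - t) *: G = (X n t' - X n t - l *: G) + (l - (t' - t)) *: G.
 exact: scale_split.
apply: leT (NPD (HPB (HPB (hk _) (hk _)) (HPZ _ hG)) (HPZ _ hG)) _.
rewrite (NPZ _ hG).
have d1 : `|l - (t' - t)| * NP k G <= rn n * NP k G.
 by apply: ler_wpM2r;[exact: NP_ge0|exact: leT d hr].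
apply: leT (lerD q d1) _.
have lb : l <= (t' - t) + rn n by move: d;rewrite ler_norml => /andP[_];move: hr;lra.
have tT1 : t' - t <= `|T| by have:= ler_norm T;move: t0 tT;lra.
have q1 : l * (B + C * rn n) <= ((t' - t) + rn n) * (B + C * rn n) by apply: ler_wpM2r => //;exact: addr_ge0.
apply: leT (lerD q1 (lexx _)) _.
have rK : rn n * K <= e by rewrite -ler_pdivlMr//;exact: h1.
have G0:= NP_ge0 k G;have r1:= rn_le1 R n.
have q2 : rn n * (1 + (`|T| + 1) * C) * (1 + B + NP k G) <= e * (1 + B + NP k G).
 by apply: ler_wpM2r => //;rewrite !addr_ge0.
have q3 : rn n * (t' - t + rn n) * C <= rn n * (`|T| + 1) * C.
 apply: ler_wpM2r => //;apply: ler_wpM2l => //;exact: lerD.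
have q4 : 0 <= rn n * ((`|T| + 1) * C) * (B + NP k G).
 by rewrite !mulr_ge0// addr_ge0.
rewrite -[leRHS]/((t' - t) * B + e * _);apply: leT (lerD (lexx ((t' - t) * B)) q2).
move: q3 q4;set x:= rn n;set y:= `|T|;set s:= t' - t;set g:= NP k G => q3 q4.
have -> : (s + x) * (B + C * x) + x * g = s * B + x * (B + g) + x * (s + x) * C by ring.
have -> : s * B + x * (1 + (y + 1) * C) * (1 + B + g) =
 s * B + x * (B + g) + x * (y + 1) * C + (x + x * ((y + 1) * C) * (B + g)) by ring.
have x0 : 0 <= x by exact: ltW (rn_gt0 R n).
lra.
Qed.

Lemma scheme_nls u : (forall t, 0 <= t -> HP k.+2 (u t)) -> unif k.+2 X u -> nls k u.
move=> hu un;apply: flow_limit hu un scheme_abnd scheme_acont scheme_aode => n t _;exact: hX.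
Qed.

Lemma scheme_init u : (forall t, 0 <= t -> HP k.+2 (u t)) -> unif k.+2 X u -> NP k.+2 (u 0 - w) = 0.
move=> hu un;apply/eqP;rewrite eq_le NP_ge0 andbT;apply: (@le_eps _ _ _ 1) => // e e0 _.
have [n0 h]:= un 0 e e0;have:= h n0 0 (leqnn _) (lexx _) (lexx _).
have -> : sU n0 0 w = w.
 by rewrite /sU (_ : idx n0 0 = 0%N)//;apply: idx_unique => //;rewrite mul0r lexx mul1r hn_gt0.
by rewrite NP_distC add0r mulr1.
Qed.

Lemma scheme_even u t : (forall t, 0 <= t -> HP k.+2 (u t)) -> unif k.+2 X u -> 0 <= t ->
 evenP w -> evenP (u t).
move=> hu un t0 ew;apply: evenP_closed => [|e e0];first by apply: HP_le (hu t t0);lia.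
have [n0 h]:= un t e e0;exists (X n0 t);split.
- by apply: HP_sU;apply: HP_le hw;lia.
- by apply: evenP_nU => //;apply: HP_le hw;lia.
by apply: leT (h n0 t _ t0 (lexx _)) => //;apply: NP_le;lia.
Qed.

End OneData.

(** The estimate is in the norm of order k + 2 although the data have order k + 5; this is what
    extends the flow to data of order k + 2. *)
Lemma scheme_lip k (N T : R) : exists2 L, 0 <= L & forall w w' u u', HP k.+4.+1 w -> HP k.+4.+1 w' ->
 NP k.+2 w <= N -> NP k.+2 w' <= N ->
 (forall t, 0 <= t -> HP k.+2 (u t)) -> (forall t, 0 <= t -> HP k.+2 (u' t)) ->
 unif k.+2 (fun n t => sU n t w) u -> unif k.+2 (fun n t => sU n t w') u' ->
 forall t, 0 <= t -> t <= T -> NP k.+2 (u t - u' t) <= L * NP k.+2 (w - w').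
have [L [n0 h]]:= nU_lip k.+1 N (normr_ge0 T).
exists `|L| => // w w' u u' hw hw' wN wN' hu hu' un un' t t0 tT.
have hw2 : HP k.+2 w by apply: HP_le hw;lia.
have hw2' : HP k.+2 w' by apply: HP_le hw';lia.
apply: (@le_eps _ _ _ 2) => // e e0 _.
have [n1 h1]:= un T e e0;have [n2 h2]:= un' T e e0.
pose n:= maxn n0 (maxn n1 n2).
have a0:= h w w' n (idx n t) hw2 hw2' wN wN' (leq_maxl _ _) (idx_time n t0 (leT tT (ler_norm _))).
have a1:= h1 n t (leq_trans (leq_maxl _ _) (leq_maxr _ _)) t0 tT.
have a2:= h2 n t (leq_trans (leq_maxr _ _) (leq_maxr _ _)) t0 tT.
have hX x : HP k.+2 x -> HP k.+2 (sU n t x) by exact: HP_sU.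
have s1:= NP_dist (hu t t0) (hX w hw2) (hu' t t0).
have s2:= NP_dist (hX w hw2) (hX w' hw2') (hu' t t0).
rewrite (NP_distC _ (u t) (sU n t w)) in s1.
have:= ler_wpM2r (NP_ge0 k.+2 (w - w')) (ler_norm L).
rewrite -/(sU n t w) -/(sU n t w') in a0;move: s1 s2 a0 a1 a2;clear;lra.
Qed.

End SchemeFlow.

(** * Convergence of Steklov means *)

Section Averages.
Variable R : realType.
Import WholeLine.
Local Notation mu:= (@lebesgue_measure R).
Local Notation rn:= (@rn R).

Lemma l2_locally_integrable (f : R -> R) : l2 f -> locally_integrable setT f.
move=> lf;have mf:= l2_meas lf;split => //;first exact: openT.
move=> K _ cK;have [M [_ hM]]:= compact_bounded cK.
pose N:= `|M| + 1;have hN x : K x -> `|x| <= N.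
 by apply: hM;rewrite /N;apply: le_lt_trans (ler_norm M) _;rewrite ltrDl.
have N0 : 0 <= N by rewrite addr_ge0.
have /integrableP[mi fi]:= l2_int lf (l2_indT (- N - 1) (N + 1)).
have mK : measurable K by exact: compact_measurable.
apply: le_lt_trans fi.
apply: leT (_ : (\int[mu]_(x in K) `|(f x * ind (- N - 1) (N + 1) x)%:E| <= _)%E).
 apply: eqW;apply: eq_integral => x;rewrite inE => Kx.
 have:= hN x Kx;rewrite ler_norml ind_le;last by lra.
 move=> /andP[a b];rewrite (_ : (_ && _) = true) ?mulr1//.
 by apply/andP;split;move: a b;lra.
apply: ge0_subset_integral => //.
exact: mdom.
by apply/measurable_EFinP;apply: measurableT_comp => //;exact/measurable_EFinP.
Qed.

Lemma stek_cvg_ae (f : R -> R) : l2 f -> {ae mu, forall x, stek (rn n) f x @[n --> \oo] --> f x}.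
move=> lf;have loc:= l2_locally_integrable lf.
pose E (x : R) (n : nat) : set R:= `]x - rn n, x + rn n]%classic.
have r0 n : 0 < rn n:= rn_gt0 R n.
have muE x n : mu (E x n) = (2 * rn n)%:E.
 rewrite /E lebesgue_measure_itv /= lte_fin ifT;last by have:= r0 n;lra.
 by rewrite -EFinD;congr EFin;ring.
have hE x : nicely_shrinking x (E x).
 split;first by move=> n;exact: measurable_itv.
 exists (2, fun n => PosNum (mulr_gt0 (ltr0n R 2) (r0 n)));split => //=.
 - apply: (@geo_cvg0 R 2) => n;rewrite ger0_norm// mulr_ge0//;exact: ltW.
 - move=> n y;rewrite /E /= in_itv /= => /andP[a b];rewrite /ball /=.
  by rewrite ltr_norml;apply/andP;split;have:= r0 n;lra.
 - move=> n;rewrite muE lebesgue_measure_ball;last by rewrite mulr_ge0// ltW. rewrite -EFinM lee_fin mulr2n.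
  by have:= r0 n;lra.
apply: (aeS _ (lebesgue_differentiation loc)) => x /(nice_lebesgue_differentiation hE loc) h.
have e n : (fun n => (mu (E x n))^-1 * \int[mu]_(y in E x n) (f y)%:E)%E n = (stek (rn n) f x)%:E.
 rewrite /= muE stekE [X in _ = X]EFinM -(integral_ip lf (l2_indT _ _)) inver gt_eqF ?mulr_gt0//.
 congr (_ * _)%E;rewrite integral_mkcond;apply: eq_integral => y _.
 rewrite patchE /E;case: ifPn => yE.
  move: yE;rewrite inE /= in_itv /= => /andP[a b];rewrite ind_le;last by have:= r0 n;lra.
  by rewrite a b mulr1.
 move: yE;rewrite notin_setE /= in_itv /= => /negP/negPf yE;rewrite ind_le;last by have:= r0 n;lra.
 by rewrite yE mulr0.
have h' : (stek (rn n) f x)%:E @[n --> \oo] --> (f x)%:E.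
 by move: h;rewrite (_ : (fun n => _) = (fun n => (stek (rn n) f x)%:E))//;apply/funext => n;exact: e.
by move/fine_cvgP: h' => [_].
Qed.

(** Means converge almost everywhere by Lebesgue differentiation and do not increase the norm;
    strong convergence follows without any density argument. *)
Lemma stek_strong (f : R -> R) : l2 f -> nrm (stek (rn n) f - f) @[n --> \oo] --> 0.
move=> lf;apply: l2_strong => // [n|n|].
- exact: l2_stek (rn_gt0 R n) _ lf.
- exact: nrm_stek (rn_gt0 R n) _ lf.
by apply: (aeS _ (stek_cvg_ae lf)) => x h _.
Qed.

End Averages.

(** * The Schroedinger flow for data of limited regularity *)

Section Density.
Variable R : realType.
Import WholeLine.
Local Notation chain:= (nat -> R -> R).
Local Notation V:= (chain * chain)%type.
Local Notation rn:= (@rn R).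
Implicit Types (T C e t tau d B M r : R) (w : V) (c : chain) (k n i j : nat) (u : R -> V).

(** Averaging gains a derivative: the new level k + 1 is the difference quotient of level k, which
    is the derivative of the mean of level k. *)
Definition smc r k c : chain:= fun j => if (j <= k)%N then stek r (c j) else dq r (c j.-1).

Lemma isH_smc r k c : 0 < r -> isH k c -> isH k.+1 (smc r k c).
move=> r0 hc;split => j jk;rewrite /smc.
 case: ifP => h;first exact: l2_stek (isH_l2 hc h).
 by apply: l2_dq;apply: (isH_l2 hc);rewrite -ltnS (leq_trans _ jk) ?ltnS ?leq_pred//;case: j h {jk}.
have jk' : (j <= k)%N by [];rewrite jk'.
case: ifP => h;last exact: prim_stek (isH_l2 hc jk').
by rewrite (stek_of_prim r (isH_prim hc h));exact: prim_stek (isH_l2 hc jk').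
Qed.

Definition smP r k w : V:= (smc r k w.1, smc r k w.2).
(** Each average gains one order; three lead from k + 2 to the order k + 5 for which the scheme
    converges. *)
Definition smP3 r k w : V:= smP r k.+2 (smP r k.+1 (smP r k w)).

Lemma HP_smP r k w : 0 < r -> HP k w -> HP k.+1 (smP r k w).
by move=> r0 [a b];split;exact: isH_smc. Qed.
Lemma HP_smP3 r k w : 0 < r -> HP k w -> HP k.+3 (smP3 r k w).
by move=> r0 hw;do 3 apply: HP_smP => //. Qed.

Lemma smP3E r k w j : (j <= k)%N -> (smP3 r k w).1 j = stek r (stek r (stek r (w.1 j))) /\
 (smP3 r k w).2 j = stek r (stek r (stek r (w.2 j))).
by move=> jk;rewrite /smP3 /smP /smc /= jk (leqW jk) (leqW (leqW jk)).
Qed.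

Lemma NP_smP3 r k w : 0 < r -> HP k w -> NP k (smP3 r k w) <= NP k w.
move=> r0 hw;apply: NP_mono => j jk;have [la lb]:= HP_l2 hw jk.
have s3 f : l2 f -> nrm (stek r (stek r (stek r f))) <= nrm f.
 move=> lf;have l1:= l2_stek r0 lf;have l2':= l2_stek r0 l1.
 exact: leT (nrm_stek r0 l2') (leT (nrm_stek r0 l1) (nrm_stek r0 lf)).
by rewrite /np;have [-> ->]:= smP3E r w jk;apply: hyp_mono;rewrite ?nrm_ge0//;exact: s3.
Qed.

Lemma smP3_close r k w : 0 < r -> HP k w ->
 NP k (smP3 r k w - w) <= \sum_(j < k.+1) 3 * (nrm (stek r (w.1 j) - w.1 j) + nrm (stek r (w.2 j) - w.2 j)).
move=> r0 hw;apply: ler_sum => j _;have jk : (j <= k)%N by rewrite -ltnS.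
have [la lb]:= HP_l2 hw jk.
have s3 f : l2 f -> nrm (stek r (stek r (stek r f)) - f) <= 3 * nrm (stek r f - f).
 move=> lf;have l1:= l2_stek r0 lf;have l2':= l2_stek r0 l1;have l3:= l2_stek r0 l2'.
 have b1 : nrm (stek r (stek r f) - stek r f) <= nrm (stek r f - f).
  rewrite -(stekB r l1 lf);apply: nrm_stek => //;exact: l2B.
 have b2 : nrm (stek r (stek r (stek r f)) - stek r (stek r f)) <= nrm (stek r f - f).
  by apply: leT b1;rewrite -(stekB r l2' l1);apply: nrm_stek => //;exact: l2B.
 have -> : stek r (stek r (stek r f)) - f =
   (stek r (stek r (stek r f)) - stek r (stek r f)) + ((stek r (stek r f) - stek r f) + (stek r f - f)).
  by rewrite !addrA !subrK.
 apply: leT (nrmD (l2B l3 l2') (l2D (l2B l2' l1) (l2B l1 lf))) _.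
 have:= nrmD (l2B l2' l1) (l2B l1 lf);lra.
rewrite /np;apply: leT (hyp_sum (nrm_ge0 _ _) (nrm_ge0 _ _)) _.
have [e1 e2]:= smP3E r w jk.
rewrite mulrDr;apply: lerD.
 by rewrite -[(smP3 r k w - w).1 j]/((smP3 r k w).1 j - w.1 j) e1;exact: s3.
by rewrite -[(smP3 r k w - w).2 j]/((smP3 r k w).2 j - w.2 j) e2;exact: s3.
Qed.

Lemma sum_cvg0 (F : nat -> nat -> R) n : (forall j, (j < n)%N -> F j i @[i --> \oo] --> 0) ->
 \sum_(j < n) F j i @[i --> \oo] --> 0.
elim: n => [|n IH] h.
 by rewrite (_ : (fun i => _) = cst 0);[exact: cvg_cst|apply/funext => i;rewrite big_ord0].
rewrite (_ : (fun i => _) = (fun i => \sum_(j < n) F j i + F n i));last by apply/funext => i;rewrite big_ord_recr.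
by rewrite -[X in _ --> X]addr0;apply: (@cvgD _ R^o);[apply: IH => j jn;apply: h;exact: leqW|exact: h].
Qed.

Lemma smP3_cvg k w : HP k w -> NP k (smP3 (rn n) k w - w) @[n --> \oo] --> (0 : R).
move=> hw;apply: (@cvg0_le R _ (fun n => \sum_(j < k.+1)
  3 * (nrm (stek (rn n) (w.1 j) - w.1 j) + nrm (stek (rn n) (w.2 j) - w.2 j)))).
 by move=> n;rewrite ger0_norm ?NP_ge0//;exact: smP3_close (rn_gt0 R n) hw.
apply: (@sum_cvg0 (fun j n => 3 * (nrm (stek (rn n) (w.1 j) - w.1 j) + nrm (stek (rn n) (w.2 j) - w.2 j)))) => j jk;have [la lb]:= HP_l2 hw (jk : (j <= k)%N).
have -> : (0 : R) = 3 * (0 + 0) by rewrite addr0 mulr0.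
by apply: cvgM;[exact: cvg_cst|apply: cvgD;exact: stek_strong].
Qed.

Lemma nls_exists k w : HP k.+2 w -> evenP w -> exists u, [/\ nls k u, NP k.+2 (u 0 - w) = 0 &
 forall t, 0 <= t -> evenP (u t)].
move=> hw ew.
(* Radii are selected so that the smoothed data converge geometrically, the rate that completeness
   asks for. *)
have /choice[phi hphi] : forall i, exists n, NP k.+2 (smP3 (rn n) k.+2 w - w) <= rn i.
 move=> i;have /cvgrPdist_le/(_ _ (rn_gt0 R i))[n _ h]:= smP3_cvg hw.
 by exists n;have:= h n (leqnn _);rewrite sub0r normrN ger0_norm ?NP_ge0.
pose W i:= smP3 (rn (phi i)) k.+2 w.
have hW i : HP k.+4.+1 (W i) by exact: HP_smP3 (rn_gt0 R _) hw.
have hW2 i : HP k.+2 (W i) by apply: HP_le (hW i);lia.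
have nW i : NP k.+2 (W i) <= NP k.+2 w by exact: NP_smP3 (rn_gt0 R _) hw.
have eW i : evenP (W i).
 have hw1 : HP 1 w by apply: HP_le hw.
 have [la lb]:= HP_l2 hw1 (leq0n 1).
 have r0:= rn_gt0 R (phi i).
 have s3 f : l2 f -> (forall x, f (- x) = f x) -> forall x,
   stek (rn (phi i)) (stek (rn (phi i)) (stek (rn (phi i)) f)) (- x) =
   stek (rn (phi i)) (stek (rn (phi i)) (stek (rn (phi i)) f)) x.
  by move=> lf ef x;rewrite !stek_even//;repeat apply: l2_stek => //;repeat apply: stek_even => //;
    repeat apply: l2_stek => //.
 move=> s;have [-> ->]:= smP3E (rn (phi i)) w (leq0n k.+2).
 by split;apply: s3 => // x;case: (ew x).
have /choice[X hX] : forall i, exists u, (forall t, 0 <= t -> HP k.+2 (u t)) /\ unif k.+2 (fun n t => sU n t (W i)) u.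
 by move=> i;have [u a b]:= scheme_limit (hW i);exists u.
have hXH i t : 0 <= t -> HP k.+2 (X i t) by case: (hX i) => h _;exact: h.
have nX i : nls k (X i) by case: (hX i) => a b;exact: scheme_nls (hW i) _ a b.
have [||u hu un]:= @unif_complete R k.+2 X.
- by move=> n t;exact: hXH.
- move=> T;have [L L0 h]:= scheme_lip k (NP k.+2 w) T.
 exists (L * 2), 0%N => n t _ t0 tT;case: (hX n) => a1 b1;case: (hX n.+1) => a2 b2.
 apply: leT (h _ _ _ _ (hW n.+1) (hW n) (nW _) (nW _) a2 a1 b2 b1 t t0 tT) _.
 rewrite -mulrA;apply: ler_wpM2l => //.
 apply: leT (NP_dist (hW2 n.+1) hw (hW2 n)) _;rewrite (NP_distC _ w).
 have r1 : rn n.+1 <= rn n.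
  by rewrite /rn;apply: ler_wiXn2l;rewrite ?invr_ge0 ?invf_le1 ?ler1n.
 have:= hphi n;have:= hphi n.+1;rewrite -/(W n) -/(W n.+1);lra.
exists u;split.
- apply: (flow_limit hXH hu un).
 + move=> T N;exists N => //;case: (nX N) => _ h _ _;exact: h.
 + move=> T e N e0;exists N => //;case: (nX N) => _ _ h _;exact: h.
 + move=> T e e0;exists 0%N => n t t' G B _ t0 tt _ hG B0 hB;case: (nX n) => _ _ _ h.
  apply: leT (h t t' G B t0 tt hG B0 hB) _;rewrite lerDl;apply: mulr_ge0;first exact: ltW.
  by rewrite !addr_ge0// NP_ge0.
- apply/eqP;rewrite eq_le NP_ge0 andbT;apply: (@le_eps _ _ _ 2) => // e e0 _.
 have [n0 h0]:= un 0 e e0;have [n1 h1]:= rn_small e0.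
 pose n:= maxn n0 n1;have a1:= h0 n 0 (leq_maxl _ _) (lexx _) (lexx _).
 have a2:= h1 n (leq_maxr _ _);have a3:= hphi n;rewrite -/(W n) in a3.
 have [b1 b2]:= hX n;have a4:= scheme_init b1 b2.
 have s1:= NP_dist (hu 0 (lexx _)) (hXH n 0 (lexx _)) hw.
 have s2:= NP_dist (hXH n 0 (lexx _)) (hW2 n) hw.
 rewrite (NP_distC _ (u 0) (X n 0)) in s1;rewrite a4 in s2.
 by rewrite add0r;move: s1 s2 a1 a2 a3;lra.
move=> t t0;apply: evenP_closed => [|e e0];first by apply: HP_le (hu t t0).
have [n0 h]:= un t e e0;exists (X n0 t);split.
- by apply: HP_le (hXH n0 t t0).
- by case: (hX n0) => a b;exact: scheme_even (hW n0) _ _ a b t0 (eW n0).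
by apply: leT (h n0 t _ t0 (lexx _)) => //;exact: NP_le.
Qed.

End Density.

(** * Linear systems with skew coefficients *)

Section SkewSystems.
Variable R : realType.
Variable n : nat.
Import HalfLine.
Local Notation D:= (@dom R false).
Local Notation vecf:= ('I_n -> R -> R).
Implicit Types (s : R) (u w : vecf) (a : 'I_n -> 'I_n -> R -> R).

Lemma dom_ge0 (x : R) : D x <-> 0 <= x.
by rewrite /dom /= in_itv /= andbT. Qed.

(** Completeness of the reals read off from that of L2, after multiplication by an indicator of norm
    one. *)
Lemma geo_limit (v : nat -> R) (C : R) : (forall m, `|v m.+1 - v m| <= C * 2^-1 ^+ m) ->
 exists l, forall m, `|v m - l| <= 2 * C * 2^-1 ^+ m.
move=> h;have D0 : D 0 by apply/dom_ge0. have D1 : D 1 by apply/dom_ge0.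
pose I : R -> R:= ind 0 1;have lI : l2 I by exact: l2_ind.
have nI : nrm I = 1 by rewrite nrm_ind// subr0 normr1 sqrtr1.
have lF m : l2 (v m *: I) by exact: l2Z.
have hF m : nrm (v m.+1 *: I - v m *: I) <= C * 2^-1 ^+ m by rewrite -scalerBl nrmZ// nI mulr1.
have [f lf hf]:= l2_complete lF hF.
exists (ip f I) => m;have -> : v m - ip f I = ip (v m *: I - f) I.
 by rewrite (ipBl (lF m) lf lI) (ipZl _ lI lI) -nrm_sq nI expr1n mulr1.
by apply: leT (CS (l2B (lF m) lf) lI) _;rewrite nI mulr1.
Qed.

Lemma prim_sum (F G : vecf) : (forall i, prim (F i) (G i)) ->
 prim (fun s => \sum_i F i s) (fun s => \sum_i G i s).
move=> h;have -> : (fun s => \sum_i F i s) = \sum_i F i by apply/funext => s;rewrite fct_sumE.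
have -> : (fun s => \sum_i G i s) = \sum_i G i by apply/funext => s;rewrite fct_sumE.
apply: (big_ind2 (fun f g : R -> R => prim f g)) => //;[exact: prim0|by move=> *;exact: primD].
Qed.

Definition mulv a u : vecf:= fun i s => \sum_j a i j s * u j s.
Definition dotv u w : R -> R:= fun s => \sum_i u i s * w i s.
Definition sys a u (g : vecf):= forall i, prim (u i) (mulv a u i + g i).
Definition bddv u:= exists2 C, 0 <= C & forall i s, 0 <= s -> `|u i s| <= C.
Definition skew a:= forall i j s, a i j s = - a j i s.

Lemma skew_dot a u w s : skew a -> dotv (mulv a u) w s + dotv u (mulv a w) s = 0.
move=> sk;rewrite /dotv /mulv.
under eq_bigr do rewrite big_distrl /=.
under [X in _ + X]eq_bigr do rewrite big_distrr /=.
rewrite exchange_big /= -big_split big1// => i _;rewrite -big_split big1// => j _ /=.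
by rewrite (sk j i);ring.
Qed.

(** By skewness the coefficients drop out of the derivative of the inner product. Conservation,
    uniqueness and global bounds all come from this. *)
Lemma dot_sys a u w (g h : vecf) : skew a -> bddv u -> bddv w -> sys a u g -> sys a w h ->
 prim (dotv u w) (fun s => dotv g w s + dotv u h s).
move=> sk [A A0 uA] [B B0 wB] su sw.
have Dx x : D x -> 0 <= x by move/dom_ge0.
have:= prim_sum (fun i => prim_mul (su i) (sw i) (fun x dx => uA i x (Dx x dx)) (fun x dx => wB i x (Dx x dx))).
apply: prim_eq => // s _.
have /eqP:= skew_dot u w s sk;rewrite addrC addr_eq0 => /eqP e.
rewrite /dotv;under eq_bigr do rewrite !fE mulrDl mulrDr.
rewrite big_split /= !big_split /=;rewrite -[X in X + _ + _]/(dotv (mulv a u) w s) -[X in _ + (X + _)]/(dotv u (mulv a w) s) e;ring.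
Qed.

Lemma prim_const (f f' : R -> R) s : prim f f' -> (forall x, D x -> f' x = 0) -> 0 <= s -> f s = f 0.
move=> [_ h] z s0;apply/eqP;rewrite -subr_eq0 h;[|by apply/dom_ge0|by apply/dom_ge0].
by rewrite (@ip_eq R false f' 0 (ind 0 s) (ind 0 s)) ?ip0l// => x dx;rewrite z// !mul0r.
Qed.

Lemma dot_const a u w s : skew a -> bddv u -> bddv w -> sys a u 0 -> sys a w 0 -> 0 <= s ->
 dotv u w s = dotv u w 0.
move=> sk bu bw su sw;apply: prim_const (dot_sys sk bu bw su sw) _ => x _.
by rewrite /dotv !big1 ?addr0// => i _;rewrite ?mul0r ?mulr0.
Qed.

Lemma dot_zero u s : dotv u u s = 0 -> forall i, u i s = 0.
move=> h i;apply/eqP;rewrite -sqrf_eq0 expr2;move: h => /eqP;rewrite psumr_eq0.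
 by move=> /allP/(_ i);rewrite mem_index_enum => /(_ isT).
by move=> j _;rewrite -expr2 sqr_ge0.
Qed.

Lemma bddvB u w : bddv u -> bddv w -> bddv (u - w).
move=> [A A0 uA] [B B0 wB];exists (A + B) => [|i s s0];first exact: addr_ge0.
by rewrite -[(u - w) i s]/(u i s - w i s);apply: leT (ler_normB _ _) _;apply: lerD;[exact: uA|exact: wB].
Qed.

Lemma sysB a u w (g h : vecf) : sys a u g -> sys a w h -> sys a (u - w) (g - h).
move=> su sw i;apply: prim_eq (primB (su i) (sw i)) => // s _.
by rewrite !fE /mulv -[RHS]/(_ + (g i s - h i s)) -[X in _ = X + _]/(\sum_j a i j s * (u j s - w j s));
 under [X in _ = X + _]eq_bigr do rewrite mulrBr;rewrite sumrB;ring.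
Qed.

Lemma sys_unique a u w : skew a -> bddv u -> bddv w -> sys a u 0 -> sys a w 0 ->
 (forall i, u i 0 = w i 0) -> forall i s, 0 <= s -> u i s = w i s.
move=> sk bu bw su sw e i s s0;have bd:= bddvB bu bw.
have sd : sys a (u - w) 0 by rewrite -(subrr (0 : vecf));exact: sysB.
have:= dot_const sk bd bd sd sd s0.
rewrite [RHS]/dotv [RHS]big1;last first.
 by move=> j _;rewrite -[X in X * _]/(u j 0 - w j 0) e subrr mul0r.
by move/dot_zero/(_ i)/eqP;rewrite -[X in X == _]/(u i s - w i s) subr_eq0 => /eqP.
Qed.

Lemma ind_refl (x0 : R) : ind x0 x0 = 0 :> (R -> R).
apply/funext => z;rewrite ind_le//;case: (boolP (_ < _ <= _)) => // /andP[h1 h2].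
by have:= lt_le_trans h1 h2;rewrite ltxx.
Qed.

Lemma prim_of (x0 c : R) (g : R -> R) : D x0 -> l2 g -> prim (fun s => c + ip g (ind x0 s)) g.
move=> d0 lg;split => // x y dx dy.
have lx:= l2_ind d0 dx;have ly:= l2_ind d0 dy;have lxy:= l2_ind dx dy.
have -> : ind x0 y = ind x0 x + ind x y :> (R -> R) by rewrite ind_chasles.
by rewrite (ipDr lx lxy lg);ring.
Qed.

(** * Solutions by Picard iteration on short intervals and gluing *)

Section Existence.
Variable a : 'I_n -> 'I_n -> R -> R.
Variable K : R.
Hypotheses (K0 : 0 <= K) (la : forall i j, l2 (a i j)) (aK : forall i j s, 0 <= s -> `|a i j s| <= K).

(** Coefficients switched off outside (x, y]: solutions are constant there, which makes gluing of
    stages immediate. *)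
Definition cut (x y : R) i j : R -> R:= ind x y * a i j.

Lemma mulv_cut_bound (x y M : R) u i s : 0 <= s -> 0 <= M -> (forall j, `|u j s| <= M) ->
 `|mulv (cut x y) u i s| <= n%:R * (K * M) * `|ind x y s|.
move=> s0 M0 uM;apply: leT (ler_norm_sum _ _ _) _.
have -> : n%:R * (K * M) * `|ind x y s| = \sum_(j < n) (K * M * `|ind x y s|).
 by rewrite sumr_const card_ord -[RHS]mulr_natl -[LHS]mulrA.
apply: ler_sum => j _;rewrite !normrM -mulrA mulrC;apply: ler_wpM2r => //.
by apply: ler_pM => //;exact: aK.
Qed.

Lemma mulv_cut_out (x y : R) u i s : ind x y s = 0 -> mulv (cut x y) u i s = 0.
by move=> e;rewrite /mulv big1// => j _;rewrite /cut mulfE e !mul0r. Qed.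

Lemma mulv_cut_in (x y : R) u i s : ind x y s = 1 -> mulv (cut x y) u i s = mulv a u i s.
by move=> e;apply: eq_bigr => j _;rewrite /cut mulfE e mul1r. Qed.

Lemma prim_flat (f f' : R -> R) (p q : R) : prim f f' -> 0 <= p -> p <= q ->
 (forall z, p < z -> z <= q -> f' z = 0) -> f q = f p.
move=> [_ h] p0 pq z;apply/eqP;rewrite -subr_eq0 h;[|by apply/dom_ge0|by apply/dom_ge0;exact: leT pq].
rewrite (@ip_eq R false f' 0 (ind p q) (ind p q)) ?ip0l// => x dx.
rewrite ind_le//;case: (boolP (p < x <= q)) => [/andP[h1 h2]|_];last by rewrite !mulr0.
by rewrite z// !mul0r.
Qed.

Lemma loc_int (x0 d M s : R) (g : R -> R) : 0 <= x0 -> 0 <= d -> 0 <= M -> 0 <= s -> l2 g ->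
 (forall z, 0 <= z -> `|g z| <= M * `|ind x0 (x0 + d) z|) -> `|ip g (ind x0 s)| <= M * d.
move=> x00 d0 M0 s0 lg gM;have xd : x0 <= x0 + d by rewrite lerDl.
have D0 : D x0 by apply/dom_ge0. have D1 : D (x0 + d) by apply/dom_ge0;exact: addr_ge0.
have Ds : D s by apply/dom_ge0.
pose I : R -> R:= ind x0 (x0 + d);have lI : l2 I by exact: l2_ind.
have ls : l2 (ind x0 s) by exact: l2_ind.
have -> : ip g (ind x0 s) = ip g (ind x0 s * I).
 apply: ip_eq => z /dom_ge0 z0;rewrite !mulfE /I (ind_le _ xd).
 case: (boolP (x0 < z <= x0 + d)) => h;first by rewrite mulr1.
 have:= gM z z0;rewrite (ind_le _ xd) (negPf h) normr0 mulr0 normr_le0 => /eqP ->;by rewrite !mul0r.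
have [_ ng]:= nrm_le_scale (l2_meas lg) lI M0 (fun z dz => gM z (proj1 (dom_ge0 z) dz)).
apply: leT (CS lg (l2_indM _ _ lI)) _.
have n2 : nrm (ind x0 s * I) <= nrm I by exact: nrm_indM.
have e : nrm I * nrm I = d by rewrite -expr2 nrm_sq ip_ind//;ring.
rewrite -[X in _ <= M * X]e mulrA;apply: ler_pM;rewrite ?nrm_ge0//.
Qed.

Lemma l2_mulv b u i : (forall i j, l2 (b i j)) -> (forall j, measurable_fun D (u j)) -> bddv u -> l2 (mulv b u i).
move=> lb mu [C C0 uC];have -> : mulv b u i = \sum_j (u j * b i j).
 by apply/funext => s;rewrite fct_sumE;apply: eq_bigr => j _;rewrite mulfE mulrC.
by apply: l2_sum => j;apply: (l2M (c:= C)) => // x /dom_ge0;exact: uC.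
Qed.

Lemma l2_cut (x y : R) i j : 0 <= x -> 0 <= y -> l2 (cut x y i j).
by move=> x0 y0;apply: l2_indM => //;apply/dom_ge0. Qed.

Lemma mulvB b u w i s : mulv b u i s - mulv b w i s = mulv b (u - w) i s.
by rewrite /mulv -sumrB;apply: eq_bigr => j _;rewrite -mulrBr. Qed.

Section Stage.
Variables (x0 d C : R) (c : 'I_n -> R).
Hypotheses (x00 : 0 <= x0) (d0 : 0 <= d) (small : n%:R * K * d <= 2^-1) (C0 : 0 <= C) (cC : forall i, `|c i| <= C).
Local Notation ca:= (cut x0 (x0 + d)).

Fixpoint picard (m : nat) : vecf:= if m is m'.+1 then fun i s => c i + ip (mulv ca (picard m') i) (ind x0 s)
 else fun i _ => c i.

Let Dx0 : D x0. by apply/dom_ge0. Qed.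
Let x1 : 0 <= x0 + d. exact: addr_ge0. Qed.
Let nK0 : 0 <= n%:R * K. exact: mulr_ge0. Qed.

Let step_bound u i s M : bddv u -> (forall j, measurable_fun D (u j)) -> 0 <= M -> 0 <= s ->
 (forall j z, 0 <= z -> `|u j z| <= M) -> `|ip (mulv ca u i) (ind x0 s)| <= M / 2.
move=> bu mu M0 s0 uM;have lm : l2 (mulv ca u i) by apply: l2_mulv => // *;exact: l2_cut.
apply: leT (loc_int x00 d0 (M:= n%:R * (K * M)) _ s0 lm _) _.
- by rewrite !mulr_ge0.
- by move=> z z0;apply: mulv_cut_bound => // j;exact: uM.
by rewrite (_ : n%:R * (K * M) * d = M * (n%:R * K * d));[exact: ler_wpM2l|ring].
Qed.

Lemma picard_ok m : bddv (picard m) /\ forall j, measurable_fun D (picard m j).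
elim: m => [|m [b mm]].
 by split;[exists C => // i s _;exact: cC|move=> j;exact: measurable_cst].
have lm i : l2 (mulv ca (picard m) i) by apply: l2_mulv => // *;exact: l2_cut.
split;last by move=> j;apply: prim_meas (prim_of _ Dx0 (lm j)).
have [B B0 bB]:= b;exists (C + B / 2) => [|i s s0];first by rewrite addr_ge0// divr_ge0.
apply: leT (ler_normD _ _) _;apply: lerD => //;exact: step_bound.
Qed.

Lemma picard_close m i s : 0 <= s -> `|picard m.+1 i s - picard m i s| <= C * 2^-1 ^+ m.
elim: m i s => [|m IH] i s s0;have lm m' j : l2 (mulv ca (picard m') j)
 by (apply: l2_mulv => [*||];[exact: l2_cut|by case: (picard_ok m')|by case: (picard_ok m')]).
 rewrite /= addrAC subrr add0r expr0 mulr1.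
 have [b mm]:= picard_ok 0;apply: (@leT _ _ (C / 2)).
  by apply: (step_bound (u:= picard 0)) => // j z _;exact: cC.
 by rewrite ler_pdivrMr// ler_peMr// ler1n.
have [b1 m1]:= picard_ok m.+1;have [b2 m2]:= picard_ok m.
have -> : picard m.+2 i s - picard m.+1 i s = ip (mulv ca (picard m.+1 - picard m) i) (ind x0 s).
 have -> : mulv ca (picard m.+1 - picard m) i = mulv ca (picard m.+1) i - mulv ca (picard m) i.
  by apply/funext => z;rewrite subfE mulvB.
 rewrite (ipBl (lm m.+1 i) (lm m i));last by apply: l2_ind => //;apply/dom_ge0.
 by rewrite [LHS]/= opprD addrACA subrr add0r.
rewrite exprSr mulrA;apply: step_bound => //.
- exact: bddvB.
- by move=> j;apply: measurable_funB.
by rewrite mulr_ge0// exprn_ge0// invr_ge0.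
Qed.

(** The iteration contracts by one half because n K d <= 1/2. The pointwise limit has a square
    integrable right-hand side by Fatou, and the relation [prim] is closed under the limit. *)
Lemma stage : exists w, [/\ forall i, prim (w i) (mulv ca w i), bddv w & forall i, w i x0 = c i].
have lm m' j : l2 (mulv ca (picard m') j).
 by apply: l2_mulv => [*||];[exact: l2_cut|by case: (picard_ok m')|by case: (picard_ok m')].
have /choice[W hW] : forall p : 'I_n * R, exists l, 0 <= p.2 -> forall m, `|picard m p.1 p.2 - l| <= 2 * C * 2^-1 ^+ m.
 move=> [i s];have [s0|]:= boolP (0 <= s);last by exists 0.
 have [l hl]:= geo_limit (fun m => picard_close m i s0);by exists l.
pose w i s:= W (i, s).
have hw m i s : 0 <= s -> `|picard m i s - w i s| <= 2 * C * 2^-1 ^+ m by move=> s0;exact: (hW (i, s)).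
have e0 m : 0 <= 2 * C * 2^-1 ^+ m by rewrite mulr_ge0 ?exprn_ge0 ?invr_ge0// mulr_ge0.
have cv i s : 0 <= s -> picard m i s @[m --> \oo] --> w i s.
 by move=> s0;apply/subr_cvg0;apply: geo_cvg0 => m;exact: hw.
have wb i s : 0 <= s -> `|w i s| <= C + 2 * C.
 move=> s0;have:= hw 0%N i s s0;rewrite expr0 mulr1 distrC => h.
 by rewrite -[w i s](subrK (c i)) addrC;apply: leT (ler_normD _ _) _;exact: lerD.
have bw : bddv w by exists (C + 2 * C) => //;rewrite addr_ge0// mulr_ge0.
pose I : R -> R:= ind x0 (x0 + d).
have lI : l2 I by apply: l2_ind => //;apply/dom_ge0.
have cvm i s : 0 <= s -> mulv ca (picard m) i s @[m --> \oo] --> mulv ca w i s.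
 move=> s0;apply/subr_cvg0;apply: (@geo_cvg0 R (n%:R * (K * (2 * C)) * `|I s|)) => m.
 rewrite mulvB;apply: leT (mulv_cut_bound _ _ i s0 (e0 m) _) _;first by move=> j;exact: hw.
 by apply: eqW;rewrite /I;ring.
have pb m i s : 0 <= s -> `|picard m i s| <= 5 * C.
 move=> s0;rewrite -[picard m i s](subrK (w i s));apply: leT (ler_normD _ _) _.
 have h1:= hw m i s s0;have h2:= wb i s s0.
 have h3 : 2 * C * 2^-1 ^+ m <= 2 * C * 1.
  by apply: ler_wpM2l;[rewrite mulr_ge0|rewrite exprn_ile1 ?invr_ge0// invf_le1// ler1n].
 by move: h1 h2 h3;lra.
have lw i : l2 (mulv ca w i).
 have []:= @l2_fatouT R false (fun m => mulv ca (picard m) i) (mulv ca w i) (n%:R * (K * (5 * C)) * nrm I) (fun m => lm m i) _ _ => //.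
  move=> m;have C5 : 0 <= n%:R * (K * (5 * C)) by rewrite !mulr_ge0.
  have []:= @nrm_le_scale R false (mulv ca (picard m) i) I _ (l2_meas (lm m i)) lI C5 => // z /dom_ge0 z0.
  by apply: mulv_cut_bound => //;[rewrite mulr_ge0|move=> j;exact: pb].
 by move=> x /dom_ge0;exact: cvm.
exists w;split => // i;last first.
 have:= cv i x0 x00;have -> : (fun m => picard m i x0) = cst (c i).
  apply/funext => -[//|m] /=.
  by rewrite ind_refl ipC ip0l addr0.
 by move=> /cvg_lim => <- //;rewrite lim_cst.
apply: (@prim_closed R false (fun m => picard m.+1 i) (fun m => mulv ca (picard m) i)).
- by move=> m;exact: prim_of.
- exact: lw.
- apply: (@geo_cvg0 R (n%:R * (K * (2 * C)) * nrm I)) => m;rewrite ger0_norm ?nrm_ge0//.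
 have C5 : 0 <= n%:R * (K * (2 * C * 2^-1 ^+ m)) by rewrite !mulr_ge0// exprn_ge0// invr_ge0.
 have ld : l2 (mulv ca (picard m) i - mulv ca w i) by exact: l2B.
 have []:= @nrm_le_scale R false _ I _ (l2_meas ld) lI C5.
  by move=> z /dom_ge0 z0;rewrite subfE mulvB;apply: mulv_cut_bound => // j;exact: hw.
 by move=> _ /leT;apply;apply: eqW;ring.
by move=> x /dom_ge0 xx;have:= cv i x xx;rewrite -(cvg_shiftS (fun m => picard m i x)).
Qed.

End Stage.
Local Notation frozen d c N u:= [/\ forall i, prim (u i) (mulv (cut 0 (N%:R * d)) u i), bddv u,
 forall i, u i 0 = c i & forall i s, N%:R * d <= s -> u i s = u i (N%:R * d)].

Lemma frozen_exists (d : R) (c : 'I_n -> R) N : 0 <= d -> n%:R * K * d <= 2^-1 -> exists u, frozen d c N u.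
move=> d0 small;elim: N => [|N [u [su bu u0 uc]]].
 exists (fun i _ => c i);split => // [i|].
  by apply: prim_eq (prim_cst false (c i)) => // s _;rewrite mul0r mulv_cut_out// ind_refl.
 exists (\sum_i `|c i|) => [|i s _];first exact: sumr_ge0.
 by rewrite (bigD1 i)//= lerDl sumr_ge0.
pose x0:= N%:R * d;have x00 : 0 <= x0 by rewrite mulr_ge0.
have x01 : x0 <= x0 + d by rewrite lerDl.
have e1 : N.+1%:R * d = x0 + d by rewrite -natr1 mulrDl mul1r.
have [C C0 uC]:= bu.
have [w [sw bw w0]]:= stage x00 d0 small C0 (fun i => uC i x0 x00).
have dx0 : D x0 by apply/dom_ge0.
have wl i s : 0 <= s -> s <= x0 -> w i s = u i x0.
 move=> s0 sx;rewrite -w0;apply/esym;apply: (prim_flat (sw i) s0 sx) => z _ zx.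
 by apply: mulv_cut_out;rewrite ind_le// ltNge zx.
have wr i s : x0 + d <= s -> w i s = w i (x0 + d).
 move=> sx;apply: (prim_flat (sw i) (leT x00 x01) sx) => z zx _.
 by apply: mulv_cut_out;rewrite ind_le// [z <= _]leNgt zx andbF.
(* Before [x0] the new stage is constant, after [x0] the old solution is; their sum minus the common
   value agrees with each on its own side. *)
rewrite e1;pose v : vecf:= fun i s => u i s + w i s - u i x0.
have vl i s : 0 <= s -> s <= x0 -> v i s = u i s by move=> s0 sx;rewrite /v wl// addrK.
have vr i s : x0 <= s -> v i s = w i s by move=> sx;rewrite /v uc// addrAC subrr add0r.
exists v;split.
- move=> i;have p:= primB (primD (su i) (sw i)) (prim_cst false (u i x0)).
 apply: prim_eq p => // s /dom_ge0 s0;rewrite subr0 addfE -/x0.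
 have [sx|xs]:= leP s x0.
  rewrite [X in _ + X]mulv_cut_out ?addr0;last by rewrite ind_le// ltNge sx.
  apply: eq_bigr => j _;rewrite vl// /cut !mulfE !ind_le ?(leT x00 x01)// sx.
  by rewrite (leT sx x01).
 rewrite mulv_cut_out ?add0r;last by rewrite ind_le// [s <= _]leNgt xs andbF.
 apply: eq_bigr => j _;rewrite vr ?(ltW xs)// /cut !mulfE !ind_le ?(leT x00 x01)// xs.
 by rewrite (le_lt_trans x00 xs).
- have [B B0 wB]:= bw;exists (C + B + C) => [|i s s0];first by rewrite !addr_ge0.
 apply: leT (ler_normB _ _) _;apply: lerD;last exact: uC.
 by apply: leT (ler_normD _ _) _;apply: lerD;[exact: uC|exact: wB].
- by move=> i;rewrite vl.
by move=> i s xs;rewrite !vr ?(leT x01 xs)// wr.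
Qed.

Hypothesis sk : skew a.

Lemma skew_cut (x y : R) : skew (cut x y).
by move=> i j s;rewrite /cut !mulfE sk mulrN. Qed.

(** The shorter solution solves the longer cut system up to a source that vanishes before time N d,
    so the squared distance is constant until then. *)
Lemma frozen_agree (d : R) (c : 'I_n -> R) N M u w : 0 <= d -> (N <= M)%N -> frozen d c N u -> frozen d c M w ->
 forall i s, 0 <= s -> s <= N%:R * d -> u i s = w i s.
move=> d0 NM [su bu u0 _] [sw bw w0 _] i s s0 sN.
have NdM : N%:R * d <= M%:R * d by apply: ler_wpM2r => //;rewrite ler_nat.
have N0 : 0 <= N%:R * d by rewrite mulr_ge0.
pose aM:= cut 0 (M%:R * d).
pose g : vecf:= fun i => mulv (cut 0 (N%:R * d)) u i - mulv aM u i.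
have su' : sys aM u g by move=> j;rewrite /g addrC subrK;exact: su.
have sw' : sys aM w 0 by move=> j;rewrite -[(0 : vecf) j]/(0 : R -> R) addr0;exact: sw.
have skM : skew aM by exact: skew_cut.
have bd:= bddvB bu bw;have sd:= sysB su' sw'.
have p:= dot_sys skM bd bd sd sd.
have:= prim_flat p (lexx 0) s0;rewrite [dotv _ _ 0]/dotv big1;last first.
 by move=> j _;rewrite -[X in X * _]/(u j 0 - w j 0) u0 w0 subrr mul0r.
move=> h;apply/eqP;rewrite -subr_eq0;apply/eqP;apply: (dot_zero (u:= u - w));apply: h => z z0 zs.
have gz j : (g - 0) j z = 0.
 rewrite subr0 /g subfE !mulv_cut_in ?subrr//;rewrite ind_le// ?z0 ?(leT zs)//.
  exact: leT sN NdM.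
 exact: leT N0 NdM.
by rewrite /dotv !big1 ?addr0// => j _;rewrite gz ?mul0r ?mulr0.
Qed.

Lemma ode_exists (c : 'I_n -> R) : exists u, [/\ sys a u 0, bddv u & forall i, u i 0 = c i].
pose d:= (2 * (n%:R * K + 1))^-1.
have nK0 : 0 <= n%:R * K by exact: mulr_ge0.
have d0 : 0 < d by rewrite invr_gt0 mulr_gt0// ltr_wpDl.
have small : n%:R * K * d <= 2^-1.
 rewrite /d invfM mulrCA ler_piMr ?invr_ge0//.
 by rewrite ler_pdivrMr ?ltr_wpDl// mul1r lerDl.
have /choice[U hU] : forall N, exists u, frozen d c N u by move=> N;exact: frozen_exists (ltW d0) small.
pose N (s : R):= (Num.truncn (s / d)).+1.
have sN s : 0 <= s -> s <= (N s)%:R * d.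
 move=> s0;have /truncn_itv/andP[_] : 0 <= s / d by rewrite divr_ge0// ltW.
 by rewrite ltr_pdivrMr// => /ltW.
pose u : vecf:= fun i s => U (N s) i s.
have uE M i s : 0 <= s -> s <= M%:R * d -> u i s = U M i s.
 move=> s0 sM;have [l|/ltnW l]:= leqP (N s) M.
  exact: (frozen_agree (ltW d0) l (hU _) (hU _) i s0 (sN s s0)).
 by apply/esym;exact: (frozen_agree (ltW d0) l (hU _) (hU _) i s0 sM).
pose E:= \sum_i c i * c i.
have E0 : 0 <= E by apply: sumr_ge0 => i _;rewrite -expr2 sqr_ge0.
have UE M i s : 0 <= s -> `|U M i s| <= 1 + E.
 move=> s0;have [sU bU U0 _]:= hU M.
 have sU' : sys (cut 0 (M%:R * d)) (U M) 0 by move=> j;rewrite -[(0 : vecf) j]/(0 : R -> R) addr0;exact: sU.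
 have:= dot_const (skew_cut _ _) bU bU sU' sU' s0.
 rewrite [RHS](_ : _ = E);last by apply: eq_bigr => j _;rewrite U0.
 move=> e;have : U M i s * U M i s <= E.
  rewrite -e /dotv (bigD1 i)//= lerDl;apply: sumr_ge0 => j _;by rewrite -expr2 sqr_ge0.
 rewrite -expr2 -real_normK ?num_real//;have:= sqr_ge0 (`|U M i s| - 1);rewrite sqrrB1 expr2.
 have:= sqr_ge0 `|U M i s|;rewrite expr2;lra.
have bu : bddv u by exists (1 + E) => [|i s s0];[rewrite addr_ge0|exact: UE].
have mU M j : measurable_fun D (U M j) by case: (hU M) => sU _ _ _;exact: prim_meas (sU j).
have bU M : bddv (U M) by case: (hU M).
have Mbig x : exists M0, forall M, (M0 <= M)%N -> x <= M%:R * d.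
 exists (Num.bound (x / d)) => M hM;rewrite -ler_pdivrMr//.
 have:= archi_boundP (normr_ge0 (x / d)) => h.
 apply: leT (ler_norm _) _;apply: leT (ltW h) _;rewrite ler_nat.
 by apply: leq_trans hM;rewrite /Num.bound normr_id.
have lu i : l2 (mulv a u i).
 have lUM M : l2 (mulv a (U M) i) by exact: l2_mulv.
 have []:= @l2_fatouT R false (fun M => mulv a (U M) i) (mulv a u i) (\sum_j (1 + E) * nrm (a i j)) lUM _ _ => //.
  move=> M;have -> : mulv a (U M) i = \sum_j (U M j * a i j).
   by apply/funext => s;rewrite fct_sumE;apply: eq_bigr => j _;rewrite mulfE mulrC.
  have lj j : l2 (U M j * a i j) by apply: (l2M (c:= 1 + E)) => // x /dom_ge0;exact: UE.
  apply: leT (nrm_sum _ lj) _;apply: ler_sum => j _;apply: nrmM => //;last by rewrite addr_ge0.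
  by move=> x /dom_ge0;exact: UE.
 move=> x /dom_ge0 x0;have [M0 hM0]:= Mbig x.
 apply: cvg_near_cst;exists M0 => // M /= hM.
 by apply: eq_bigr => j _;rewrite (uE M)// hM0.
exists u;split => // [i|i];last by rewrite (uE 0%N) ?mul0r//;case: (hU 0%N).
rewrite -[(0 : vecf) i]/(0 : R -> R) addr0;split => // x y /dom_ge0 x0 /dom_ge0 y0.
have [M0 hM0]:= Mbig (Num.max x y);have hM:= hM0 M0 (leqnn _).
have xM : x <= M0%:R * d by apply: leT hM;rewrite le_max lexx.
have yM : y <= M0%:R * d by apply: leT hM;rewrite le_max lexx orbT.
have [sU _ _ _]:= hU M0;rewrite (uE M0)// (uE M0)//.
have [_ ->]:= sU i;[|exact/dom_ge0|exact/dom_ge0].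
apply: ip_eq => z /dom_ge0 z0;rewrite [ind x y z]indE.
have key : 0 < z -> z <= M0%:R * d -> mulv (cut 0 (M0%:R * d)) (U M0) i z = mulv a u i z.
 move=> zz zM;rewrite mulv_cut_in;last by rewrite ind_le ?zz ?zM// mulr_ge0// ltW.
 by apply: eq_bigr => j _;rewrite (uE M0).
case: (boolP (x < z <= y)) => [/andP[h1 h2]|_].
 by rewrite key// ?(le_lt_trans x0)// (leT h2).
case: (boolP (y < z <= x)) => [/andP[h1 h2]|_];last by rewrite subrr !mulr0.
by rewrite key// ?(le_lt_trans y0)// (leT h2).
Qed.

End Existence.
End SkewSystems.

(** * Calculus on the half-line: null functions, Riemann sums, time integrals *)

Section HalfLine.
Variable R : realType.
Import HalfLine.
Local Notation D:= (@dom R false).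
Local Notation mu:= (@lebesgue_measure R).
Local Notation rn:= (@rn R).
Local Notation chain:= (nat -> R -> R).

Implicit Types (T e d t tau x y s r : R).

Definition ext (f : R -> R) : R -> R:= f \_ D.

Lemma extE f x : 0 <= x -> ext f x = f x.
by move=> x0;rewrite /ext patchE ifT// inE;exact/dom_ge0. Qed.

Lemma ip_ext f h : ipT (ext f) h = ip f h.
rewrite !ipE /Rintegral [in RHS]integral_mkcond;congr fine;apply: eq_integral => x _.
by rewrite /ext !patchE;case: ifP;rewrite ?mul0r.
Qed.

Lemma l2_ext f : l2 f -> l2T (ext f).
move=> [mf fi];split.
 by apply/(measurable_restrictT _ _).1 => //;exact: mdom.
move: fi;rewrite [in X in X -> _]integral_mkcond;congr (_ < _)%E;apply: eq_integral => x _.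
by rewrite /ext !patchE;case: ifP;rewrite ?expr0n.
Qed.

Lemma nrm_ext f : nrmT (ext f) = nrm f.
rewrite !nrmE ip_ext;congr Num.sqrt;apply: ip_eq => x /dom_ge0 x0;by rewrite extE.
Qed.

Lemma stek_ext (r x : R) f : stek r (ext f) x = (2 * r)^-1 * ip f (ind (x - r) (x + r)).
by rewrite stekE ip_ext. Qed.

(** At a point x > 0 the means of small radius are integrals over subintervals of the half-line,
    hence zero, and they converge to [g] almost everywhere. *)
Lemma zero_ae g : l2 g -> (forall x y, 0 <= x -> 0 <= y -> ip g (ind x y) = 0) ->
 {ae mu, forall x, D x -> g x = 0} /\ nrm g = 0.
move=> lg h;have le:= l2_ext lg.
have a1 : {ae mu, forall x, ext g x = 0}.
 apply: (aeS2 _ (stek_cvg_ae le) (ae_neq2 0 0)) => x hx [/eqP x0 _].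
 have [xp|xn]:= ltP 0 x;last first.
  by rewrite /ext patchE ifF//;apply/negbTE;rewrite notin_setE => /dom_ge0 x0';apply: x0;apply/le_anti;rewrite xn.
 have [n0 hn]:= rn_small xp.
 have : stek (rn n) (ext g) x @[n --> \oo] --> (0 : R).
  apply: cvg_near_cst;exists n0 => // n /= /hn hr;rewrite stek_ext h ?mulr0//;first by rewrite subr_ge0.
  by rewrite addr_ge0// ltW// rn_gt0.
 by move=> /cvg_lim c;rewrite -(cvg_lim (@Rhausdorff R) hx) c.
split;first by apply: (aeS _ a1) => x e /dom_ge0 x0;rewrite -e extE.
rewrite -nrm_ext;apply/eqP;rewrite -sqrf_eq0 nrm_sq;apply/eqP.
by rewrite (ip_ae le (l20 R true) le a1) ip0l.
Qed.

(** Over an interval of length e^2 the local sup bound reads |f s| e <= e^2 |f'|, with e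
    arbitrary. *)
Lemma prim_zero f f' : prim f f' -> l2 f -> nrm f = 0 -> forall s, 0 <= s -> f s = 0.
move=> p lf z s s0;apply/eqP;rewrite -normr_le0.
apply: (@le_eps R _ 0 (nrm f'));first exact: nrm_ge0.
move=> e e0 _;rewrite add0r.
have ds : D s by exact/dom_ge0.
have:= prim_sup_local p lf ds e0.
have ds' : D (s + e ^+ 2) by apply/dom_ge0;rewrite addr_ge0// exprn_ge0// ltW.
have n1 : nrm (ind s (s + e ^+ 2) * f) <= 0 by rewrite -z;exact: nrm_indM.
have n2:= @nrm_indM R false f' s (s + e ^+ 2) (prim_l2 p).
move=> h;have h2 : `|f s| * e <= e * nrm f' * e.
 apply: leT h _;rewrite -[leRHS]add0r;apply: lerD => //.
 rewrite (_ : e * nrm f' * e = e ^+ 2 * nrm f');last by ring.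
 by apply: ler_wpM2l => //;rewrite exprn_ge0// ltW.
by rewrite ler_pM2r in h2.
Qed.

(** Consequently a chain is determined by its bottom level: everywhere below the top, up to a null
    set at the top. *)
Lemma chain_zero k (c : chain) : isH k c -> (forall s, 0 <= s -> c 0%N s = 0) ->
 forall j, (j <= k)%N -> nrm (c j) = 0 /\ ((j < k)%N -> forall s, 0 <= s -> c j s = 0).
move=> hc c0;have e0 : nrm (c 0%N) = 0.
 by rewrite (@nrm_eq R false (c 0%N) 0) ?nrm0// => x /dom_ge0;exact: c0.
elim=> [|j IH] jk;first by split.
have [_ z]:= IH (ltnW jk);have pj:= isH_prim hc jk.
have ipz x y : 0 <= x -> 0 <= y -> ip (c j.+1) (ind x y) = 0.
 by move=> x0 y0;case: pj => _ <-;rewrite ?z ?subrr//;exact/dom_ge0.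
have [az nz]:= zero_ae (isH_l2 hc jk) ipz;split=> // jk1 s s0.
exact: prim_zero (isH_prim hc jk1) (isH_l2 hc jk) nz s s0.
Qed.

(* Dyadic Riemann sums: with W sampled at left end points, rs n t tau approximates the integral over [t, t + tau]. *)
Section RiemannSums.
Variables (V : lmodType R) (H : V -> Prop) (N : V -> R).
Hypotheses (HD : forall u v, H u -> H v -> H (u + v)) (HZ : forall (c : R) u, H u -> H (c *: u)).
Hypotheses (ND : forall u v, H u -> H v -> N (u + v) <= N u + N v)
 (NZ : forall (c : R) u, H u -> N (c *: u) = `|c| * N u).
Variable W : R -> V.
Hypothesis HW : forall t, 0 <= t -> H (W t).
Implicit Types (B : R) (G : V) (n m : nat).

Fixpoint rs n t tau : V:= if n is n'.+1 then rs n' t (tau / 2) + rs n' (t + tau / 2) (tau / 2) else tau *: W t.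

Let half_ge0 t : 0 <= t -> 0 <= t / 2. by move=> t0;rewrite divr_ge0. Qed.

Lemma H_rs n t tau : 0 <= t -> 0 <= tau -> H (rs n t tau).
elim: n t tau => [|n IH] t tau t0 tau0 /=;first by apply: HZ;exact: HW.
by apply: HD;apply: IH => //;rewrite ?addr_ge0 ?half_ge0.
Qed.

Let HB u v : H u -> H v -> H (u - v).
by move=> hu hv;apply: HD => //;rewrite -scaleN1r;exact: HZ. Qed.

Lemma rs_bound n t tau G B : 0 <= t -> 0 <= tau -> H G ->
 (forall x, t <= x -> x <= t + tau -> N (W x - G) <= B) -> N (rs n t tau - tau *: G) <= tau * B.
move=> + + hG;elim: n t tau => [|n IH] t tau t0 tau0 h /=.
 rewrite -scalerBr NZ;last by apply: HB => //;exact: HW.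
 by rewrite ger0_norm//;apply: ler_wpM2l => //;apply: h;rewrite ?lerDl.
have th:= half_ge0 tau0;have t0' : 0 <= t + tau / 2 by exact: addr_ge0.
have e : t + tau / 2 + tau / 2 = t + tau by rewrite -addrA -splitr.
have -> : rs n t (tau / 2) + rs n (t + tau / 2) (tau / 2) - tau *: G =
  (rs n t (tau / 2) - (tau / 2) *: G) + (rs n (t + tau / 2) (tau / 2) - (tau / 2) *: G).
 by rewrite addrACA -opprD -scalerDl -splitr.
have hh x : 0 <= x -> H (rs n x (tau / 2) - (tau / 2) *: G).
 by move=> x0;apply: HB;[exact: H_rs|exact: HZ].
apply: leT (ND (hh t t0) (hh _ t0')) _.
rewrite [X in X * B](splitr tau) mulrDl;apply: lerD;apply: IH => // x x1 x2;apply: h => //.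
- by apply: leT x2 _;rewrite -e lerDl.
- by apply: leT x1;rewrite lerDl.
- by rewrite -e.
Qed.

Lemma rs_refine n m t tau e : (n <= m)%N -> 0 <= t -> 0 <= tau ->
 (forall x y, t <= x -> x <= y -> y <= t + tau -> y - x <= tau / 2 ^+ n -> N (W y - W x) <= e) ->
 N (rs m t tau - rs n t tau) <= tau * e.
elim: n m t tau => [|n IH] m t tau nm t0 tau0 h.
 apply: rs_bound => //;first exact: HW.
 by move=> x x1 x2;apply: h => //;rewrite expr0 divr1 lerBlDl.
case: m nm => // m nm /=.
have th:= half_ge0 tau0;have t0' : 0 <= t + tau / 2 by exact: addr_ge0.
have e' : t + tau / 2 + tau / 2 = t + tau by rewrite -addrA -splitr.
rewrite opprD addrACA.
have hh x : 0 <= x -> H (rs m x (tau / 2) - rs n x (tau / 2)) by move=> x0;apply: HB;exact: H_rs.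
apply: leT (ND (hh t t0) (hh _ t0')) _.
have ee : tau / 2 / 2 ^+ n = tau / 2 ^+ n.+1 by rewrite exprS invfM mulrA.
rewrite [X in X * e](splitr tau) mulrDl;apply: lerD;apply: IH => // x y x1 xy y1;rewrite ee => d;apply: h => //.
- by apply: leT y1 _;rewrite -e' lerDl.
- by apply: leT x1;rewrite lerDl.
- by rewrite -e'.
Qed.

End RiemannSums.

(** Forward differentiability, uniform on bounded time intervals: the scalar form in which mean
    value inequalities deliver time derivatives. *)
Definition pdiff (f g : R -> R):= forall T e, 0 < e -> exists2 d, 0 < d & forall t t', 0 <= t -> t <= t' ->
 t' <= T -> t' - t <= d -> `|f t' - f t - (t' - t) * g t| <= e * (t' - t).

Lemma two_pow_small (T d : R) : 0 < d -> exists n, T / 2 ^+ n <= d.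
move=> d0;have : 0 < d / (`|T| + 1) by rewrite divr_gt0// ltr_pwDr.
move=> /rn_small[n hn];exists n;have:= hn n (leqnn _);rewrite /rn exprVn ler_pdivlMr ?ltr_pwDr// => h.
rewrite mulrC;apply: leT h;apply: ler_wpM2l;first by rewrite invr_ge0 exprn_ge0.
by apply: leT (ler_norm T) _;rewrite lerDl.
Qed.

Lemma rs_pdiff (f g : R -> R) t tau : pdiff f g -> 0 <= t -> 0 <= tau ->
 (@rs R^o g n t tau) @[n --> \oo] --> f (t + tau) - f t.
move=> h t0 tau0;apply/cvgrPdist_le => e e0.
have e1 : 0 < e / (tau + 1) by rewrite divr_gt0// ltr_wpDl.
have [d d0 hd]:= h (t + tau) _ e1.
have [n0 hn0]:= two_pow_small tau d0.
have key n x y : 0 <= x -> 0 <= y -> x + y <= t + tau -> y / 2 ^+ n <= d ->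
  `|f (x + y) - f x - @rs R^o g n x y| <= e / (tau + 1) * y.
 elim: n x y => [|n IH] x y x0 y0 xy yd /=.
  have:= hd x (x + y) x0;rewrite lerDl => /(_ y0 xy);rewrite addrAC subrr add0r.
  by apply;move: yd;rewrite expr0 divr1.
 have yh : 0 <= y / 2 by rewrite divr_ge0.
 have ee : y / 2 / 2 ^+ n = y / 2 ^+ n.+1 by rewrite exprS invfM mulrA.
 have e' : x + y / 2 + y / 2 = x + y by rewrite -addrA -splitr.
 have l1 : x + y / 2 <= t + tau by apply: leT xy;rewrite -e' lerDl.
 have i1:= IH x (y / 2) x0 yh l1;have i2:= IH (x + y / 2) (y / 2) (addr_ge0 x0 yh).
 rewrite e' ee in i2;rewrite ee in i1.
 have:= i1 yd;have:= i2 yh xy yd.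
 set A:= @rs R^o g n _ _;set B:= @rs R^o g n _ _ => h1 h2.
 have -> : f (x + y) - f x - (B + A) = (f (x + y / 2) - f x - B) + (f (x + y) - f (x + y / 2) - A) by ring.
 apply: leT (ler_normD _ _) _;
 have -> : e / (tau + 1) * y = e / (tau + 1) * (y / 2) + e / (tau + 1) * (y / 2) by rewrite -mulrDr -splitr.
 exact: lerD.
exists n0 => // n /= nn.
apply: leT (key n t tau t0 tau0 (lexx _) _) _.
 apply: leT hn0;apply: ler_wpM2l => //;rewrite lef_pV2 ?posrE ?exprn_gt0//.
 by rewrite ler_weXn2l// ler1n.
by rewrite mulrAC ler_pdivrMr ?ltr_wpDl//;apply: ler_wpM2l;[exact: ltW|rewrite lerDl].
Qed.

Definition ucont (g : R -> R):= forall T e, 0 < e -> exists2 d, 0 < d & forall t t', 0 <= t -> t <= t' ->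
 t' <= T -> t' - t <= d -> `|g t' - g t| <= e.

Lemma ucont_meas g : ucont g -> measurable_fun D g.
move=> h;have c : continuous (fun x : R => g (Num.max 0 x) : R).
 move=> x;apply/cvgrPdist_le => e e0.
 have [d d0 hd]:= h (Num.max 0 x + 1) e e0.
 pose r:= Num.min d 1;have r0 : 0 < r by rewrite lt_min d0 ltr01.
 near=> y;have xy : `|x - y| < r by near: y;exact: cvgr_dist_lt.
 have rd : r <= d by rewrite ge_min lexx. have r1 : r <= 1 by rewrite ge_min lexx orbT.
 have xm : 0 <= Num.max 0 x by rewrite le_max lexx.
 have ym : 0 <= Num.max 0 y by rewrite le_max lexx.
 have l : `|Num.max 0 x - Num.max 0 y| <= `|x - y|.
  exact: (clamp_lip false x y).
 have l' : `|Num.max 0 x - Num.max 0 y| <= r by apply: leT l (ltW xy).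
 have [m|/ltW m]:= leP (Num.max 0 x) (Num.max 0 y).
  rewrite distrC;apply: hd => //.
   by move: l';rewrite distrC ger0_norm ?subr_ge0//;lra.
  by move: l';rewrite distrC ger0_norm ?subr_ge0//;lra.
 apply: hd => //;first by rewrite lerDl.
 by move: l';rewrite ger0_norm ?subr_ge0//;lra.
have m:= continuous_measurable_fun c.
apply: (eq_measurable_fun (fun x => g (Num.max 0 x))).
 by move=> x;rewrite inE => /dom_ge0 x0;rewrite max_r.
exact: measurable_funS m.
Unshelve. all: by end_near. Qed.

Lemma ucont_bounded g T : ucont g -> exists2 M, 0 <= M & forall t, 0 <= t -> t <= T -> `|g t| <= M.
move=> h;have [d d0 hd]:= h T 1 ltr01.
have key n : forall t, 0 <= t -> t <= T -> t <= n%:R * d -> `|g t| <= `|g 0| + n%:R.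
 elim: n => [|n IH] t t0 tT td.
  have -> : t = 0 by apply/le_anti;rewrite t0 andbT;move: td;rewrite mul0r.
  by rewrite addr0.
 have [l|/ltW l]:= leP t (n%:R * d).
  by apply: leT (IH t t0 tT l) _;rewrite lerD2l ler_nat.
 have nd : 0 <= n%:R * d by rewrite mulr_ge0// ltW.
 have a:= IH (n%:R * d) nd (leT l tT) (lexx _).
 have b : `|g t - g (n%:R * d)| <= 1.
  by apply: hd => //;move: td;rewrite -natr1 mulrDl mul1r;lra.
 have:= ler_normD (g t - g (n%:R * d)) (g (n%:R * d));rewrite subrK -natr1;lra.
exists (`|g 0| + (Num.bound (T / d))%:R) => [|t t0 tT];first by rewrite addr_ge0.
apply: key => //;rewrite -ler_pdivrMr//;have:= archi_boundP (normr_ge0 (T / d)) => b.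
apply: (@leT _ _ (T / d));first by apply: ler_wpM2r => //;rewrite invr_ge0 ltW.
by apply: leT (ler_norm _) _;move: b;rewrite /Num.bound normr_id => /ltW.
Qed.

Definition tint (g : R -> R) t:= ip g (ind 0 t).

Lemma tint0 g : tint g 0 = 0.
by rewrite /tint ind_refl ipC ip0l. Qed.

Lemma tint_bound g t t' c B : ucont g -> 0 <= t -> t <= t' -> 0 <= B ->
 (forall x, t <= x -> x <= t' -> `|g x - c| <= B) -> `|tint g t' - tint g t - (t' - t) * c| <= (t' - t) * B.
move=> ug t0 tt B0 h;have t'0:= leT t0 tt.
have [M M0 hM]:= ucont_bounded t' ug;have mg:= ucont_meas ug.
have d0 : D 0 by exact/dom_ge0. have dt : D t by exact/dom_ge0. have dt' : D t' by exact/dom_ge0.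
have lI x y : 0 <= x -> 0 <= y -> l2 (ind x y) by move=> x0 y0;apply: l2_ind;exact/dom_ge0.
(* [g] need not be square integrable at infinity. Freezing it after t' makes it bounded, and a
   product with an indicator is then in L2 with the same integrals. *)
pose G : R -> R:= fun x => g (Num.min x t').
have mG : measurable_fun D G.
 apply: ucont_meas => T e e0;have [d dd hd]:= ug t' e e0;exists d => // x y x0 xy _ yd.
 apply: hd;rewrite ?le_min ?x0 ?t'0 ?ge_min ?lexx ?orbT//.
  by rewrite xy.
 by rewrite /Num.min;case: ltP => h1;case: ltP => h2;move: h1 h2 yd xy;lra.
have GM x : D x -> `|G x| <= M by move=> /dom_ge0 x0;apply: hM;rewrite ?le_min ?x0 ?t'0 ?ge_min ?lexx ?orbT.
have Gg x : x <= t' -> G x = g x by move=> xt;rewrite /G min_l.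
have lGI x y : 0 <= x -> 0 <= y -> l2 (G * ind x y) by move=> x0 y0;apply: (l2M (c:= M)) => //;exact: lI.
have e0 x y : 0 <= x -> x <= y -> y <= t' -> ip g (ind x y) = ip (G * ind 0 t') (ind x y).
 move=> x0 xy yt;apply: ip_eq => z /dom_ge0 z0;rewrite mulfE !ind_le//.
 case: (boolP (x < z <= y)) => [/andP[z1 z2]|_];last by rewrite !mulr0.
 have zt:= leT z2 yt;by rewrite (Gg z zt) (le_lt_trans x0 z1) zt /= !mulr1.
have lG:= lGI 0 t' (lexx 0) t'0.
rewrite /tint (e0 0 t')// (e0 0 t)//.
have -> : ind 0 t' = ind 0 t + ind t t' :> (R -> R) by rewrite ind_chasles.
rewrite ind_chasles.
have -> : ip (G * ind 0 t') (ind 0 t') = ip (G * ind 0 t') (ind 0 t) + ip (G * ind 0 t') (ind t t').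
 by rewrite -(ipDr (lI 0 t (lexx _) t0) (lI t t' t0 t'0) lG) ind_chasles.
have -> : (t' - t) * c = ip (c *: ind t t') (ind t t').
 by rewrite (ipZl _ (lI _ _ t0 t'0) (lI _ _ t0 t'0)) ip_ind// mulrC.
pose Y : R -> R:= ind t t' * (G * ind 0 t') - c *: ind t t'.
have lY : l2 Y by apply: l2B;[exact: l2_indM|apply: l2Z;exact: lI].
have -> : ip (G * ind 0 t') (ind 0 t) + ip (G * ind 0 t') (ind t t') - ip (G * ind 0 t') (ind 0 t) -
  ip (c *: ind t t') (ind t t') = ip Y (ind t t').
 rewrite /Y (ipBl (l2_indM _ _ lG) (l2Z _ (lI _ _ t0 t'0)) (lI _ _ t0 t'0)).
 congr (_ - _);rewrite addrAC subrr add0r;apply: ip_eq => z _.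
 by rewrite !mulfE (ind_le _ tt);case: (boolP (t < z <= t')) => _;rewrite ?mulr1 ?mul1r ?mulr0 ?mul0r.
rewrite mulrC;apply: loc_int => //;first by rewrite subr_ge0.
move=> z z0;rewrite (addrC t) subrK /Y !fE !ind_le//.
case: (boolP (t < z <= t')) => [/andP[z1 z2]|_];last by rewrite mul0r mulr0 subrr normr0 mulr0.
by rewrite mul1r !mulr1 normr1 mulr1 (le_lt_trans t0 z1) z2 mulr1 Gg//;apply: h => //;exact: ltW.
Qed.

Lemma tint_pdiff g : ucont g -> pdiff (tint g) g.
move=> ug T e e0;have [d d0 hd]:= ug T e e0;exists d => // t t' t0 tt tT td.
rewrite [leRHS]mulrC;apply: tint_bound => //;first exact: ltW.
by move=> x x1 x2;apply: hd => //;[exact: leT x2 tT|move: x2 td;lra].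
Qed.

End HalfLine.

(** * Time integrals of curves of chains *)

Section ChainPrimitive.
Variable R : realType.
Import HalfLine.
Local Notation chain:= (nat -> R -> R).
Implicit Types (T e d t tau x y s : R) (n m i j : nat).

Definition ucontN k (W : R -> chain):= forall T e, 0 < e -> exists2 d, 0 < d & forall t t', 0 <= t -> t <= t' ->
 t' <= T -> t' - t <= d -> NH k (W t' - W t) <= e.

Lemma cvg_subseq (u : nat -> R) (phi : nat -> nat) (l : R) : (forall i, (i <= phi i)%N) ->
 u n @[n --> \oo] --> l -> u (phi i) @[i --> \oo] --> l.
move=> hp h;apply: cvg_comp h => A [n0 _ hA];exists n0 => // i /= hi;apply: hA => /=.
exact: leq_trans hi (hp i).
Qed.

Variables (k : nat) (W : R -> chain).
Hypothesis HW : forall t, 0 <= t -> isH k.+1 (W t).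
Hypothesis UW : ucontN k.+1 W.
Local Notation N:= (NH k.+1).
Local Notation rsW:= (@rs R chain W).

Lemma rs_chain n t tau j s : rsW n t tau j s = @rs R R^o (fun x => W x j s) n t tau.
by elim: n t tau => [//|n IH] t tau /=;rewrite -!IH. Qed.

Lemma W_ucont s : 0 <= s -> ucont (fun t => W t 0%N s).
move=> s0 T e e0;have [d d0 hd]:= UW T e0;exists d => // t t' t0 tt tT td.
have h:= isHB (HW (leT t0 tt)) (HW t0).
apply: leT (hd t t' t0 tt tT td);apply: leT (isH_sup (x:= s) h (ltn0Sn k) _) _.
 exact/dom_ge0.
by apply: NH_le.
Qed.

Let HD:= (@isHD R false k.+1).
Let HZ:= (@isHZ R false k.+1).
Let ND:= (@NHD R false k.+1).
Let NZ:= (@NHZ R false k.+1).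

Lemma local_integral t tau : 0 <= t -> 0 <= tau -> exists I : chain, [/\ isH k.+1 I,
 forall (G : chain) (B : R), isH k.+1 G -> (forall x, t <= x -> x <= t + tau -> N (W x - G) <= B) ->
  N (I - tau *: G) <= tau * B &
 forall s, 0 <= s -> I 0%N s = tint (fun x => W x 0%N s) (t + tau) - tint (fun x => W x 0%N s) t].
move=> t0 tau0.
have hrs n : isH k.+1 (rsW n t tau) by apply: (H_rs HD HZ HW).
have /choice[phi hphi] : forall i, exists n0, forall m, (n0 <= m)%N -> N (rsW m t tau - rsW n0 t tau) <= 2^-1 ^+ i.
 move=> i;have e0 : 0 < 2^-1 ^+ i / (tau + 1) by rewrite divr_gt0 ?ltr_wpDl// exprn_gt0.
 have [d d0 hd]:= UW (t + tau) e0;have [n0 hn0]:= two_pow_small tau d0.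
 exists n0 => m hm;apply: leT (rs_refine HD HZ ND NZ HW hm t0 tau0 (e:= 2^-1 ^+ i / (tau + 1)) _) _.
  move=> x y x1 xy y1 yd;apply: hd => //;[exact: leT x1|exact: leT yd hn0].
 rewrite mulrCA ger_pMr ?exprn_gt0//.
 by rewrite ler_pdivrMr ?ltr_wpDl// mul1r lerDl.
(* A strictly increasing choice of refinement levels beyond the required thresholds, along which
   increments are geometric. *)
pose Phi:= fix F i : nat:= if i is i'.+1 then (maxn (F i') (phi i)).+1 else phi 0%N.
have Phi_phi i : (phi i <= Phi i)%N by case: i => [//|i] /=;apply: leqW;exact: leq_maxr.
have Phi_phi' i : (phi i <= Phi i.+1)%N by apply: leq_trans (Phi_phi i) _;apply: leqW;exact: leq_maxl.
have Phi_i i : (i <= Phi i)%N by elim: i => [//|i IH] /=;rewrite ltnS;apply: leq_trans IH (leq_maxl _ _).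
have step i : N (rsW (Phi i.+1) t tau - rsW (Phi i) t tau) <= 2 * 2^-1 ^+ i.
 have -> : rsW (Phi i.+1) t tau - rsW (Phi i) t tau = (rsW (Phi i.+1) t tau - rsW (phi i) t tau) - (rsW (Phi i) t tau - rsW (phi i) t tau).
  by rewrite opprB addrA subrK.
 apply: leT (NHB (isHB (hrs _) (hrs _)) (isHB (hrs _) (hrs _))) _.
 rewrite (mulr_natl _ 2) mulr2n;exact: lerD (hphi i _ (Phi_phi' i)) (hphi i _ (Phi_phi i)).
have [I hI cI]:= isH_complete (fun i => hrs (Phi i)) step.
have eI c : N (c - I) = N (I - c) by rewrite -NHN opprB.
exists I;split => //.
 move=> G B hG hB;set C:= k.+2%:R * (2 * 2) in cI.
 apply: (@le_eps R _ _ C);first by rewrite mulr_ge0.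
 move=> e e0 _;have [i hi]:= rn_small e0;have {}hi:= hi i (leqnn i).
 have -> : I - tau *: G = (I - rsW (Phi i) t tau) + (rsW (Phi i) t tau - tau *: G) by rewrite addrA subrK.
 have h1:= cI i;rewrite eI in h1.
 have h2:= rs_bound HD HZ ND NZ HW (Phi i) t0 tau0 hG hB.
 apply: leT (NHD (isHB hI (hrs _)) (isHB (hrs _) (isHZ tau hG))) _.
 rewrite addrC;apply: lerD => //;apply: leT h1 _;rewrite mulrC;apply: ler_wpM2r => //.
 by rewrite mulr_ge0.
move=> s s0;have ds : @dom R false s by exact/dom_ge0.
have c1 : rsW (Phi i) t tau 0%N s @[i --> \oo] --> I 0%N s.
 apply/subr_cvg0;apply: (@geo_cvg0 R (k.+2%:R * (2 * 2))) => i;apply: leT (cI i).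
 apply: leT (isH_sup (x:= s) (isHB (hrs _) hI) (ltn0Sn k) ds) _;exact: NH_le.
have c2:= cvg_subseq Phi_i (rs_pdiff (tint_pdiff (W_ucont s0)) t0 tau0).
rewrite -(cvg_lim (@Rhausdorff R) c1) -(cvg_lim (@Rhausdorff R) c2);congr (limn _).
by apply/funext => i;rewrite rs_chain.
Qed.

(** The integrals over [0, t] and over [t, t'] are built independently; they fit together because
    their bottom levels do and a chain is determined by its bottom level. *)
Lemma chain_primitive : exists U : R -> chain, [/\ forall t, 0 <= t -> isH k.+1 (U t),
 forall s t, 0 <= s -> 0 <= t -> U t 0%N s = tint (fun x => W x 0%N s) t &
 forall t t' (G : chain) (B : R), 0 <= t -> t <= t' -> isH k.+1 G ->
  (forall x, t <= x -> x <= t' -> N (W x - G) <= B) -> N (U t' - U t - (t' - t) *: G) <= (t' - t) * B].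
have /choice[U hU] : forall t, exists I, 0 <= t -> isH k.+1 I /\ forall s, 0 <= s -> I 0%N s = tint (fun x => W x 0%N s) t.
 move=> t;have [t0|]:= boolP (0 <= t);last by exists 0.
 have [I [hI _ h]]:= local_integral (lexx 0) t0;exists I => _;split => // s s0.
 by rewrite h// add0r tint0 subr0.
have HU t : 0 <= t -> isH k.+1 (U t) by move=> t0;case: (hU t t0).
have U0 t s : 0 <= t -> 0 <= s -> U t 0%N s = tint (fun x => W x 0%N s) t by move=> t0 s0;case: (hU t t0) => _;apply.
exists U;split => // [s t s0 t0|t t' G B t0 tt hG hB];first exact: U0.
have t'0:= leT t0 tt;have tau0 : 0 <= t' - t by rewrite subr_ge0.
have [I [hI bI I0]]:= local_integral t0 tau0.
have e : t + (t' - t) = t' by rewrite addrC subrK.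
have hd : isH k.+1 (U t' - U t - I) by apply: isHB => //;apply: isHB;exact: HU.
have d0 s : 0 <= s -> (U t' - U t - I) 0%N s = 0.
 by move=> s0;rewrite -[LHS]/(U t' 0%N s - U t 0%N s - I 0%N s) !U0// I0// e subrr.
have z : N (U t' - U t - I) = 0.
 by rewrite /NH big1// => j _;case: (chain_zero hd d0 (ltn_ord j : (j <= k.+1)%N)).
have -> : U t' - U t - (t' - t) *: G = (U t' - U t - I) + (I - (t' - t) *: G) by rewrite addrA subrK.
apply: leT (NHD hd (isHB hI (isHZ _ hG))) _;rewrite z add0r.
by apply: bI => // x x1 x2;apply: hB => //;rewrite -e.
Qed.

End ChainPrimitive.

(** * Orthonormal frames and their time derivative *)

Section Frames.
Variable R : realType.
Import HalfLine.
Local Notation D:= (@dom R false).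
Local Notation chain:= (nat -> R -> R).
Local Notation vecf:= ('I_3 -> R -> R).
Implicit Types (x y s tau : R) (k l : R -> R) (F G : 'I_3 -> vecf) (c r : 'I_3).

Definition o0 : 'I_3:= @Ordinal 3 0 isT.
Definition o1 : 'I_3:= @Ordinal 3 1 isT.
Definition o2 : 'I_3:= @Ordinal 3 2 isT.

Lemma sum3 (Z : nmodType) (f : 'I_3 -> Z) : \sum_i f i = f o0 + f o1 + f o2.
by rewrite !big_ord_recl big_ord0 addr0 addrA;congr (_ + _ + _);congr f;apply: val_inj.
Qed.

Lemma ord3P (P : 'I_3 -> Prop) : P o0 -> P o1 -> P o2 -> forall i, P i.
move=> h0 h1 h2 [[|[|[|i]]] hi] //;[rewrite (_ : Ordinal hi = o0)|rewrite (_ : Ordinal hi = o1)|rewrite (_ : Ordinal hi = o2)];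
 by [|apply: val_inj].
Qed.

(** The parallel (Bishop) frame p, q, v with p' = -k v, q' = -l v, v' = k p + l q. Unlike the Frenet
    frame it exists where the curvature vanishes. *)
Definition curvm k l : 'I_3 -> 'I_3 -> R -> R:= fun i j s =>
 match nat_of_ord i, nat_of_ord j with
 | 0%N, 2%N => - k s | 1%N, 2%N => - l s | 2%N, 0%N => k s | 2%N, 1%N => l s | _, _ => 0
 end.

Lemma skew_curvm k l : skew (curvm k l).
by move=> i j s;move: i j;do 2 apply: ord3P;rewrite /curvm /= ?oppr0 ?opprK. Qed.

Lemma sys3 k l (u g : vecf) : prim (u o0) (g o0 - k * u o2) -> prim (u o1) (g o1 - l * u o2) ->
 prim (u o2) (g o2 + k * u o0 + l * u o1) -> sys (curvm k l) u g.
move=> p0 p1 p2;apply: ord3P;[apply: prim_eq p0|apply: prim_eq p1|apply: prim_eq p2] => // s _;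
 rewrite !fE /mulv sum3 /curvm /=;ring.
Qed.

Lemma sys3_inv k l (u g : vecf) : sys (curvm k l) u g -> [/\ prim (u o0) (g o0 - k * u o2),
 prim (u o1) (g o1 - l * u o2) & prim (u o2) (g o2 + k * u o0 + l * u o1)].
move=> h;split;[apply: prim_eq (h o0)|apply: prim_eq (h o1)|apply: prim_eq (h o2)] => // s _;
 rewrite fE /mulv sum3 /curvm /= !fE;ring.
Qed.

(** [F c r] is the c-th Cartesian coordinate of the r-th frame vector, so that for each fixed c the
    three numbers solve one scalar skew system. In [orth] the sum runs over the frame vectors;
    orthonormality of the vectors themselves is the transposed statement. *)
Definition frame k l F:= forall c, sys (curvm k l) (F c) 0 /\ bddv (F c).
Definition orth F:= forall s, 0 <= s -> forall c c', dotv (F c) (F c') s = (c == c')%:R.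

Lemma frame_prim k l F c : frame k l F -> [/\ prim (F c o0) (- (k * F c o2)), prim (F c o1) (- (l * F c o2)) &
 prim (F c o2) (k * F c o0 + l * F c o1)].
move=> /(_ c)[/sys3_inv[p0 p1 p2] _];split;[apply: prim_eq p0|apply: prim_eq p1|apply: prim_eq p2] => // s _;
 rewrite !fE -[(0 : vecf) _ s]/(0 : R);ring.
Qed.

Lemma frame_orth k l F : frame k l F -> (forall c c', dotv (F c) (F c') 0 = (c == c')%:R) -> orth F.
move=> hF h s s0 c c';have [sc bc]:= hF c;have [sc' bc']:= hF c'.
by rewrite (dot_const (skew_curvm k l) bc bc' sc sc' s0).
Qed.

(** A one-sided inverse of a square matrix is two-sided. *)
Lemma orth_rows F s r r' : orth F -> 0 <= s -> \sum_c F c r s * F c r' s = (r == r')%:R.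
move=> h s0;pose M : 'M[R]_3:= \matrix_(i, j) F j i s.
have e : M^T *m M = 1%:M.
 apply/matrixP => i j;rewrite !mxE -(h s s0 i j);apply: eq_bigr => q _;by rewrite !mxE.
by have /matrixP/(_ r r'):= mulmx1C e;rewrite !mxE => <-;apply: eq_bigr => q _;rewrite !mxE.
Qed.

Lemma orth_bound F s c r : orth F -> 0 <= s -> `|F c r s| <= 1.
move=> h s0;have:= h s s0 c c;rewrite eqxx /dotv => e.
have : F c r s ^+ 2 <= 1.
 by rewrite -[leRHS]e (bigD1 r)//= expr2 lerDl sumr_ge0// => j _;rewrite -expr2 sqr_ge0.
by move=> q;rewrite -ler_sqr ?nnegrE// real_normK ?num_real// expr1n.
Qed.

Lemma orth_expand F s (z : 'I_3 -> R) r : orth F -> 0 <= s ->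
 z r = \sum_c (\sum_r' F c r' s * z r') * F c r s.
move=> h s0;under eq_bigr do rewrite big_distrl /=.
rewrite exchange_big /=.
have e r' : \sum_c F c r' s * z r' * F c r s = (r' == r)%:R * z r'.
 by rewrite -(orth_rows r' r h s0) big_distrl /=;apply: eq_bigr => c _;ring.
rewrite (eq_bigr _ (fun r' _ => e r')) (bigD1 r)//= eqxx mul1r big1 ?addr0//.
by move=> r' /negbTE ->;rewrite mul0r.
Qed.

(** Variation of constants: pairing with the frame removes the homogeneous part, and what is left is
    an antiderivative of the paired source. *)
Lemma skew_growth k l F (u g : vecf) s r : frame k l F -> orth F -> bddv u -> sys (curvm k l) u g ->
 (forall i, l2 (g i)) -> 0 <= s ->
 `|u r s| <= 3 * (\sum_i `|u i 0| + Num.sqrt s * \sum_i nrm (g i)).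
move=> hF oF bu su lg s0;have d0 : D 0 by exact/dom_ge0. have ds : D s by exact/dom_ge0.
pose X c:= dotv (F c) u.
have mF c i : measurable_fun D (F c i) by case: (hF c) => sF _;exact: prim_meas (sF i).
have F1 c i x : D x -> `|F c i x| <= 1 by move/dom_ge0;exact: orth_bound.
have lFg c i : l2 (F c i * g i) by apply: (l2M (c:= 1)) => // x;exact: F1.
have hX c : `|X c s| <= \sum_i `|u i 0| + Num.sqrt s * \sum_i nrm (g i).
 have [sF bF]:= hF c;have p:= dot_sys (skew_curvm k l) bF bu sF su.
 have:= prim_holder p d0 ds;rewrite subr0 (ger0_norm s0) => h.
 have n1 : nrm (fun x => dotv 0 u x + dotv (F c) g x) <= \sum_i nrm (g i).
  rewrite (_ : (fun x => _) = \sum_i F c i * g i);last first.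
   apply/funext => x;rewrite fct_sumE /dotv [X in X + _]big1 ?add0r//.
   by move=> i _;rewrite -[(0 : vecf) i x]/(0 : R) mul0r.
  apply: leT (nrm_sum _ (lFg c)) _;apply: ler_sum => i _;rewrite -[leRHS]mul1r.
  by apply: nrmM => // x;exact: F1.
 have e0 : `|X c 0| <= \sum_i `|u i 0|.
  apply: leT (ler_norm_sum _ _ _) _;apply: ler_sum => i _;rewrite normrM -[leRHS]mul1r.
  by apply: ler_wpM2r => //;exact: F1.
 rewrite -[X c s](subrK (X c 0)) addrC;apply: leT (ler_normD _ _) _;apply: lerD => //.
 by apply: leT h _;rewrite mulrC;apply: ler_wpM2l => //;exact: sqrtr_ge0.
rewrite (orth_expand (fun i => u i s) r oF s0);apply: leT (ler_norm_sum _ _ _) _.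
set M:= _ + _ in hX *.
have -> : 3 * M = \sum_(c < 3) M by rewrite sumr_const card_ord mulr_natl.
apply: ler_sum => c _;rewrite normrM -[leRHS]mulr1;apply: ler_pM => //;first exact: hX.
exact: F1.
Qed.

Lemma frame_exists k l (init : 'I_3 -> 'I_3 -> R) (M : R) : l2 k -> l2 l -> 0 <= M ->
 (forall s, 0 <= s -> `|k s| <= M /\ `|l s| <= M) ->
 (forall c c', \sum_r init c r * init c' r = (c == c')%:R) ->
 exists F, [/\ frame k l F, orth F & forall c r, F c r 0 = init c r].
move=> lk ll M0 b oi.
have la i j : l2 (curvm k l i j).
 by move: i j;do 2 apply: ord3P;rewrite /curvm /=;try exact: l20;try exact: l2N;by [].
have aM i j s : 0 <= s -> `|curvm k l i j s| <= M.
 move=> s0;have [b1 b2]:= b s s0.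
 by move: i j;do 2 apply: ord3P;rewrite /curvm /= ?normr0 ?normrN.
have ex c : exists u, [/\ sys (curvm k l) u 0, bddv u & forall i, u i 0 = init c i].
 exact: ode_exists M0 la aM (skew_curvm k l) (init c).
have /choice[F hF]:= ex;have fF : frame k l F by move=> c;case: (hF c).
exists F;split => //;last by move=> c r;case: (hF c).
apply: frame_orth fF _ => c c';rewrite -oi;apply: eq_bigr => i _.
by case: (hF c) => _ _ ->;case: (hF c') => _ _ ->.
Qed.

(** The cyclic successor of an index; with it [cr] is the c-th component of the cross product. *)
Definition nx c : 'I_3:= match nat_of_ord c with 0%N => o1 | 1%N => o2 | _ => o0 end.
Definition cr (f g : 'I_3 -> R -> R) c : R -> R:= f (nx c) * g (nx (nx c)) - f (nx (nx c)) * g (nx c).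
Definition row F r : 'I_3 -> R -> R:= fun c => F c r.
Definition righthanded F s:= forall c, [/\ cr (row F o1) (row F o2) c s = F c o0 s,
 cr (row F o2) (row F o0) c s = F c o1 s & cr (row F o0) (row F o1) c s = F c o2 s].

(* the three cross products of the rows solve the same system *)
Lemma frame_righthanded k l F : frame k l F -> orth F -> righthanded F 0 -> forall s, 0 <= s -> righthanded F s.
move=> hF oF h0 s s0 c.
pose G : vecf:= fun r => match nat_of_ord r with 0%N => cr (row F o1) (row F o2) c | 1%N => cr (row F o2) (row F o0) c
 | _ => cr (row F o0) (row F o1) c end.
have F1 c' i x : D x -> `|F c' i x| <= 1 by move/dom_ge0;exact: orth_bound.
have pm c1 c2 r1 r2 f1 f2 : prim (F c1 r1) f1 -> prim (F c2 r2) f2 ->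
 prim (F c1 r1 * F c2 r2) (f1 * F c2 r2 + F c1 r1 * f2).
 by move=> p1 p2;exact: (prim_mul p1 p2 (F1 c1 r1) (F1 c2 r2)).
have [a1 b1 v1]:= frame_prim (nx c) hF;have [a2 b2 v2]:= frame_prim (nx (nx c)) hF.
have sG : sys (curvm k l) G 0.
 apply: sys3.
 - apply: prim_eq (primB (pm _ _ _ _ _ _ b1 v2) (pm _ _ _ _ _ _ b2 v1)) => // x _.
  by rewrite /G /cr /row /= !fE -[(0 : vecf) _ x]/(0 : R);ring.
 - apply: prim_eq (primB (pm _ _ _ _ _ _ v1 a2) (pm _ _ _ _ _ _ v2 a1)) => // x _.
  by rewrite /G /cr /row /= !fE -[(0 : vecf) _ x]/(0 : R);ring.
 - apply: prim_eq (primB (pm _ _ _ _ _ _ a1 b2) (pm _ _ _ _ _ _ a2 b1)) => // x _.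
  by rewrite /G /cr /row /= !fE -[(0 : vecf) _ x]/(0 : R);ring.
have bG : bddv G.
 exists 2 => // i x x0;have d : D x by exact/dom_ge0.
 have b (p q p' q' : R) : `|p| <= 1 -> `|q| <= 1 -> `|p'| <= 1 -> `|q'| <= 1 -> `|p * q - p' * q'| <= 2.
  move=> hp hq hp' hq';apply: leT (ler_normB _ _) _;rewrite !normrM (natrD _ 1 1).
  by apply: lerD;rewrite -[leRHS]mulr1;apply: ler_pM.
 by move: i;apply: ord3P;rewrite /G /cr /row /= !fE;apply: b;exact: F1.
have [sF bF]:= hF c;have [h1 h2 h3]:= h0 c.
have e:= sys_unique (skew_curvm k l) bG bF sG sF _ _ s0.
have e0 : forall i, G i 0 = F c i 0 by apply: ord3P.
by split;[exact: (e e0 o0)|exact: (e e0 o1)|exact: (e e0 o2)].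
Qed.

(* time derivative of the frame predicted by the zero curvature equations *)
Definition omg (p : chain * chain) s : R:= - 2^-1 * (p.1 0%N s ^+ 2 + p.2 0%N s ^+ 2).
Definition spin (p : chain * chain) F c : vecf:= fun r => match nat_of_ord r with
 | 0%N => fun s => p.2 1%N s * F c o2 s + omg p s * F c o1 s
 | 1%N => fun s => - p.1 1%N s * F c o2 s - omg p s * F c o0 s
 | _ => fun s => p.1 1%N s * F c o1 s - p.2 1%N s * F c o0 s end.
Definition field0 (p : chain * chain) : (R -> R) * (R -> R) :=
 (fun s => - (p.2 2%N s + 2^-1 * (p.1 0%N s ^+ 2 + p.2 0%N s ^+ 2) * p.2 0%N s),
  fun s => p.1 2%N s + 2^-1 * (p.1 0%N s ^+ 2 + p.2 0%N s ^+ 2) * p.1 0%N s).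

Section Step.
Variables (p p' : chain * chain) (F F' : 'I_3 -> vecf) (tau M : R).
Hypotheses (h1 : isH 2 p.1) (h2 : isH 2 p.2) (h1' : isH 2 p'.1) (h2' : isH 2 p'.2).
Hypotheses (hF : frame (p.1 0%N) (p.2 0%N) F) (hF' : frame (p'.1 0%N) (p'.2 0%N) F') (oF : orth F) (oF' : orth F').
Hypotheses (M1 : 1 <= M) (tau0 : 0 <= tau).
Hypothesis pM : forall j s, (j < 2)%N -> 0 <= s -> `|p.1 j s| <= M /\ `|p.2 j s| <= M.

(** The error in predicting the later frame to first order in time. It solves the frame system of
    the later curvatures with [source] on the right, which is small when the curvatures move along
    the Schroedinger field: the zero curvature condition in integrated form. *)
Definition defect c : vecf:= fun r => F' c r - F c r - tau *: spin p F c r.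
Definition rho1 : R -> R:= p'.1 0%N - p.1 0%N - tau *: (field0 p).1.
Definition rho2 : R -> R:= p'.2 0%N - p.2 0%N - tau *: (field0 p).2.
Definition source c : vecf:= fun r => match nat_of_ord r with
 | 0%N => - (rho1 * F c o2) - tau *: ((p'.1 0%N - p.1 0%N) * spin p F c o2)
 | 1%N => - (rho2 * F c o2) - tau *: ((p'.2 0%N - p.2 0%N) * spin p F c o2)
 | _ => rho1 * F c o0 + rho2 * F c o1 + tau *: ((p'.1 0%N - p.1 0%N) * spin p F c o0 + (p'.2 0%N - p.2 0%N) * spin p F c o1)
 end.

Let Dx x : D x -> 0 <= x. by move/dom_ge0. Qed.
Let F1 c r x : D x -> `|F c r x| <= 1. by move/Dx;exact: orth_bound. Qed.
Let pM1 j x : (j < 2)%N -> D x -> `|p.1 j x| <= M. by move=> j2 /Dx x0;case: (pM j2 x0). Qed.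
Let pM2 j x : (j < 2)%N -> D x -> `|p.2 j x| <= M. by move=> j2 /Dx x0;case: (pM j2 x0). Qed.

Lemma omg_prim : prim (omg p) (- (p.1 0%N * p.1 1%N + p.2 0%N * p.2 1%N)).
have q1:= prim_mul (isH_prim h1 (j:= 0) isT) (isH_prim h1 (j:= 0) isT) (fun x => pM1 (j:= 0) isT) (fun x => pM1 (j:= 0) isT).
have q2:= prim_mul (isH_prim h2 (j:= 0) isT) (isH_prim h2 (j:= 0) isT) (fun x => pM2 (j:= 0) isT) (fun x => pM2 (j:= 0) isT).
by apply: prim_eq (primZ (- 2^-1) (primD q1 q2)) => x _;rewrite /omg !fE;field.
Qed.

Lemma omg_bound x : D x -> `|omg p x| <= M ^+ 2.
move=> d;rewrite /omg mulNr normrN ger0_norm ?mulr_ge0 ?invr_ge0 ?addr_ge0 ?sqr_ge0//.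
have q (z : R) : `|z| <= M -> z ^+ 2 <= M ^+ 2.
 by move=> zM;rewrite -real_normK ?num_real// ler_pXn2r ?nnegrE// (leT ler01).
have:= q _ (pM1 (j:= 0) isT d);have:= q _ (pM2 (j:= 0) isT d);lra.
Qed.

Lemma defect_sys c : sys (curvm (p'.1 0%N) (p'.2 0%N)) (defect c) (source c).
have [a b v]:= frame_prim c hF;have [a' b' v']:= frame_prim c hF'.
have pm (f g f' g' : R -> R) (A B : R) : (forall x, D x -> `|f x| <= A) -> (forall x, D x -> `|g x| <= B) ->
 prim f f' -> prim g g' -> prim (f * g) (f' * g + f * g').
 by move=> bf bg pf pg;exact: prim_mul pf pg bf bg.
have l1:= isH_prim h2 (j:= 1) isT;have k1:= isH_prim h1 (j:= 1) isT.
have Bl x:= pM2 (j:= 1) (x:= x) isT;have Bk x:= pM1 (j:= 1) (x:= x) isT.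
apply: sys3.
- have q:= primB (primB a' a) (primZ tau (primD (pm _ _ _ _ _ _ Bl (F1 c o2) l1 v) (pm _ _ _ _ _ _ omg_bound (F1 c o1) omg_prim b))).
 apply: prim_eq q => x _;first by rewrite /defect /spin /= !fE.
 by rewrite /defect /source /rho1 /field0 /spin /= /omg !fE;field.
- have q:= primB (primB b' b) (primZ tau (primB (primN (pm _ _ _ _ _ _ Bk (F1 c o2) k1 v)) (pm _ _ _ _ _ _ omg_bound (F1 c o0) omg_prim a))).
 apply: prim_eq q => x _;first by rewrite /defect /spin /= !fE;ring.
 by rewrite /defect /source /rho2 /field0 /spin /= /omg !fE;field.
- have q:= primB (primB v' v) (primZ tau (primB (pm _ _ _ _ _ _ Bk (F1 c o1) k1 b) (pm _ _ _ _ _ _ Bl (F1 c o0) l1 a))).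
 apply: prim_eq q => x _;first by rewrite /defect /spin /= !fE.
 by rewrite /defect /source /rho1 /rho2 /field0 /spin /= /omg !fE;field.
Qed.

Let M0 : 0 <= M. exact: leT ler01 M1. Qed.
Let MM : M <= M ^+ 2. by rewrite expr2 ler_peMr. Qed.
Let lk0 : l2 (p.1 0%N). exact: (isH_l2 h1 (leq0n 2)). Qed.
Let ll0 : l2 (p.2 0%N). exact: (isH_l2 h2 (leq0n 2)). Qed.
Let ldk : l2 (p'.1 0%N - p.1 0%N). by apply: l2B => //;exact: (isH_l2 h1' (leq0n 2)). Qed.
Let ldl : l2 (p'.2 0%N - p.2 0%N). by apply: l2B => //;exact: (isH_l2 h2' (leq0n 2)). Qed.

Lemma spin_bound c r x : D x -> `|spin p F c r x| <= 2 * M ^+ 2.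
move=> d;have q (z w z' w' : R) : `|z| <= M ^+ 2 -> `|z'| <= M ^+ 2 -> `|w| <= 1 -> `|w'| <= 1 -> `|z * w - z' * w'| <= 2 * M ^+ 2.
 move=> hz hz' hw hw';apply: leT (ler_normB _ _) _;rewrite !normrM (natrD _ 1 1) mulrDl mul1r.
 by apply: lerD;rewrite -[leRHS]mulr1;apply: ler_pM.
have b1:= leT (pM1 (j:= 1) isT d) MM;have b2:= leT (pM2 (j:= 1) isT d) MM.
have b3:= omg_bound d.
move: r;apply: ord3P;rewrite /spin /=.
- by rewrite -[X in _ + X]opprK -mulrN;apply: q;rewrite ?normrN//;exact: F1.
- by apply: q;rewrite ?normrN//;exact: F1.
- by apply: q => //;exact: F1.
Qed.

Lemma spin_meas c r : measurable_fun D (spin p F c r).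
have mF c' i : measurable_fun D (F c' i) by case: (hF c') => sF _;exact: prim_meas (sF i).
have mo : measurable_fun D (omg p):= prim_meas omg_prim.
have m1 : measurable_fun D (p.1 1%N):= prim_meas (isH_prim h1 (j:= 1) isT).
have m2 : measurable_fun D (p.2 1%N):= prim_meas (isH_prim h2 (j:= 1) isT).
move: r;apply: ord3P;rewrite /spin /=.
- by apply: measurable_funD;apply: measurable_funM.
- by apply: measurable_funB;apply: measurable_funM => //;exact: measurableT_comp.
- by apply: measurable_funB;apply: measurable_funM.
Qed.

Lemma l2_field0 : l2 (field0 p).1 /\ l2 (field0 p).2.
have aux f g : l2 f -> l2 g -> l2 (fun s => g s + 2^-1 * (p.1 0%N s ^+ 2 + p.2 0%N s ^+ 2) * f s).
 move=> lf lg;have -> : (fun s => g s + 2^-1 * (p.1 0%N s ^+ 2 + p.2 0%N s ^+ 2) * f s) = g + (fun s => - omg p s) * f.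
  by apply/funext => s;rewrite /omg !fE;ring.
 apply: l2D => //;apply: (l2M (c:= M ^+ 2)) => //;first by apply: measurableT_comp => //;exact: prim_meas omg_prim.
 by move=> x dx;rewrite normrN;exact: omg_bound.
split;last exact: aux lk0 (isH_l2 h1 (leqnn 2)).
exact: l2N (aux _ _ ll0 (isH_l2 h2 (leqnn 2))).
Qed.

Definition source_size:= nrm rho1 + nrm rho2 + tau * (2 * M ^+ 2) * (nrm (p'.1 0%N - p.1 0%N) + nrm (p'.2 0%N - p.2 0%N)).

Lemma source_bound c r : l2 (source c r) /\ nrm (source c r) <= source_size.
have [lf1 lf2]:= l2_field0.
have lr1 : l2 rho1 by apply: l2B => //;exact: l2Z.
have lr2 : l2 rho2 by apply: l2B => //;exact: l2Z.
have mF c' i : measurable_fun D (F c' i) by case: (hF c') => sF _;exact: prim_meas (sF i).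
have rF f i : l2 f -> l2 (f * F c i) /\ nrm (f * F c i) <= nrm f.
 move=> lf;rewrite mulrC;split;first by apply: (l2M (c:= 1)) => // x;exact: F1.
 by rewrite -[leRHS]mul1r;apply: nrmM => // x;exact: F1.
have sF f i : l2 f -> l2 (f * spin p F c i) /\ nrm (f * spin p F c i) <= 2 * M ^+ 2 * nrm f.
 have M20 : 0 <= 2 * M ^+ 2 by rewrite mulr_ge0// exprn_ge0.
 move=> lf;rewrite mulrC;split;first by apply: (l2M (c:= 2 * M ^+ 2) (spin_meas c i)) => // x;exact: spin_bound.
 by apply: nrmM => //;[exact: spin_meas|move=> x;exact: spin_bound].
have tz f : l2 f -> nrm (tau *: f) = tau * nrm f by move=> lf;rewrite nrmZ// ger0_norm.
have n1:= nrm_ge0 false rho1;have n2:= nrm_ge0 false rho2.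
have n3:= nrm_ge0 false (p'.1 0%N - p.1 0%N);have n4:= nrm_ge0 false (p'.2 0%N - p.2 0%N).
have tM : 0 <= tau * (2 * M ^+ 2) by rewrite !mulr_ge0// exprn_ge0.
have [a1 b1]:= rF rho1 o2 lr1;have [a2 b2]:= rF rho2 o2 lr2.
have [a3 b3]:= rF rho1 o0 lr1;have [a4 b4]:= rF rho2 o1 lr2.
have [a5 b5]:= sF _ o2 ldk;have [a6 b6]:= sF _ o2 ldl;have [a7 b7]:= sF _ o0 ldk;have [a8 b8]:= sF _ o1 ldl.
have tb f g : nrm f <= 2 * M ^+ 2 * nrm g -> tau * nrm f <= tau * (2 * M ^+ 2) * nrm g.
 by move=> h;rewrite -mulrA;exact: ler_wpM2l.
have p3:= mulr_ge0 tM n3;have p4:= mulr_ge0 tM n4.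
rewrite /source_size [X in _ + X]mulrDr.
move: r;apply: ord3P;rewrite /source /=;split.
- by apply: l2B;[exact: l2N|exact: l2Z].
- apply: leT (nrmB (l2N a1) (l2Z _ a5)) _;rewrite nrmN tz//;have:= tb _ _ b5;move: b1 n2 p4;lra.
- by apply: l2B;[exact: l2N|exact: l2Z].
- apply: leT (nrmB (l2N a2) (l2Z _ a6)) _;rewrite nrmN tz//;have:= tb _ _ b6;move: b2 n1 p3;lra.
- by apply: l2D;[exact: l2D|apply: l2Z;exact: l2D].
- apply: leT (nrmD (l2D a3 a4) (l2Z _ (l2D a7 a8))) _;rewrite (tz _ (l2D a7 a8)).
 have e1:= nrmD a3 a4;have e2:= ler_wpM2l tau0 (nrmD a7 a8).
 have e3:= tb _ _ b7;have e4:= tb _ _ b8;move: b3 b4 e1 e2 e3 e4.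
 move: (nrm (_ * spin p F c o0)) (nrm (_ * spin p F c o1)) (nrm (_ + _)) => A B C;clear a1 b1 a2 b2 a5 b5 a6 b6 p3 p4 tb sF rF tz a3 a4 a7 a8.
 move: (nrm (_ + _)) (nrm (p'.1 0%N - _)) (nrm (p'.2 0%N - _)) (nrm rho1) (nrm rho2) (nrm (rho1 * _)) (nrm (rho2 * _)).
 by move=> *;lra.
Qed.

Lemma defect_bound c r s : 0 <= s ->
 `|defect c r s| <= 3 * (\sum_i `|defect c i 0| + Num.sqrt s * (3 * source_size)).
move=> s0;have bd : bddv (defect c).
 exists (1 + 1 + tau * (2 * M ^+ 2));first by rewrite !addr_ge0// !mulr_ge0// exprn_ge0.
 move=> i x x0;have d : D x by exact/dom_ge0.
 rewrite /defect !fE;apply: leT (ler_normB _ _) _;apply: lerD.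
  by apply: leT (ler_normB _ _) _;apply: lerD;[exact: orth_bound|exact: F1].
 by rewrite normrM ger0_norm//;apply: ler_wpM2l => //;exact: spin_bound.
apply: leT (skew_growth r hF' oF' bd (defect_sys c) (fun i => proj1 (source_bound c i)) s0) _.
rewrite ler_pM2l//;apply: lerD => //;apply: ler_wpM2l;first exact: sqrtr_ge0.
have -> : 3 * source_size = \sum_(i < 3) source_size by rewrite sumr_const card_ord mulr_natl.
by apply: ler_sum => i _;case: (source_bound c i).
Qed.

End Step.

End Frames.

(** * Evolution of the frame under the Schroedinger flow *)

Section MovingFrame.
Variable R : realType.
Import HalfLine.
Local Notation D:= (@dom R false).
Local Notation chain:= (nat -> R -> R).
Local Notation V:= (chain * chain)%type.
Local Notation vecf:= ('I_3 -> R -> R).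
Implicit Types (T e d t tau x y s : R) (f g : R -> R) (w : V) (F G : 'I_3 -> vecf) (c r : 'I_3) (k j n : nat).

Lemma l2_restrict f : l2T f -> l2 f /\ nrm f <= nrmT f.
move=> [mf fi].
have lf : l2 f.
 split;first exact: measurable_funTS mf.
 apply: le_lt_trans fi;apply: ge0_subset_integral => //.
 - exact: mdom.
 - exact: mdom.
 - by apply/measurable_EFinP;exact: measurable_funX.
 - by move=> x _;rewrite lee_fin sqr_ge0.
split=> //;rewrite -nrm_ext;apply: nrm_le => //;first exact: l2_ext.
by move=> x _;rewrite /ext patchE;case: ifP;rewrite ?normr0.
Qed.

Lemma prim_restrict f g : primT f g -> prim f g.
move=> [lg h];split;first by case: (l2_restrict lg).
move=> x y /dom_ge0 x0 /dom_ge0 y0;rewrite h// -ip_ext;apply: ip_eq => z _.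
have [z0|z0]:= leP 0 z;first by rewrite extE.
rewrite indE [x < z]ltNge [y < z]ltNge (ltW (lt_le_trans z0 x0)) (ltW (lt_le_trans z0 y0)) /=.
by rewrite subrr !mulr0.
Qed.

Lemma isH_restrict k (c : chain) : isHT k c -> isH k c.
by move=> [l p];split => j jk;[case: (l2_restrict (l j jk))|exact: prim_restrict (p j jk)].
Qed.

Lemma nrm_np k w j : HP k w -> (j <= k)%N -> nrm (w.1 j) <= NP k w /\ nrm (w.2 j) <= NP k w.
move=> hw jk;have [la lb]:= HP_l2 hw jk;have h:= NP_np w jk.
split.
 exact: leT (proj2 (l2_restrict la)) (leT (hyp_l _ (nrm_ge0 _ _)) h).
exact: leT (proj2 (l2_restrict lb)) (leT (hyp_r _ (nrm_ge0 _ _)) h).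
Qed.

Lemma HP_sup k w j s : HP k w -> (j < k)%N -> `|w.1 j s| <= NP k w /\ `|w.2 j s| <= NP k w.
move=> [h1 h2] jk;split.
 exact: leT (isH_sup (x:= s) h1 jk I) (leT (NH_le true _ jk) (NH_NP1 _ _)).
exact: leT (isH_sup (x:= s) h2 jk I) (leT (NH_le true _ jk) (NH_NP2 _ _)).
Qed.

(** The mean of f' around 0 is a centred quotient of an even function, hence zero, and it tends to
    f' 0 with the radius. *)
Lemma even_deriv0 f f' f'' : primT f f' -> primT f' f'' -> (forall s, f (- s) = f s) -> f' 0 = 0.
move=> p1 p2 ev;apply/eqP;rewrite -normr_le0;apply: (@le_eps R _ 0 (nrmT f''));first exact: nrm_ge0.
(* The window then has length e^2, and Cauchy-Schwarz turns the integral of |f''| over it into e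
   times a norm. *)
move=> e e0 _;rewrite add0r;pose r:= e ^+ 2 / 2.
have r0 : 0 < r by rewrite divr_gt0 ?exprn_gt0.
have l1:= prim_l2 p1;have [l2n nn]:= l2_norm (prim_l2 p2).
have h:= stek_close_pt r0 0 p2 l1.
have z : stek r f' 0 = 0.
 by rewrite (stek_of_prim r p1) dqE !fE /tr /= !add0r ev subrr mulr0.
rewrite z sub0r normrN in h;apply: leT h _.
rewrite stekE mulrA divff ?mul1r ?gt_eqF ?mulr_gt0//;apply: leT (ler_norm _) _.
apply: leT (CS l2n (l2_indT _ _)) _;rewrite nn mulrC;apply: ler_wpM2r;first exact: nrm_ge0.
rewrite nrm_ind// sub0r add0r opprK -mulr2n -mulr_natr /r -mulrA mulVf// mulr1 ger0_norm ?sqr_ge0//.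
by rewrite sqrtr_sqr ger0_norm// ltW.
Qed.

Lemma evenP_deriv0 w : HP 2 w -> evenP w -> w.1 1%N 0 = 0 /\ w.2 1%N 0 = 0.
move=> [h1 h2] ev;split.
 by apply: even_deriv0 (isH_prim h1 (j:= 0) isT) (isH_prim h1 (j:= 1) isT) _ => s;case: (ev s).
by apply: even_deriv0 (isH_prim h2 (j:= 0) isT) (isH_prim h2 (j:= 1) isT) _ => s;case: (ev s).
Qed.

Lemma mvt_bound (f df : R -> R) (a b : R) (M : R) : (forall x, is_derive x 1 f (df x)) ->
 (forall x, `|x - a| <= `|b - a| -> `|df x - df a| <= M) -> `|f b - f a - df a * (b - a)| <= M * `|b - a|.
move=> hd hM.
have cf : continuous f.
 by move=> x;apply: differentiable_continuous;apply/derivable1_diffP;exact: (@ex_derive _ _ _ _ _ _ _ (hd x)).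
have [ab|/ltW ba]:= leP a b.
 have [c cab ->]:= MVT_segment ab (fun x _ => hd x) (continuous_subspaceT cf).
 rewrite -mulrBl normrM;apply: ler_wpM2r => //;apply: hM.
 by move: cab;rewrite in_itv /= => /andP[h1 h2];rewrite !ger0_norm ?subr_ge0// lerD2r.
have [c cab e]:= MVT_segment ba (fun x _ => hd x) (continuous_subspaceT cf).
have e2 : f b - f a = df c * (b - a) by rewrite -opprB e;ring.
rewrite e2 -mulrBl normrM;apply: ler_wpM2r => //;apply: hM.
move: cab;rewrite in_itv /= => /andP[h1 h2];rewrite !ler0_norm ?subr_le0// lerN2 lerD2r//.
Qed.

Lemma sin_cos_lip x y : `|sin x - sin y| <= `|x - y| /\ `|cos x - cos y| <= `|x - y|.
have b1 (z : R) : `|cos z| <= 1 by rewrite ler_norml cos_geN1 cos_le1.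
have b2 (z : R) : `|sin z| <= 1 by rewrite ler_norml sin_geN1 sin_le1.
have key (f df : R -> R) : (forall z : R, is_derive z 1 f (df z)) -> (forall z, `|df z| <= 1) -> `|f x - f y| <= `|x - y|.
 move=> hd h1.
 have cf : continuous f.
  by move=> z;apply: differentiable_continuous;apply/derivable1_diffP;exact: (@ex_derive _ _ _ _ _ _ _ (hd z)).
 wlog xy : x y / x <= y.
  by move=> wl;have [|/ltW]:= leP x y;[exact: wl|rewrite distrC (distrC x);exact: wl].
 have [c _ e]:= MVT_segment xy (fun z _ => hd z) (continuous_subspaceT cf).
 rewrite distrC e normrM (distrC x) -[leRHS]mul1r;exact: ler_wpM2r.
split;first by apply: (key _ (@cos R)) => // z;exact: is_derive_sin.
by apply: (key _ (fun z => - sin z)) => z;rewrite normrN.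
Qed.

Lemma cos_taylor x y : `|cos y - cos x + (y - x) * sin x| <= (y - x) ^+ 2.
have h : `|cos y - cos x - (- sin x) * (y - x)| <= `|y - x| * `|y - x|.
 apply: (@mvt_bound (@cos R) (fun z => - sin z)) => z hz.
 by apply: leT hz;rewrite -opprD normrN;have []:= sin_cos_lip z x.
have -> : cos y - cos x + (y - x) * sin x = cos y - cos x - (- sin x) * (y - x) by ring.
by apply: leT h _;rewrite -normrM -expr2 ger0_norm ?sqr_ge0.
Qed.

Lemma sin_taylor x y : `|sin y - sin x - (y - x) * cos x| <= (y - x) ^+ 2.
have h : `|sin y - sin x - cos x * (y - x)| <= `|y - x| * `|y - x|.
 apply: (@mvt_bound (@sin R) (@cos R)) => z hz.
 by apply: leT hz;have []:= sin_cos_lip z x.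
have -> : sin y - sin x - (y - x) * cos x = sin y - sin x - cos x * (y - x) by ring.
by apply: leT h _;rewrite -normrM -expr2 ger0_norm ?sqr_ge0.
Qed.

Section Along.
Variables (m : nat) (psi : R -> V).
Hypotheses (hpsi : nls m psi) (epsi : forall t, 0 <= t -> evenP (psi t)).

Let HPpsi t : 0 <= t -> HP m.+2 (psi t). by case: hpsi => h _ _ _;exact: h. Qed.
Let HP2 t : 0 <= t -> HP 2 (psi t). by move=> t0;apply: HP_le (HPpsi t0). Qed.

Let m02 : (m <= m.+2)%N. by rewrite leqW. Qed.
Let HPm t : 0 <= t -> HP m (psi t). by move=> t0;exact: HP_le m02 (HPpsi t0). Qed.

Lemma psi_bound T : exists2 M, 1 <= M & forall t, 0 <= t -> t <= T -> NP m.+2 (psi t) <= M.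
case: hpsi => _ /(_ T)[M hM] _ _;exists (Num.max 1 M);first by rewrite le_max lexx.
by move=> t t0 tT;apply: leT (hM t t0 tT) _;rewrite le_max lexx orbT.
Qed.

Lemma psi_incr T e : 0 < e -> exists2 d, 0 < d & forall t t', 0 <= t -> t <= t' -> t' <= T -> t' - t <= d ->
 NP m (psi t' - psi t - (t' - t) *: field (psi t)) <= (t' - t) * e /\ NP m.+2 (psi t' - psi t) <= e.
move=> e0;have [M M1 hM]:= psi_bound T;have M0:= leT ler01 M1.
case: (hpsi) => _ _ fc fo.
pose L:= 1 + 6 * algc R m ^+ 2 * M ^+ 2.
have L1 : 1 <= L by rewrite lerDl mulr_ge0 ?sqr_ge0// mulr_ge0// sqr_ge0.
have L0 : 0 < L by exact: lt_le_trans ltr01 L1.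
have [d d0 hd]:= fc T (e / L) (divr_gt0 e0 L0).
exists d => // t t' t0 tt tT td;split;last first.
 apply: leT (hd t t' t0 tt tT td) _;rewrite ler_pdivrMr//;exact: ler_peMr (ltW e0) L1.
apply: fo => //;[exact: HP_field (HPpsi t0)|exact: ltW|].
move=> x tx xt;have x0:= leT t0 tx;have xT:= leT xt tT.
have m12 : (m.+1 <= m.+2)%N by [].
have b y : 0 <= y -> y <= T -> NP m.+1 (psi y) <= M by move=> y0 yT;exact: leT (NP_le _ m12) (hM y y0 yT).
apply: leT (NP_field_lip (HPpsi x0) (HPpsi t0) (b x x0 xT) (b t t0 (leT tt tT))) _.
rewrite -/L;have : NP m.+2 (psi x - psi t) <= e / L.
 by apply: hd => //;apply: leT td;rewrite lerD2r.
by rewrite ler_pdivlMr// mulrC.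
Qed.

Definition om0 t:= omg (psi t) 0.

Lemma om0_ucont : ucont om0.
move=> T e e0;have [M M1 hM]:= psi_bound T;have M0:= lt_le_trans ltr01 M1.
have e1 : 0 < e / (2 * M) by rewrite divr_gt0// mulr_gt0.
have [d d0 hd]:= psi_incr T e1;exists d => // t t' t0 tt tT td.
have [_ b]:= hd t t' t0 tt tT td;have t'0:= leT t0 tt.
have [a1 a2]:= HP_sup 0 (HPpsi t0) (ltn0Sn _ : (0 < m.+2)%N).
have [c1 c2]:= HP_sup 0 (HPpsi t'0) (ltn0Sn _ : (0 < m.+2)%N).
have [b1 b2]:= HP_sup 0 (HPB (HPpsi t'0) (HPpsi t0)) (ltn0Sn _ : (0 < m.+2)%N).
have hMt:= hM t t0 (leT tt tT);have hMt':= hM t' t'0 tT.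
have q (z z' : R) : `|z| <= M -> `|z'| <= M -> `|z' - z| <= e / (2 * M) -> `|z' ^+ 2 - z ^+ 2| <= e.
 move=> h h' hb;rewrite subr_sqr normrM.
 have -> : e = e / (2 * M) * (2 * M) by rewrite divfK// gt_eqF// mulr_gt0.
 apply: ler_pM => //;apply: leT (ler_normD _ _) _;rewrite (mulr_natl _ 2) mulr2n;exact: lerD.
have q1:= q _ _ (leT a1 hMt) (leT c1 hMt') (leT b1 b).
have q2:= q _ _ (leT a2 hMt) (leT c2 hMt') (leT b2 b).
rewrite /om0 /omg -mulrBr mulNr normrN normrM [`|2^-1|]ger0_norm ?invr_ge0// opprD addrACA.
have:= ler_normD ((psi t').1 0%N 0 ^+ 2 - (psi t).1 0%N 0 ^+ 2) ((psi t').2 0%N 0 ^+ 2 - (psi t).2 0%N 0 ^+ 2).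
by move: q1 q2;lra.
Qed.

(** At s = 0 evenness removes the terms with k_s and l_s from the predicted motion: the frame only
    turns about e_3, with angular velocity [om0], and [theta] is the angle. *)
Definition theta t:= tint om0 t.

Definition init t c r : R:= match nat_of_ord c, nat_of_ord r with
 | 0%N, 0%N => cos (theta t) | 0%N, 1%N => - sin (theta t) | 1%N, 0%N => sin (theta t) | 1%N, 1%N => cos (theta t)
 | 2%N, 2%N => 1 | _, _ => 0 end.

Lemma init_orth t c c' : \sum_r init t c r * init t c' r = (c == c')%:R.
have e:= cos2Dsin2 (theta t);rewrite !expr2 in e.
move: c c';do 2 apply: ord3P;rewrite sum3 /init /= ?mulr0 ?mul0r ?addr0 ?add0r ?mulr1//;try by rewrite -e;ring.
all: ring.
Qed.

Lemma init_righthanded t F : (forall c r, F c r 0 = init t c r) -> righthanded F 0.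
move=> h;have e:= cos2Dsin2 (theta t);rewrite !expr2 in e.
apply: ord3P;split;rewrite /cr /row /nx !fE /= !h /init /= ?mulr0 ?mul0r ?mulr1 ?mul1r ?subr0 ?sub0r ?oppr0 ?opprK//;
 by rewrite -e;ring.
Qed.

Lemma moving_frame_exists : exists F : R -> 'I_3 -> vecf, forall t, 0 <= t ->
 [/\ frame ((psi t).1 0%N) ((psi t).2 0%N) (F t), orth (F t), (forall c r, F t c r 0 = init t c r) &
   forall s, 0 <= s -> righthanded (F t) s].
have /choice[F hF] : forall t, exists F, 0 <= t ->
 [/\ frame ((psi t).1 0%N) ((psi t).2 0%N) F, orth F & forall c r, F c r 0 = init t c r].
 move=> t;have [t0|]:= boolP (0 <= t);last by exists (fun _ _ _ => 0).
 have [h1 h2]:= HPpsi t0;have [l1 _]:= l2_restrict (isH_l2 h1 (leq0n _));have [l2' _]:= l2_restrict (isH_l2 h2 (leq0n _)).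
 have [F hF]:= frame_exists l1 l2' (NP_ge0 m.+2 (psi t)) (fun s _ => HP_sup s (HPpsi t0) (ltn0Sn _)) (@init_orth t).
 by exists F.
exists F => t t0;have [a b c]:= hF t t0;split => // s s0.
by apply: frame_righthanded a b (init_righthanded c) s s0.
Qed.

Variable F : R -> 'I_3 -> vecf.
Hypothesis hF : forall t, 0 <= t -> [/\ frame ((psi t).1 0%N) ((psi t).2 0%N) (F t), orth (F t) & forall c r, F t c r 0 = init t c r].

Lemma init_incr T e : 0 < e -> exists2 d, 0 < d & forall t t' c r, 0 <= t -> t <= t' -> t' <= T -> t' - t <= d ->
 `|F t' c r 0 - F t c r 0 - (t' - t) * spin (psi t) (F t) c r 0| <= e * (t' - t).
move=> e0;have e2 : 0 < e / 2 by rewrite divr_gt0.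
have [M M0 hM]:= ucont_bounded T om0_ucont.
have [d1 d10 hd1]:= tint_pdiff om0_ucont T e2.
(* The first bound controls the linearisation of the angle; the second makes the quadratic Taylor
   remainder at most e / 2 times t' - t. *)
pose d:= Num.min d1 (e / 2 / (M + e / 2) ^+ 2).
have Me : 0 < M + e / 2 by rewrite ltr_wpDl.
have d0 : 0 < d by rewrite lt_min d10 divr_gt0// exprn_gt0.
exists d => // t t' c r t0 tt tT;rewrite le_min => /andP[td td2];have t'0:= leT t0 tt.
have [_ _ i1]:= hF t0;have [_ _ i2]:= hF t'0.
have tau0 : 0 <= t' - t by rewrite subr_ge0.
have [z1 z2]:= evenP_deriv0 (HP2 t0) (epsi t0).
have b1:= hd1 t t' t0 tt tT td;rewrite -/(theta t') -/(theta t) in b1.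
have b2 : `|theta t' - theta t| <= (M + e / 2) * (t' - t).
 have -> : theta t' - theta t = (t' - t) * om0 t + (theta t' - theta t - (t' - t) * om0 t) by ring.
 apply: leT (ler_normD _ _) _;rewrite [leRHS]mulrDl;apply: lerD => //.
 by rewrite normrM ger0_norm// mulrC;apply: ler_wpM2r => //;apply: hM => //;exact: leT tt tT.
have b3 : (theta t' - theta t) ^+ 2 <= e / 2 * (t' - t).
 rewrite -real_normK ?num_real//;apply: leT (_ : ((M + e / 2) * (t' - t)) ^+ 2 <= _).
  by rewrite ler_pXn2r ?nnegrE// mulr_ge0// ltW.
 rewrite exprMn [X in _ * X]expr2 mulrA;apply: ler_wpM2r => //.
 by move: td2;rewrite ler_pdivlMr ?exprn_gt0// mulrC.
have cb (z : R) : `|cos z| <= 1 by rewrite ler_norml cos_geN1 cos_le1.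
have sb (z : R) : `|sin z| <= 1 by rewrite ler_norml sin_geN1 sin_le1.
have key (A q : R) : `|A| <= (theta t' - theta t) ^+ 2 -> `|q| <= 1 ->
  `|A + (theta t' - theta t - (t' - t) * om0 t) * q| <= e * (t' - t).
 move=> hA hq;apply: leT (ler_normD _ _) _.
 have -> : e * (t' - t) = e / 2 * (t' - t) + e / 2 * (t' - t) by rewrite -mulrDl -splitr.
 apply: lerD;first exact: leT hA b3.
 by rewrite normrM -[leRHS]mulr1;exact: ler_pM.
have et0 : 0 <= e * (t' - t) by rewrite mulr_ge0// ltW.
have ct:= cos_taylor (theta t) (theta t');have st:= sin_taylor (theta t) (theta t').
move: c r;do 2 apply: ord3P;rewrite /spin /= !i1 !i2 /init /= -/(om0 t) ?z1 ?z2.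
- have:= key _ (- sin (theta t)) ct;rewrite normrN => /(_ (sb _));congr (`|_| <= _);ring.
- have:= key (- (sin (theta t') - sin (theta t) - (theta t' - theta t) * cos (theta t))) (- cos (theta t)).
 rewrite !normrN => /(_ st (cb _));congr (`|_| <= _);ring.
- by apply: leT et0;rewrite normr_le0;apply/eqP;ring.
- have:= key _ (cos (theta t)) st => /(_ (cb _));congr (`|_| <= _);ring.
- have:= key _ (- sin (theta t)) ct;rewrite normrN => /(_ (sb _));congr (`|_| <= _);ring.
- by apply: leT et0;rewrite normr_le0;apply/eqP;ring.
- by apply: leT et0;rewrite normr_le0;apply/eqP;ring.
- by apply: leT et0;rewrite normr_le0;apply/eqP;ring.
- by apply: leT et0;rewrite normr_le0;apply/eqP;ring.
Qed.

Lemma field_level0 w : (field w).1 0%N = (field0 w).1 /\ (field w).2 0%N = (field0 w).2.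
split;apply/funext => s.
 rewrite -[LHS]/(- (w.2 2%N s + 2^-1 * (w.1 0%N s * w.1 0%N s * w.2 0%N s + w.2 0%N s * w.2 0%N s * w.2 0%N s))).
 by rewrite /field0 /=;ring.
rewrite -[LHS]/(w.1 2%N s + 2^-1 * (w.1 0%N s * w.1 0%N s * w.1 0%N s + w.2 0%N s * w.2 0%N s * w.1 0%N s)).
by rewrite /field0 /=;ring.
Qed.

(** The defect at the boundary comes from the rotation, the source from the mean value form of the
    flow. The factor sqrt s in the growth bound makes the estimate uniform on bounded
    s-intervals. *)
Lemma frame_evol T S e : 0 <= S -> 0 < e -> exists2 d, 0 < d & forall t t' c r s, 0 <= t -> t <= t' -> t' <= T -> t' - t <= d ->
 0 <= s -> s <= S -> `|F t' c r s - F t c r s - (t' - t) * spin (psi t) (F t) c r s| <= e * (t' - t).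
move=> S0 e0;have [M M1 hM]:= psi_bound T;have M0:= leT ler01 M1.
have e1 : 0 < e / 18 by rewrite divr_gt0.
have [d1 d10 hd1]:= init_incr T e1.
(* Nine times e / 18 is one half of e, for the boundary term; [Q] makes the source term, with its
   factor 9 (sqrt S + 1) (2 + 4 M^2), the other half. *)
pose Q:= 18 * (Num.sqrt S + 1) * (2 + 4 * M ^+ 2).
have sS:= sqrtr_ge0 S.
have q10 : 0 < Num.sqrt S + 1 by rewrite ltr_wpDl.
have q20 : 0 < 2 + 4 * M ^+ 2 by have:= sqr_ge0 M;lra.
have Q0 : 0 < Q by rewrite /Q mulr_gt0// mulr_gt0.
have e2 : 0 < e / Q by rewrite divr_gt0.
have [d2 d20 hd2]:= psi_incr T e2.
exists (Num.min d1 d2);first by rewrite lt_min d10.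
move=> t t' c r s t0 tt tT;rewrite le_min => /andP[td1 td2] s0 sS';have t'0:= leT t0 tt.
have tau0 : 0 <= t' - t by rewrite subr_ge0.
have [f1 q1 _]:= hF t0;have [f2 q2 _]:= hF t'0.
have [a b]:= hd2 t t' t0 tt tT td2.
have [h1 h2]:= HP2 t0;have [h1' h2']:= HP2 t'0.
have pM j x : (j < 2)%N -> 0 <= x -> `|(psi t).1 j x| <= M /\ `|(psi t).2 j x| <= M.
 move=> j2 _;have [|u1 u2]:= HP_sup x (HPpsi t0) (_ : (j < m.+2)%N);first exact: leq_trans j2 _.
 by have u3:= hM t t0 (leT tt tT);split;[exact: leT u1 u3|exact: leT u2 u3].
have:= defect_bound (isH_restrict h1) (isH_restrict h2) (isH_restrict h1') (isH_restrict h2') f1 f2 q1 q2 M1 tau0 pM c r s0.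
rewrite {1}/defect !fE => /leT;apply.
have hd : HP m (psi t' - psi t - (t' - t) *: field (psi t)).
 by apply: HPB;[apply: HPB;exact: HPm|apply: HPZ;apply: HP_field;exact: HPpsi].
have [n1 n2] : nrm ((psi t').1 0%N - (psi t).1 0%N - (t' - t) *: (field (psi t)).1 0%N) <= _ /\
 nrm ((psi t').2 0%N - (psi t).2 0%N - (t' - t) *: (field (psi t)).2 0%N) <= _:= nrm_np hd (leq0n m).
have [n3 n4] : nrm ((psi t').1 0%N - (psi t).1 0%N) <= _ /\ nrm ((psi t').2 0%N - (psi t).2 0%N) <= _ :=
 nrm_np (HPB (HPpsi t'0) (HPpsi t0)) (leq0n m.+2).
have [k1 k2]:= field_level0 (psi t).
rewrite /source_size /rho1 /rho2 -k1 -k2.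
have z1:= nrm_ge0 false ((psi t').1 0%N - (psi t).1 0%N - (t' - t) *: (field (psi t)).1 0%N).
have z2:= nrm_ge0 false ((psi t').2 0%N - (psi t).2 0%N - (t' - t) *: (field (psi t)).2 0%N).
have z3:= nrm_ge0 false ((psi t').1 0%N - (psi t).1 0%N);have z4:= nrm_ge0 false ((psi t').2 0%N - (psi t).2 0%N).
set X1:= nrm _ in n1 z1 *;set X2:= nrm _ in n2 z2 *;set X3:= nrm _ in n3 z3 *;set X4:= nrm _ in n4 z4 *.
have S1 : X1 + X2 + (t' - t) * (2 * M ^+ 2) * (X3 + X4) <= (t' - t) * (e / Q * (2 + 4 * M ^+ 2)).
 have x34 : (t' - t) * (2 * M ^+ 2) * (X3 + X4) <= (t' - t) * (2 * M ^+ 2) * (e / Q + e / Q).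
  by apply: ler_wpM2l;[rewrite !mulr_ge0// exprn_ge0|apply: lerD;[exact: leT n3 b|exact: leT n4 b]].
 have:= leT n1 a;have:= leT n2 a;move: x34;set w:= e / Q;nra.
have dz : \sum_i `|defect (psi t) (F t) (F t') (t' - t) c i 0| <= 3 * (e / 18 * (t' - t)).
 have -> : 3 * (e / 18 * (t' - t)) = \sum_(i < 3) (e / 18 * (t' - t)) by rewrite sumr_const card_ord mulr_natl.
 by apply: ler_sum => i _;rewrite /defect !fE;apply: hd1.
apply: leT (_ : 3 * (3 * (e / 18 * (t' - t)) + (Num.sqrt S + 1) * (3 * ((t' - t) * (e / Q * (2 + 4 * M ^+ 2))))) <= _).
 rewrite ler_pM2l//;apply: lerD => //;apply: ler_pM;rewrite ?sqrtr_ge0//.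
 - apply: mulr_ge0 => //;apply: addr_ge0;first exact: addr_ge0.
  by apply: mulr_ge0;[rewrite !mulr_ge0// exprn_ge0|exact: addr_ge0].
 - by apply: leT (ler_wsqrtr sS') _;rewrite lerDl.
 - by rewrite ler_pM2l.
have -> : e / Q = e / 18 / (Num.sqrt S + 1) / (2 + 4 * M ^+ 2) by rewrite /Q !invfM !mulrA.
apply: eqW;field.
by rewrite !gt_eqF.
Qed.

End Along.
End MovingFrame.

(** * Vector fields in the moving frame as Sobolev chains *)

Section MovingChains.
Variable R : realType.
Import HalfLine.
Local Notation D:= (@dom R false).
Local Notation chain:= (nat -> R -> R).
Local Notation V:= (chain * chain)%type.
Local Notation vecf:= ('I_3 -> R -> R).
Local Notation tri:= ('I_3 -> chain).
Implicit Types (T e d t s C : R) (w : V) (F : 'I_3 -> vecf) (Y : tri) (c r : 'I_3) (k n j : nat).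

(** Bisect the interval until its pieces are shorter than the uniform threshold of
    differentiability. *)
Lemma pdiff_lip (f g : R -> R) T C t t' : pdiff f g -> (forall x, 0 <= x -> x <= T -> `|g x| <= C) ->
 0 <= t -> t <= t' -> t' <= T -> `|f t' - f t| <= C * (t' - t).
move=> h gC t0 tt tT;apply: (@le_eps R _ _ (t' - t));first by rewrite subr_ge0.
move=> e e0 _;have [d d0 hd]:= h T e e0;rewrite -mulrDl.
have [n hn]:= two_pow_small (t' - t) d0;rewrite ler_pdivrMr ?exprn_gt0// in hn.
elim: n t t' hn t0 tt tT => [|n IH] t t' hn t0 tt tT.
 rewrite expr0 mulr1 in hn;have h1:= hd t t' t0 tt tT hn.
 have h2 : `|(t' - t) * g t| <= C * (t' - t).
  by rewrite normrM ger0_norm ?subr_ge0// mulrC ler_wpM2r ?subr_ge0// gC// (leT tt).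
 rewrite -[f t' - f t](subrK ((t' - t) * g t));apply: leT (ler_normD _ _) _.
 by rewrite mulrDl addrC;exact: lerD.
pose y:= (t + t') / 2;have y1 : t <= y by rewrite /y;lra.
have y2 : y <= t' by rewrite /y;lra.
rewrite exprS in hn;have hy : d * 2 ^+ n = d * (2 * 2 ^+ n) / 2 by rewrite mulrCA mulrAC divff// mul1r.
have e1 : y - t <= d * 2 ^+ n by rewrite hy /y;move: hn;set A:= d * _;lra.
have e2 : t' - y <= d * 2 ^+ n by rewrite hy /y;move: hn;set A:= d * _;lra.
have:= IH _ _ e1 t0 y1 (leT y2 tT);have:= IH _ _ e2 (leT t0 y1) y2 tT.
rewrite -[f t' - f t](subrKA (f y)) => a b;apply: leT (ler_normD _ _) _;lra.
Qed.

Lemma pdiff_eq (f f' g : R -> R) : pdiff f g -> pdiff f' g -> f 0 = f' 0 -> forall t, 0 <= t -> f t = f' t.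
move=> h h' e0 t t0;have hB : pdiff (fun x => f x - f' x) (fun=> 0).
 move=> T e he;have e2 : 0 < e / 2 by rewrite divr_gt0.
 have [d d0 hd]:= h T _ e2;have [d' d0' hd']:= h' T _ e2.
 exists (Num.min d d');first by rewrite lt_min d0.
 move=> x y x0 xy yT;rewrite le_min => /andP[k1 k2].
 have a:= hd x y x0 xy yT k1;have b:= hd' x y x0 xy yT k2.
 have -> : f y - f' y - (f x - f' x) - (y - x) * 0 = (f y - f x - (y - x) * g x) - (f' y - f' x - (y - x) * g x) by ring.
 by apply: leT (ler_normB _ _) _;move: a b;lra.
have b0 x : 0 <= x -> x <= t -> `|(fun=> 0 : R) x| <= 0 by rewrite normr0.
have:= pdiff_lip hB b0 (lexx 0) t0 (lexx t).
by rewrite e0 subrr subr0 mul0r normr_le0 subr_eq0 => /eqP.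
Qed.

Definition lcont (f : R -> R -> R):= forall T e, 0 < e -> exists2 d, 0 < d & forall t t', 0 <= t -> t <= t' ->
 t' <= T -> t' - t <= d -> nrm (f t' - f t) <= e.

Lemma ucontN_lcont k (W : R -> chain) : (forall j, (j <= k)%N -> lcont (fun t => W t j)) -> ucontN k W.
move=> h T e e0;elim: k e e0 h => [|k IH] e e0 h.
 have [d d0 hd]:= h 0%N isT T e e0;exists d => // t t' t0 tt tT td.
 by rewrite /NH big_ord_recl big_ord0 addr0;exact: hd.
have e2 : 0 < e / 2 by rewrite divr_gt0.
have [d d0 hd]:= IH _ e2 (fun j jk => h j (leqW jk));have [d' d0' hd']:= h k.+1 (leqnn _) T _ e2.
exists (Num.min d d');first by rewrite lt_min d0.
move=> t t' t0 tt tT;rewrite le_min => /andP[k1 k2];rewrite /NH big_ord_recr /=.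
have:= hd t t' t0 tt tT k1;have:= hd' t t' t0 tt tT k2;rewrite /NH /= -[(W t' - W t) k.+1]/(W t' k.+1 - W t k.+1);lra.
Qed.

Definition ccurve k (W : R -> chain):= [/\ forall t, 0 <= t -> isH k (W t), ucontN k W &
 forall T, exists2 M, 0 <= M & forall t, 0 <= t -> t <= T -> NH k (W t) <= M].

Lemma ccurve_le k n W : (n <= k)%N -> ccurve k W -> ccurve n W.
move=> nk [h c b];split.
- by move=> t t0;exact: isH_le nk (h t t0).
- move=> T e e0;have [d d0 hd]:= c T e e0;exists d => // t t' t0 tt tT td.
 exact: leT (NH_le _ _ nk) (hd t t' t0 tt tT td).
- by move=> T;have [M M0 hM]:= b T;exists M => // t t0 tT;exact: leT (NH_le _ _ nk) (hM t t0 tT).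
Qed.

Lemma ccurve_csh k W : ccurve k.+1 W -> ccurve k (fun t => csh (W t)).
move=> [h c b];split.
- by move=> t t0;exact: isH_csh (h t t0).
- move=> T e e0;have [d d0 hd]:= c T e e0;exists d => // t t' t0 tt tT td.
 exact: leT (NH_csh_le _ k (W t' - W t)) (hd t t' t0 tt tT td).
- by move=> T;have [M M0 hM]:= b T;exists M => // t t0 tT;exact: leT (NH_csh_le _ k _) (hM t t0 tT).
Qed.

Lemma ccurveN k W : ccurve k W -> ccurve k (fun t => - W t).
move=> [h c b];split.
- by move=> t t0;exact: isHN (h t t0).
- move=> T e e0;have [d d0 hd]:= c T e e0;exists d => // t t' t0 tt tT td.
 by rewrite -opprD NHN;exact: hd.
- by move=> T;have [M M0 hM]:= b T;exists M => // t t0 tT;rewrite NHN;exact: hM.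
Qed.

Lemma ccurveD k W X : ccurve k W -> ccurve k X -> ccurve k (fun t => W t + X t).
move=> [h c b] [h' c' b'];split.
- by move=> t t0;exact: isHD (h t t0) (h' t t0).
- move=> T e e0;have e2 : 0 < e / 2 by rewrite divr_gt0.
 have [d d0 hd]:= c T _ e2;have [d' d0' hd']:= c' T _ e2.
 exists (Num.min d d');first by rewrite lt_min d0.
 move=> t t' t0 tt tT;rewrite le_min => /andP[k1 k2];have t'0:= leT t0 tt.
 rewrite opprD addrACA;apply: leT (NHD (isHB (h _ t'0) (h _ t0)) (isHB (h' _ t'0) (h' _ t0))) _.
 by have:= hd t t' t0 tt tT k1;have:= hd' t t' t0 tt tT k2;lra.
- move=> T;have [M M0 hM]:= b T;have [M' M0' hM']:= b' T;exists (M + M');first exact: addr_ge0.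
 by move=> t t0 tT;apply: leT (NHD (h _ t0) (h' _ t0)) (lerD _ _);[exact: hM|exact: hM'].
Qed.

Lemma ccurve_cprod k W X : ccurve k.+1 W -> ccurve k.+1 X -> ccurve k.+1 (fun t => cprod (W t) (X t)).
move=> [h c b] [h' c' b'];pose A : R:= k.+2%:R * 2 ^+ k.+1.
have A0 : 0 < A by rewrite mulr_gt0// exprn_gt0.
split.
- by move=> t t0;exact: isH_cprod (h t t0) (h' t t0).
- move=> T e e0;have [M M0 hM]:= b T;have [M' M0' hM']:= b' T.
 have B0 : 0 < M + M' + 1 by rewrite ltr_wpDl// addr_ge0.
 have e2 : 0 < e / (A * (M + M' + 1)) by rewrite divr_gt0// mulr_gt0.
 have [d d0 hd]:= c T _ e2;have [d' d0' hd']:= c' T _ e2.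
 exists (Num.min d d');first by rewrite lt_min d0.
 move=> t t' t0 tt tT;rewrite le_min => /andP[k1 k2];have t'0:= leT t0 tt.
 have -> : cprod (W t') (X t') - cprod (W t) (X t) = cprod (W t' - W t) (X t') + cprod (W t) (X t' - X t).
  by rewrite cprodBl cprodBr addrA subrK.
 have q1:= isHB (h _ t'0) (h _ t0);have q2:= isHB (h' _ t'0) (h' _ t0).
 apply: leT (NHD (isH_cprod q1 (h' _ t'0)) (isH_cprod (h _ t0) q2)) _.
 apply: leT (lerD (NH_cprod q1 (h' _ t'0)) (NH_cprod (h _ t0) q2)) _;rewrite -/A -mulrDr.
 have a1:= hd t t' t0 tt tT k1;have a2:= hd' t t' t0 tt tT k2.
 have b1:= hM t t0 (leT tt tT);have b2:= hM' t' t'0 tT.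
 have -> : e = A * (e / (A * (M + M' + 1)) * (M + M' + 1)) by field;rewrite !gt_eqF.
 rewrite ler_pM2l//;set q:= e / _ in e2 a1 a2 *.
 have p1 : NH k.+1 (W t' - W t) * NH k.+1 (X t') <= q * M' by apply: ler_pM;rewrite ?NH_ge0.
 have p2 : NH k.+1 (W t) * NH k.+1 (X t' - X t) <= M * q by apply: ler_pM;rewrite ?NH_ge0.
 by move: p1 p2 e2;clear;move: (NH _ _ * _) (NH _ _ * _) => P Q;lra.
- move=> T;have [M M0 hM]:= b T;have [M' M0' hM']:= b' T;exists (A * (M * M')).
  by rewrite !mulr_ge0// ltW.
 move=> t t0 tT;apply: leT (NH_cprod (h _ t0) (h' _ t0)) _;rewrite -/A ler_pM2l//.
 by apply: ler_pM;rewrite ?NH_ge0// ?hM ?hM'.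
Qed.

Lemma ccurve0 k : ccurve k (fun=> 0).
split;first by move=> *;exact: isH0.
 by move=> T e e0;exists 1 => // *;rewrite subrr NH0 ltW.
by move=> T;exists 0 => // *;rewrite NH0.
Qed.

(* derivative in s of the coordinates of a vector field with respect to the frame *)
Definition Dt w Y : tri:= fun r => match nat_of_ord r with
 | 0%N => csh (Y o0) + cprod w.1 (Y o2) | 1%N => csh (Y o1) + cprod w.2 (Y o2)
 | _ => csh (Y o2) - cprod w.1 (Y o0) - cprod w.2 (Y o1) end.
(** Frame vectors are not square integrable and cannot be chains. The j-th derivative of a field
    with coordinates [Y] is recombined from the j-th iterate of the coordinates, each term being a
    bounded function times one in L2. *)
Definition lev F w Y c : chain:= fun j => \sum_r F c r * iter j (Dt w) Y r 0%N.
(** Coordinates of the curvature vector x_ss = k p + l q; [wstart] below is its quarter turn k q - l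
    p, the cross product of x_s and x_ss, hence the velocity of the curve. *)
Definition zstart w : tri:= fun r => match nat_of_ord r with 0%N => w.1 | 1%N => w.2 | _ => 0 end.
Definition wstart w : tri:= fun r => match nat_of_ord r with 0%N => - w.2 | 1%N => w.1 | _ => 0 end.

Lemma Dt_level0 w Y s : [/\ Dt w Y o0 0%N s = Y o0 1%N s + w.1 0%N s * Y o2 0%N s,
 Dt w Y o1 0%N s = Y o1 1%N s + w.2 0%N s * Y o2 0%N s &
 Dt w Y o2 0%N s = Y o2 1%N s - w.1 0%N s * Y o0 0%N s - w.2 0%N s * Y o1 0%N s].
by []. Qed.

Lemma isH_Dt n w Y : isH n.+1 w.1 -> isH n.+1 w.2 -> (forall r, isH n.+1 (Y r)) -> forall r, isH n (Dt w Y r).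
move=> h1 h2 h;have n1:= leqnSn n.
by apply: ord3P;rewrite /Dt /=;do ?[apply: isHD|apply: isHN];try exact: isH_csh;apply: isH_le n1 _;exact: isH_cprod.
Qed.

Lemma isH_iter n w Y : isH n w.1 -> isH n w.2 -> (forall r, isH n (Y r)) ->
 forall j, (j <= n)%N -> forall r, isH (n - j) (iter j (Dt w) Y r).
move=> h1 h2 h;elim=> [_ r|j IH jn];first by rewrite subn0.
have e : (n - j = (n - j.+1).+1)%N by rewrite subnSK.
apply: isH_Dt;last by move=> r;rewrite -e;exact: IH (ltnW jn) r.
 by apply: isH_le h1;rewrite -e leq_subr.
by apply: isH_le h2;rewrite -e leq_subr.
Qed.

Lemma ccurve_iter n (w : R -> V) (Y : R -> tri) : ccurve n (fun t => (w t).1) -> ccurve n (fun t => (w t).2) ->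
 (forall r, ccurve n (fun t => Y t r)) -> forall j, (j <= n)%N -> forall r, ccurve (n - j) (fun t => iter j (Dt (w t)) (Y t) r).
move=> h1 h2 h;elim=> [_ r|j IH jn];first by rewrite subn0;exact: h.
have e : (n - j = (n - j.+1).+1)%N by rewrite subnSK.
have w1 : ccurve (n - j) (fun t => (w t).1) by apply: ccurve_le h1;exact: leq_subr.
have w2 : ccurve (n - j) (fun t => (w t).2) by apply: ccurve_le h2;exact: leq_subr.
move: (IH (ltnW jn)) w1 w2;rewrite e => hj w1 w2;have n1:= leqnSn (n - j.+1).
have m0:= ccurve_le n1 (ccurve_cprod w1 (hj o2));have m1:= ccurve_le n1 (ccurve_cprod w2 (hj o2)).
have m2:= ccurveN (ccurve_le n1 (ccurve_cprod w1 (hj o0)));have m3:= ccurveN (ccurve_le n1 (ccurve_cprod w2 (hj o1))).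
apply: ord3P.
- exact: ccurveD (ccurve_csh (hj o0)) m0.
- exact: ccurveD (ccurve_csh (hj o1)) m1.
- exact: ccurveD (ccurveD (ccurve_csh (hj o2)) m2) m3.
Qed.

Lemma isH_lev n w Y F c : frame (w.1 0%N) (w.2 0%N) F -> orth F -> isH n w.1 -> isH n w.2 -> (forall r, isH n (Y r)) ->
 isH n (lev F w Y c).
move=> fF oF h1 h2 h;have F1 r x : D x -> `|F c r x| <= 1 by move/dom_ge0;exact: orth_bound.
have [a b v]:= frame_prim c fF.
have mF r : measurable_fun D (F c r) by case: (fF c) => sF _;exact: prim_meas (sF r).
split=> j jn.
 rewrite /lev;apply: (@l2_sum R false) => r;apply: (l2M (c:= 1) (mF r) (F1 r)).
 exact: isH_l2 (isH_iter h1 h2 h jn r) (leq0n _).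
have hj r : isH (n - j) (iter j (Dt w) Y r):= isH_iter h1 h2 h (ltnW jn) r.
have j0 : (0 < n - j)%N by rewrite subn_gt0.
have pr r:= isH_prim (hj r) j0;have su r x:= isH_sup (x:= x) (hj r) j0.
have q0:= prim_mul a (pr o0) (F1 o0) (su o0);have q1:= prim_mul b (pr o1) (F1 o1) (su o1).
have q2:= prim_mul v (pr o2) (F1 o2) (su o2).
apply: prim_eq (primD (primD q0 q1) q2) => x _;rewrite /lev /= sum3 !fE//.
by have [-> -> ->]:= Dt_level0 w (iter j (Dt w) Y) x;ring.
Qed.

(** The frame is bounded by 1 and Lipschitz in time uniformly in s, the coefficients are continuous
    in L2; each of the three products is given e / 3, split evenly between the two causes. *)
Lemma lev_lcont n (w : R -> V) (Y : R -> tri) (F : R -> 'I_3 -> vecf) c j :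
 (forall t, 0 <= t -> frame ((w t).1 0%N) ((w t).2 0%N) (F t) /\ orth (F t)) ->
 (forall T, exists2 L, 0 <= L & forall t t' r s, 0 <= t -> t <= t' -> t' <= T -> 0 <= s -> `|F t' c r s - F t c r s| <= L * (t' - t)) ->
 ccurve n (fun t => (w t).1) -> ccurve n (fun t => (w t).2) -> (forall r, ccurve n (fun t => Y t r)) -> (j <= n)%N ->
 lcont (fun t => lev (F t) (w t) (Y t) c j).
move=> hF lip h1 h2 h jn T e e0;have [L L0 hL]:= lip T.
pose G t r:= iter j (Dt (w t)) (Y t) r 0%N.
have lG t r : 0 <= t -> l2 (G t r).
 by move=> t0;have [q _ _]:= ccurve_iter h1 h2 h jn r;exact: isH_l2 (q t t0) (leq0n _).
have cG r : exists2 d, 0 < d & forall t t', 0 <= t -> t <= t' -> t' <= T -> t' - t <= d -> nrm (G t' r - G t r) <= e / 6.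
 have [_ q _]:= ccurve_iter h1 h2 h jn r;have e6 : 0 < e / 6 by rewrite divr_gt0.
 have [d d0 hd]:= q T _ e6;exists d => // t t' t0 tt tT td;apply: leT (hd t t' t0 tt tT td).
 exact: (NH_nrm _ (iter j (Dt (w t')) (Y t') r - iter j (Dt (w t)) (Y t) r) (leq0n _)).
have bG r : exists2 M, 0 <= M & forall t, 0 <= t -> t <= T -> nrm (G t r) <= M.
 have [_ _ q]:= ccurve_iter h1 h2 h jn r;have [M M0 hM]:= q T;exists M => // t t0 tT;apply: leT (hM t t0 tT).
 exact: (NH_nrm _ (iter j (Dt (w t)) (Y t) r) (leq0n _)).
have [d' d0 hd] : exists2 d, 0 < d & forall r t t', 0 <= t -> t <= t' -> t' <= T -> t' - t <= d -> nrm (G t' r - G t r) <= e / 6.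
 have [d1 d10 k1]:= cG o0;have [d2 d20 k2]:= cG o1;have [d3 d30 k3]:= cG o2.
 exists (Num.min d1 (Num.min d2 d3));first by rewrite !lt_min d10 d20.
 by apply: ord3P => t t' t0 tt tT;rewrite !le_min => /and3P[? ? ?];[apply: k1|apply: k2|apply: k3].
have [M M0 hM] : exists2 M, 0 <= M & forall r t, 0 <= t -> t <= T -> nrm (G t r) <= M.
 have [A A0 k1]:= bG o0;have [B B0 k2]:= bG o1;have [C C0 k3]:= bG o2;exists (A + B + C);first by rewrite !addr_ge0.
 by apply: ord3P => t t0 tT;[move: (k1 t t0 tT)|move: (k2 t t0 tT)|move: (k3 t t0 tT)];lra.
have K0 : 0 < L * M + 1 by rewrite ltr_wpDl// mulr_ge0.
exists (Num.min d' (e / 6 / (L * M + 1)));first by rewrite lt_min d0 !divr_gt0.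
move=> t t' t0 tt tT;rewrite le_min => /andP[k1 k2];have t'0:= leT t0 tt.
have [fF oF]:= hF t t0;have [fF' oF']:= hF t' t'0;have tau0 : 0 <= t' - t by rewrite subr_ge0.
have mF x r : 0 <= x -> measurable_fun D (F x c r) by move=> /hF[/(_ c)[sF _] _];exact: prim_meas (sF r).
have part r : l2 (F t' c r * G t' r - F t c r * G t r) /\ nrm (F t' c r * G t' r - F t c r * G t r) <= e / 3.
 have -> : F t' c r * G t' r - F t c r * G t r = F t' c r * (G t' r - G t r) + (F t' c r - F t c r) * G t r.
  by rewrite mulrBr mulrBl addrA subrK.
 have b1 x : D x -> `|F t' c r x| <= 1 by move/dom_ge0;exact: orth_bound.
 have b2 x : D x -> `|(F t' c r - F t c r) x| <= L * (t' - t) by move/dom_ge0 => x0;exact: hL.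
 have lB:= l2B (lG t' r t'0) (lG t r t0);have mB:= measurable_funB (mF _ r t'0) (mF _ r t0).
 have l1:= l2M (mF t' r t'0) b1 lB;have l1':= l2M mB b2 (lG t r t0).
 split;first exact: l2D.
 apply: leT (nrmD l1 l1') _;have -> : e / 3 = e / 6 + e / 6 by field.
 have LT : 0 <= L * (t' - t) by exact: mulr_ge0.
 apply: lerD;first by apply: leT (nrmM (mF t' r t'0) b1 ler01 lB) _;rewrite mul1r;exact: hd.
 apply: leT (nrmM mB b2 LT (lG t r t0)) _.
 apply: leT (_ : L * (t' - t) * M <= _);first by apply: ler_wpM2l => //;apply: hM => //;exact: leT tt tT.
 rewrite ler_pdivlMr// in k2;apply: leT k2;rewrite mulrAC mulrC;apply: ler_wpM2l => //;lra.
rewrite (_ : _ - _ = \sum_r (F t' c r * G t' r - F t c r * G t r));last by rewrite -sumrB.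
apply: leT (nrm_sum _ (fun r => proj1 (part r))) _.
have -> : e = \sum_(r < 3) (e / 3) by rewrite sumr_const card_ord -[RHS]mulr_natr divfK.
by apply: ler_sum => r _;case: (part r).
Qed.

End MovingChains.

(** * Reconstruction of the curve from the frame *)

Section CurveFromFrame.
Variable R : realType.
Import HalfLine.
Local Notation D:= (@dom R false).
Local Notation chain:= (nat -> R -> R).
Local Notation V:= (chain * chain)%type.
Local Notation vecf:= ('I_3 -> R -> R).
Implicit Types (T e d t s C : R) (w : V) (c r : 'I_3) (k n j : nat).

Lemma lcont_ucontN k j (W : R -> chain) : ucontN k W -> (j <= k)%N -> lcont (fun t => W t j).
move=> h jk T e e0;have [d d0 hd]:= h T e e0;exists d => // t t' t0 tt tT td.
exact: leT (NH_nrm _ (W t' - W t) jk) (hd t t' t0 tt tT td).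
Qed.

Lemma ucontN_at k (W : R -> chain) t0 e : ucontN k W -> 0 <= t0 -> 0 < e ->
 exists2 d, 0 < d & forall t, 0 <= t -> `|t - t0| <= d -> NH k (W t - W t0) <= e.
move=> h t00 e0;have [d d0 hd]:= h (t0 + 1) e e0;exists (Num.min d 1);first by rewrite lt_min d0 ltr01.
move=> t p;rewrite le_min => /andP[h1 h2].
have [tt|/ltW tt]:= leP t0 t.
 rewrite ger0_norm ?subr_ge0// in h1 h2;apply: hd => //;lra.
by rewrite distrC ger0_norm ?subr_ge0// in h1 h2;rewrite -NHN opprB;apply: hd => //;lra.
Qed.

Variables (m : nat) (psi : R -> V) (F : R -> 'I_3 -> vecf).
Hypotheses (hpsi : nls m psi) (epsi : forall t, 0 <= t -> evenP (psi t)).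
Hypothesis hF : forall t, 0 <= t -> [/\ frame ((psi t).1 0%N) ((psi t).2 0%N) (F t), orth (F t) & forall c r, F t c r 0 = init psi t c r].
Hypothesis rF : forall t, 0 <= t -> forall s, 0 <= s -> righthanded (F t) s.
Local Notation K:= m.+2.

Let HPpsi t : 0 <= t -> HP K (psi t). by case: hpsi => h _ _ _;exact: h. Qed.
Let half1 t : 0 <= t -> isH K (psi t).1. by move=> /HPpsi[h _];exact: isH_restrict. Qed.
Let half2 t : 0 <= t -> isH K (psi t).2. by move=> /HPpsi[_ h];exact: isH_restrict. Qed.

Lemma NH_half w : HP K w -> NH K w.1 <= K.+1%:R * NP K w /\ NH K w.2 <= K.+1%:R * NP K w.
by move=> h;split;apply: NH_bound => j jk;have []:= nrm_np h jk. Qed.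

Lemma ccurve_psi : ccurve K (fun t => (psi t).1) /\ ccurve K (fun t => (psi t).2).
have cc T e : 0 < e -> exists2 d, 0 < d & forall t t', 0 <= t -> t <= t' -> t' <= T -> t' - t <= d ->
  NH K ((psi t').1 - (psi t).1) <= e /\ NH K ((psi t').2 - (psi t).2) <= e.
 move=> e0;have e1 : 0 < e / K.+1%:R by rewrite divr_gt0.
 have [d d0 hd]:= psi_incr hpsi T e1;exists d => // t t' t0 tt tT td.
 have [_ b]:= hd t t' t0 tt tT td;have [b1 b2]:= NH_half (HPB (HPpsi (leT t0 tt)) (HPpsi t0)).
 by rewrite ler_pdivlMr// mulrC in b;split;[exact: leT b1 b|exact: leT b2 b].
have bb T : exists2 M, 0 <= M & forall t, 0 <= t -> t <= T -> NH K (psi t).1 <= M /\ NH K (psi t).2 <= M.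
 have [M M1 hM]:= psi_bound hpsi T;exists (K.+1%:R * M);first by rewrite mulr_ge0// (leT ler01).
 move=> t t0 tT;have [b1 b2]:= NH_half (HPpsi t0).
 by split;[apply: leT b1 _|apply: leT b2 _];apply: ler_wpM2l => //;exact: hM.
split;split => //.
- by move=> T e e0;have [d d0 hd]:= cc T e e0;exists d => // t t' t0 tt tT td;case: (hd t t' t0 tt tT td).
- by move=> T;have [M M0 hM]:= bb T;exists M => // t t0 tT;case: (hM t t0 tT).
- by move=> T e e0;have [d d0 hd]:= cc T e e0;exists d => // t t' t0 tt tT td;case: (hd t t' t0 tt tT td).
- by move=> T;have [M M0 hM]:= bb T;exists M => // t t0 tT;case: (hM t t0 tT).
Qed.

Lemma frame_pdiff c r s : 0 <= s -> pdiff (fun t => F t c r s) (fun t => spin (psi t) (F t) c r s).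
move=> s0 T e e0;have [d d0 hd]:= frame_evol hpsi epsi hF T s0 e0;exists d => // t t' t0 tt tT td.
exact: hd.
Qed.

Lemma frame_lip T : exists2 L, 0 <= L & forall c t t' r s, 0 <= t -> t <= t' -> t' <= T -> 0 <= s -> `|F t' c r s - F t c r s| <= L * (t' - t).
have [M M1 hM]:= psi_bound hpsi T;have M0:= leT ler01 M1.
exists (2 * M ^+ 2);first by rewrite mulr_ge0// exprn_ge0.
move=> c t t' r s t0 tt tT s0;have:= frame_pdiff c r s0 => /pdiff_lip;apply=> // x x0 xT.
have [fF oF _]:= hF x0;have xT':= leT xT tT.
apply: (spin_bound oF M1 _ c r);last exact/dom_ge0.
move=> j y j2 _;have [|u1 u2]:= HP_sup y (HPpsi x0) (_ : (j < K)%N);first exact: leq_trans j2 _.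
by have u3:= hM x x0 xT';split;[exact: leT u1 u3|exact: leT u2 u3].
Qed.

Lemma lev_curve (Y : R -> 'I_3 -> chain) c : (forall r, ccurve K (fun t => Y t r)) ->
 (forall t, 0 <= t -> isH K (lev (F t) (psi t) (Y t) c)) /\ ucontN K (fun t => lev (F t) (psi t) (Y t) c).
move=> hY;have [c1 c2]:= ccurve_psi;split.
 move=> t t0;have [fF oF _]:= hF t0;apply: isH_lev => //;[exact: half1|exact: half2|].
 by move=> r;case: (hY r) => h _ _;exact: h.
apply: ucontN_lcont => j jk;apply: lev_lcont c1 c2 hY jk => //.
 by move=> t t0;case: (hF t0).
by move=> T;have [L L0 hL]:= frame_lip T;exists L => // *;exact: hL.
Qed.

(** As chains in s, [Zc] carries the components of x_ss and [Wc] those of x_t. *)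
Definition Zc c t:= lev (F t) (psi t) (zstart (psi t)) c.
Definition Wc c t:= lev (F t) (psi t) (wstart (psi t)) c.

Lemma Zc_curve c : (forall t, 0 <= t -> isH K (Zc c t)) /\ ucontN K (Zc c).
by have [c1 c2]:= ccurve_psi;apply: lev_curve;apply: ord3P => //;exact: ccurve0.
Qed.

Lemma Wc_curve c : (forall t, 0 <= t -> isH K (Wc c t)) /\ ucontN K (Wc c).
by have [c1 c2]:= ccurve_psi;apply: lev_curve;apply: ord3P => //;[exact: ccurveN|exact: ccurve0].
Qed.

Lemma Zc0 c t s : Zc c t 0%N s = (psi t).1 0%N s * F t c o0 s + (psi t).2 0%N s * F t c o1 s.
by rewrite /Zc /lev sum3 /= !fE -[X in _ + F t c o2 s * X]/(0 : R) mulr0 addr0 mulrC [X in _ + X]mulrC.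
Qed.

Lemma Wc0 c t s : Wc c t 0%N s = (psi t).1 0%N s * F t c o1 s - (psi t).2 0%N s * F t c o0 s.
rewrite /Wc /lev sum3 !fE;set Y:= wstart _.
have -> : iter 0 (Dt (psi t)) Y o0 0%N s = - (psi t).2 0%N s by [].
have -> : iter 0 (Dt (psi t)) Y o1 0%N s = (psi t).1 0%N s by [].
have -> : iter 0 (Dt (psi t)) Y o2 0%N s = 0 by [].
ring.
Qed.

(** Compatibility of mixed derivatives: the s-derivative of the velocity is the time derivative of
    the tangent, so integrating the velocity in time yields a curve with the prescribed tangent. *)
Lemma Wc1 c t s : Wc c t 1%N s = spin (psi t) (F t) c o2 s.
rewrite /Wc /lev sum3 /= !fE;have [-> -> ->]:= Dt_level0 (psi t) (wstart (psi t)) s.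
rewrite /wstart /spin /= -![(0 : chain) _ s]/(0 : R) -![(- (psi t).2) _ s]/(- (psi t).2 _ s);ring.
Qed.

(** [U] is the displacement from the initial curve. It, unlike the position, is square integrable,
    and is obtained as the time integral of the velocity chain. *)
Lemma position_exists c : exists U : R -> chain, [/\ forall t, 0 <= t -> isH K (U t), forall j s, (j < K)%N -> 0 <= s -> U 0 j s = 0,
 forall j s, (j < K)%N -> 0 <= s -> pdiff (fun t => U t j s) (fun t => Wc c t j s), ucontN K U &
 forall t0 e, 0 <= t0 -> 0 < e -> exists2 d, 0 < d & forall t, 0 <= t -> `|t - t0| <= d ->
  NH K (U t - U t0 - (t - t0) *: Wc c t0) <= e * `|t - t0|].
have [hW uW]:= Wc_curve c;have [U [hU U0 est]]:= chain_primitive hW uW.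
have z0 j s : (j < K)%N -> 0 <= s -> U 0 j s = 0.
 move=> jK s0;have [|_ h]:= chain_zero (hU 0 (lexx 0)) _ (ltnW jK);last exact: h.
 by move=> x x0;rewrite U0// tint0.
have fw T e : 0 < e -> exists2 d, 0 < d & forall t t', 0 <= t -> t <= t' -> t' <= T -> t' - t <= d ->
  NH K (U t' - U t - (t' - t) *: Wc c t) <= e * (t' - t) /\ NH K (U t' - U t - (t' - t) *: Wc c t') <= e * (t' - t).
 move=> e0;have [d d0 hd]:= uW T e e0;exists d => // t t' t0 tt tT td;have t'0:= leT t0 tt.
 split;rewrite [leRHS]mulrC;apply: est => //;try exact: hW.
  by move=> x tx xt;apply: hd => //;lra.
 by move=> x tx xt;rewrite -NHN opprB;apply: hd => //;lra.
exists U;split => //.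
- move=> j s jK s0 T e e0;have [d d0 hd]:= fw T e e0;exists d => // t t' t0 tt tT td.
 have [h _]:= hd t t' t0 tt tT td;apply: leT h;have t'0:= leT t0 tt.
 have hh:= isHB (isHB (hU _ t'0) (hU _ t0)) (isHZ (t' - t) (hW _ t0)).
 by apply: leT (isH_sup (x:= s) hh jK _) _;[exact/dom_ge0|exact: NH_le].
- move=> T e e0;have [d d0 hd]:= uW T 1 ltr01.
 (* A bound on [0, T] out of uniform continuity: finitely many steps of length [d], each adding at
    most 1. *)
 have [M M0 hM] : exists2 M, 0 <= M & forall t, 0 <= t -> t <= T -> NH K (Wc c t) <= M.
  have [n hn]:= two_pow_small T d0;rewrite ler_pdivrMr ?exprn_gt0// in hn.
  suff h p t : 0 <= t -> t <= T -> t <= d * p%:R -> NH K (Wc c t) <= NH K (Wc c 0) + p%:R.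
   exists (NH K (Wc c 0) + (2 ^ n)%N%:R);first by rewrite addr_ge0 ?NH_ge0.
   by move=> t t0 tT;apply: h => //;apply: leT tT _;rewrite natrX.
  elim: p t => [|p IH] t t0 tT;first by rewrite mulr0 addr0 => t1;rewrite (_ : t = 0) //;apply: le_anti;rewrite t0 t1.
  rewrite -natr1 mulrDr mulr1 => tp;have [td|/ltW dt]:= leP t d.
   have:= NHD (hW 0 (lexx 0)) (isHB (hW t t0) (hW 0 (lexx 0)));rewrite addrC subrK.
   have:= hd 0 t (lexx 0) t0 tT;rewrite subr0 => /(_ td);have : 0 <= p%:R :> R by [];lra.
  have q0 : 0 <= t - d by rewrite subr_ge0.
  have:= NHD (hW _ q0) (isHB (hW t t0) (hW _ q0));rewrite addrC subrK.
  have qt : t - d <= t by lra.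
  have:= hd _ _ q0 qt tT;have -> : t - (t - d) = d by ring.
  move=> /(_ (lexx d));have:= IH (t - d) q0 (leT qt tT);have -> : (t - d <= d * p%:R) = true by lra.
  by move=> /(_ isT);lra.
 exists (e / (M + 1));first by rewrite divr_gt0// ltr_wpDl.
 move=> t t' t0 tt tT;rewrite ler_pdivlMr ?ltr_wpDl// => td.
 have:= @est t t' 0 M t0 tt (isH0 _ _ _);rewrite scaler0 subr0 => h;apply: leT (h _) _.
  by move=> x tx xt;rewrite subr0;apply: hM;[exact: leT tx|exact: leT xt tT].
 apply: leT td;apply: ler_wpM2l;lra.
- move=> t0 e t00 e0;have [d d0 hd]:= fw (t0 + 1) e e0;exists (Num.min d 1);first by rewrite lt_min d0 ltr01.
 move=> t p;rewrite le_min => /andP[h1 h2].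
 have [tt|/ltW tt]:= leP t0 t.
  by rewrite ger0_norm ?subr_ge0// in h1 h2 *;case: (hd t0 t t00 tt _ h1) => //;lra.
 rewrite distrC ger0_norm ?subr_ge0// in h1 h2 *;rewrite -NHN.
 have -> : - (U t - U t0 - (t - t0) *: Wc c t0) = U t0 - U t - (t0 - t) *: Wc c t0.
  by rewrite !opprD !opprK -scaleNr !opprB [in LHS]addrC [in RHS]addrC (addrC (- U t)).
 by case: (hd t t0 p tt _ h1) => //;lra.
Qed.

End CurveFromFrame.

(** * A smooth step function *)

Section SmoothStep.
Variable R : realType.
Implicit Types (x y a b c e M : R) (f g : R -> R) (n : nat).

(** The family x^-n exp (-1/x), extended by zero, is closed under differentiation up to linear
    combinations, and all members are O(x^2) at 0, which settles the derivative there. *)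
Definition flat n x : R:= if x <= 0 then 0 else (x ^-1) ^+ n * expR (- x^-1).

Lemma flat_le n x : `|flat n x| <= n.+2`!%:R * x ^+ 2.
have [x0|x0]:= leP x 0;first by rewrite /flat x0 normr0 mulr_ge0// sqr_ge0.
rewrite /flat [x <= 0]leNgt x0 /=.
have u0 : 0 < x^-1 by rewrite invr_gt0.
rewrite ger0_norm ?mulr_ge0 ?expR_ge0 ?exprn_ge0 ?(ltW u0)// expRN ler_pdivrMr ?expR_gt0//.
have h : (x^-1) ^+ n.+2 / n.+2`!%:R <= expR x^-1.
 by have:= expR_ge1Dxn n.+1 (ltW u0);lra.
rewrite ler_pdivrMr ?ltr0n ?fact_gt0// in h.
have -> : x^-1 ^+ n = x^-1 ^+ n.+2 * x ^+ 2.
 by rewrite -(addn2 n) exprD -mulrA -exprMn mulVf ?gt_eqF// expr1n mulr1.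
rewrite [leRHS]mulrAC;apply: ler_wpM2r;[exact: sqr_ge0|rewrite [leRHS]mulrC;exact: h].
Qed.

Lemma quadratic_derive0 f M : (forall x, `|f x| <= M * x ^+ 2) -> is_derive (0 : R) 1 f 0.
move=> h;have M0 : 0 <= M by have:= h 1;rewrite expr1n mulr1;exact: leT.
have f0 : f 0 = 0 by apply/eqP;rewrite -normr_le0;have:= h 0;rewrite expr0n mulr0.
have cv : h^-1 *: (f (h *: 1 + 0) - f 0) @[h --> 0^'] --> (0 : R).
 apply/cvgrPdist_le => e e0;near=> z;rewrite sub0r normrN f0 subr0 addr0 /GRing.scale /= mulr1 normrM normfV.
 have z0 : z != 0 by near: z;exact: nbhs_dnbhs_neq.
 rewrite ler_pdivrMl ?normr_gt0//;apply: leT (h z) _.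
 have : `|z| <= e / (M + 1).
  near: z;apply: dnbhs0_le;rewrite divr_gt0// ltr_wpDl//.
 rewrite ler_pdivlMr ?ltr_wpDl// => hz;rewrite -real_normK ?num_real// expr2 mulrA [X in _ <= X]mulrC.
 apply: ler_wpM2r => //;rewrite mulrC;apply: leT hz;apply: ler_wpM2l => //;lra.
by apply: DeriveDef;[apply/cvg_ex;exists 0|apply/cvg_lim].
Unshelve. all: by end_near.
Qed.

Lemma flat_derive n x : is_derive x 1 (flat n) (flat n.+2 x - n%:R * flat n.+1 x).
have [x0|x0|->]:= ltgtP x 0;last first.
- by rewrite /flat lexx mulr0 subr0;apply: quadratic_derive0 => y;exact: flat_le.
- have xn : x != 0 by rewrite gt_eqF.
 apply: (@near_eq_is_derive _ _ _ (fun y => (y ^-1) ^+ n * expR (- y^-1))).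
  by near=> y;rewrite /flat leNgt ifN// negbK;near: y;exact: lt_nbhsr.
 have dV : is_derive x 1 (fun y : R => y^-1) (- x^-1 ^+ 2).
  by have:= @is_deriveV R id x 1 1 xn (is_derive_id _ _);rewrite /GRing.scale /= mulr1 -exprVn.
 have dE : is_derive x 1 (expR \o (fun y : R => - y^-1)) (expR (- x^-1) * x^-1 ^+ 2).
  by have dN:= is_deriveN dV;rewrite opprK in dN;exact: is_derive1_comp.
 have dX : is_derive x 1 (fun y : R => y^-1 ^+ n) (n%:R * x^-1 ^+ n.-1 * - x^-1 ^+ 2).
  have h:= @is_deriveX _ _ _ n _ _ _ dV;rewrite exprfctE in h;apply: (is_derive_eq h);rewrite /GRing.scale /=;ring.
 apply: (is_derive_eq (is_deriveM dX dE)).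
 rewrite /flat leNgt x0 /= /GRing.scale /= !exprSr;case: n dX => [|n] dX;last rewrite exprSr /=;ring.
- apply: (@near_eq_is_derive _ _ _ (fun=> 0)).
  by near=> y;rewrite /flat ifT// ltW//;near: y;exact: lt_nbhsl.
 by rewrite /flat (ltW x0) mulr0 subr0;exact: is_derive_cst.
Unshelve. all: by end_near.
Qed.

(** A syntactic class whose derivatives stay in the class, so that derivatives of every order exist
    by induction. *)
Inductive smooth : (R -> R) -> Prop :=
| smooth_cst c : smooth (fun=> c)
| smooth_flat n a b : smooth (fun x => flat n (a * x + b))
| smoothD f g : smooth f -> smooth g -> smooth (fun x => f x + g x)
| smoothM f g : smooth f -> smooth g -> smooth (fun x => f x * g x)
| smoothV f : smooth f -> (forall x, f x != 0) -> smooth (fun x => (f x)^-1).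

Lemma is_derive_affine f (f' : R) a b x : is_derive (a * x + b) 1 f f' -> is_derive x 1 (fun y => f (a * y + b)) (a * f').
move=> h;have d : is_derive x 1 (fun y : R => a * y + b) a.
 apply: (is_derive_eq (is_deriveD (is_deriveZ a (is_derive_id x 1)) (is_derive_cst b x 1))).
 by rewrite addr0 /GRing.scale /= mulr1.
by rewrite [a * f']mulrC;exact: (@is_derive1_comp R f (fun y => a * y + b) x f' a h d).
Qed.

Lemma smooth_derive f : smooth f -> exists2 g, smooth g & forall x, is_derive x 1 f (g x).
elim=> {f}.
- by move=> c;exists (fun=> 0);[exact: smooth_cst|move=> x;exact: is_derive_cst].
- move=> n a b;exists (fun x => a * (flat n.+2 (a * x + b) + - n%:R * flat n.+1 (a * x + b))).
  by apply: smoothM (smooth_cst _) (smoothD (smooth_flat _ _ _) (smoothM (smooth_cst _) (smooth_flat _ _ _))).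
 by move=> x;apply: is_derive_affine;rewrite mulNr;exact: flat_derive.
- move=> f g _ [f' sf df] _ [g' sg dg];exists (fun x => f' x + g' x);first exact: smoothD.
 by move=> x;exact: is_deriveD.
- move=> f g hf [f' sf df] hg [g' sg dg];exists (fun x => f x * g' x + g x * f' x).
  by apply: smoothD;apply: smoothM.
 by move=> x;exact: is_deriveM.
- move=> f hf [f' sf df] nz;exists (fun x => -1 * ((f x)^-1 * (f x)^-1) * f' x).
  by apply: smoothM => //;apply: smoothM;[exact: smooth_cst|apply: smoothM;exact: smoothV].
 move=> x;apply: (is_derive_eq (is_deriveV (nz x) (df x))).
 by rewrite /GRing.scale /= mulN1r expr2 invfM.
Qed.

Lemma smooth_derive1 f n : smooth f -> smooth (derive1n n f) /\ forall x, derivable (derive1n n f) x 1.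
move=> sf;have s g : smooth g -> smooth (derive1 g).
 move=> /smooth_derive[g' sg dg];rewrite (_ : derive1 g = g')//;apply/funext => x.
 by rewrite derive1E;exact: derive_val.
have h : smooth (derive1n n f) by elim: n => [//|n IH];rewrite derive1nS;exact: s.
by split=> // x;have [g' _ dg]:= smooth_derive h;exact: (@ex_derive _ _ _ _ _ _ _ (dg x)).
Qed.

Lemma smooth_step : exists th th' : R -> R, [/\ forall a b, smooth (fun x => th (a * x + b)),
 forall x, is_derive x 1 th (th' x), forall x, x <= 0 -> th x = 0, forall x, 1 <= x -> th x = 1 &
 forall x, 0 <= th x <= 1].
(* The step is f(x) / (f(x) + f(1 - x)); the denominator is positive because x and 1 - x are never
   both nonpositive. *)
pose den x:= flat 0 x + flat 0 (- x + 1).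
have f0 x : 0 <= flat 0 x by rewrite /flat;case: ifP => // _;rewrite mulr_ge0 ?expR_ge0.
have fp x : 0 < x -> 0 < flat 0 x by move=> x0;rewrite /flat leNgt x0 mulr_gt0 ?expR_gt0.
have d0 x : 0 < den x.
 have [x0|x0]:= leP x 0;last by rewrite ltr_wpDr// fp.
 by rewrite ltr_wpDl// fp//;lra.
pose th x:= flat 0 x * (den x)^-1.
have sth a b : smooth (fun x => th (a * x + b)).
 apply: smoothM;first exact: smooth_flat.
 apply: smoothV => [|x];last by rewrite gt_eqF.
 apply: smoothD;first exact: smooth_flat.
 rewrite (_ : (fun x => _) = (fun x => flat 0 (- a * x + (1 - b))));first exact: smooth_flat.
 by apply/funext => x;congr flat;ring.
have [th' _ dth]:= smooth_derive (sth 1 0).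
exists th, th';split => //.
- move=> x;have:= dth x;rewrite (_ : (fun y => _) = th)//;apply/funext => y;congr th;ring.
- by move=> x x0;rewrite /th {1}/flat x0 mul0r.
- move=> x x1;rewrite /th /den [flat 0 (- x + 1)]/flat ifT ?addr0 ?divff ?gt_eqF ?fp//;lra.
- move=> x;rewrite /th divr_ge0 ?(ltW (d0 _))//= ler_pdivrMr// mul1r lerDl;exact: f0.
Qed.

End SmoothStep.

(** * From chains to weak derivatives *)

Section WeakDerivatives.
Variable R : realType.
Local Notation mu:= (@lebesgue_measure R).
Import HalfLine.
Local Notation D:= (@dom R false).
Local Notation chain:= (nat -> R -> R).
Implicit Types (T e d t s x y a b M : R) (f g h phi : R -> R) (k n j : nat).

Lemma Rpos_itv : @Rpos R = `]0, +oo[%classic.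
by rewrite set_itvoy. Qed.

Lemma measurable_Rpos : measurable (@Rpos R).
by rewrite Rpos_itv;exact: measurable_itv. Qed.

Lemma meas_Rpos f : measurable_fun (@Rpos R) f -> measurable_fun D f.
move=> mf;have -> : D = [set 0] `|` @Rpos R.
 apply/seteqP;split => x /=;rewrite in_itv/= andbT.
  by rewrite le_eqVlt => /orP[/eqP <-|x0];[left|right].
 by case=> [->//|/ltW].
by apply/measurable_funU => //;[exact: measurable_Rpos|split => //;exact: measurable_fun_set1].
Qed.

Lemma int_Rpos f : measurable_fun D f -> (\int[mu]_(x in @Rpos R) (f x)%:E = \int[mu]_(x in D) (f x)%:E)%E.
move=> mf;rewrite Rpos_itv integral_itv_obnd_cbnd//.
apply/measurable_EFinP;apply: measurable_funS mf;first exact: mdom.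
by move=> x /=;rewrite !in_itv/= !andbT => /ltW.
Qed.

Lemma meas_DRpos f : measurable_fun D f -> measurable_fun (@Rpos R) f.
by apply: measurable_funS;[exact: mdom|move=> x x0;apply/dom_ge0;exact: ltW].
Qed.

Lemma L2P f : L2 f <-> l2 f.
split=> [[mf fi]|[mf fi]].
 have m:= meas_Rpos mf;split => //;rewrite -(int_Rpos (f:= fun x => f x ^+ 2))//;exact: measurable_funX.
by split;[exact: meas_DRpos|rewrite (int_Rpos (f:= fun x => f x ^+ 2))//;exact: measurable_funX].
Qed.

Lemma ip_Rpos f g : l2 f -> l2 g -> (\int[mu]_(x in @Rpos R) (f x * g x)%:E = (ip f g)%:E)%E.
move=> lf lg;rewrite -(integral_ip lf lg) (int_Rpos (f:= fun x => f x * g x))//.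
by apply: measurable_funM;[case: lf|case: lg].
Qed.

Lemma sq_Rpos f : l2 f -> (\int[mu]_(x in @Rpos R) (f x ^+ 2)%:E = (nrm f ^+ 2)%:E)%E.
move=> lf;rewrite nrm_sq -(ip_Rpos lf lf);apply: eq_integral => x _;by rewrite expr2.
Qed.

Lemma test_derive phi : test_fun phi -> test_fun (derive1 phi).
move=> [sm [a [b [a0 [ab z]]]]];split.
 by move=> n x;have:= sm n.+1 x;rewrite derive1Sn.
exists a, b;split=> //;split=> // x hx;rewrite derive1E;apply: derive_val.
have hn : \near x, (fun=> 0 : R) x = phi x.
 case: hx => hx;near=> y;symmetry;apply: z;[left|right];near: y;[exact: lt_nbhsl|exact: lt_nbhsr].
exact: (near_eq_is_derive hn (is_derive_cst (0 : R) x 1)).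
Unshelve. all: by end_near.
Qed.

Lemma test_diff phi x : test_fun phi -> is_derive x 1 phi (derive1 phi x).
by move=> [sm _];rewrite derive1E;apply: derivableP;exact: (sm 0%N x). Qed.

Lemma test_bounded phi : test_fun phi -> exists2 M, 0 <= M & forall x, `|phi x| <= M.
move=> tp;have cf : continuous phi.
 by move=> x;apply: differentiable_continuous;apply/derivable1_diffP;exact: (@ex_derive _ _ _ _ _ _ _ (test_diff x tp)).
case: tp => _ [a [b [a0 [ab z]]]].
have cn : {within `[a, b], continuous (fun x => `|phi x|)}.
 by apply: continuous_subspaceT => x;apply: continuous_comp;[exact: cf|exact: norm_continuous].
have [c _ hc]:= EVT_max (ltW ab) cn;exists `|phi c| => // x.
have [xa|xa]:= ltP x a;first by rewrite z ?normr0//;left.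
have [xb|xb]:= ltP b x;first by rewrite z ?normr0//;right.
by apply: hc;rewrite in_itv /= xa xb.
Qed.

Lemma test_l2 phi : test_fun phi -> l2 phi.
move=> tp;have cf : continuous phi.
 by move=> x;apply: differentiable_continuous;apply/derivable1_diffP;exact: (@ex_derive _ _ _ _ _ _ _ (test_diff x tp)).
have [M M0 hM]:= test_bounded tp;case: tp => _ [a [b [a0 [ab z]]]].
have b0 : 0 <= b by lra.
have li : l2 (ind 0 b) by apply: l2_ind;exact/dom_ge0.
have mp : measurable_fun D phi by apply: measurable_funTS;exact: continuous_measurable_fun.
apply: (l2_eq (f:= phi * ind 0 b));last exact: (l2M (c:= M) mp (fun x _ => hM x) li).
move=> x /dom_ge0 x0;rewrite fE ind_le//;have [xa|xa]:= ltP x a;first by rewrite z ?mul0r//;left.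
have [xb|xb]:= ltP b x;first by rewrite z ?mul0r//;right.
by rewrite (lt_le_trans a0 xa) mulr1.
Qed.

(** A bounded second derivative makes f' uniformly continuous, so f and the integral of f' are both
    uniform antiderivatives of f'. *)
Lemma C2_prim f f' f'' M : (forall x, is_derive x 1 f (f' x)) -> (forall x, is_derive x 1 f' (f'' x)) ->
 (forall x, `|f'' x| <= M) -> l2 f' -> prim f f'.
move=> d1 d2 bM lf';have M0 : 0 <= M by exact: leT (normr_ge0 _) (bM 0).
have cf' : continuous f'.
 by move=> x;apply: differentiable_continuous;apply/derivable1_diffP;exact: (@ex_derive _ _ _ _ _ _ _ (d2 x)).
have lip x y : `|f' x - f' y| <= M * `|x - y|.
 wlog xy : x y / y <= x.
  by move=> wl;have [|/ltW]:= leP y x;[exact: wl|rewrite distrC (distrC x);exact: wl].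
 have [c _ ->]:= MVT_segment xy (fun z _ => d2 z) (continuous_subspaceT cf').
 by rewrite normrM;exact: ler_wpM2r.
have small e : 0 < e -> 0 < e / (M + 1) by move=> e0;rewrite divr_gt0// ltr_wpDl.
have uc : ucont f'.
 move=> T e /small e1;exists (e / (M + 1)) => // t t' t0 tt tT.
 rewrite ler_pdivlMr ?ltr_wpDl// => td;apply: leT (lip _ _) _;rewrite ger0_norm ?subr_ge0//.
 by apply: leT td;rewrite mulrC;apply: ler_wpM2l;rewrite ?subr_ge0//;lra.
have pd : pdiff f f'.
 move=> T e /small e1;exists (e / (M + 1)) => // t t' t0 tt tT.
 rewrite ler_pdivlMr ?ltr_wpDl// => td;have tau0 : 0 <= t' - t by rewrite subr_ge0.
 have -> : e * (t' - t) = e * `|t' - t| by rewrite ger0_norm.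
 rewrite [(t' - t) * _]mulrC;apply: (mvt_bound d1) => x hx;apply: leT (lip _ _) _.
 rewrite (ger0_norm tau0) in hx;apply: leT td;rewrite [leRHS]mulrC;apply: ler_pM => //;lra.
have key t : 0 <= t -> f t - f 0 = ip f' (ind 0 t).
 have pd' : pdiff (fun t => f t - f 0) f'.
  move=> T e e0;have [d d0 hd]:= pd T e e0;exists d => // t1 t2 h1 h2 h3 h4.
  by have:= hd t1 t2 h1 h2 h3 h4;rewrite opprB addrA subrK.
 by apply: (pdiff_eq pd' (tint_pdiff uc));rewrite subrr tint0.
split=> // x y dx dy;have x0 : 0 <= x by exact/dom_ge0. have y0 : 0 <= y by exact/dom_ge0.
have d0 : D 0 by exact/dom_ge0.
have lx:= l2_ind d0 dx;have ly:= l2_ind d0 dy.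
rewrite -(ind_chasles x 0 y) (ind_opp 0 x) ipDr ?ipNr//;last exact: l2N.
by rewrite -!key//;ring.
Qed.

Lemma test_prim phi : test_fun phi -> prim phi (derive1 phi).
move=> tp;have t1:= test_derive tp;have t2:= test_derive t1;have [M _ hM]:= test_bounded t2.
exact: (C2_prim (fun x => test_diff x tp) (fun x => test_diff x t1) hM (test_l2 t1)).
Qed.

(** Test functions vanish near 0, so integration by parts leaves no boundary term. *)
Lemma prim_weak f g : prim f g -> l2 f -> is_weak_deriv f g.
move=> p lf phi tp;have l1:= test_l2 tp;have l1':= test_l2 (test_derive tp);have lg:= prim_l2 p.
have z0 : phi 0 = 0 by case: tp => _ [a [b [a0 [_ z]]]];apply: z;left.
rewrite (ip_Rpos lf l1') (ip_Rpos lg l1) -EFinN;congr EFin.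
have:= ibp p (test_prim tp) lf l1;rewrite z0 mulr0 oppr0 => /eqP;rewrite addrC addr_eq0 => /eqP ->.
by [].
Qed.

(** A weak chain has to start with [f] itself, which agrees with the bottom level for s > 0 only;
    hence the patched sequence [g]. *)
Lemma encode k (c : chain) f e : isH k c -> (forall s, 0 < s -> f s = c 0%N s) -> NH k c ^+ 2 <= e -> Hk_sq_le k f e.
move=> hc fE ce;pose g j:= if j is 0%N then f else c j.
have gE j s : 0 < s -> g j s = c j s by case: j => [|j] //;exact: fE.
have lg j : (j <= k)%N -> L2 (g j).
 move=> jk;have /L2P[mc ic]:= isH_l2 hc jk;split.
  by apply: eq_measurable_fun mc => x;rewrite inE => x0;rewrite gE.
 have -> // : (\int[mu]_(x in @Rpos R) (g j x ^+ 2)%:E = \int[mu]_(x in @Rpos R) (c j x ^+ 2)%:E)%E.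
 by apply: eq_integral => x;rewrite inE => x0;rewrite gE.
exists g;split.
 split=> //;split=> // j jk phi tp.
 have:= prim_weak (isH_prim hc jk) (isH_l2 hc (ltnW jk)) tp.
 have q i (w : R -> R) : (\int[mu]_(x in @Rpos R) (g i x * w x)%:E = \int[mu]_(x in @Rpos R) (c i x * w x)%:E)%E.
  by apply: eq_integral => x;rewrite inE => x0;rewrite gE.
 by rewrite !q.
rewrite (eq_bigr (fun j : 'I_k.+1 => (nrm (c j) ^+ 2)%:E));last first.
 move=> j _;rewrite -(sq_Rpos (isH_l2 hc (ltn_ord j : (j <= k)%N))).
 by apply: eq_integral => x;rewrite inE => x0;rewrite gE.
rewrite sumEFin lee_fin;apply: leT ce;rewrite expr2 /NH mulr_suml;apply: ler_sum => j _.
rewrite expr2;apply: ler_wpM2l;first exact: nrm_ge0.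
exact: (NH_nrm _ c (ltn_ord j : (j <= k)%N)).
Qed.

End WeakDerivatives.

(** * From weak derivatives to chains *)

Section DecodeWeakDerivatives.
Variable R : realType.
Local Notation mu:= (@lebesgue_measure R).
Import HalfLine.
Local Notation D:= (@dom R false).
Local Notation chain:= (nat -> R -> R).
Implicit Types (T e d t s x y a b M r : R) (f g h phi : R -> R) (k n j : nat).

Lemma ip_ae_half f g h : l2 f -> l2 g -> l2 h -> {ae mu, forall x, 0 < x -> f x = g x} -> ip f h = ip g h.
move=> lf lg lh fg;have e q : ip q h = ipT (ext q) (ext h).
 by rewrite ip_ext;apply: ip_eq => x /dom_ge0 x0;rewrite extE.
rewrite !e;apply: ip_ae;try exact: l2_ext.
apply: (aeS2 _ fg (ae_neq2 0 0)) => x hx [/eqP x0 _].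
have [xp|xn]:= ltP 0 x;first by rewrite !extE ?hx ?ltW.
have xD : (x \in D) = false by apply/negbTE;rewrite notin_setE => /dom_ge0 x0';apply: x0;apply/le_anti;rewrite xn.
by rewrite /ext !patchE xD.
Qed.

Lemma prim_ae f g g' : prim f g -> l2 g' -> {ae mu, forall x, 0 < x -> g x = g' x} -> prim f g'.
move=> [lg h] lg' gg;split => // x y dx dy;rewrite h//;apply: ip_ae_half => //;exact: l2_ind.
Qed.

Lemma ae_point (P : R -> Prop) a b : a < b -> {ae mu, forall x, P x} -> exists2 x, a < x <= b & P x.
move=> ab aeP;apply: contrapT => no.
have neg : mu.-negligible (`]a, b]%classic : set R).
 by apply: negligibleS aeP => x /=;rewrite in_itv/= => x0 Px;apply: no;exists x.
have m1 : mu (`]a, b]%classic : set R) = (b - a)%:E by rewrite lebesgue_measure_itv /= lte_fin ab -EFinB.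
have /eqP:= etrans (esym m1) (proj1 (negligibleP mu (measurable_itv _)) neg).
by rewrite eqe subr_eq0 gt_eqF.
Qed.

Section Kernel.
Variables (th th' : R -> R) (C : R).
Hypotheses (sth : forall a b, smooth (fun x => th (a * x + b))) (dth : forall x, is_derive x 1 th (th' x)).
Hypotheses (th0 : forall x, x <= 0 -> th x = 0) (th1 : forall x, 1 <= x -> th x = 1) (th01 : forall x, 0 <= th x <= 1).
Hypotheses (C0 : 0 <= C) (th'C : forall x, `|th' x| <= C) (th'0 : forall x, x < 0 \/ 1 < x -> th' x = 0).

(** A smooth version of the indicator of the points beyond x, climbing on [x, x + r]. Its derivative
    [kern] is a one-sided mollifier of mass one, and differences of two such steps are the test
    functions to be used. *)
Definition stepf r x s:= th (r^-1 * s + (- (r^-1 * x))).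
Definition kern r x s:= r^-1 * th' (r^-1 * s + (- (r^-1 * x))).

Let arg r x s : r^-1 * s + (- (r^-1 * x)) = r^-1 * (s - x). by rewrite mulrBr. Qed.

Lemma step_derive r x s : is_derive s 1 (stepf r x) (kern r x s).
by apply: is_derive_affine;exact: dth. Qed.

Lemma step0 r x s : 0 < r -> s <= x -> stepf r x s = 0.
by move=> r0 sx;rewrite /stepf arg th0// pmulr_rle0 ?invr_gt0// subr_le0. Qed.

Lemma step1 r x s : 0 < r -> x + r <= s -> stepf r x s = 1.
by move=> r0 sx;rewrite /stepf arg th1// mulrC ler_pdivlMr// mul1r lerBrDl. Qed.

Lemma kern0 r x s : 0 < r -> s < x \/ x + r < s -> kern r x s = 0.
move=> r0 h;rewrite /kern arg th'0 ?mulr0//;case: h => h;[left|right].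
 by rewrite pmulr_rlt0 ?invr_gt0// subr_lt0.
by rewrite mulrC ltr_pdivlMr// mul1r ltrBrDl.
Qed.

Lemma step_test r x y : 0 < r -> 0 < x -> x < y -> test_fun (fun s => stepf r x s - stepf r y s) /\
 derive1 (fun s => stepf r x s - stepf r y s) = kern r x - kern r y.
move=> r0 x0 xy;split;last first.
 by apply/funext => s;rewrite derive1E;apply: derive_val;apply: is_deriveB;exact: step_derive.
split.
 move=> n z;apply: (proj2 (smooth_derive1 n _)).
 rewrite (_ : (fun s => _) = (fun s => stepf r x s + -1 * stepf r y s));last by apply/funext => s;rewrite mulN1r.
 by apply: smoothD;[exact: sth|apply: smoothM;[exact: smooth_cst|exact: sth]].
exists (x / 2), (y + r);split;first by lra.
split;first by lra.
move=> s [h|h];first by rewrite !step0 ?subrr//;lra.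
by rewrite !step1 ?subrr//;lra.
Qed.

Lemma step_ind r x y : 0 < r -> 0 < x -> x < y ->
 nrm ((fun s => stepf r x s - stepf r y s) - ind x y) <= 2 * Num.sqrt r.
move=> r0 x0 xy;have D_ z : 0 < z -> D z by move=> z0;apply/dom_ge0;exact: ltW.
have l1 : l2 (ind x (x + r)) by apply: l2_ind;apply: D_;lra.
have l1' : l2 (ind y (y + r)) by apply: l2_ind;apply: D_;lra.
have lt : l2 (fun s => stepf r x s - stepf r y s) by apply: test_l2;case: (step_test r0 x0 xy).
have li : l2 (ind x y) by apply: l2_ind;apply: D_;lra.
have n1 z : 0 < z -> nrm (ind z (z + r)) = Num.sqrt r.
 move=> z0;have dz:= D_ z z0;have dr : D (z + r) by apply: D_;exact: addr_gt0.
 by rewrite nrm_ind// addrC addKr ger0_norm// ltW.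
apply: leT (_ : nrm (ind x (x + r) + ind y (y + r)) <= _);last first.
 by have y0:= lt_trans x0 xy;apply: leT (nrmD l1 l1') _;rewrite !n1//;lra.
apply: nrm_le;[exact: l2B|exact: l2D|] => s _.
have xr : x <= x + r by lra.
have yr : y <= y + r by lra.
have q z : `|stepf r z s - (z < s)%R%:R| <= ind z (z + r) s.
 have zr : z <= z + r by lra.
 rewrite (ind_le _ zr);case: ltP => zs;last by rewrite step0// subrr normr0.
 case: (leP s (z + r)) => sz /=;last by rewrite step1 ?subrr ?normr0// ltW.
 by have /andP[a b]:= th01 (r^-1 * s + (- (r^-1 * z)));rewrite ler_norml /stepf;apply/andP;split;lra.
have -> : ((fun s => stepf r x s - stepf r y s) - ind x y) s = (stepf r x s - (x < s)%R%:R) - (stepf r y s - (y < s)%R%:R).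
 rewrite subfE (ind_le _ (ltW xy));case: (ltP x s) => xs;case: (leP s y) => sy /=;try by ring.
 by have:= lt_trans xy sy;rewrite ltNge xs.
apply: leT (ler_normB _ _) _;apply: leT (lerD (q x) (q y)) _;exact: ler_norm.
Qed.

Lemma kern_l2 r x : 0 < r -> 0 < x -> l2 (kern r x).
move=> r0 x0;have xy : x < x + r + r by lra.
have [t e]:= step_test r0 x0 xy;have:= test_l2 (test_derive t);rewrite e => lk.
have li : l2 (ind 0 (x + r)) by apply: l2_ind;apply/dom_ge0;lra.
have mk : measurable_fun D (kern r x).
 apply: measurable_funTS;apply: continuous_measurable_fun => s.
 have [g sg dg]:= smooth_derive (sth r^-1 (- (r^-1 * x))).
 have [g' _ dg']:= smooth_derive sg;have -> : kern r x = g.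
  apply/funext => z;rewrite -(@derive_val _ _ _ _ _ _ _ (step_derive r x z));exact: (@derive_val _ _ _ _ _ _ _ (dg z)).
 by apply: differentiable_continuous;apply/derivable1_diffP;exact: (@ex_derive _ _ _ _ _ _ _ (dg' s)).
apply: (l2_eq (f:= kern r x * ind 0 (x + r))).
 move=> s /dom_ge0 s0;have xr : 0 <= x + r by lra.
 rewrite fE (ind_le _ xr);case: (ltP 0 s) => s1 /=;last by rewrite mulr0 kern0//;left;lra.
 by case: leP => sx;rewrite ?mulr1// mulr0 kern0//;right.
apply: (l2M (c:= r^-1 * C)) => // s _;rewrite /kern normrM ger0_norm ?invr_ge0 ?(ltW r0)//.
by apply: ler_wpM2l => //;rewrite invr_ge0 ltW.
Qed.

Lemma kern_mass r x : 0 < r -> r < 1 -> 0 < x -> ip (ind 0 (x + 1)) (kern r x) = 1.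
move=> r0 r1 x0;have xy : x < x + 2 by lra.
have [t e]:= step_test r0 x0 xy;have [_ p]:= test_prim t.
have dx : D (x + 1) by apply/dom_ge0;lra.
have d0 : D 0 by exact/dom_ge0.
have:= p 0 (x + 1) d0 dx;rewrite e ipC => h.
have z : ip (ind 0 (x + 1)) (kern r x) = ip (ind 0 (x + 1)) (kern r x - kern r (x + 2)).
 apply: ip_eq => s _;have [s1|s1]:= leP s (x + 1);last first.
  have x1 : 0 <= x + 1 by lra.
  have -> : ind 0 (x + 1) s = 0 by rewrite (ind_le _ x1) [s <= _]leNgt s1 andbF.
  by rewrite !mul0r.
 by rewrite subfE [kern r (x + 2) s]kern0 ?subr0//;left;lra.
have e1 : stepf r (x + 2) (x + 1) = 0 by apply: step0 => //;lra.
have e2 : stepf r x 0 = 0 by apply: step0 => //;lra.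
have e3 : stepf r (x + 2) 0 = 0 by apply: step0 => //;lra.
have e4 : stepf r x (x + 1) = 1 by apply: step1 => //;lra.
by rewrite z -h e1 e2 e3 e4 !subr0.
Qed.

(** The mollifier is bounded by C / r and supported in [x, x + r], inside the ball of radius 2 r;
    that ball has measure 4 r, whence the factor 4 C. *)
Lemma kern_davg r x f : l2 f -> 0 < r -> 2 * r < 1 -> 2 * r < x ->
 (`|ip f (kern r x) - f x|%:E <= (4 * C)%:E * davg (ext f) x (2 * r))%E.
move=> lf r0 r1 rx;have x0 : 0 < x by lra.
have lk:= kern_l2 r0 x0;have li : l2 (ind 0 (x + 1)) by apply: l2_ind;apply/dom_ge0;lra.
pose G:= f - f x *: ind 0 (x + 1);have lG : l2 G by apply: l2B => //;exact: l2Z.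
have -> : ip f (kern r x) - f x = ip G (kern r x).
 by rewrite /G ipBl ?ipZl ?kern_mass ?mulr1//;[lra|exact: l2Z].
have mk : measurable_fun D (fun y => G y * kern r x y) by apply: measurable_funM;[case: lG|case: lk].
have -> : (`|ip G (kern r x)|%:E = `|(ip G (kern r x))%:E|)%E by [].
rewrite -(integral_ip lG lk).
apply: leT (le_abse_integral mu (@mdom R false) _) _;first exact/measurable_EFinP.
have lef:= l2_ext lf;have mef : measurable_fun setT (ext f) by case: lef.
pose B:= ball x (2 * r);have mB : measurable B by exact: measurable_ball.
have r2 : 0 <= 2 * r by lra.
have muB : mu B = (4 * r)%:E by rewrite lebesgue_measure_ball// mulr2n;congr EFin;lra.
pose c y:= `|ext f y - ext f x|.
have mc : measurable_fun setT c by apply: measurableT_comp => //;apply: measurable_funB.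
have -> : ((4 * C)%:E * davg (ext f) x (2 * r) = \int[mu]_(y in B) ((C / r) * c y)%:E)%E.
 under [RHS]eq_integral do rewrite EFinM.
 rewrite ge0_integralZl//;first last.
 - by rewrite lee_fin divr_ge0// ltW.
 - by move=> y _;rewrite lee_fin /c.
 - by apply/measurable_EFinP;exact: measurable_funTS.
 rewrite /davg /iavg -/B muB inver gt_eqF ?mulr_gt0// muleA -EFinM;congr (_ * _)%E.
  by congr EFin;field;rewrite gt_eqF.
rewrite integral_mkcond [leRHS]integral_mkcond;apply: ge0_le_integral => //.
- by move=> y _;rewrite erestrict_ge0.
- apply/(measurable_restrictT _ (@mdom R false));apply: measurableT_comp => //;exact/measurable_EFinP.
- apply/(measurable_restrictT _ mB);apply/measurable_EFinP;apply: measurable_funTS;exact: measurable_funM.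
move=> y _;rewrite !patchE;case: ifPn => [|_];last first.
 have q : (0%:E <= (C / r * c y)%:E)%E by rewrite lee_fin mulr_ge0 /c// divr_ge0// ltW.
 by case: ifP.
rewrite inE => /dom_ge0 y0;case: ifPn => yB.
 move: yB;rewrite inE /B /ball /= ltr_norml => /andP[y1 y2].
 have x1 : 0 <= x + 1 by lra.
 have -> : G y = f y - f x.
  rewrite /G !fE (ind_le _ x1) (_ : (_ && _) = true) ?mulr1//;apply/andP;split;lra.
 rewrite /= lee_fin normrM /c !extE//;last lra.
 rewrite mulrC;apply: ler_wpM2r => //;rewrite /kern normrM ger0_norm ?invr_ge0 ?(ltW r0)// mulrC.
 by apply: ler_wpM2r => //;rewrite invr_ge0 ltW.
rewrite notin_setE /B /ball /= in yB;have -> : kern r x y = 0;last by rewrite mulr0 /= normr0.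
apply: kern0 => //;case: (ltP y x) => yx;[by left|right].
by rewrite ltNge;apply/negP => yr;apply: yB;rewrite ltr_norml;apply/andP;split;lra.
Qed.

Lemma kern_small f x e : l2 f -> 0 < x -> lebesgue_pt (ext f) x -> 0 < e ->
 exists2 d, 0 < d & forall r, 0 < r -> r < d -> `|ip f (kern r x) - f x| <= e.
move=> lf x0 /fine_cvgP[fn cv] e0;have K0 : 0 < 4 * C + 1 by rewrite ltr_wpDl// mulr_ge0.
have eK : 0 < e / (4 * C + 1) by rewrite divr_gt0.
move/cvgrPdist_le: cv => /(_ _ eK)[d2 /= d20 h2];case: fn => d1 /= d10 h1.
exists (Num.min (Num.min d1 d2 / 2) (Num.min x 1 / 2)).
 by rewrite lt_min;apply/andP;split;rewrite divr_gt0// lt_min ?d10 ?d20 ?x0 ?ltr01.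
move=> r r0;rewrite lt_min !ltr_pdivlMr// !lt_min => /andP[/andP[r1 r2] /andP[r3 r4]].
have b d : r * 2 < d -> ball (0 : R) d (2 * r).
 by move=> rd;rewrite /ball /= sub0r normrN ger0_norm;lra.
have f1:= h1 _ (b _ r1) ltac:(lra);have f2:= h2 _ (b _ r2) ltac:(lra).
have k1 : 2 * r < 1 by lra.
have k2 : 2 * r < x by lra.
have:= kern_davg lf r0 k1 k2;move: f1 f2;rewrite /=;case: (davg _ _ _) => // v _ /=.
rewrite sub0r normrN -EFinM lee_fin => hv h;apply: leT h _.
have v1:= leT (ler_norm v) hv;apply: leT (_ : 4 * C * (e / (4 * C + 1)) <= _).
 by apply: ler_wpM2l => //;exact: mulr_ge0.
by rewrite mulrCA ger_pMr// ler_pdivrMr// mul1r lerDl.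
Qed.

End Kernel.

(** Testing with a difference of smooth steps gives, as r tends to 0, the increment formula between
    two Lebesgue points of f. Almost every point is one, and the antiderivative of h based at one of
    them is the continuous representative. *)
Lemma weak_prim f h : l2 f -> l2 h -> is_weak_deriv f h ->
 exists2 g, prim g h & {ae mu, forall x, 0 < x -> g x = f x}.
move=> lf lh w;have [th [th' [sth dth th0 th1 th01]]]:= smooth_step R.
have th'0 x : x < 0 \/ 1 < x -> th' x = 0.
 move=> hx;rewrite -(@derive_val _ _ _ _ _ _ _ (dth x)).
 case: hx => hx.
  have hn : \near x, (fun=> 0 : R) x = th x by near=> y;symmetry;apply: th0;apply: ltW;near: y;exact: lt_nbhsl.
  exact: (@derive_val _ _ _ _ _ _ _ (near_eq_is_derive hn (is_derive_cst (0 : R) x 1))).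
 have hn : \near x, (fun=> 1 : R) x = th x by near=> y;symmetry;apply: th1;apply: ltW;near: y;exact: lt_nbhsr.
 exact: (@derive_val _ _ _ _ _ _ _ (near_eq_is_derive hn (is_derive_cst (1 : R) x 1))).
have [C C0 th'C] : exists2 C, 0 <= C & forall x, `|th' x| <= C.
 have lt13 : (1 : R) < 3 by lra.
 have [t e]:= step_test sth dth th0 th1 ltr01 ltr01 lt13;have [M M0 hM]:= test_bounded (test_derive t).
 exists M => // x;have [x1|x1]:= ltP 1 x;first by rewrite th'0 ?normr0//;right.
 have:= hM (x + 1);rewrite e subfE.
 have -> : kern th' 1 3 (x + 1) = 0 by rewrite /kern th'0 ?mulr0//;left;rewrite invr1;lra.
 have -> : kern th' 1 1 (x + 1) = th' x by rewrite /kern invr1 !mul1r;congr th';ring.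
 by rewrite subr0.
have loc:= l2_locally_integrable (l2_ext lf);have aeL:= lebesgue_differentiation loc.
have key x y : 0 < x -> x < y -> lebesgue_pt (ext f) x -> lebesgue_pt (ext f) y -> f y - f x = ip h (ind x y).
 move=> x0 xy px py;have y0:= lt_trans x0 xy.
 apply/eqP;rewrite -subr_eq0 -normr_le0;apply: (@le_eps R _ 0 (2 + 2 * nrm h));first by have:= nrm_ge0 false h;lra.
 move=> e e0 _;rewrite add0r.
 have [d1 d10 h1]:= kern_small sth dth th0 th1 C0 th'C th'0 lf x0 px e0.
 have [d2 d20 h2]:= kern_small sth dth th0 th1 C0 th'C th'0 lf y0 py e0.
 (* The bound by e^2 gives sqrt r <= e, the L2 distance between the smooth steps and the indicator
    being at most 2 sqrt r. *)
 pose r:= Num.min (Num.min d1 d2 / 2) (e ^+ 2);have dm : 0 < Num.min d1 d2 by rewrite lt_min d10.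
 have r0 : 0 < r by rewrite lt_min divr_gt0// exprn_gt0.
 have rm : r < Num.min d1 d2 by apply: (@le_lt_trans _ _ (Num.min d1 d2 / 2));rewrite ?ge_min ?lexx// ltr_pdivrMr//;lra.
 move: (rm);rewrite lt_min => /andP[r1 r2].
 have re : Num.sqrt r <= e by apply: sqrt_le;[exact: ltW|rewrite ge_min lexx orbT].
 have [t te]:= step_test sth dth th0 th1 r0 x0 xy;have lt:= test_l2 t.
 have lkx:= kern_l2 sth dth th0 th1 th'C th'0 r0 x0;have lky:= kern_l2 sth dth th0 th1 th'C th'0 r0 y0.
 have lk : l2 (kern th' r x - kern th' r y) by exact: l2B.
 have:= w _ t;rewrite te (ip_Rpos lf lk) (ip_Rpos lh lt) -EFinN => -[];rewrite ipBr// => wk.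
 have li : l2 (ind x y) by apply: l2_ind;apply/dom_ge0;exact: ltW.
 have n1:= CS lh (l2B lt li);rewrite ipBr// in n1.
 have n2:= step_ind sth dth th0 th1 th01 r0 x0 xy.
 have n3 : nrm h * nrm ((fun s => stepf th r x s - stepf th r y s) - ind x y) <= nrm h * (2 * e).
  by apply: ler_wpM2l;[exact: nrm_ge0|apply: leT n2 _;rewrite ler_pM2l].
 have a1:= h1 r r0 r1;have a2:= h2 r r0 r2;have n4:= leT n1 n3.
 move: wk a1 a2 n4;set P:= ip f _;set Q:= ip f _;set S:= ip h _;set I:= ip h (ind x y).
 rewrite !ler_norml => wk /andP[? ?] /andP[? ?] /andP[? ?];apply/andP;split;nra.
have [x0 /andP[x00 _] px0]:= ae_point ltr01 aeL.
have d0 : D x0 by apply/dom_ge0;exact: ltW.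
exists (fun s => f x0 + ip h (ind x0 s));first exact: prim_of.
apply: (aeS _ aeL) => x px xp;have [xx|xx|->]:= ltgtP x x0.
- by rewrite (ind_opp x x0) ipNr ?l2_ind -?(key _ _ xp xx px px0)//;[ring|apply: l2_ind;apply/dom_ge0;exact: ltW].
- by rewrite -(key _ _ x00 xx px0 px);ring.
- by rewrite ind_refl ipC ip0l addr0.
Unshelve. all: by end_near.
Qed.

(** Every level below the top is replaced by its continuous representative; the top one is kept as
    it is. *)
Lemma decode k f (g : chain) : weak_chain k f g -> exists2 c, isH k c & forall j, (j <= k)%N -> {ae mu, forall x, 0 < x -> c j x = g j x}.
move=> [g0 [lg wg]];have lgj j : (j <= k)%N -> l2 (g j) by move=> jk;apply/L2P;exact: lg.
have /choice[c hc] : forall j, exists c, (j < k)%N -> prim c (g j.+1) /\ {ae mu, forall x, 0 < x -> c x = g j x}.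
 move=> j;have [jk|_]:= boolP (j < k)%N;last by exists (g j).
 by have [c p a]:= weak_prim (lgj j (ltnW jk)) (lgj j.+1 jk) (wg j jk);exists c.
pose c' j:= if (j < k)%N then c j else g j.
have ac j : {ae mu, forall x, 0 < x -> c' j x = g j x}.
 rewrite /c';case: ifP => jk;first by case: (hc j jk).
 by apply: (aeS _ (ae_neq2 0 0)) => x _.
exists c' => [|j _];last exact: ac.
have lc j : (j <= k)%N -> l2 (c' j).
 move=> jk;rewrite /c';case: ifP => jk';last exact: lgj.
 have [p a]:= hc j jk';have lgj':= lgj j jk;have mc:= prim_meas p.
 split=> //;have [_ fin]:= lgj';apply: le_lt_trans fin.
 rewrite -(int_Rpos (f:= fun x => c j x ^+ 2));last exact: measurable_funX.
 rewrite -(int_Rpos (f:= fun x => g j x ^+ 2));last by apply: measurable_funX;case: lgj'.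
 apply: eqW;apply: ae_eq_integral.
 - exact: measurable_Rpos.
 - by apply/measurable_EFinP;apply: measurable_funX;exact: meas_DRpos.
 - by apply/measurable_EFinP;apply: measurable_funX;apply: meas_DRpos;case: lgj'.
 - by apply: (aeS _ a) => x hx x0;rewrite hx.
split=> // j jk;rewrite {1}/c' jk;have [p _]:= hc j jk.
by apply: (prim_ae p (lc j.+1 jk));apply: (aeS _ (ac j.+1)) => x hx x0;rewrite hx.
Qed.

End DecodeWeakDerivatives.

(** * Pointwise derivatives against Sobolev derivatives *)

Section PointwiseDerivatives.
Variable R : realType.
Local Notation mu:= (@lebesgue_measure R).
Import HalfLine.
Local Notation D:= (@dom R false).
Implicit Types (T e d t s x y a b h l M : R) (f g : R -> R) (k n j m : nat).

(** Linear approximation relative to the half-line, hence automatically one-sided at 0; it serves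
    for the variables s and t alike. *)
Definition sdiff f s l:= forall e, 0 < e -> exists2 d, 0 < d & forall h, `|h| <= d -> 0 <= s + h -> `|f (s + h) - f s - h * l| <= e * `|h|.

(** The supremum of the initial segments on which Q holds is attained by the limit hypothesis and
    exceeded by the step hypothesis. *)
Lemma real_induction (Q : R -> Prop) : Q 0 ->
 (forall x, 0 <= x -> (forall y, 0 <= y -> y <= x -> Q y) -> exists2 d, 0 < d & forall y, x <= y -> y <= x + d -> Q y) ->
 (forall x, 0 < x -> (forall y, 0 <= y -> y < x -> Q y) -> Q x) -> forall x, 0 <= x -> Q x.
move=> Q0 step lim T T0;apply: contrapT => nQ.
pose S : set R:= [set x | 0 <= x /\ forall y, 0 <= y -> y <= x -> Q y].
have S0 : S 0 by split => // y y0 y0';rewrite (_ : y = 0)//;apply/le_anti;rewrite y0 y0'.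
have ubT x : S x -> x <= T.
 by move=> [x0 h];rewrite leNgt;apply/negP => /ltW Tx;exact: nQ (h T T0 Tx).
have hs : has_sup S by split;[exists 0|exists T].
have s0 : 0 <= sup S by exact: (sup_upper_bound hs).
have below y : 0 <= y -> y < sup S -> Q y.
 move=> y0 ys;have e0 : 0 < sup S - y by rewrite subr_gt0.
 by have [x [x0 hx]]:= sup_adherent e0 hs;rewrite opprB addrC subrK => yx;apply: hx => //;exact: ltW.
have Qs : Q (sup S).
 by move: s0;rewrite le_eqVlt => /orP[/eqP <-//|sp];exact: lim sp below.
have Ss y : 0 <= y -> y <= sup S -> Q y.
 by move=> y0;rewrite le_eqVlt => /orP[/eqP ->//|];exact: below.
have [d d0 hd]:= step _ s0 Ss.
have : S (sup S + d).
 split;first by rewrite addr_ge0// ltW.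
 by move=> y y0 yd;have [ys|/ltW ys]:= leP y (sup S);[exact: Ss|exact: hd].
by move/(sup_upper_bound hs);rewrite gerDl leNgt d0.
Qed.

(** Real induction: the first hypothesis extends F <= F 0 beyond a point, the second, a one-sided
    semicontinuity, carries it to limits from the left. *)
Lemma creep (F : R -> R) T : 0 <= T ->
 (forall x, 0 <= x -> x < T -> exists2 d, 0 < d & forall h, 0 <= h -> h <= d -> x + h <= T -> F (x + h) <= F x) ->
 (forall x e, 0 < x -> x <= T -> 0 < e -> exists2 d, 0 < d & forall y, 0 <= y -> x - d <= y -> y <= x -> F x <= F y + e) -> F T <= F 0.
move=> T0 fw lf;suff h : forall x, 0 <= x -> x <= T -> F x <= F 0 by exact: h T T0 (lexx T).
apply: (@real_induction (fun x => x <= T -> F x <= F 0)) => //.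
- move=> x x0 hx;have [xT|Tx]:= ltP x T;last first.
  by exists 1 => // y xy _ yT;have -> : y = x;[apply/le_anti;rewrite xy (leT yT Tx)|apply: hx => //;exact: leT xy yT].
 have [d d0 hd]:= fw x x0 xT;exists d => // y xy yd yT.
 have h:= hd (y - x);rewrite subr_ge0 lerBlDl (_ : x + (y - x) = y) in h;last by ring.
 by apply: leT (h xy yd yT) _;apply: hx => //;exact: ltW.
- move=> x x0 hx xT;apply/ler_addgt0Pr => e e0;have [d d0 hd]:= lf x e x0 xT e0.
 pose y:= Num.max 0 (x - d);have yx : y < x by rewrite gt_max x0 ltrBlDr ltrDl.
 have y0 : 0 <= y by rewrite le_max lexx.
 apply: leT (hd y y0 _ (ltW yx)) _;first by rewrite le_max lexx orbT.
 by rewrite lerD2r;apply: hx => //;exact: leT (ltW yx) xT.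
Qed.

Lemma sdiff_continuous f s (l : R) e : sdiff f s l -> 0 < e ->
 exists2 d, 0 < d & forall x : R, 0 <= x -> `|x - s| <= d -> `|f x - f s| <= e.
move=> h e0;have [d d0 hd]:= h 1 ltr01;have L0 : 0 < 1 + `|l| by rewrite ltr_pwDl.
exists (Num.min d (e / (1 + `|l|)));first by rewrite lt_min d0 divr_gt0.
move=> x x0;rewrite le_min ler_pdivlMr// => /andP[h1 h2].
have xE : s + (x - s) = x by ring.
have:= hd (x - s) h1;rewrite xE => /(_ x0) h3.
have -> : f x - f s = (f x - f s - (x - s) * l) + (x - s) * l by ring.
apply: leT (ler_normD _ _) _;rewrite normrM;apply: leT h2;rewrite mulrDr mulr1.
by rewrite lerD2r;move: h3;rewrite mul1r.
Qed.

Lemma small_open (N : set R) e : mu.-negligible N -> 0 < e -> exists U : set R, [/\ open U, N `<=` U, l2 \1_U & nrm \1_U <= e].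
move=> [M [mM M0 NM]] e0;have e2 : 0 < e ^+ 2 by rewrite exprn_gt0.
have [|U [oU MU hU]]:= lebesgue_regularity_outer mM _ e2;first by rewrite [X in (X < _)%E]M0 ltry.
have mU : measurable U by exact: open_measurable.
exists U;have [lU nU] : l2 \1_U /\ nrm \1_U <= e;last by split => //;exact: subset_trans MU.
apply: l2_of_le (ltW e0).
- exact: measurable_indic.
- apply: leT (_ : (mu (U `&` D) <= _)%E).
  apply: eqW;rewrite -integral_indic//;last exact: mdom.
  by apply: eq_integral => x _;rewrite indicE;case: (_ \in _);rewrite /= ?expr1n ?expr0n.
 apply: leT (_ : (mu U <= _)%E).
  have mI : measurable (U `&` D) by apply: measurableI => //;exact: mdom.
  by apply: le_measure;rewrite ?inE//;exact: subIsetl.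
 apply: leT (_ : (mu (U `\` M) + mu (U `&` M) <= _)%E).
  by apply: eqW;exact: measureDI.
 rewrite [X in (_ + X <= _)%E](subset_measure0 _ mM _ M0)//;last exact: measurableI.
 by rewrite adde0 ltW.
Qed.

Lemma ip_ge0_ind g x y : 0 <= x -> x <= y -> l2 g -> (forall z, 0 <= g z) -> 0 <= ip g (ind x y).
move=> x0 xy lg g0;rewrite ipE;apply: Rintegral_ge0 => z _.
by rewrite mulr_ge0// (ind_le _ xy).
Qed.

(* Denjoy: at the points of the null set where the derivative does not vanish, the increment is
   absorbed by the integral of a sum of indicators of small open neighbourhoods. *)
Lemma null_derivative_le f (l : R -> R) T : 0 <= T ->
 (forall x, 0 <= x -> sdiff f x (l x)) ->
 {ae mu, forall x, 0 < x -> l x = 0} -> f T - f 0 <= 0.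
move=> T0 df ael;apply: (@le_eps R _ 0 (T + 2 * Num.sqrt T));first by rewrite addr_ge0// mulr_ge0// sqrtr_ge0.
move=> e e0 _;rewrite add0r;pose N : set R:= [set x | 0 <= x /\ l x <> 0].
have nN : mu.-negligible N.
 have [A [mA A0 sA]]:= ael;exists (A `|` [set 0]);split.
 - by apply: measurableU => //;exact: measurable_set1.
 - apply/eqP;rewrite eq_le measure_ge0 andbT;apply: leT (measureU2 _ _ _) _ => //.
  by rewrite [X in (X + _)%E]A0 add0e [X in (X <= _)%E]lebesgue_measure_set1.
 - move=> x [x0 lx];have [->|xn]:= eqVneq x 0;[by right|left].
  by apply: sA => h;apply: lx;apply: h;rewrite lt_neqAle eq_sym xn.
(* Open sets containing the whole exceptional set, with indicators of total norm at most 2 e. Near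
   an exceptional point any number of them overlap, so the integral [P] of their sum grows there
   faster than any given slope. *)
have /choice[Ok hO] : forall k, exists U : set R, [/\ open U, N `<=` U, l2 \1_U & nrm \1_U <= e * 2^-1 ^+ k].
 by move=> k;apply: small_open => //;rewrite mulr_gt0// exprn_gt0.
have lO k : l2 \1_(Ok k) by case: (hO k).
have D_ x : 0 <= x -> D x by move=> x0;exact/dom_ge0.
have l_ x y : 0 <= x -> 0 <= y -> l2 (ind x y) by move=> x0 y0;apply: l2_ind;exact: D_.
pose S m : R -> R:= \sum_(k < m) \1_(Ok k);have SE m z : S m z = \sum_(k < m) \1_(Ok k) z by rewrite /S fct_sumE.
have lS m : l2 (S m) by apply: (@l2_sum R false) => k;exact: lO.
have [|phi lp hp]:= @l2_complete R false S e lS.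
 move=> m;have -> : S m.+1 - S m = \1_(Ok m) by apply/funext => z;rewrite subfE !SE big_ord_recr /=;ring.
 by case: (hO m).
pose P x:= ip phi (ind 0 x).
have Pinc x y : 0 <= x -> x <= y -> P y - P x = ip phi (ind x y).
 by move=> x0 xy;have y0:= leT x0 xy;rewrite /P -(ind_chasles 0 x y) (ipDr (l_ _ _ (lexx 0) x0) (l_ x y x0 y0) lp);ring.
have Pstep n x y : 0 <= x -> x <= y -> ip (S n) (ind x y) <= P y - P x.
 move=> x0 xy;have y0:= leT x0 xy;have li:= l_ x y x0 y0;rewrite Pinc// leNgt;apply/negP;rewrite -subr_gt0 => q0.
 have K0 : 0 < 2 * e * (nrm (ind x y) + 1) by rewrite !mulr_gt0// ltr_wpDl// nrm_ge0.
 have cv : (2^-1 ^+ m : R) @[m --> \oo] --> (0 : R) by apply: (@geo_cvg0 R 1) => m;rewrite mul1r ger0_norm// exprn_ge0.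
 move/cvgrPdist_lt: cv => /(_ _ (divr_gt0 q0 K0))[m _ /(_ m (leqnn m))];rewrite /= sub0r normrN ger0_norm ?exprn_ge0// => hm.
 pose p:= maxn m n.
 have pn : ip (S n) (ind x y) <= ip (S p) (ind x y).
  rewrite -subr_ge0 -ipBl//;apply: ip_ge0_ind => // [|z];first exact: l2B.
  have np : (n <= p)%N by exact: leq_maxr.
  rewrite subfE !SE subr_ge0 -(subnK np) addnC big_split_ord /= lerDl;apply: sumr_ge0 => k _;by rewrite indicE.
 have:= leT (ler_norm _) (CS (l2B (lS p) lp) li);rewrite ipBl// => b1.
 have b2 : nrm (S p - phi) * nrm (ind x y) <= 2 * e * 2^-1 ^+ p * (nrm (ind x y) + 1).
  by apply: ler_pM;rewrite ?nrm_ge0 ?hp// lerDl.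
 have b3 : 2^-1 ^+ p <= 2^-1 ^+ m :> R by apply: ler_wiXn2l;rewrite ?leq_maxl ?invr_ge0// invf_le1// ler1n.
 have:= le_lt_trans b3 hm;rewrite ltr_pdivlMr// => b4.
 by move: b4;rewrite mulrCA mulrA;lra.
have Pm x y : 0 <= x -> x <= y -> P x <= P y.
 by move=> x0 xy;have:= Pstep 0%N x y x0 xy;rewrite /S big_ord0 ip0l subr_ge0.
have P0 : P 0 = 0 by rewrite /P ind_refl ipC ip0l.
have PT : P T <= 2 * e * Num.sqrt T.
 apply: leT (leT (ler_norm _) (CS lp (l_ _ _ (lexx 0) T0))) _.
 rewrite nrm_ind ?subr0 ?(ger0_norm T0)//;try exact: D_.
 apply: ler_wpM2r;first exact: sqrtr_ge0.
 by have:= hp 0%N;rewrite /S big_ord0 sub0r nrmN expr0 mulr1.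
have : f T - e * T - P T <= f 0 - e * 0 - P 0.
 apply: (@creep (fun x => f x - e * x - P x)) => //.
 - move=> x x0 _;have [d d0 hd]:= df x x0 e e0.
  have [lx|lx]:= pselect (l x = 0).
   exists d => // h h0 hd' _;have xh : x <= x + h by rewrite lerDl.
   have:= hd h;rewrite (ger0_norm h0) lx mulr0 subr0 => /(_ hd' (addr_ge0 x0 h0)) /(leT (ler_norm _)).
   by have:= Pm x (x + h) x0 xh;lra.
  have [n hn] : exists n, `|l x| <= n%:R.
   by exists (Num.trunc `|l x|).+1;apply: ltW;exact: truncnS_gt.
  have /choice[r hr] : forall k, exists r : {posnum R}, forall z, `|z - x| < r%:num -> Ok k z.
   move=> k;have [oO sO _ _]:= hO k;have Ox : Ok k x by apply: sO.
   have:= open_nbhs_nbhs (conj oO Ox);rewrite -nbhs_ballE => -[r /= r0 hr].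
   by exists (PosNum r0) => z zx;apply: hr;rewrite /ball /= distrC.
  have [d' d'0 hd''] : exists2 d', 0 < d' & forall k, (k < n)%N -> d' < (r k)%:num.
   elim: (n) => [|p [d' d'0 IH]];first by exists 1.
   exists (Num.min d' ((r p)%:num / 2));first by rewrite lt_min d'0 divr_gt0.
   move=> k;rewrite ltnS leq_eqVlt => /orP[/eqP ->|kp];rewrite gt_min.
    by apply/orP;right;rewrite ltr_pdivrMr// ltr_pMr// ltr1n.
   by rewrite IH.
  exists (Num.min d d');first by rewrite lt_min d0.
  move=> h h0;rewrite le_min => /andP[h1 h2] _;have xh : x <= x + h by rewrite lerDl.
  have:= hd h;rewrite (ger0_norm h0) => /(_ h1 (addr_ge0 x0 h0)) h3.
  have S1 : ip (S n) (ind x (x + h)) = n%:R * h.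
   transitivity (n%:R * ip (ind x (x + h)) (ind x (x + h)));last by rewrite ip_ind//;[ring|exact: D_].
   have li:= l_ x (x + h) x0 (addr_ge0 x0 h0);rewrite -ipZl//;apply: ip_eq => z _.
   rewrite scalefE SE (ind_le _ xh);case: ltP => xz;last by rewrite !mulr0.
   case: leP => zh;last by rewrite !mulr0.
   rewrite !mulr1 (eq_bigr (fun=> 1)) ?sumr_const ?card_ord// => k _.
   rewrite indicE (_ : z \in Ok k)//;rewrite inE;apply: hr.
   rewrite gtr0_norm ?subr_gt0//;apply: le_lt_trans (hd'' k (ltn_ord k)).
   by apply: leT h2;rewrite lerBlDl.
  have:= Pstep n x (x + h) x0 xh;rewrite S1.
  have h4 : h * l x <= n%:R * h by rewrite mulrC;apply: ler_wpM2r => //;exact: leT (ler_norm _) hn.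
  by have:= leT (ler_norm _) h3;lra.
 - move=> x e1 x0 _ e10;have [d d0 hd]:= sdiff_continuous (df x (ltW x0)) e10;exists d => // y y0 yd yx.
  have:= hd y y0;rewrite distrC (ger0_norm (_ : 0 <= x - y)) ?subr_ge0// lerBlDr -lerBlDl distrC => /(_ yd).
  have:= Pm y x y0 yx;have : e * y <= e * x by rewrite ler_pM2l.
  by rewrite ler_norml => h1 h2 /andP[_];lra.
by rewrite P0 mulr0 subr0 subr0;move: PT;lra.
Qed.

Lemma null_derivative f (l : R -> R) :
 (forall x, 0 <= x -> sdiff f x (l x)) ->
 {ae mu, forall x, 0 < x -> l x = 0} -> forall x, 0 <= x -> f x = f 0.
move=> df ael x x0;apply/eqP;rewrite eq_le -subr_le0 -[f 0 <= _]subr_le0 (null_derivative_le x0 df ael) /=.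
have:= @null_derivative_le (fun x => - f x) (fun x => - l x) x x0;rewrite opprK addrC;apply.
 move=> y y0 e e0;have [d d0 hd]:= df y y0 e e0;exists d => // h h1 h2.
 by have:= hd h h1 h2;rewrite -normrN;congr (`|_| <= _);ring.
by apply: (aeS _ ael) => y hy y0;rewrite hy// oppr0.
Qed.

Lemma sderivP f s l : sderiv f s l <-> 0 <= s /\ sdiff f s l.
have quot h e : h != 0 -> (`|l - h^-1 * (f (s + h) - f s)| <= e) = (`|f (s + h) - f s - h * l| <= e * `|h|).
 move=> h0;rewrite -ler_pdivrMr ?normr_gt0// -normfV -normrM distrC;congr (`|_| <= _);field.
 exact: h0.
split=> [|[s0 h]].
- case=> -[s0 cv];[split;first exact: ltW|subst s;split=> //];move/cvgrPdist_le: cv => cv e e0;have [d /= d0 hd]:= cv e e0.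
 + exists (d / 2);first by rewrite divr_gt0.
  move=> h hd' _;have [->|hn]:= eqVneq h 0;first by rewrite addr0 subrr mul0r subr0 normr0 mulr0.
  by rewrite -quot//;apply: hd => //;rewrite /= sub0r normrN;lra.
 + exists (d / 2);first by rewrite divr_gt0.
  move=> h hd' sh;have [h0|hn]:= eqVneq h 0;first by rewrite h0 addr0 subrr mul0r subr0 normr0 mulr0.
  rewrite add0r in sh;rewrite -quot//;apply: hd => /=;first by rewrite sub0r normrN;lra.
  by rewrite lt_neqAle eq_sym hn.
- move: s0;rewrite le_eqVlt => /orP[/eqP s0|s0];[right;split=> //|left;split => //].
 + apply/cvgrPdist_le => e e0;have [d d0 hd]:= h e e0;near=> z.
  have z0 : 0 < z by near: z;exact: nbhs_right_gt.
  rewrite quot ?gt_eqF//;apply: hd;last by rewrite -s0 add0r ltW.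
  by rewrite gtr0_norm//;near: z;exact: nbhs_right_le.
 + apply/cvgrPdist_le => e e0;have [d d0 hd]:= h e e0;near=> z.
  have zn : z != 0 by near: z;exact: nbhs_dnbhs_neq.
  have zd : `|z| <= d by near: z;exact: dnbhs0_le.
  have zs : `|z| <= s by near: z;exact: dnbhs0_le.
  rewrite quot//;apply: hd => //;have:= ler_norm (- z);rewrite normrN;lra.
Unshelve. all: by end_near.
Qed.

Lemma sdiff_unique f s l l' : 0 <= s -> sdiff f s l -> sdiff f s l' -> l = l'.
move=> s0 h h';apply/eqP;rewrite -subr_eq0 -normr_le0;apply: (@le_eps R _ 0 2) => // e e0 _;rewrite add0r.
have [d d0 hd]:= h e e0;have [d' d0' hd']:= h' e e0;pose z:= Num.min d d'.
have z0 : 0 < z by rewrite lt_min d0.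
have a : `|f (s + z) - f s - z * l| <= e * z.
 by rewrite -{3}(gtr0_norm z0);apply: hd;rewrite ?addr_ge0 ?(ltW z0)// (ger0_norm (ltW z0)) /z ge_min lexx.
have b : `|f (s + z) - f s - z * l'| <= e * z.
 by rewrite -{3}(gtr0_norm z0);apply: hd';rewrite ?addr_ge0 ?(ltW z0)// (ger0_norm (ltW z0)) /z ge_min lexx orbT.
rewrite -(ler_pM2l z0) -{1}(gtr0_norm z0) -normrM.
have -> : z * (l - l') = (f (s + z) - f s - z * l') - (f (s + z) - f s - z * l) by ring.
by apply: leT (ler_normB _ _) _;move: a b;lra.
Qed.

Lemma prim_sdiff (f g g' : R -> R) s : prim f g -> prim g g' -> 0 <= s -> sdiff f s (g s).
move=> pf pg s0 e e0;have N0 : 0 < nrm g' + 1 by rewrite ltr_wpDl// nrm_ge0.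
have D_ z : 0 <= z -> D z by move=> z0;exact/dom_ge0.
have ug : ucont g.
 move=> T e1 e10;exists ((e1 / (nrm g' + 1)) ^+ 2);first by rewrite exprn_gt0// divr_gt0.
 move=> t t' t0 tt _ td;apply: leT (prim_holder pg (D_ _ t0) (D_ _ (leT t0 tt))) _.
 rewrite mulrC ger0_norm ?subr_ge0//;apply: leT (_ : e1 / (nrm g' + 1) * nrm g' <= _).
  by apply: ler_wpM2r;[exact: nrm_ge0|apply: sqrt_le => //;rewrite divr_ge0 ?ltW].
 by rewrite mulrAC ler_pdivrMr//;apply: ler_wpM2l;[exact: ltW|rewrite lerDl].
have key x y : 0 <= x -> x <= y -> (forall z, x <= z -> z <= y -> `|g z - g s| <= e) ->
  `|f y - f x - (y - x) * g s| <= (y - x) * e.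
 move=> x0 xy h;have y0:= leT x0 xy;have -> : f y - f x = tint g y - tint g x.
  have [lg hf]:= pf;rewrite (hf _ _ (D_ x x0) (D_ y y0)) /tint -(ind_chasles 0 x y).
  by rewrite (ipDr (l2_ind (D_ 0 (lexx 0)) (D_ x x0)) (l2_ind (D_ x x0) (D_ y y0)) lg);ring.
 by apply: tint_bound => //;exact: ltW.
have [d d0 hd]:= ug (s + 1) e e0;exists (Num.min 1 d);first by rewrite lt_min ltr01.
move=> h;rewrite le_min => /andP[h1 h2] sh;have [h0|/ltW h0]:= leP 0 h.
 rewrite (ger0_norm h0) in h1 h2 *;have hE : s + h - s = h by ring.
 have ss : s <= s + h by rewrite lerDl.
 by have:= key s (s + h) s0 ss;rewrite hE [h * e]mulrC;apply=> z sz zh;apply: hd => //;lra.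
rewrite (ler0_norm h0) in h1 h2 *;have ss : s + h <= s by rewrite gerDl.
have hE : s - (s + h) = - h by ring.
have:= key (s + h) s sh ss;rewrite hE => k;have -> : f (s + h) - f s - h * g s = - (f s - f (s + h) - - h * g s) by ring.
by rewrite normrN [e * _]mulrC;apply: k => z sz zs;rewrite distrC;apply: hd => //;lra.
Qed.

Lemma sdiff_cst s (l : R) : sdiff (fun=> l) s 0.
by move=> e e0;exists 1 => // h _ _;rewrite subrr mulr0 subrr normr0 mulr_ge0// ltW. Qed.

Lemma sdiffB f g s l l' : sdiff f s l -> sdiff g s l' -> sdiff (fun x => f x - g x) s (l - l').
move=> h h' e e0;have e2 : 0 < e / 2 by rewrite divr_gt0.
have [d d0 hd]:= h _ e2;have [d' d0' hd']:= h' _ e2;exists (Num.min d d');first by rewrite lt_min d0.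
move=> z;rewrite le_min => /andP[k1 k2] sz;have a:= hd z k1 sz;have b:= hd' z k2 sz.
have -> : f (s + z) - g (s + z) - (f s - g s) - z * (l - l') = (f (s + z) - f s - z * l) - (g (s + z) - g s - z * l') by ring.
by apply: leT (ler_normB _ _) _;move: a b;lra.
Qed.

Lemma sdiffD f g s (l l' : R) : sdiff f s l -> sdiff g s l' -> sdiff (fun x => f x + g x) s (l + l').
move=> h h';have:= sdiffB h (sdiffB (sdiff_cst s 0) h').
by congr (sdiff _ _ _);[apply/funext => x|];ring.
Qed.

(** [v] and the antiderivative of [A] are differentiable everywhere with derivatives equal almost
    everywhere, so they differ by a constant; the derivatives then agree everywhere. *)
Lemma prim_of_derivative (v a A A' : R -> R) : (forall s, 0 <= s -> sdiff v s (a s)) -> prim A A' -> l2 A ->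
 {ae mu, forall x, 0 < x -> A x = a x} -> prim v A /\ forall s, 0 <= s -> a s = A s.
move=> dv pA lA ae;have d0 : D 0 by exact/dom_ge0.
pose P s:= v 0 + ip A (ind 0 s);have pP : prim P A by exact: prim_of.
have dP s : 0 <= s -> sdiff P s (A s) by move=> s0;exact: prim_sdiff pP pA s0.
have e s : 0 <= s -> v s = P s.
 move=> s0;apply/eqP;rewrite -subr_eq0;apply/eqP.
 rewrite (@null_derivative (fun x => v x - P x) (fun x => a x - A x) _ _ s s0).
 - by rewrite /P ind_refl ipC ip0l addr0 subrr.
 - by move=> x x0;apply: sdiffB;[exact: dv|exact: dP].
 - by apply: (aeS _ ae) => x hx x0;rewrite hx ?subrr.
split;first by apply: prim_eq pP => // x /dom_ge0 x0;rewrite e.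
move=> s s0;apply: (sdiff_unique s0 (dv s s0)) => eps e0.
have [d dd hd]:= dP s s0 eps e0;exists d => // h h1 h2;rewrite !e//;exact: hd.
Qed.

End PointwiseDerivatives.

(** * The initial frame and the even extension of its curvatures *)

Section InitialFrame.
Variable R : realType.
Import HalfLine.
Local Notation D:= (@dom R false).
Local Notation chain:= (nat -> R -> R).
Local Notation V:= (chain * chain)%type.
Local Notation vecf:= ('I_3 -> R -> R).
Implicit Types (s x y z : R) (f g : R -> R) (c r : 'I_3) (k n j i N : nat) (w : V).

Lemma cprod_eq0 (f g : chain) i s : (forall a b, (a + b = i)%N -> f a s * g b s = 0) -> cprod f g i s = 0.
elim: i f g => [|i IH] f g h /=;first exact: (h 0%N 0%N).
rewrite fE !IH ?addr0// => a b ab;rewrite /csh;apply: h;lia.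
Qed.

(* parity in j + i of the levels at 0 of the iterated frame components *)
Lemma parity w n : (forall j, (j < n)%N -> odd j -> iter j (Dt w) (zstart w) o0 0%N 0 = 0 /\ iter j (Dt w) (zstart w) o1 0%N 0 = 0) ->
 forall N, (N < n)%N -> forall j i, (j + i = N)%N ->
 (odd N -> iter j (Dt w) (zstart w) o0 i 0 = 0 /\ iter j (Dt w) (zstart w) o1 i 0 = 0) /\
 (~~ odd N -> iter j (Dt w) (zstart w) o2 i 0 = 0).
move=> h;pose Y j:= iter j (Dt w) (zstart w);elim/ltn_ind => N IH Nn.
have w1 a : (a < N)%N -> odd a -> w.1 a 0 = 0 /\ w.2 a 0 = 0 by move=> aN oa;apply: (proj1 (IH a aN (ltn_trans aN Nn) 0%N a erefl)).
have mixed r j i : (j + i).+1 = N -> (r = o0 \/ r = o1 -> ~~ odd N) -> (r = o2 -> odd N) ->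
  cprod w.1 (Y j r) i 0 = 0 /\ cprod w.2 (Y j r) i 0 = 0.
 move=> ji h01 h2;suff q a b : (a + b = i)%N -> (w.1 a 0 = 0 /\ w.2 a 0 = 0) \/ Y j r b 0 = 0.
  by split;apply: cprod_eq0 => a b ab;case: (q a b ab) => [[e1 e2]|e];rewrite ?e1 ?e2 ?e ?mul0r ?mulr0.
 move=> ab;have [oa|ea]:= boolP (odd a);first by left;apply: w1 => //;lia.
 have bN : (j + b < N)%N by lia.
 have [h1 h2']:= IH _ bN (ltn_trans bN Nn) j b erefl;right.
 move: r h01 h2;apply: ord3P => h01 h2.
 - by apply: (proj1 (h1 _));have:= h01 (or_introl erefl);lia.
 - by apply: (proj2 (h1 _));have:= h01 (or_intror erefl);lia.
 - by apply: h2';have:= h2 erefl;lia.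
have odd_case : odd N -> forall i j, (j + i = N)%N -> Y j o0 i 0 = 0 /\ Y j o1 i 0 = 0.
 move=> oN;elim=> [|i IHi] j ji;first by rewrite addn0 in ji;rewrite ji;exact: h.
 have [e0 e1]:= IHi j.+1 (etrans (addSnnS j i) ji);have [|||c1 c2]:= @mixed o2 j i;[exact: etrans (esym (addnS j i)) ji|by case|by []|].
 have l0 : Y j.+1 o0 i 0 = Y j o0 i.+1 0 + cprod w.1 (Y j o2) i 0 by [].
 have l1 : Y j.+1 o1 i 0 = Y j o1 i.+1 0 + cprod w.2 (Y j o2) i 0 by [].
 by move: l0 l1;rewrite e0 e1 c1 c2 !addr0 => <- <-.
have even_case : ~~ odd N -> forall j i, (j + i = N)%N -> Y j o2 i 0 = 0.
 move=> eN;elim=> [|j IHj] i ji;first by [].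
 have e2:= IHj i.+1 (etrans (esym (addSnnS j i)) ji).
 have [|||c1 _]:= @mixed o0 j i;[exact: ji|by []|by []|];have [|||_ c2]:= @mixed o1 j i;[exact: ji|by []|by []|].
 have l2' : Y j.+1 o2 i 0 = Y j o2 i.+1 0 - cprod w.1 (Y j o0) i 0 - cprod w.2 (Y j o1) i 0 by [].
 by rewrite -/(Y j.+1) l2' e2 c1 c2 !subr0.
by move=> j i ji;split=> hN;[exact: odd_case|exact: even_case].
Qed.

Section EvenExtension.
Variables (k : nat) (c : chain).
Hypotheses (hc : isH k c) (odd0 : forall j, (j < k)%N -> odd j -> c j 0 = 0).

(** Level j of the even extension has parity (-1)^j; the two halves match at 0 as soon as the odd
    levels vanish there. *)
Definition even_ext : chain:= fun j s => if 0 <= s then c j s else (-1) ^+ j * c j (- s).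

Lemma isH_even_ext : isHT k even_ext.
have le2 j : (j <= k)%N -> l2T (even_ext j).
 move=> jk;have lj:= isH_l2 hc jk;have le:= l2_ext lj;have [mj _]:= lj.
 pose h:= ext (c j) * \1_(@Rpos R);have mh : measurable_fun setT h.
  by have mR:= @measurable_Rpos R;apply: measurable_funM;[case: le|exact: measurable_indic].
 have hE s : h s = if 0 < s then c j s else 0.
  rewrite /h fE indicE (_ : (s \in @Rpos R) = (0 < s));last by apply/idP/idP;rewrite inE.
  case: ltP => s0;last by rewrite /= mulr0.
  by rewrite mulr1 extE// ltW.
 have lh : l2T h.
  apply: (@l2_le R true h (ext (c j)) 1 mh le) => s _;rewrite mul1r hE;case: ltP => s0;last by rewrite normr0.
  by rewrite extE// ltW.
 have lr : l2T (refl h) by have []:= l2_comp (preserving_refl R) lh.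
 apply: (l2_eq (f:= ext (c j) + (-1) ^+ j *: refl h));last by apply: l2D => //;exact: l2Z.
 move=> s _;rewrite !fE /refl /= hE oppr_gt0 /even_ext /ext patchE.
 have -> : (s \in D) = (0 <= s) by apply/idP/idP;rewrite ?inE;move/dom_ge0.
 by case: (leP 0 s) => s0;rewrite ?mulr0 ?addr0 ?add0r.
split=> // j jk;have lg:= le2 j.+1 jk;have pj:= isH_prim hc jk;have [lgj _]:= pj.
have d0 : D 0 by exact/dom_ge0.
have pos (g : R -> R) y : 0 <= y -> (forall s, 0 < s -> g s = c j.+1 s) -> ipT g (ind 0 y) = c j y - c j 0.
 move=> y0 gE;case: pj => _ -> //;last exact/dom_ge0.
 rewrite -ip_ext;apply: ip_eq => z _;rewrite (ind_le _ y0);case: (ltP 0 z) => z0;last by rewrite /= !mulr0.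
 by rewrite gE// extE// ltW.
have key y : even_ext j y - even_ext j 0 = ipT (even_ext j.+1) (ind 0 y).
 have e0 : even_ext j 0 = c j 0 by rewrite /even_ext lexx.
 have [y0|y0]:= leP 0 y.
  by rewrite e0 (pos _ y y0);[rewrite /even_ext y0|move=> s s0;rewrite /even_ext ltW].
 have lrg : l2T (refl (even_ext j.+1)) by have []:= l2_comp (preserving_refl R) lg.
 have rr : even_ext j.+1 = refl (refl (even_ext j.+1)) by apply/funext => s;rewrite /refl /= opprK.
 have ny : 0 <= - y by rewrite oppr_ge0 ltW.
 rewrite e0 (ind_opp y 0) ipNr//;last exact: l2_indT.
 rewrite rr ip_refl// oppr0.
 have -> : refl (even_ext j.+1) = (-1) ^+ j.+1 *: ((-1) ^+ j.+1 *: refl (even_ext j.+1)).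
  by rewrite scalerA -exprMn mulrNN mulr1 expr1n scale1r.
 rewrite ipZl ?l2_indT//;[|exact: l2Z|exact: l2_indT].
 rewrite (pos _ _ ny);last first.
  by move=> s s0;rewrite !fE /refl /= /even_ext leNgt oppr_lt0 s0 /= opprK mulrA -exprMn mulrNN mulr1 expr1n mul1r.
 rewrite {1}/even_ext leNgt y0 /= exprS;have [oj|ej]:= boolP (odd j).
  by rewrite (odd0 jk oj);ring.
 by rewrite -signr_odd (negbTE ej) expr0;ring.
split=> // x y _ _;rewrite -(ind_chasles x 0 y) (ind_opp 0 x) ipDr ?ipNr -?key//;try exact: l2_indT.
 by ring.
by apply: l2N;exact: l2_indT.
Qed.

End EvenExtension.

(** Regularity of order n with the chain hidden: in the induction below derivatives are expressions
    rather than levels of a given chain. *)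
Definition reg n f:= exists2 c : chain, isH n c & c 0%N = f.

Lemma reg_S n f g : l2 f -> prim f g -> reg n g -> reg n.+1 f.
by move=> lf p [c hc e];exists (fun i => if i is i'.+1 then c i' else f) => //;apply: isH_S => //=;rewrite e. Qed.
Lemma regD n f g : reg n f -> reg n g -> reg n (f + g).
by move=> [c hc <-] [c' hc' <-];exists (c + c') => //;exact: isHD. Qed.
Lemma regN n f : reg n f -> reg n (- f).
by move=> [c hc <-];exists (- c) => //;exact: isHN. Qed.
Lemma regM n f g (B : R) : measurable_fun D f -> (forall x, D x -> `|f x| <= B) -> reg n f -> reg n g -> reg n (f * g).
move=> mf bf [c hc ef] [c' hc' eg];case: n hc hc' => [|n] hc hc';last first.
 by exists (cprod c c');[exact: isH_cprod|rewrite /= ef eg].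
exists (fun=> f * g) => //;split=> // j _;rewrite -eg;apply: l2M mf bf _;exact: (isH_l2 hc' (leqnn 0)).
Qed.

Variables (K : nat) (v : vecf) (A : 'I_3 -> chain).
Hypotheses (K0 : (0 < K)%N) (hA : forall c, isH K (A c)) (pv : forall c, prim (v c) (A c 0%N)).
Hypotheses (v1 : forall s, 0 <= s -> \sum_c v c s ^+ 2 = 1) (v0 : forall c, v c 0 = (c == o2)%:R).
Hypothesis tr0 : forall j, (j < K)%N -> odd j -> A o0 j 0 = 0 /\ A o1 j 0 = 0.

Let Dx x : D x -> 0 <= x. by move/dom_ge0. Qed.
Let vb c x : D x -> `|v c x| <= 1.
move=> /Dx x0;rewrite -sqrtr_sqr;apply: sqrt_le => //;rewrite expr1n -(v1 x0).
by rewrite (bigD1 c) //= lerDl;apply: sumr_ge0 => i _;exact: sqr_ge0.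
Qed.

Lemma initial_bound : exists2 B, 0 <= B & forall c x, D x -> `|A c 0%N x| <= B.
exists (\sum_c NH 1 (A c));first by apply: sumr_ge0 => c _;exact: NH_ge0.
move=> c x dx;apply: leT (isH_sup (hA c) K0 dx) _.
by rewrite (bigD1 c) //= lerDl;apply: sumr_ge0 => i _;exact: NH_ge0.
Qed.

(** The constant |v|^2 is an antiderivative of twice the inner product of v and v_s, all of whose
    integrals therefore vanish; this product being itself an antiderivative of an L2 function, it is
    zero everywhere. *)
Lemma tangent_orth s : 0 <= s -> \sum_c A c 0%N s * v c s = 0.
have [B B0 bA]:= initial_bound;move=> s0.
have p1 c : prim (v c * v c) (A c 0%N * v c + v c * A c 0%N) by exact: prim_mul (pv c) (pv c) (vb c) (vb c).
have p2 c : prim (A c 0%N * v c) (A c 1%N * v c + A c 0%N * A c 0%N).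
 exact: prim_mul (isH_prim (hA c) K0) (pv c) (bA c) (vb c).
pose f:= A o0 0%N * v o0 + A o1 0%N * v o1 + A o2 0%N * v o2.
have q1 : prim (v o0 * v o0 + v o1 * v o1 + v o2 * v o2) (f + f).
 by apply: prim_eq (primD (primD (p1 o0) (p1 o1)) (p1 o2)) => // x _;rewrite /f !fE;ring.
have q2 : prim f _:= primD (primD (p2 o0) (p2 o1)) (p2 o2).
have l2f : l2 f.
 rewrite (_ : f = 2^-1 *: (f + f));first by apply: l2Z;exact: prim_l2 q1.
 by apply/funext => x;rewrite !scalefE addfE;field.
have [|_ nf]:= @zero_ae R f l2f;last by rewrite sum3;exact: (prim_zero q2 l2f nf s0).
move=> x y x0 y0;have dx : D x by exact/dom_ge0. have dy : D y by exact/dom_ge0.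
case: q1 => _ /(_ x y dx dy);rewrite !fE;have:= v1 x0;have:= v1 y0;rewrite !sum3 !expr2 => -> ->.
rewrite subrr ipDl//;[lra|exact: l2_ind].
Qed.

(** The skew matrix A v^T - v A^T, with A = v_s, generates parallel transport along v: it sends v to
    A, as |v| = 1 and A is orthogonal to v, and vectors orthogonal to v to multiples of v. Its
    solutions starting from e_1 and e_2 complete v to a rotation-free frame. *)
Lemma initial_frame : exists (G : 'I_3 -> vecf) (w : V), [/\ isH K w.1 /\ isH K w.2, frame (w.1 0%N) (w.2 0%N) G, orth G,
 forall c r, G c r 0 = (c == r)%:R & forall c s, 0 <= s -> G c o2 s = v c s].
have [B B0 bA]:= initial_bound.
pose a (i j : 'I_3) : R -> R:= fun s => A i 0%N s * v j s - v i s * A j 0%N s.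
have sa : skew a by move=> u u' s;rewrite /a;ring.
have mv c : measurable_fun D (v c):= prim_meas (pv c).
have la (i j : 'I_3) : l2 (a i j).
 have lA c : l2 (A c 0%N):= isH_l2 (hA c) (leq0n K).
 rewrite (_ : a i j = v j * A i 0%N - v i * A j 0%N);last by apply/funext => s;rewrite /a !fE;ring.
 by apply: l2B;[exact: l2M (mv j) (vb j) (lA i)|exact: l2M (mv i) (vb i) (lA j)].
have ba (i j : 'I_3) s : 0 <= s -> `|a i j s| <= 2 * B.
 move=> s0;have d : D s by exact/dom_ge0.
 rewrite /a;apply: leT (ler_normB _ _) _;rewrite !normrM.
 have m1 : `|A i 0%N s| * `|v j s| <= B by rewrite -[leRHS]mulr1;apply: ler_pM => //;[exact: bA|exact: vb].
 have m2 : `|v i s| * `|A j 0%N s| <= B by rewrite -[leRHS]mul1r;apply: ler_pM => //;[exact: vb|exact: bA].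
 lra.
have B20 : 0 <= 2 * B by rewrite mulr_ge0.
have [p [sp bp p0]]:= ode_exists B20 la ba sa (fun i : 'I_3 => (i == o0)%:R).
have [q [sq bq q0]]:= ode_exists B20 la ba sa (fun i : 'I_3 => (i == o1)%:R).
have bv : bddv v by exists 1 => // i s s0;apply: vb;exact/dom_ge0.
have sv : sys a v 0.
 move=> i;apply: prim_eq (pv i) => // s /Dx s0;rewrite fE -[(0 : vecf) i s]/(0 : R) addr0 /mulv /a.
 under eq_bigr do rewrite mulrBl -mulrA -[v i s * _ * _]mulrA.
 rewrite sumrB -!mulr_sumr tangent_orth// mulr0 subr0 (eq_bigr (fun c => v c s ^+ 2));first by rewrite v1// mulr1.
 by move=> c _;rewrite expr2.
pose Gt : 'I_3 -> vecf:= fun r => match nat_of_ord r with 0%N => p | 1%N => q | _ => v end.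
have sG r : sys a (Gt r) 0 /\ bddv (Gt r) by move: r;apply: ord3P.
have G0 r c : Gt r c 0 = (c == r)%:R by move: r;apply: ord3P;rewrite /Gt /=.
have oGt : orth Gt.
 move=> s s0 r r';have [s1 b1]:= sG r;have [s2 b2]:= sG r'.
 rewrite (dot_const sa b1 b2 s1 s2 s0) /dotv sum3 !G0.
 by move: r r' s1 b1 s2 b2;do 2 apply: ord3P => //=;rewrite ?mulr0 ?mulr1 ?addr0 ?add0r.
pose G : 'I_3 -> vecf:= fun c r => Gt r c.
have oG : orth G by move=> s s0 c c';exact: (orth_rows c c' oGt s0).
(* Frame coordinates of the j-th derivative of v_s; k and l are the first two at j = 0. Their
   derivatives are coordinates at level j + 1 plus products of coordinates at levels 0 and j, so the
   full regularity of k and l follows by induction. *)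
pose X j r : R -> R:= \sum_c A c j * Gt r c.
have XE j r s : X j r s = \sum_c A c j s * Gt r c s by rewrite /X fct_sumE.
have X2 s : 0 <= s -> X 0%N o2 s = 0 by move=> s0;rewrite XE;exact: tangent_orth.
have Gb r c x : D x -> `|Gt r c x| <= 1 by move/Dx;exact: orth_bound.
have mG r c : measurable_fun D (Gt r c) by case: (sG r) => h _;exact: prim_meas (h c).
have lX j r : (j <= K)%N -> l2 (X j r).
 move=> jK;apply: (@l2_sum R false) => c;rewrite mulrC;apply: l2M (mG r c) (Gb r c) _;exact: isH_l2 (hA c) jK.
have expand (z : 'I_3 -> R) s c : 0 <= s -> z c = (\sum_c' Gt o0 c' s * z c') * p c s + (\sum_c' Gt o1 c' s * z c') * q c s + (\sum_c' Gt o2 c' s * z c') * v c s.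
 by move=> s0;rewrite {1}(orth_expand z c oGt s0) sum3.
have dot0 r r' s : 0 <= s -> \sum_c Gt r c s * Gt r' c s = (r == r')%:R by move=> s0;exact: oGt.
have ps r c : r != o2 -> prim (Gt r c) (- (X 0%N r * v c)).
 move=> r2;have [s1 _]:= sG r;apply: prim_eq (s1 c) => // s /Dx s0.
 rewrite fE -[(0 : vecf) c s]/(0 : R) addr0 /mulv /a.
 under eq_bigr do rewrite mulrBl -mulrA -[v c s * _ * _]mulrA.
 rewrite sumrB -!mulr_sumr -(XE 0%N r s) (eq_bigr (fun c => Gt o2 c s * Gt r c s))// dot0// eq_sym (negbTE r2).
 by rewrite -[false%:R]/(0 : R) !fE;ring.
have vs c : prim (v c) (X 0%N o0 * p c + X 0%N o1 * q c).
 apply: prim_eq (pv c) => // s /Dx s0;rewrite {1}(expand (fun c => A c 0%N s) s c s0) !fE !XE.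
 have -> : \sum_c' Gt o2 c' s * A c' 0%N s = 0.
  by transitivity (X 0%N o2 s);[rewrite XE;apply: eq_bigr => c' _;exact: mulrC|exact: X2].
 by rewrite mul0r addr0;congr (_ * _ + _ * _);apply: eq_bigr => c' _;rewrite mulrC.
have pA j c : (j < K)%N -> prim (A c j) (A c j.+1) by exact: isH_prim.
have bAj j c x : (j < K)%N -> D x -> `|A c j x| <= NH j.+1 (A c) by move=> jK;exact: isH_sup.
have pX j : (j < K)%N -> [/\ prim (X j o0) (X j.+1 o0 - X 0%N o0 * X j o2), prim (X j o1) (X j.+1 o1 - X 0%N o1 * X j o2) &
  prim (X j o2) (X j.+1 o2 + X 0%N o0 * X j o0 + X 0%N o1 * X j o1)].
 move=> jK;have m r c g : prim (Gt r c) g -> prim (A c j * Gt r c) (A c j.+1 * Gt r c + A c j * g).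
  by move=> pg;exact: prim_mul (pA j c jK) pg (fun x => bAj j c x jK) (Gb r c).
 split.
 - apply: prim_eq (prim_sum (fun c => m o0 c _ (ps o0 c isT))) => x _;first by rewrite XE.
  rewrite !fE [X j o2 x]XE [X j.+1 _ x]XE mulr_sumr -sumrB /=;apply: eq_bigr => c _;rewrite !fE /Gt /=;ring.
 - apply: prim_eq (prim_sum (fun c => m o1 c _ (ps o1 c isT))) => x _;first by rewrite XE.
  rewrite !fE [X j o2 x]XE [X j.+1 _ x]XE mulr_sumr -sumrB /=;apply: eq_bigr => c _;rewrite !fE /Gt /=;ring.
 - apply: prim_eq (prim_sum (fun c => m o2 c _ (vs c))) => x _;first by rewrite XE.
  rewrite !fE [X j o0 x]XE [X j o1 x]XE [X j.+1 _ x]XE !mulr_sumr -!big_split /=;apply: eq_bigr => c _;rewrite !fE /Gt /=;ring.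
have X0b r x : D x -> `|X 0%N r x| <= 3 * B.
 move=> d;rewrite XE;apply: leT (ler_norm_sum _ _ _) _.
 have -> : 3 * B = \sum_(c < 3) B by rewrite sumr_const card_ord mulr_natl.
 by apply: ler_sum => c _;rewrite normrM -[leRHS]mulr1;apply: ler_pM => //;[exact: bA|exact: Gb].
have mX r : measurable_fun D (X 0%N r) by case: (lX 0%N r (leq0n K)).
have regX n j : (j + n <= K)%N -> forall r, reg n (X j r).
 elim: n j => [|n IH] j jn r;first by exists (fun=> X j r) => //;split=> // i _;apply: lX;rewrite -(addn0 j).
 have jK : (j < K)%N by apply: leq_trans jn;rewrite addnS ltnS leq_addr.
 have r1 : forall r, reg n (X j.+1 r) by apply: IH;rewrite addSnnS.
 have r2 r' : reg n (X j r') by apply: IH;apply: leq_trans jn;rewrite leq_add2l.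
 have r3 r' : reg n (X 0%N r') by apply: IH;apply: leq_trans jn;rewrite add0n addnS leqW// leq_addl.
 have mul r' r'' : reg n (X 0%N r' * X j r'') by apply: regM (mX r') (X0b r') (r3 r') (r2 r'').
 have [h0 h1 h2]:= pX j jK;move: r;apply: ord3P;(apply: reg_S;first exact: lX (ltnW jK)).
 - exact: h0.
 - by apply: regD (r1 o0) (regN (mul _ _)).
 - exact: h1.
 - by apply: regD (r1 o1) (regN (mul _ _)).
 - exact: h2.
 - by apply: regD (regD (r1 o2) (mul _ _)) (mul _ _).
have [k hk ek]:= regX K 0%N (leqnn _) o0;have [l hl el]:= regX K 0%N (leqnn _) o1.
exists G, (k, l);split => //=;last by move=> c r;rewrite /G G0.
move=> c;split.
 rewrite ek el;apply: sys3.
 - by apply: prim_eq (ps o0 c isT) => // s _;rewrite !fE -[(0 : vecf) _ s]/(0 : R) add0r.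
 - by apply: prim_eq (ps o1 c isT) => // s _;rewrite !fE -[(0 : vecf) _ s]/(0 : R) add0r.
 - by apply: prim_eq (vs c) => // s _;rewrite !fE -[(0 : vecf) _ s]/(0 : R) add0r.
by exists 1 => // r s s0;apply: Gb;exact/dom_ge0.
Qed.

(** The frame is the identity at s = 0, so the vanishing traces of v_s are vanishing coordinates of
    iterated derivatives. By parity the odd derivatives of k and l vanish at 0, and their even
    extensions keep the order K. *)
Lemma initial_data : exists (G : 'I_3 -> vecf) (w : V), [/\ HP K w, evenP w, frame (w.1 0%N) (w.2 0%N) G /\ orth G,
 forall c r, G c r 0 = (c == r)%:R & forall c s, 0 <= s -> G c o2 s = v c s].
have [G [w [[h1 h2] fG oG G0 Gv]]]:= initial_frame.
have levA c j s : (j < K)%N -> 0 <= s -> lev G w (zstart w) c j s = A c j s.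
 have hz : isH K (lev G w (zstart w) c) by apply: isH_lev => //;apply: ord3P => //;exact: isH0.
 have e s' : 0 <= s' -> (lev G w (zstart w) c - A c) 0%N s' = 0.
  have [pa _ _]:= frame_prim c fG;move=> s0.
  suff : forall x, 0 <= x -> lev G w (zstart w) c 0%N x = A c 0%N x by move=> h;rewrite -[LHS]/(_ - _) h// subrr.
  have p1 : prim (v c) (lev G w (zstart w) c 0%N).
   have [_ _ pv']:= frame_prim c fG;apply: prim_eq pv' => x;first by move/Dx;exact: Gv.
   move=> _;rewrite /lev sum3 !fE;set Y:= zstart w.
   have -> : iter 0 (Dt w) Y o0 0%N x = w.1 0%N x by [].
   have -> : iter 0 (Dt w) Y o1 0%N x = w.2 0%N x by [].
   by have -> : iter 0 (Dt w) Y o2 0%N x = 0 by [];ring.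
  have pd:= primB p1 (pv c);have ld:= prim_l2 pd.
  have [|_ nz]:= @zero_ae R _ ld.
   move=> x y x0 y0;case: pd => _ <-;[|exact/dom_ge0|exact/dom_ge0].
   by rewrite !fE !subrr.
  move=> x x0;apply/eqP;rewrite -subr_eq0;apply/eqP.
  exact: (prim_zero (primB (isH_prim hz K0) (isH_prim (hA c) K0)) ld nz x0).
 by move=> jK s0;have [_ /(_ jK s s0)/eqP]:= chain_zero (isHB hz (hA c)) e (ltnW jK);rewrite subr_eq0 => /eqP.
have T0 j : (j < K)%N -> odd j -> iter j (Dt w) (zstart w) o0 0%N 0 = 0 /\ iter j (Dt w) (zstart w) o1 0%N 0 = 0.
 move=> jK oj;have [t0 t1]:= tr0 jK oj.
 have:= levA o0 j 0 jK (lexx 0);have:= levA o1 j 0 jK (lexx 0).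
 by rewrite t0 t1 /lev !sum3 !fE !G0 /= !(mul0r, mul1r, add0r, addr0).
have od j : (j < K)%N -> odd j -> w.1 j 0 = 0 /\ w.2 j 0 = 0.
 by move=> jK oj;exact: (proj1 (parity T0 jK (j:= 0) (i:= j) erefl) oj).
have e1:= isH_even_ext h1 (fun j jK oj => proj1 (od j jK oj));have e2:= isH_even_ext h2 (fun j jK oj => proj2 (od j jK oj)).
exists G, (even_ext w.1, even_ext w.2);split=> //.
- have ev (c : chain) s : even_ext c 0%N (- s) = even_ext c 0%N s.
  rewrite /even_ext !expr0 !mul1r oppr_ge0 opprK;case: (ltgtP s 0) => [||->] //;by rewrite oppr0.
 by move=> s;split;exact: ev.
- split=> // c;have [sG bG]:= fG c;split=> //.
 have e (c' : chain) s : D s -> even_ext c' 0%N s = c' 0%N s by move=> /Dx s0;rewrite /even_ext s0.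
 have [q0 q1 q2]:= sys3_inv sG;apply: sys3.
 - by apply: prim_eq q0 => // s d;rewrite !fE /= e.
 - by apply: prim_eq q1 => // s d;rewrite !fE /= e.
 - by apply: prim_eq q2 => // s d;rewrite !fE /= !e.
Qed.

End InitialFrame.

(** * From the moving frame to a solution of the stated problem *)

Section Existence.
Variable R : realType.
Local Notation mu:= (@lebesgue_measure R).
Import HalfLine.
Local Notation D:= (@dom R false).
Local Notation chain:= (nat -> R -> R).
Local Notation V:= (chain * chain)%type.
Local Notation vecf:= ('I_3 -> R -> R).
Implicit Types (s t d e : R) (f g : R -> R) (c r : 'I_3) (k n j i : nat) (u : R -> R -> R).

Definition mkvec (f : 'I_3 -> R) : vec R:= (f o0, f o1, f o2).
Lemma vc_mkvec (f : 'I_3 -> R) c : vc c (mkvec f) = f c.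
by move: c;apply: ord3P. Qed.
Lemma mkvecK (a : vec R) : mkvec (fun c => vc c a) = a.
by case: a => [[]]. Qed.
Lemma vcP i : (i < 3)%N -> exists c : 'I_3, i = c.
by move=> i3;exists (Ordinal i3). Qed.

Lemma nrm0_ae g : l2 g -> nrm g = 0 -> {ae mu, forall x, 0 < x -> g x = 0}.
move=> lg n0;have [|a _]:= zero_ae lg;last by apply: (aeS _ a) => x h x0;apply: h;apply/dom_ge0;exact: ltW.
move=> x y x0 y0;apply/eqP;rewrite -normr_le0;have lx : l2 (ind x y) by apply: l2_ind;exact/dom_ge0.
by apply: leT (CS lg lx) _;rewrite n0 mul0r.
Qed.

Lemma ae_nrm0 g : l2 g -> {ae mu, forall x, 0 < x -> g x = 0} -> nrm g = 0.
move=> lg a;have [|_ //]:= zero_ae lg;move=> x y x0 y0.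
by rewrite (ip_ae_half lg (l20 R false) _ a) ?ip0l//;apply: l2_ind;exact/dom_ge0.
Qed.

Lemma chain_ae_unique k (b c : chain) : (0 < k)%N -> isH k b -> isH k c -> {ae mu, forall x, 0 < x -> b 0%N x = c 0%N x} ->
 forall j, (j <= k)%N -> nrm (b j - c j) = 0 /\ ((j < k)%N -> forall s, 0 <= s -> b j s = c j s).
move=> k0 hb hc a j jk;have h:= isHB hb hc.
have n0 : nrm ((b - c) 0%N) = 0.
 by apply: ae_nrm0 (isH_l2 h (leq0n k)) _;apply: (aeS _ a) => x e x0;rewrite -[LHS]/(b 0%N x - c 0%N x) e// subrr.
have [z0 z]:= chain_zero h (prim_zero (isH_prim h k0) (isH_l2 h (leq0n k)) n0) jk.
by split=> // jk' s s0;apply/eqP;rewrite -subr_eq0;apply/eqP;exact: z.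
Qed.

(** The trace belongs to some continuous representative of some weak derivative. Arbitrarily close
    to 0 there are points where it coincides with the level of the chain, and that level is
    continuous up to 0. *)
Lemma trace_eq k (A : chain) f j (l : R) : (j < k)%N -> (0 < j)%N -> isH k A -> {ae mu, forall x, 0 < x -> A 0%N x = f x} ->
 wtrace j f l -> A j 0 = l.
move=> jk j0 hA aA [g [wg [h [_ [hl ah]]]]];have [b hb ab]:= decode wg.
have g0 : g 0%N = f by case: wg.
have a0 : {ae mu, forall x, 0 < x -> b 0%N x = A 0%N x}.
 by apply: (aeS2 _ (ab 0%N (leq0n _)) aA) => x e1 e2 x0;rewrite e1// e2// g0.
have hA':= isH_le (ltnW jk) hA;have [n0 _]:= chain_ae_unique j0 hb hA' a0 (leqnn j).
have lb:= l2B (isH_l2 hb (leqnn j)) (isH_l2 hA' (leqnn j)).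
have ae : {ae mu, forall x, 0 < x -> h x = A j x}.
 apply: (aeS2 _ (nrm0_ae lb n0) (aeS2 (S:= fun x => 0 < x -> h x = b j x) _ ah (ab j (leqnn j)))) => [x e1 e2 x0|x e1 e2 x0].
  by have:= e1 x0;rewrite fE e2// => /eqP;rewrite subr_eq0 => /eqP.
 by rewrite e2// e1.
apply/eqP;rewrite -subr_eq0 -normr_le0;apply: (@le_eps R _ 0 2) => // e e0 _;rewrite add0r.
move/cvgrPdist_le: hl => /(_ e e0)[d1 /= d10 h1].
pose N:= nrm (A j.+1) + 1;have N0 : 0 < N by rewrite ltr_wpDl// nrm_ge0.
have dd : 0 < Num.min (d1 / 2) ((e / N) ^+ 2) by rewrite lt_min divr_gt0// exprn_gt0// divr_gt0.
have [x /andP[x0]]:= ae_point dd ae;rewrite le_min => /andP[x1 x2] hx.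
have b1 : `|l - h x| <= e by apply: h1 => //=;rewrite sub0r normrN gtr0_norm//;lra.
have d0 : D 0 by exact/dom_ge0. have dx : D x by apply/dom_ge0;exact: ltW.
have b2 : `|A j x - A j 0| <= e.
 apply: leT (prim_holder (isH_prim hA jk) d0 dx) _;rewrite subr0 gtr0_norm//.
 apply: leT (_ : nrm (A j.+1) * (e / N) <= _).
  by apply: ler_wpM2l;[exact: nrm_ge0|apply: sqrt_le => //;rewrite divr_ge0 ?(ltW e0) ?(ltW N0)].
 by rewrite mulrCA ger_pMr// ler_pdivrMr// mul1r lerDl.
rewrite (hx x0) in b1;have -> : A j 0 - l = - (l - A j x) - (A j x - A j 0) by ring.
by apply: leT (ler_normB _ _) _;rewrite normrN;lra.
Qed.

Lemma sdiff_ext f g s (l : R) : 0 <= s -> (forall x, 0 <= x -> f x = g x) -> sdiff f s l -> sdiff g s l.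
by move=> s0 fg h e e0;have [d d0 hd]:= h e e0;exists d => // z zd sz;rewrite -!fg//;exact: hd. Qed.

Lemma small_sq e : 0 < e -> exists2 d, 0 < d & forall x : R, 0 <= x -> x <= d -> x ^+ 2 <= e.
move=> e0;exists (Num.min 1 e);first by rewrite lt_min ltr01.
move=> x x0;rewrite le_min => /andP[x1 xe];apply: leT xe;rewrite expr2;exact: ler_piMr.
Qed.

Lemma CH_of_chain k (U : R -> chain) u : (forall t, 0 <= t -> isH k (U t)) -> ucontN k U ->
 (forall t s, 0 <= t -> 0 < s -> u t s = U t 0%N s) -> CH k u.
move=> hU uU uE;split.
 by move=> t t0;exists (NH k (U t) ^+ 2);apply: encode (hU t t0) _ (lexx _) => s s0;exact: uE.
move=> t0 t00 e e0;have [d d0 hd]:= small_sq e0;have [d' d'0 hd']:= ucontN_at uU t00 d0.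
exists d';split=> // t tp td;apply: (encode (isHB (hU t tp) (hU t0 t00)));last first.
 by apply: hd;[exact: NH_ge0|apply: hd' => //;exact: ltW].
by move=> s s0;rewrite !uE.
Qed.

Variables (m : nat) (x0 v0 a0 : R -> vec R).
Local Notation K:= m.+2.
Hypotheses (dx0 : forall s, 0 <= s -> vsderiv x0 s (v0 s)) (dv0 : forall s, 0 <= s -> vsderiv v0 s (a0 s)).
Hypotheses (ha0 : forall i, (i < 3)%N -> inH (2 + m) (fun s => vc i (a0 s))) (nv0 : forall s, 0 <= s -> vnorm (v0 s) = 1).
Local Notation v:= (fun c s => vc c (v0 s)).

Lemma vnormE (a : vec R) : (vnorm a == 1) = (\sum_(c < 3) vc c a ^+ 2 == 1).
rewrite /vnorm sum3 /=;set y:= _ + _ + _;have y0 : 0 <= y by rewrite !addr_ge0// sqr_ge0.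
by rewrite -(@eqrXn2 _ 2)// ?sqrtr_ge0// sqr_sqrtr// expr1n.
Qed.

Lemma acceleration_chain : exists A : 'I_3 -> chain, forall c, [/\ isH K (A c), prim (v c) (A c 0%N),
 forall s, 0 <= s -> vc c (a0 s) = A c 0%N s & forall s, 0 <= s -> sdiff (fun y => vc c (x0 y)) s (vc c (v0 s))].
have /choice[A hA] : forall c, exists A : chain, isH K A /\ {ae mu, forall x, 0 < x -> A 0%N x = vc c (a0 x)}.
 move=> c;have [e [g [wg _]]]:= ha0 (ltn_ord c);have [A hA aA]:= decode wg;exists A;split=> //.
 by have:= aA 0%N isT;case: wg => ->.
exists A => c;have [h a]:= hA c.
have dv s : 0 <= s -> sdiff (v c) s (vc c (a0 s)) by move=> s0;have /sderivP[]:= dv0 s0 (ltn_ord c).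
have [p e]:= prim_of_derivative dv (isH_prim h (j:= 0) isT) (isH_l2 h (leq0n _)) a.
by split=> // s s0;have /sderivP[]:= dx0 s0 (ltn_ord c).
Qed.

Hypothesis comp : compatA ((2 + m)./2) v0 a0.

(** The cross product with e_3 vanishes exactly when both horizontal components do, and the indices
    2k - 1 in the condition run through all odd orders below m + 2. *)
Lemma trace_parity (A : 'I_3 -> chain) : (forall c, isH K (A c) /\ forall s, 0 <= s -> vc c (a0 s) = A c 0%N s) ->
 forall j, (j < K)%N -> odd j -> A o0 j 0 = 0 /\ A o1 j 0 = 0.
move=> hA j jK oj;have [v00 tr]:= comp;pose k:= j.+1./2.
have kj : (k.*2 - 1)%N = j by rewrite /k;lia.
have [|l [hl]]:= tr k;first by rewrite /k;lia.
have ae c : {ae mu, forall x, 0 < x -> A c 0%N x = vc c (a0 x)}.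
 by apply: (aeS _ (ae_neq2 (0 : R) 0)) => x _ xp;case: (hA c) => _ ->//;exact: ltW.
have e c : A c j 0 = vc c l.
 have jp : (0 < j)%N by case: j oj {jK kj k tr hl} => //.
 by apply: (trace_eq jK jp (proj1 (hA c)) (ae c));have:= hl c (ltn_ord c);rewrite kj.
rewrite !e v00 /cross /= !mul0r !mul1r !sub0r !subr0 => -[/eqP + h2 _].
by rewrite oppr_eq0 => /eqP ->;rewrite h2.
Qed.

Lemma solution_exists : exists x xs xss : R -> R -> vec R, Sol m x0 x xs xss /\
 forall s t, 0 <= s -> 0 <= t -> vnorm (xs s t) = 1.
have [A hA]:= acceleration_chain.
have hAc c : isH K (A c) by case: (hA c). have pv c : prim (v c) (A c 0%N) by case: (hA c).
have v1 s : 0 <= s -> \sum_c v c s ^+ 2 = 1 by move=> s0;apply/eqP;rewrite -vnormE nv0.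
have v00 c : v c 0 = (c == o2)%:R by case: comp => -> _;move: c;apply: ord3P.
have tr:= trace_parity (fun c => conj (hAc c) (let: And4 _ _ e _:= hA c in e)).
have [G [w [hw ew [fG oG] G0 Gv]]]:= initial_data (isT : (0 < K)%N) hAc pv v1 v00 tr.
have [psi [hpsi psi0 epsi]]:= nls_exists hw ew.
have [F hF']:= moving_frame_exists hpsi.
have hF t : 0 <= t -> [/\ frame ((psi t).1 0%N) ((psi t).2 0%N) (F t), orth (F t) & forall c r, F t c r 0 = init psi t c r].
 by move=> t0;case: (hF' t t0).
have rF t : 0 <= t -> forall s, 0 <= s -> righthanded (F t) s by move=> t0;case: (hF' t t0).
have hp0 : HP K (psi 0) by case: hpsi => h _ _ _;exact: h.
have pw s : (psi 0).1 0%N s = w.1 0%N s /\ (psi 0).2 0%N s = w.2 0%N s.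
 have [h1 h2]:= HP_sup s (HPB hp0 hw) (isT : (0 < K)%N);rewrite psi0 !normr_le0 in h1 h2.
 by split;apply/eqP;rewrite -subr_eq0.
have F0 c s : 0 <= s -> F 0 c o2 s = v c s.
 move=> s0;rewrite -Gv//;have [f0 _ i0]:= hF 0 (lexx 0);have [sF bF]:= f0 c;have [sG bG]:= fG c.
 have e1 : (psi 0).1 0%N = w.1 0%N by apply/funext => y;case: (pw y).
 have e2 : (psi 0).2 0%N = w.2 0%N by apply/funext => y;case: (pw y).
 rewrite e1 e2 in sF;apply: (sys_unique (skew_curvm _ _) bF bG sF sG _ o2 s0) => r.
 rewrite i0 G0 /init /theta tint0 cos0 sin0 oppr0.
 by move: c r {sF bF sG bG};do 2 apply: ord3P.
have /choice[U hU]:= position_exists hpsi epsi hF.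
(* Both sides have the time derivative [spin] and the same initial value: the tangent of the
   reconstructed curve is the third frame vector. *)
have FU c t s : 0 <= t -> 0 <= s -> F t c o2 s = v c s + U c t 1%N s.
 move=> t0 s0;have [_ z pd _ _]:= hU c.
 have h:= pd 1%N s isT s0;have h':= frame_pdiff hpsi epsi hF c o2 s0.
 have pU : pdiff (fun t => v c s + U c t 1%N s) (fun t => spin (psi t) (F t) c o2 s).
  move=> T e e0;have [d d0 hd]:= h T e e0;exists d => // t1 t2 h1 h2 h3 h4.
  by have:= hd t1 t2 h1 h2 h3 h4;rewrite Wc1;congr (`|_| <= _);ring.
 by apply: (pdiff_eq h' pU _ t0);rewrite F0// z// addr0.
pose Z c t:= Zc psi F c t;pose W c t:= Wc psi F c t.
have hZ c:= Zc_curve hpsi epsi hF c;have hW c:= Wc_curve hpsi epsi hF c.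
exists (fun s t => mkvec (fun c => vc c (x0 s) + U c t 0%N s)), (fun s t => mkvec (fun c => F t c o2 s)),
 (fun s t => mkvec (fun c => Z c t 0%N s)).
have sE (f : 'I_3 -> R -> R -> R) t c : (fun y => vc c (mkvec (fun c => f c t y))) = f c t.
 by apply/funext => y;rewrite vc_mkvec.
split;last first.
 move=> s t s0 t0;apply/eqP;rewrite vnormE;under eq_bigr do rewrite vc_mkvec.
 have [_ oF _]:= hF t t0;have:= orth_rows o2 o2 oF s0;rewrite eqxx => e.
 by apply/eqP;rewrite -[RHS]e;apply: eq_bigr => c _;rewrite expr2.
split.
 move=> s t s0 t0;split=> i /vcP[c ->];apply/sderivP;split => //.
  rewrite (sE (fun c t y => vc c (x0 y) + U c t 0%N y) t c) vc_mkvec FU//;have [hUc _ _ _ _]:= hU c.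
  have h:= hUc t t0;apply: sdiffD;first by case: (hA c) => _ _ _;apply.
  exact: prim_sdiff (isH_prim h (j:= 0) isT) (isH_prim h (j:= 1) isT) s0.
 rewrite (sE (fun c t y => F t c o2 y) t c) vc_mkvec;have [fF _ _]:= hF t t0;have [_ _ pz]:= frame_prim c fF.
 have pF : prim (F t c o2) (Z c t 0%N) by apply: prim_eq pz => // y _;rewrite /Z Zc0 !fE.
 exact: prim_sdiff pF (isH_prim (proj1 (hZ c) t t0) (j:= 0) isT) s0.
split.
 move=> s t s0 t0;have s0':= ltW s0;have t0':= ltW t0;move=> i /vcP[c ->].
 (* Right-handedness turns the cross product of v with k p + l q into k q - l p. *)
 have cE : vc c (cross (mkvec (fun c => F t c o2 s)) (mkvec (fun c => Z c t 0%N s))) = W c t 0%N s.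
  have R3:= rF t t0' s s0';rewrite /W Wc0;have [e0 e1 _]:= R3 c;move: e0 e1.
  by move: c;apply: ord3P;rewrite /cross /= /Z !Zc0 /cr /row /nx !fE /= => <- <-;ring.
 suff [[_ h]|[h _]] : sderiv (fun tau => vc c (x0 s) + U c tau 0%N s) t (W c t 0%N s).
 - by rewrite cE;under eq_fun do rewrite !vc_mkvec.
 - by rewrite h ltxx in t0.
 apply/sderivP;split => // e e0;have [hUc _ _ _ q]:= hU c;have [d d0 hd]:= q t e t0' e0.
 exists d => // h h1 h2;have:= hd (t + h) h2;have -> : t + h - t = h by ring.
 move=> /(_ h1);apply: leT.
 have hh:= isHB (isHB (hUc _ h2) (hUc _ t0')) (isHZ h (proj1 (hW c) t t0')).
 apply: leT (leT (isH_sup (x:= s) hh (isT : (0 < K)%N) _) (NH_le _ _ (isT : (1 <= K)%N)));last exact/dom_ge0.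
 rewrite -[X in _ <= `|X|]/(U c (t + h) 0%N s - U c t 0%N s - h * W c t 0%N s).
 by rewrite opprD addrACA subrr add0r.
split.
 move=> s s0;rewrite -[RHS]mkvecK;congr mkvec;apply/funext => c;have [_ z _ _ _]:= hU c.
 by rewrite z ?addr0// ltW.
split.
 move=> t t0;have [_ _ i0]:= hF t (ltW t0);rewrite /mkvec !i0 /init /=.
 by [].
move=> i /vcP[c ->];have [hUc z _ uU q]:= hU c;have [hZ1 uZ]:= hZ c;have [hW1 uW]:= hW c.
have uE t s : 0 <= t -> 0 < s -> vc c (mkvec (fun c => vc c (x0 s) + U c t 0%N s)) - vc c (x0 s) = U c t 0%N s.
 by move=> t0 s0;rewrite vc_mkvec addrAC subrr add0r.
split;last first.
 exists (fun t s => W c t 0%N s);split;first exact: CH_of_chain hUc uU uE.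
 split;first exact: CH_of_chain hW1 uW _.
 move=> t0 t00 e e0;have [d d0 hd]:= small_sq e0;have [d' d'0 hd']:= q t0 d t00 d0.
 exists d';split=> // t tp tn td;have tt : t - t0 != 0 by rewrite subr_eq0.
 have hh:= isHB (isHB (hUc _ tp) (hUc _ t00)) (isHZ (t - t0) (hW1 t0 t00)).
 apply: (encode (isHZ (t - t0)^-1 hh)) => [s s0|].
  rewrite !uE// -[RHS]/((t - t0)^-1 * (U c t 0%N s - U c t0 0%N s - (t - t0) * W c t0 0%N s)).
  by rewrite mulrBr mulKf// mulrC.
 apply: hd;first exact: NH_ge0.
 rewrite NHZ// normfV ler_pdivrMl ?normr_gt0// mulrC;apply: hd' => //;exact: ltW.
(* Two more orders in space: from level 2 on, the derivatives of the displacement are differences of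
   x_ss at times t and 0, each of order m + 2. *)
pose C t : chain:= fun j => match j with 0%N => U c t 0%N | 1%N => U c t 1%N | j'.+2 => Z c t j' - Z c 0 j' end.
have hC t : 0 <= t -> isH K.+2 (C t).
 move=> t0;have hz:= isHB (hZ1 t t0) (hZ1 0 (lexx 0));have h:= hUc t t0.
 split=> [[|[|j]] jK|[|[|j]] jK];rewrite /C.
 - exact: isH_l2 h _.
 - exact: isH_l2 h _.
 - exact: (isH_l2 hz).
 - exact: isH_prim h _.
 - have [fF _ _]:= hF t t0;have [_ _ p1]:= frame_prim c fF.
  have [fF0 _ _]:= hF 0 (lexx 0);have [_ _ p0]:= frame_prim c fF0.
  apply: prim_eq (primB p1 p0) => y dy;rewrite !fE;last by rewrite /Z !Zc0.
  have y0 : 0 <= y by exact/dom_ge0.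
  by rewrite (FU c t y t0 y0) (F0 c y y0) addrAC subrr add0r.
 - exact: (isH_prim hz).
apply: (CH_of_chain (U:= C) hC) uE;apply: ucontN_lcont => -[|[|j]] jK.
- exact: lcont_ucontN uU _.
- exact: lcont_ucontN uU _.
- move=> T e e0;have [d d0 hd]:= lcont_ucontN uZ (jK : (j <= K)%N) T e0.
 exists d => // t t' t0 tt tT td;have:= hd t t' t0 tt tT td;rewrite /C.
 by have -> : Z c t' j - Z c 0 j - (Z c t j - Z c 0 j) = Z c t' j - Z c t j by rewrite opprB addrA subrK.
Qed.

End Existence.

(** * Uniqueness by an energy estimate for the tangents *)

Section Uniqueness.
Variable R : realType.
Local Notation mu:= (@lebesgue_measure R).
Import HalfLine.
Local Notation D:= (@dom R false).
Local Notation chain:= (nat -> R -> R).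
Local Notation vecf:= ('I_3 -> R -> R).
Implicit Types (s t d e : R) (f g : R -> R) (c : 'I_3) (k n j i : nat).

(** The bound comes with some weak chain; decoded, it coincides with [b] up to null sets at every
    level, and so do the norms. *)
Lemma Hk_norm k f (b : chain) e : (0 < k)%N -> 0 <= e -> Hk_sq_le k f (e ^+ 2) -> isH k b ->
 {ae mu, forall x, 0 < x -> b 0%N x = f x} -> NH k b <= k.+1%:R * e.
move=> k0 e0 [g [wg hs]] hb ab;have [c hc ac]:= decode wg;have [g0 [lg _]]:= wg.
have lgj j : (j <= k)%N -> l2 (g j) by move=> jk;apply/L2P;exact: lg.
apply: NH_bound => j jk;apply: leT (_ : nrm (g j) <= _).
 have a0 : {ae mu, forall x, 0 < x -> b 0%N x = c 0%N x}.
  by apply: (aeS2 _ ab (ac 0%N (leq0n k))) => x e1 e2 x0;rewrite e1// e2// g0.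
 have [n0 _]:= chain_ae_unique k0 hb hc a0 jk;have lb:= isH_l2 hb jk;have lc:= isH_l2 hc jk.
 have n1 : nrm (c j - g j) = 0.
  by apply: ae_nrm0;[exact: l2B (lgj _ jk)|apply: (aeS _ (ac j jk)) => x ex x0;rewrite subfE ex ?subrr].
 have -> : b j = (b j - c j) + ((c j - g j) + g j) by rewrite !subrK.
 have lcg:= l2B lc (lgj j jk).
 apply: leT (nrmD (l2B lb lc) (l2D lcg (lgj j jk))) _;rewrite n0 add0r.
 by apply: leT (nrmD lcg (lgj j jk)) _;rewrite n1 add0r.
rewrite -ler_sqr ?nnegrE ?nrm_ge0//;move: hs.
rewrite (eq_bigr (fun i : 'I_k.+1 => (nrm (g i) ^+ 2)%:E)) => [|i _];last exact: sq_Rpos (lgj i (ltn_ord i)).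
rewrite sumEFin lee_fin;apply: leT;have jk' : (j < k.+1)%N by [].
by rewrite (bigD1 (Ordinal jk'))//= lerDl;apply: sumr_ge0 => i _;exact: sqr_ge0.
Qed.

Lemma sdiff_ae_eq f g s (l l' : R) : 0 <= s -> sdiff f s l -> sdiff g s l' ->
 {ae mu, forall x, 0 < x -> f x = g x} -> f s = g s.
move=> s0 hf hg a;apply/eqP;rewrite -subr_eq0 -normr_le0;apply: (@le_eps R _ 0 2) => // e e0 _;rewrite add0r.
have [d d0 hd]:= sdiff_continuous hf e0;have [d' d'0 hd']:= sdiff_continuous hg e0.
have sd : s < s + Num.min d d' by rewrite ltrDl lt_min d0.
have [x /andP[sx xd] fg]:= ae_point sd a;have x0:= le_lt_trans s0 sx.
have : `|x - s| <= Num.min d d' by rewrite gtr0_norm ?subr_gt0// lerBlDl.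
rewrite le_min => /andP[/(hd x (ltW x0)) h1 /(hd' x (ltW x0)) h2].
have -> : f s - g s = (g x - g s) - (f x - f s) by rewrite fg//;ring.
by apply: leT (ler_normB _ _) _;lra.
Qed.

Lemma sdiffM f g s (l l' : R) : 0 <= s -> sdiff f s l -> sdiff g s l' -> sdiff (fun x => f x * g x) s (l * g s + f s * l').
move=> s0 hf hg e e0;have M0 : 0 < `|g s| + `|f s| + `|l| + 2 by rewrite ltr_wpDl// !addr_ge0.
have q0 : 0 < Num.min 1 (e / (`|g s| + `|f s| + `|l| + 2)) by rewrite lt_min ltr01 divr_gt0.
set q:= Num.min _ _ in q0;have [q1 qe] : q <= 1 /\ q * (`|g s| + `|f s| + `|l| + 2) <= e.
 by split;[|rewrite -ler_pdivlMr//];rewrite /q ge_min lexx ?orbT.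
have [d d0 hd]:= hf q q0;have [d' d'0 hd']:= hg q q0;have [d2 d20 hd2]:= sdiff_continuous hg q0.
exists (Num.min d (Num.min d' d2));first by rewrite !lt_min d0 d'0.
move=> h;rewrite !le_min => /and3P[h1 h2 h3] sh.
have hE : s + h - s = h by ring.
have a:= hd h h1 sh;have b:= hd' h h2 sh;have:= hd2 (s + h) sh;rewrite hE => /(_ h3) c2.
have -> : f (s + h) * g (s + h) - f s * g s - h * (l * g s + f s * l') =
 (f (s + h) - f s - h * l) * g s + (f (s + h) - f s - h * l) * (g (s + h) - g s) +
 f s * (g (s + h) - g s - h * l') + h * l * (g (s + h) - g s) by ring.
set X:= f (s + h) - f s - h * l in a *;set Y:= g (s + h) - g s - h * l' in b *;set Z:= g (s + h) - g s in c2 *.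
apply: leT (ler_normD _ _) _;apply: leT (lerD (ler_normD _ _) (lexx _)) _.
apply: leT (lerD (lerD (ler_normD _ _) (lexx _)) (lexx _)) _;rewrite !normrM.
have H0:= normr_ge0 h;apply: leT (_ : q * (`|g s| + `|f s| + `|l| + 2) * `|h| <= _);last exact: ler_wpM2r.
have a1:= ler_wpM2r (normr_ge0 (g s)) a;have b1:= ler_wpM2l (normr_ge0 (f s)) b.
have c1:= ler_wpM2l (mulr_ge0 H0 (normr_ge0 l)) c2.
have x1 : `|X| * `|Z| <= q * `|h| * 1 by apply: ler_pM => //;exact: leT c2 q1.
have qh : 0 <= q * `|h| by rewrite mulr_ge0// ltW.
by apply: leT (lerD (lerD (lerD a1 x1) b1) c1) _;move: qh;lra.
Qed.

Lemma sdiff_cr (f f' g g' : vecf) s c : 0 <= s -> (forall c, sdiff (f c) s (f' c s)) -> (forall c, sdiff (g c) s (g' c s)) ->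
 sdiff (cr f g c) s ((cr f' g c + cr f g' c) s).
move=> s0 hf hg;have:= sdiffB (sdiffM s0 (hf (nx c)) (hg (nx (nx c)))) (sdiffM s0 (hf (nx (nx c))) (hg (nx c))).
by rewrite /cr !fE;congr (sdiff _ _ _);ring.
Qed.

Lemma ip_dot0 (p q : vecf) : (forall c, l2 (p c)) -> (forall c, l2 (q c)) ->
 (forall s, 0 <= s -> \sum_c p c s * q c s = 0) -> \sum_c ip (p c) (q c) = 0.
move=> lp lq h;have li c : mu.-integrable D (EFin \o (fun x => p c x * q c x)) by exact: l2_int.
rewrite sum3 !ipE -RintegralD//;last exact: mdom;rewrite -RintegralD//;[|exact: mdom|].
 rewrite -[RHS](ip0l false (0 : R -> R)) ipE;apply: eq_Rintegral => x;rewrite inE => /dom_ge0 /h.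
 by rewrite sum3 mul0r.
by rewrite (_ : _ \o _ = (EFin \o (fun x => p o0 x * q o0 x)) \+ (EFin \o (fun x => p o1 x * q o1 x)))//;apply: integrableD;first exact: mdom.
Qed.

Lemma cr_l2 (p g : vecf) M c : 0 <= M -> (forall c, measurable_fun D (p c)) -> (forall c x, D x -> `|p c x| <= M) ->
 (forall c, l2 (g c)) -> l2 (cr p g c) /\ nrm (cr p g c) <= M * (nrm (g (nx (nx c))) + nrm (g (nx c))).
move=> M0 mp pM lg;have l c1 c2 : l2 (p c1 * g c2) by exact: l2M (mp c1) (pM c1) (lg c2).
have n c1 c2 : nrm (p c1 * g c2) <= M * nrm (g c2) by exact: nrmM (mp c1) (pM c1) M0 (lg c2).
split;first exact: l2B.
by apply: leT (nrmB (l _ _) (l _ _)) _;rewrite mulrDr;apply: lerD.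
Qed.

Section EnergyRate.
Variables (d w Y : 'I_3 -> chain) (q : vecf) (B : R).
Hypotheses (hd : forall c, isH 3 (d c)) (hw : forall c, isH 2 (w c)) (hY : forall c, isH 2 (Y c)).
Hypotheses (YB : forall c, NH 2 (Y c) <= B) (d00 : forall c, d c 0%N 0 = 0) (w10 : forall c, w c 1%N 0 = 0).
Local Notation lv u j:= (fun c => u c j%N : R -> R).
Hypothesis w0E : forall c s, 0 <= s -> w c 0%N s = (cr (lv d 0) (lv Y 0) c + cr q (lv d 1) c) s.
Hypothesis w1E : forall c s, 0 <= s -> w c 1%N s = (cr (lv d 0) (lv Y 1) c + cr q (lv d 2) c) s.

Let ld j c : (j <= 3)%N -> l2 (d c j). by move=> h;exact: isH_l2 (hd c) h. Qed.
Let lw j c : (j <= 2)%N -> l2 (w c j). by move=> h;exact: isH_l2 (hw c) h. Qed.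
Let lY j c : (j <= 2)%N -> l2 (Y c j). by move=> h;exact: isH_l2 (hY c) h. Qed.
Let n:= \sum_c (nrm (d c 0%N) + nrm (d c 1%N)).
Let ncn c : nrm (d c 0%N) + nrm (d c 1%N) <= n.
by rewrite /n (bigD1 c)//= lerDl;apply: sumr_ge0 => i _;rewrite addr_ge0 ?nrm_ge0. Qed.
Let n0 : 0 <= n. by apply: sumr_ge0 => c _;rewrite addr_ge0 ?nrm_ge0. Qed.

Let cr0 j c : (j <= 2)%N -> l2 (cr (lv d 0) (lv Y j) c) /\ nrm (cr (lv d 0) (lv Y j) c) <= n * (B + B).
move=> j2;have [c1|c1 x dx|c1|l h]:= @cr_l2 (lv d 0) (lv Y j) n c n0.
- exact: isH_meas (hd c1) _.
- exact: leT (prim_sup (isH_prim (hd c1) (isT : (0 < 3)%N)) (ld c1 (leq0n 3)) dx) (ncn c1).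
- exact: lY.
split=> //;apply: leT h _;apply: ler_wpM2l => //.
by apply: lerD;apply: leT (NH_nrm _ _ j2) (YB _).
Qed.

Let ip_bound j : (j <= 2)%N -> `|\sum_c ip (d c 1%N) (cr (lv d 0) (lv Y j) c)| <= 6 * B * n ^+ 2.
move=> j2;apply: leT (ler_norm_sum _ _ _) _.
apply: leT (_ : \sum_(c < 3) n * (n * (B + B)) <= _).
 apply: ler_sum => c _;have [l h]:= cr0 c j2;apply: leT (CS (ld c _) l) _ => //.
 by apply: ler_pM;rewrite ?nrm_ge0//;apply: leT (ncn c);rewrite lerDr nrm_ge0.
rewrite sumr_const card_ord -mulr_natl le_eqVlt;apply/orP;left;apply/eqP;ring.
Qed.

Let swap j : (j < 2)%N -> (forall c s, 0 <= s -> w c j s = (cr (lv d 0) (lv Y j) c + cr q (lv d j.+1) c) s) ->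
 \sum_c ip (d c j.+1) (w c j) = \sum_c ip (d c j.+1) (cr (lv d 0) (lv Y j) c).
move=> j2 wE;have lc c:= proj1 (cr0 c (ltnW j2));have lwj c : l2 (w c j) by exact: lw (ltnW j2).
have ldj c : l2 (d c j.+1) by apply: ld;exact: ltnW.
apply/eqP;rewrite -subr_eq0 -sumrB;under eq_bigr do rewrite -ipBr//.
apply/eqP;apply: ip_dot0 => // [c|s s0];first exact: l2B.
under eq_bigr do rewrite subfE wE// !fE.
by rewrite sum3 /cr /nx !fE /=;ring.
Qed.

(** Here d is the difference of the tangents, w that of the velocities, q one tangent and Y the
    second derivative of the other curve. One integration by parts pairs d' with w and d'' with w';
    the terms q cross d' and q cross d'' then drop out as triple products. In the remaining pairing
    of d'' with d cross Y' a second integration by parts removes d'', and the triple product of d',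
    d', Y' vanishes. Boundary terms vanish since d = 0 and w' = 0 at 0. *)
Lemma energy_rate : `|\sum_c (ip (d c 0%N) (w c 1%N) + ip (d c 1%N) (w c 2))| <= 72 * B * \sum_c (nrm (d c 0%N) ^+ 2 + nrm (d c 1%N) ^+ 2).
have B0 : 0 <= B by exact: leT (NH_ge0 _ _ _) (YB o0).
have hd2 c : isH 2 (d c) by exact: isH_le (hd c).
have e1 : \sum_c ip (d c 0%N) (w c 1%N) = - \sum_c ip (d c 1%N) (cr (lv d 0) (lv Y 0) c).
 rewrite -(@swap 0) // -sumrN;apply: eq_bigr => c _.
 have:= ibp (isH_prim (hd c) (isT : (0 < 3)%N)) (isH_prim (hw c) (isT : (0 < 2)%N)) (@ld 0 c isT) (@lw 0 c isT).
 by rewrite d00 mul0r oppr0 => /eqP;rewrite addrC addr_eq0 => /eqP.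
have pY c1 c2 : prim (d c1 0%N * Y c2 1%N) (d c1 1%N * Y c2 1%N + d c1 0%N * Y c2 2) by exact: prim_mulH (hd2 c1) (hY c2) _ _.
have e2 : \sum_c ip (d c 1%N) (w c 2) = \sum_c ip (d c 1%N) (cr (lv d 0) (lv Y 2) c).
 have -> : \sum_c ip (d c 1%N) (w c 2) = - \sum_c ip (d c 2) (cr (lv d 0) (lv Y 1) c).
  rewrite -(@swap 1) // -sumrN;apply: eq_bigr => c _.
  have:= ibp (isH_prim (hd c) (isT : (1 < 3)%N)) (isH_prim (hw c) (isT : (1 < 2)%N)) (@ld 1 c isT) (@lw 1 c isT).
  by rewrite w10 mulr0 oppr0 => /eqP;rewrite addrC addr_eq0 => /eqP.
 have l1 c : l2 (cr (lv d 1) (lv Y 1) c).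
  have M0 : 0 <= \sum_c NH 2 (d c) by apply: sumr_ge0 => c1 _;exact: NH_ge0.
  have [c1|c1 x dx|c1|//]:= @cr_l2 (lv d 1) (lv Y 1) (\sum_c NH 2 (d c)) c M0.
  - exact: isH_meas (hd c1) _.
  - apply: leT (isH_sup (hd2 c1) (isT : (1 < 2)%N) dx) _.
   by rewrite (bigD1 c1)//= lerDl;apply: sumr_ge0 => c2 _;exact: NH_ge0.
  - exact: lY.
 have l0 c:= proj1 (cr0 c (isT : (2 <= 2)%N)).
 have z : \sum_c ip (d c 1%N) (cr (lv d 1) (lv Y 1) c) = 0.
  apply: ip_dot0 => // [c|s _];first exact: ld.
  by rewrite sum3 /cr /nx !fE /=;ring.
 rewrite -[RHS]add0r -[X in X + _]z -sumrN -[RHS]big_split;apply: eq_bigr => c _ /=.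
 have pc : prim (cr (lv d 0) (lv Y 1) c) (cr (lv d 1) (lv Y 1) c + cr (lv d 0) (lv Y 2) c).
  apply: prim_eq (primB (pY (nx c) (nx (nx c))) (pY (nx (nx c)) (nx c))) => x _ //.
  by rewrite /cr !fE;ring.
 have:= ibp (isH_prim (hd c) (isT : (1 < 3)%N)) pc (@ld 1 c isT) (proj1 (cr0 c (isT : (1 <= 2)%N))).
 have z1 : cr (lv d 0) (lv Y 1) c 0 = 0 by rewrite /cr !fE !d00 !mul0r subrr.
 rewrite (ipDr (l1 c) (l0 c) (@ld 1 c isT)) z1 mulr0 oppr0 => /eqP.
 by rewrite addrC addr_eq0 => /eqP ->;rewrite opprK.
(* [n] is a sum of six norms, whence the factor 6; two bounds 6 B n^2 then give 72. *)
have n2 : n ^+ 2 <= 6 * \sum_c (nrm (d c 0%N) ^+ 2 + nrm (d c 1%N) ^+ 2).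
 rewrite /n !sum3;set a0:= nrm _;set a1:= nrm _;set a2:= nrm _;set a3:= nrm _;set a4:= nrm _;set a5:= nrm _.
 rewrite -subr_ge0 (_ : _ - _ = (a0 - a1) ^+ 2 + (a0 - a2) ^+ 2 + (a0 - a3) ^+ 2 + (a0 - a4) ^+ 2 + (a0 - a5) ^+ 2 +
  ((a1 - a2) ^+ 2 + (a1 - a3) ^+ 2 + (a1 - a4) ^+ 2 + (a1 - a5) ^+ 2) + ((a2 - a3) ^+ 2 + (a2 - a4) ^+ 2 + (a2 - a5) ^+ 2) +
  ((a3 - a4) ^+ 2 + (a3 - a5) ^+ 2 + (a4 - a5) ^+ 2));last by ring.
 by rewrite !addr_ge0 ?sqr_ge0.
rewrite big_split e1 e2 /=;apply: leT (ler_normD _ _) _;rewrite normrN.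
apply: leT (lerD (ip_bound (leq0n 2)) (ip_bound (isT : (2 <= 2)%N))) _.
have:= ler_wpM2l (mulr_ge0 (ler0n R 12) B0) n2;lra.
Qed.

End EnergyRate.

Lemma nrm_sq_sdiff (p : R -> R -> R) g t : 0 <= t -> (forall t, 0 <= t -> l2 (p t)) -> l2 g ->
 (forall e, 0 < e -> exists2 d, 0 < d & forall t', 0 <= t' -> `|t' - t| <= d -> nrm (p t' - p t - (t' - t) *: g) <= e * `|t' - t|) ->
 sdiff (fun t => nrm (p t) ^+ 2) t (2 * ip (p t) g).
move=> t0 lp lg hp e e0;have N0:= nrm_ge0 false (p t);have G0:= nrm_ge0 false g.
pose a:= Num.min 1 (e / (4 * (nrm (p t) + 1)));have a0 : 0 < a by rewrite lt_min ltr01 divr_gt0// mulr_gt0// ltr_wpDl.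
have [a1 ae] : a <= 1 /\ a * (4 * (nrm (p t) + 1)) <= e.
 by split;rewrite -?ler_pdivlMr ?mulr_gt0 ?ltr_wpDl// /a ge_min lexx ?orbT.
have [d d0 hd]:= hp a a0;pose b:= e / (2 * (1 + nrm g) ^+ 2).
have q0 : 0 < 2 * (1 + nrm g) ^+ 2 by rewrite mulr_gt0// exprn_gt0// ltr_pwDl.
have b0 : 0 < b by rewrite divr_gt0.
exists (Num.min d b);first by rewrite lt_min d0.
move=> h;rewrite le_min => /andP[h1 h2] sh;have hE : t + h - t = h by ring.
have:= hd (t + h) sh;rewrite hE => /(_ h1);set r:= p (t + h) - _ - _ => hr.
have lh : l2 (h *: g) by exact: l2Z.
have lr : l2 r by apply: l2B => //;apply: l2B;exact: lp.
have -> : p (t + h) = p t + (r + h *: g) by apply/funext => x;rewrite /r !fE;ring.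
have lp0:= lp t t0;rewrite (nrm_sqD lp0 (l2D lr lh)) (ipDr lr lh lp0) (ipZr _ lg lp0).
set X:= nrm (r + _) ^+ 2.
have -> : nrm (p t) ^+ 2 + 2 * (ip (p t) r + h * ip (p t) g) + X - nrm (p t) ^+ 2 - h * (2 * ip (p t) g) = 2 * ip (p t) r + X by ring.
have H0:= normr_ge0 h.
have i1 : `|ip (p t) r| <= nrm (p t) * (a * `|h|) by apply: leT (CS (lp t t0) lr) _;exact: ler_wpM2l.
have i2 : X <= `|h| ^+ 2 * (1 + nrm g) ^+ 2.
 rewrite -exprMn /X ler_pXn2r ?nnegrE ?nrm_ge0 ?mulr_ge0 ?addr_ge0//.
 apply: leT (nrmD lr lh) _;rewrite nrmZ// mulrDr mulr1;apply: lerD => //.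
 by apply: leT hr _;exact: ler_piMl.
have X0 : 0 <= X by exact: sqr_ge0.
apply: leT (ler_normD _ _) _;rewrite normrM (ger0_norm X0) (ger0_norm (ler0n R 2)).
have i3 : `|h| ^+ 2 * (1 + nrm g) ^+ 2 <= `|h| * (e / 2).
 rewrite expr2 -mulrA;apply: ler_wpM2l => //;move: h2;rewrite /b ler_pdivlMr//;lra.
have i4:= ler_wpM2r H0 ae;have:= mulr_ge0 (ltW a0) H0;lra.
Qed.

Lemma sdiff_decreasing (F l : R -> R) T : 0 <= T -> (forall x : R, 0 <= x -> x <= T -> sdiff F x (l x) /\ l x < 0) -> F T <= F 0.
move=> T0 h;apply: creep => // [x x0 xT|x e x0 xT e0].
 have [hF lx]:= h x x0 (ltW xT);have l0 : 0 < - l x by rewrite oppr_gt0.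
 have [d d0 hd]:= hF _ l0;exists d => // y y0 yd _.
 have:= hd y;rewrite (ger0_norm y0) => /(_ yd (addr_ge0 x0 y0));rewrite ler_norml => /andP[_];lra.
have [hF _]:= h x (ltW x0) xT;have [d d0 hd]:= sdiff_continuous hF e0;exists d => // y y0 yd yx.
have:= hd y y0;rewrite distrC (ger0_norm (_ : 0 <= x - y)) ?subr_ge0// => /(_ _).
rewrite lerBlDr -lerBlDl => /(_ yd);rewrite distrC ler_norml => /andP[_];lra.
Qed.

(** The factor 1 - 2 C z plays the part of an exponential, and the term -e z makes the derivative
    strictly negative; the condition 4 C d <= 1 keeps the factor at least 1/2. *)
Lemma gronwall_zero (E l : R -> R) t d C : 0 <= t -> 0 <= C -> 4 * C * d <= 1 ->
 (forall x : R, t <= x -> x <= t + d -> [/\ sdiff E x (l x), 0 <= E x & l x <= C * E x]) -> E t = 0 -> 0 <= d -> E (t + d) = 0.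
move=> t0 C0 Cd h Et d0;have td : t <= t + d by rewrite lerDl.
have [_ E0 _]:= h _ td (lexx _);apply/le_anti;rewrite E0 andbT.
suff key e : 0 < e -> E (t + d) * (1 - 2 * C * d) - e * d <= 0.
 apply: (@le_eps R _ 0 (2 * d));first by rewrite mulr_ge0.
 move=> e e0 _;have:= key e e0;have:= ler_wpM2l E0 Cd;lra.
move=> e0;pose F z:= E (t + z) * (1 - 2 * C * z) - e * z.
have F0 : F 0 = 0 by rewrite /F addr0 Et mul0r mulr0 subrr.
rewrite -[_ - _]/(F d) -F0.
apply: (@sdiff_decreasing F (fun z => l (t + z) * (1 - 2 * C * z) + E (t + z) * (- (2 * C)) - e)) => // z z0 zd.
have tz : t <= t + z by rewrite lerDl.
have [hE Ez lz]:= h (t + z) tz (lerD (lexx t) zd);split.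
 have lin (k : R) : sdiff (fun z => k * z) z k.
  by move=> e1 e10;exists 1 => // y _ _;rewrite (_ : _ - _ = 0) ?normr0 ?mulr_ge0// ?ltW//;ring.
 apply: sdiffB (lin e);apply: sdiffM => //.
  by move=> e1 e10;have [d1 d10 hd]:= hE e1 e10;exists d1 => // y y1 y2;rewrite addrA;apply: hd => //;rewrite -addrA addr_ge0.
 by rewrite -[- _]sub0r;apply: sdiffB;[exact: sdiff_cst|exact: lin].
have zC : 4 * C * z <= 1 by apply: leT Cd;apply: ler_wpM2l => //;exact: mulr_ge0.
have p : 0 <= 1 - 2 * C * z by lra.
have:= ler_wpM2r p lz;have:= mulr_ge0 C0 Ez.
have:= mulr_ge0 (mulr_ge0 C0 Ez) (mulr_ge0 C0 z0);lra.
Qed.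

Section SolutionChains.
Variables (m : nat) (x0 v0 a0 : R -> vec R) (A : 'I_3 -> chain).
Hypothesis hA : forall c, [/\ isH m.+2 (A c), prim (fun s => vc c (v0 s)) (A c 0%N),
 forall s, 0 <= s -> vc c (a0 s) = A c 0%N s & forall s, 0 <= s -> sdiff (fun y => vc c (x0 y)) s (vc c (v0 s))].

(** A solution in decoded form: [E] is the displacement as a chain of order 4, [W] its time
    derivative as a chain of order 2, both identified pointwise with the functions of the
    solution. *)
Definition sol_chain (y ys yss : R -> R -> vec R) c (E W : R -> chain):= [/\
 forall t, 0 <= t -> isH 4 (E t) /\ forall s, 0 <= s -> [/\ vc c (y s t) = vc c (x0 s) + E t 0%N s,
  vc c (ys s t) = vc c (v0 s) + E t 1%N s & vc c (yss s t) = A c 0%N s + E t 2 s],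
 forall t, 0 <= t -> forall e, 0 < e -> exists2 d, 0 < d & forall t', 0 <= t' -> `|t' - t| <= d -> NH 4 (E t' - E t) <= e,
 forall t, 0 <= t -> isH 2 (W t) /\ forall e, 0 < e -> exists2 d, 0 < d &
  forall t', 0 <= t' -> `|t' - t| <= d -> NH 2 (E t' - E t - (t' - t) *: W t) <= e * `|t' - t|,
 forall t, 0 < t -> W t 1%N 0 = 0 /\ forall s, 0 < s -> W t 0%N s = vc c (cross (ys s t) (yss s t)) &
 forall s, 0 <= s -> E 0 0%N s = 0].

Lemma sol_chain_exists y ys yss c : Sol m x0 y ys yss -> exists E W, sol_chain y ys yss c E W.
move=> [sol1 [sol2 [sol3 [sol4 sol5]]]];have c3:= ltn_ord c;have [hA2 pv _ dx]:= hA c.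
have [[inU cU] [w [_ [[inW _] dW]]]]:= sol5 c c3;pose u t s:= vc c (y s t) - vc c (x0 s).
have dec k f : inH k f -> exists b, isH k b /\ {ae mu, forall x, 0 < x -> b 0%N x = f x}.
 by move=> [e [g [wg _]]];have [b hb ab]:= decode wg;exists b;split=> //;have:= ab 0%N isT;case: wg => ->.
have /choice[E hE] : forall t, exists b, 0 <= t -> isH (4 + m) b /\ {ae mu, forall x, 0 < x -> b 0%N x = u t x}.
 move=> t;have [t0|_]:= boolP (0 <= t);last by exists 0.
 by have [b hb]:= dec _ _ (inU t t0);exists b.
have /choice[W hW] : forall t, exists b, 0 <= t -> isH (2 + m) b /\ {ae mu, forall x, 0 < x -> b 0%N x = w t x}.
 move=> t;have [t0|_]:= boolP (0 <= t);last by exists 0.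
 by have [b hb]:= dec _ _ (inW t t0);exists b.
have all0 (P : R -> Prop) : (forall x, 0 < x -> P x) -> {ae mu, forall x, 0 < x -> P x}.
 by move=> h;apply: (aeS _ (ae_neq2 (0 : R) 0)) => x _;exact: h.
have pE t j : 0 <= t -> (j < 4)%N -> prim (E t j) (E t j.+1).
 by move=> t0 j4;have [h _]:= hE t t0;apply: isH_prim h _;rewrite (leq_trans j4)// leq_addr.
have du t s : 0 <= t -> 0 <= s -> sdiff (u t) s (vc c (ys s t) - vc c (v0 s)).
 by move=> t0 s0;apply: sdiffB (dx s s0);have [/(_ c c3)/sderivP[]]:= sol1 s t s0 t0.
have e0 t s : 0 <= t -> 0 <= s -> E t 0%N s = u t s.
 move=> t0 s0;have [_ ae]:= hE t t0;apply: (sdiff_ae_eq s0 _ (du t s t0 s0) ae).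
 exact: prim_sdiff (pE t 0%N t0 isT) (pE t 1%N t0 isT) s0.
have e1 t s : 0 <= t -> 0 <= s -> E t 1%N s = vc c (ys s t) - vc c (v0 s).
 move=> t0 s0;apply: (sdiff_unique s0 (prim_sdiff (pE t 0%N t0 isT) (pE t 1%N t0 isT) s0)).
 by apply: (sdiff_ext s0 _ (du t s t0 s0)) => r r0;rewrite e0.
have e2 t s : 0 <= t -> 0 <= s -> E t 2 s = vc c (yss s t) - A c 0%N s.
 move=> t0 s0;apply: (sdiff_unique s0 (prim_sdiff (pE t 1%N t0 isT) (pE t 2 t0 isT) s0)).
 apply: (@sdiff_ext R (fun r => vc c (ys r t) - vc c (v0 r))) => // [r r0|];first by rewrite e1.
 apply: sdiffB;last exact: prim_sdiff pv (isH_prim hA2 (j:= 0) isT) s0.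
 by have [_ /(_ c c3)/sderivP[]]:= sol1 s t s0 t0.
have dT t : 0 <= t -> forall e, 0 < e -> exists2 d, 0 < d &
  forall t', 0 <= t' -> `|t' - t| <= d -> NH 2 (E t' - E t - (t' - t) *: W t) <= e * `|t' - t|.
 move=> t0 e ep;have q0 : 0 < e / (2 + m).+1%:R by rewrite divr_gt0.
 have [d [d0 hd]]:= dW t t0 _ (exprn_gt0 2 q0);exists (d / 2);first by rewrite divr_gt0.
 move=> t' t'0 td;have [->|tn]:= eqVneq t' t.
  have -> : E t - E t - (t - t) *: W t = (0 : R) *: W t.
   apply/funext => j;apply/funext => r;rewrite -[LHS]/(E t j r - E t j r - (t - t) * W t j r).
   by rewrite !subrr sub0r mul0r oppr0 -[RHS]/(0 * W t j r) mul0r.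
  by rewrite NHZ ?normr0 ?mul0r ?mulr_ge0 ?(ltW ep)//;apply: isH_le (proj1 (hW t t0));exact: leq_addr.
 have tt : t' - t != 0 by rewrite subr_eq0.
 have hWt:= proj1 (hW t t0);have h24 : (2 + m <= 4 + m)%N by rewrite leq_add2r.
 have hEE:= isH_le h24 (isHB (proj1 (hE t' t'0)) (proj1 (hE t t0))).
 have hb:= isHB (isHZ (t' - t)^-1 hEE) hWt.
 have td2 : `|t' - t| < d by apply: le_lt_trans td _;rewrite ltr_pdivrMr// ltr_pMr// ltr1n.
 have:= Hk_norm (isT : (0 < 2 + m)%N) (ltW q0) (hd t' t'0 tn td2) hb;rewrite mulrCA divff ?pnatr_eq0// mulr1 => n1.
 have -> : E t' - E t - (t' - t) *: W t = (t' - t) *: ((t' - t)^-1 *: (E t' - E t) - W t).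
  apply/funext => j;apply/funext => r.
  rewrite -[LHS]/(E t' j r - E t j r - (t' - t) * W t j r) -[RHS]/((t' - t) * ((t' - t)^-1 * (E t' j r - E t j r) - W t j r)).
  by rewrite [RHS]mulrBr mulVKf.
 rewrite NHZ;last by apply: isH_le hb;exact: leq_addr.
 rewrite mulrC;apply: ler_wpM2r => //;apply: leT (NH_le _ _ (leq_addr m 2)) (n1 _).
 apply: (aeS2 _ (all0 _ (fun x x0' => conj (e0 t' x t'0 (ltW x0')) (e0 t x t0 (ltW x0')))) (proj2 (hW t t0))) => x h h' xp.
 have [h1 h2]:= h xp;rewrite -[LHS]/((t' - t)^-1 * (E t' 0%N x - E t 0%N x) - W t 0%N x) h1 h2 h'//.
 by rewrite mulrC.
have dtE j t s : (j < 2)%N -> 0 <= t -> 0 <= s -> sdiff (fun t => E t j s) t (W t j s).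
 move=> j2 t0 s0 e ep;have [d d0 hd]:= dT t t0 e ep;exists d => // h h1 h2.
 have:= hd (t + h) h2;have hE' : t + h - t = h by ring.
 rewrite hE' => /(_ h1);apply: leT.
 have hh : isH 2 (E (t + h) - E t - h *: W t).
  apply: isHB;first by apply: isHB;[have:= proj1 (hE _ h2)|have:= proj1 (hE t t0)];apply: isH_le;rewrite ltnW// ltnS leq_addr.
  by apply: isHZ;apply: isH_le (proj1 (hW t t0));exact: leq_addr.
 have ds : D s by exact/dom_ge0.
 exact: leT (isH_sup hh j2 ds) (NH_le _ _ j2).
exists E, W;split.
- move=> t t0;split=> [|s s0];first by apply: isH_le (proj1 (hE t t0));exact: leq_addr.
 by rewrite e0// e1// e2// /u !(addrC _ (_ - _)) !subrK.
- move=> t t0 e ep;have q0 : 0 < e / (4 + m).+1%:R by rewrite divr_gt0.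
 have [d [d0 hd]]:= cU t t0 _ (exprn_gt0 2 q0);exists (d / 2);first by rewrite divr_gt0.
 move=> t' t'0 td;have td2 : `|t' - t| < d by apply: le_lt_trans td _;rewrite ltr_pdivrMr// ltr_pMr// ltr1n.
 have hEE:= isHB (proj1 (hE t' t'0)) (proj1 (hE t t0)).
 have:= Hk_norm (isT : (0 < 4 + m)%N) (ltW q0) (hd t' t'0 td2) hEE;rewrite mulrCA divff ?pnatr_eq0// mulr1 => n1.
 apply: leT (NH_le _ _ (leq_addr m 4)) (n1 _);apply: all0 => x xp.
 by rewrite -[LHS]/(E t' 0%N x - E t 0%N x) (e0 _ _ t'0 (ltW xp)) (e0 _ _ t0 (ltW xp)).
- by move=> t t0;split;[apply: isH_le (proj1 (hW t t0));exact: leq_addr|exact: dT].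
- move=> t tp;have t0:= ltW tp;split=> [|s sp].
  (* The boundary tangent is constant for t > 0, and by continuity also at t = 0, so its time
     derivative vanishes. *)
  pose l:= vc c (@e3 R) - vc c (v0 0).
  have el r : 0 < r -> E r 1%N 0 = l by move=> rp;rewrite e1 ?(ltW rp)// sol4.
  have el' r : 0 <= r -> E r 1%N 0 = l.
   rewrite le_eqVlt => /orP[/eqP <-|];last exact: el.
   exact: (sdiff_ae_eq (lexx 0) (dtE 1%N 0 0 isT (lexx 0) (lexx 0)) (sdiff_cst 0 l) (all0 _ el)).
  apply: (sdiff_unique t0 (dtE 1%N t 0 isT t0 (lexx 0))).
  by apply: (sdiff_ext t0 _ (sdiff_cst t l)) => r r0;rewrite el'.
 apply: (sdiff_unique t0 (dtE 0%N t s isT t0 (ltW sp))).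
 have h : sdiff (fun r => vc c (y s r)) t (vc c (cross (ys s t) (yss s t))).
  by have /sderivP[] : sderiv (fun r => vc c (y s r)) t (vc c (cross (ys s t) (yss s t))) by left;split=> //;exact: sol2.
 rewrite -[vc c _]subr0;apply: (sdiff_ext t0 _ (sdiffB h (sdiff_cst t (vc c (x0 s))))) => r r0.
 by rewrite e0// ltW.
- move=> s s0;have l0:= lexx (0 : R).
 apply: (sdiff_ae_eq s0 (prim_sdiff (pE 0 0%N l0 isT) (pE 0 1%N l0 isT) s0) (sdiff_cst s 0)).
 by apply: all0 => x xp;rewrite e0 ?(ltW xp)// /u sol3// subrr.
Qed.

Lemma solution_unique x xs xss y ys yss : Sol m x0 x xs xss -> Sol m x0 y ys yss ->
 forall s t, 0 <= s -> 0 <= t -> y s t = x s t.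
move=> Sx Sy;have /choice[Ex /choice[Wx hx]]:= fun c => sol_chain_exists c Sx.
have /choice[Ey /choice[Wy hy]]:= fun c => sol_chain_exists c Sy.
pose d c t : chain:= Ey c t - Ex c t;pose w c t : chain:= Wy c t - Wx c t.
pose Y c t : chain:= csh (csh (Ey c t)) + A c.
have hEx c t : 0 <= t -> isH 4 (Ex c t) by case: (hx c) => h _ _ _ _ /h[].
have hEy c t : 0 <= t -> isH 4 (Ey c t) by case: (hy c) => h _ _ _ _ /h[].
have hd c t : 0 <= t -> isH 4 (d c t) by move=> t0;apply: isHB;[exact: hEy|exact: hEx].
have hw c t : 0 <= t -> isH 2 (w c t).
 by move=> t0;apply: isHB;[case: (hy c) => _ _ /(_ t t0)[]|case: (hx c) => _ _ /(_ t t0)[]].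
have hA2 c : isH 2 (A c) by case: (hA c) => h _ _ _;exact: isH_le h.
have hY c t : 0 <= t -> isH 2 (Y c t) by move=> t0;apply: isHD (hA2 c);do 2 apply: isH_csh;exact: hEy.
have vx c s t : 0 <= s -> 0 <= t -> [/\ vc c (x s t) = vc c (x0 s) + Ex c t 0%N s,
  vc c (xs s t) = vc c (v0 s) + Ex c t 1%N s & vc c (xss s t) = A c 0%N s + Ex c t 2 s].
 by move=> s0 t0;case: (hx c) => /(_ t t0)[_ /(_ s s0)].
have vy c s t : 0 <= s -> 0 <= t -> [/\ vc c (y s t) = vc c (x0 s) + Ey c t 0%N s,
  vc c (ys s t) = vc c (v0 s) + Ey c t 1%N s & vc c (yss s t) = A c 0%N s + Ey c t 2 s].
 by move=> s0 t0;case: (hy c) => /(_ t t0)[_ /(_ s s0)].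
have dE c t j s : d c t j s = Ey c t j s - Ex c t j s by [].
have wE c t j s : w c t j s = Wy c t j s - Wx c t j s by [].
have YE c t j s : Y c t j s = Ey c t j.+2 s + A c j s by [].
pose q t c s:= vc c (xs s t).
have dq t c s : 0 <= t -> 0 <= s -> sdiff (q t c) s (Y c t 0%N s - d c t 2 s).
 move=> t0 s0;have [/(_ s t s0 t0)[_ h] _]:= Sx;have /sderivP[_]:= h c (ltn_ord c).
 by have [_ _ ->]:= vx c s t s0 t0;rewrite YE dE;congr (sdiff _ _ _);ring.
have pdd j t c s : (j < 3)%N -> 0 <= t -> 0 <= s -> sdiff (d c t j) s (d c t j.+1 s).
 by move=> j3 t0 s0;have h:= hd c t t0;exact: prim_sdiff (isH_prim h (ltnW j3 : (j < 4)%N)) (isH_prim h (j3 : (j.+1 < 4)%N)) s0.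
have w0E t c s : 0 < t -> 0 <= s ->
  w c t 0%N s = (cr (fun c => d c t 1%N) (fun c => Y c t 0%N) c + cr (q t) (fun c => d c t 2) c) s /\
  w c t 1%N s = (cr (fun c => d c t 1%N) (fun c => Y c t 1%N) c + cr (q t) (fun c => d c t 3) c) s.
 move=> tp;have t0:= ltW tp;set F:= cr _ _ c + _.
 (* With d the tangent difference, d' cross Y and q' cross d' cancel because q' = Y - d'; the
    derivative of F thus contains no first derivative of d. *)
 have dF r : 0 <= r -> sdiff F r ((cr (fun c => d c t 1%N) (fun c => Y c t 1%N) c + cr (q t) (fun c => d c t 3) c) r).
  move=> r0;have:= sdiffD (@sdiff_cr (fun c => d c t 1%N) (fun c => d c t 2) (fun c => Y c t 0%N) (fun c => Y c t 1%N) r c r0 _ _)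
   (@sdiff_cr (q t) (fun c => Y c t 0%N - d c t 2) (fun c => d c t 2) (fun c => d c t 3) r c r0 _ _).
  have h1 c1 : sdiff (d c1 t 1%N) r (d c1 t 2 r) by exact: pdd.
  have h2 c1 : sdiff (d c1 t 2) r (d c1 t 3 r) by exact: pdd.
  have h3 c1 : sdiff (Y c1 t 0%N) r (Y c1 t 1%N r).
   by have h:= hY c1 t t0;exact: prim_sdiff (isH_prim h (j:= 0) isT) (isH_prim h (j:= 1) isT) r0.
  have h4 c1 : sdiff (q t c1) r ((Y c1 t 0%N - d c1 t 2) r) by exact: dq.
  by move=> /(_ h1 h3 h4 h2);congr (sdiff _ _ _);rewrite /cr !fE;ring.
 have hwt:= hw c t t0;have dw r : 0 <= r -> sdiff (w c t 0%N) r (w c t 1%N r).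
  by move=> r0;exact: prim_sdiff (isH_prim hwt (j:= 0) isT) (isH_prim hwt (j:= 1) isT) r0.
 have e r : 0 <= r -> w c t 0%N r = F r.
  move=> r0;apply: (sdiff_ae_eq r0 (dw r r0) (dF r r0));apply: (aeS _ (ae_neq2 (0 : R) 0)) => z _ zp.
  have z0:= ltW zp;rewrite wE;have [_ _ _ /(_ t tp)[_ ->//] _]:= hy c;have [_ _ _ /(_ t tp)[_ ->//] _]:= hx c.
  have X c1:= vx c1 z t z0 t0;have Z c1:= vy c1 z t z0 t0;rewrite /F /cr !fE /q !YE !dE.
  have [_ -> _]:= X (nx c);have [_ -> _]:= X (nx (nx c)).
  have CE (a b : vec R) : vc c (cross a b) = vc (nx c) a * vc (nx (nx c)) b - vc (nx (nx c)) a * vc (nx c) b.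
   by move: (c);apply: ord3P.
  rewrite !CE;have [_ -> ->]:= X (nx c);have [_ -> ->]:= X (nx (nx c)).
  by have [_ -> ->]:= Z (nx c);have [_ -> ->]:= Z (nx (nx c));ring.
 by move=> s0;split;[exact: e|apply: (sdiff_unique s0 (dw s s0));apply: (sdiff_ext s0 _ (dF s s0)) => r /e].
pose en t:= \sum_c (nrm (d c t 1%N) ^+ 2 + nrm (d c t 2) ^+ 2).
pose l t:= \sum_c (2 * ip (d c t 1%N) (w c t 1%N) + 2 * ip (d c t 2) (w c t 2)).
have en0 t : 0 <= en t by apply: sumr_ge0 => c _;rewrite addr_ge0 ?sqr_ge0.
have den t : 0 <= t -> sdiff en t (l t).
 move=> t0;have h j c : (j <= 2)%N -> sdiff (fun t => nrm (d c t j) ^+ 2) t (2 * ip (d c t j) (w c t j)).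
  move=> j2;apply: (@nrm_sq_sdiff (fun t => d c t j)) => // [r r0||e e0].
  - exact: isH_l2 (hd c r r0) (leq_trans j2 _).
  - exact: isH_l2 (hw c t t0) j2.
  have e2 : 0 < e / 2 by rewrite divr_gt0.
  have [_ _ /(_ t t0)[hWx /(_ _ e2)[d1 d10 hd1]] _ _]:= hx c;have [_ _ /(_ t t0)[hWy /(_ _ e2)[d2 d20 hd2]] _ _]:= hy c.
  exists (Num.min d1 d2);first by rewrite lt_min d10.
  move=> r r0;rewrite le_min => /andP[/(hd1 r r0) k1 /(hd2 r r0) k2].
  have -> : d c r j - d c t j - (r - t) *: w c t j = (Ey c r - Ey c t - (r - t) *: Wy c t) j - (Ex c r - Ex c t - (r - t) *: Wx c t) j.
   apply/funext => s;rewrite -[RHS]/((Ey c r j s - Ey c t j s - (r - t) * Wy c t j s) - (Ex c r j s - Ex c t j s - (r - t) * Wx c t j s)).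
   by rewrite -[LHS]/((Ey c r j s - Ex c r j s) - (Ey c t j s - Ex c t j s) - (r - t) * (Wy c t j s - Wx c t j s));ring.
  have hh1 : isH 2 (Ey c r - Ey c t - (r - t) *: Wy c t).
   by apply: isHB (isHZ _ hWy);apply: isH_le (isHB (hEy c r r0) (hEy c t t0)).
  have hh2 : isH 2 (Ex c r - Ex c t - (r - t) *: Wx c t).
   by apply: isHB (isHZ _ hWx);apply: isH_le (isHB (hEx c r r0) (hEx c t t0)).
  apply: leT (nrmB (isH_l2 hh1 j2) (isH_l2 hh2 j2)) _.
  have:= leT (NH_nrm _ _ j2) k1;have:= leT (NH_nrm _ _ j2) k2;lra.
 have hc c:= sdiffD (h 1%N c isT) (h 2 c isT).
 have -> : en = fun t => (nrm (d o0 t 1%N) ^+ 2 + nrm (d o0 t 2) ^+ 2) + (nrm (d o1 t 1%N) ^+ 2 + nrm (d o1 t 2) ^+ 2) +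
   (nrm (d o2 t 1%N) ^+ 2 + nrm (d o2 t 2) ^+ 2) by apply/funext => r;rewrite /en sum3.
 by rewrite /l sum3;exact: sdiffD (sdiffD (hc o0) (hc o1)) (hc o2).
have nz t c : en t = 0 -> nrm (d c t 1%N) = 0 /\ nrm (d c t 2) = 0.
 move=> e0;have : nrm (d c t 1%N) ^+ 2 + nrm (d c t 2) ^+ 2 <= 0.
  by rewrite -e0 /en (bigD1 c)//= lerDl;apply: sumr_ge0 => i _;rewrite addr_ge0 ?sqr_ge0.
 have:= sqr_ge0 (nrm (d c t 1%N));have:= sqr_ge0 (nrm (d c t 2)) => h1 h2 h3.
 by split;apply/eqP;rewrite -sqrf_eq0;apply/eqP;lra.
have rate t B : 0 < t -> (forall c, NH 2 (Y c t) <= B) -> l t <= 144 * B * en t.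
 move=> tp YB;have t0:= ltW tp.
 have bc c : d c t 1%N 0 = 0.
  have [_ e1 _]:= vx c 0 t (lexx 0) t0;have [_ e2 _]:= vy c 0 t (lexx 0) t0;rewrite dE.
  have [_ [_ [_ [bx _]]]]:= Sx;have [_ [_ [_ [by_ _]]]]:= Sy.
  by move: e1 e2;rewrite bx// by_// => e1;rewrite {1}e1 => /addrI ->;rewrite subrr.
 have b1 c : w c t 1%N 0 = 0.
  by rewrite wE;have [_ _ _ /(_ t tp)[-> _] _]:= hx c;have [_ _ _ /(_ t tp)[-> _] _]:= hy c;rewrite subrr.
 have:= @energy_rate (fun c => csh (d c t)) (fun c => w c t) (fun c => Y c t) (q t) B _ _ _ YB bc b1 _ _.
 move=> /(_ (fun c => isH_csh (hd c t t0)) (fun c => hw c t t0) (fun c => hY c t t0)).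
 move=> /(_ (fun c s h => proj1 (w0E t c s tp h)) (fun c s h => proj2 (w0E t c s tp h))).
 move=> /(leT (ler_norm _)) h;rewrite -[leRHS]/(144 * B * \sum_c (nrm (csh (d c t) 0%N) ^+ 2 + nrm (csh (d c t) 1%N) ^+ 2)).
 have -> : l t = 2 * \sum_c (ip (csh (d c t) 0%N) (w c t 1%N) + ip (csh (d c t) 1%N) (w c t 2)).
  by rewrite mulr_sumr;apply: eq_bigr => c _;rewrite mulrDr.
 by move: h;lra.
have enz t : 0 <= t -> en t = 0.
 (* Bounds on [Y] are local in time, so the vanishing of the energy is propagated by real induction,
    over one short Gronwall interval at a time. *)
 move: t;apply: real_induction => [|t t0 IH|t tp IH].
 - rewrite /en big1// => c _;have l0:= lexx (0 : R);have h0:= hd c 0 l0.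
  have z s : 0 <= s -> d c 0 0%N s = 0.
   by move=> s0;rewrite dE;have [_ _ _ _ ->//]:= hx c;have [_ _ _ _ ->//]:= hy c;rewrite subrr.
  have [-> _]:= chain_zero h0 z (isT : (1 <= 4)%N);have [-> _]:= chain_zero h0 z (isT : (2 <= 4)%N).
  by rewrite expr0n addr0.
 - have et:= IH t t0 (lexx t).
  have /choice[r hr] : forall c, exists r, 0 < r /\ forall t', 0 <= t' -> `|t' - t| <= r -> NH 4 (Ey c t' - Ey c t) <= 1.
   by move=> c;have [_ /(_ t t0 1 ltr01)[r r0 h] _ _ _]:= hy c;exists r.
  pose B:= \sum_c (NH 4 (Ey c t) + 1 + NH 2 (A c)).
  have B0 : 0 <= B by apply: sumr_ge0 => c _;rewrite !addr_ge0 ?NH_ge0.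
  have YB c t' : 0 <= t' -> `|t' - t| <= r c -> NH 2 (Y c t') <= B.
   move=> t'0 td;apply: leT (_ : NH 4 (Ey c t) + 1 + NH 2 (A c) <= _);last first.
    by rewrite /B (bigD1 c)//= lerDl;apply: sumr_ge0 => i _;rewrite !addr_ge0 ?NH_ge0.
   apply: leT (NHD (isH_csh (isH_csh (hEy c t' t'0))) (hA2 c)) _;rewrite lerD2r.
   apply: leT (NH_csh_le _ _ _) _;apply: leT (NH_csh_le _ _ _) _.
   have -> : Ey c t' = Ey c t + (Ey c t' - Ey c t).
    by apply/funext => j;apply/funext => s;rewrite -[RHS]/(Ey c t j s + (Ey c t' j s - Ey c t j s));ring.
   apply: leT (NHD (hEy c t t0) (isHB (hEy c t' t'0) (hEy c t t0))) _.
   by rewrite lerD2l;exact: (proj2 (hr c)).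
  pose C:= 144 * B;have C0 : 0 <= C by rewrite mulr_ge0.
  pose e:= Num.min (Num.min (r o0) (Num.min (r o1) (r o2))) (1 / (4 * (C + 1))).
  have ep : 0 < e by rewrite !lt_min !(proj1 (hr _)) divr_gt0// mulr_gt0// ltr_wpDl.
  have er c : e <= r c.
   by rewrite /e;move: c;apply: ord3P;rewrite !ge_min lexx ?orbT.
  have eC : 4 * C * e <= 1.
   apply: leT (_ : 4 * (C + 1) * e <= _);first by apply: (ler_wpM2r (ltW ep));rewrite mulrDr mulr1 lerDl.
   by rewrite mulrC -ler_pdivlMr ?mulr_gt0 ?ltr_wpDl// /e ge_min lexx orbT.
  exists e => // y' ty yt;have yE : t + (y' - t) = y' by ring.
  have y0 : 0 <= y' - t by rewrite subr_ge0.
  have ye : y' - t <= e by rewrite lerBlDl.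
  rewrite -yE;apply: (@gronwall_zero en l t (y' - t) C) => // [|z tz zt].
   by apply: leT eC;apply: ler_wpM2l;rewrite ?mulr_ge0.
  have z0':= leT t0 tz;split => //;first exact: den.
  have [zp|z_0]:= ltP 0 z.
   apply: rate => // c;apply: YB => //;rewrite ger0_norm ?subr_ge0//;apply: leT (er c).
   by apply: leT ye;rewrite lerBlDl.
  have ezt : z = t by apply/le_anti;rewrite tz (leT z_0 t0).
  (* The rate estimate holds for positive times; at z = t = 0 the derivative vanishes together with
     the energy. *)
  have -> : l z = 0.
   rewrite /l ezt big1// => c _;have [n1 n2]:= nz t c et.
   have ip0 j : (j <= 2)%N -> nrm (d c t j) = 0 -> ip (d c t j) (w c t j) = 0.
    move=> j2 n0;apply/eqP;rewrite -normr_le0;have:= CS (isH_l2 (hd c t t0) (leq_trans j2 _)) (isH_l2 (hw c t t0) j2).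
    by rewrite n0 mul0r;apply.
   by rewrite !ip0// mulr0 addr0.
  by rewrite mulr_ge0.
 - apply/eqP;rewrite -normr_le0;apply: (@le_eps R _ 0 1) => // e e0 _;rewrite add0r mulr1.
  have [r r0 hr]:= sdiff_continuous (den t (ltW tp)) e0;pose y':= Num.max 0 (t - r).
  have yt : y' < t by rewrite gt_max tp ltrBlDr ltrDl.
  have y0 : 0 <= y' by rewrite le_max lexx.
  have:= hr y' y0;rewrite IH// sub0r normrN;apply.
  by rewrite distrC gtr0_norm ?subr_gt0// lerBlDr -lerBlDl le_max lexx orbT.
move=> s t s0 t0;rewrite -(mkvecK (y s t)) -(mkvecK (x s t));congr mkvec;apply/funext => c.
have [-> _ _]:= vy c s t s0 t0;have [-> _ _]:= vx c s t s0 t0;congr (_ + _).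
apply/eqP;rewrite -subr_eq0 -dE -normr_le0;have h:= hd c t t0;have [n1 _]:= nz t c (enz t t0).
apply: (@le_eps R _ 0 (nrm (d c t 0%N)));first exact: nrm_ge0.
(* The energy controls derivatives of the displacement difference only. A constant in L2 is zero,
   seen here by averaging over intervals of length e^-2. *)
move=> e e0 _;rewrite add0r;have ei : 0 < e^-1 by rewrite invr_gt0.
have:= prim_sup_scaled (isH_prim h (j:= 0) isT) (isH_l2 h (leq0n 4)) (proj2 (dom_ge0 _) s0) ei.
by rewrite n1 mulr0 addr0 ler_pdivrMr// mulrC.
Qed.

End SolutionChains.

End Uniqueness.

Theorem theorem5p2 (R : realType) (m : nat) (x0 v0 a0 : R -> vec R) :
  (forall s, 0 <= s -> vsderiv x0 s (v0 s)) ->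
  (forall s, 0 <= s -> vsderiv v0 s (a0 s)) ->
  (forall i, (i < 3)%N -> inH (2 + m) (fun s => vc i (a0 s))) ->
  (forall s, 0 <= s -> vnorm (v0 s) = 1) ->
  vc 2 (x0 0) = 0 ->
  compatA ((2 + m)./2) v0 a0 ->
  exists x xs xss : R -> R -> vec R,
    Sol m x0 x xs xss /\
    (forall s t, 0 <= s -> 0 <= t -> vnorm (xs s t) = 1) /\
    (forall y ys yss, Sol m x0 y ys yss ->
       forall s t, 0 <= s -> 0 <= t -> y s t = x s t).
Proof.
move=> dx dv ha nv _ comp; have [x [xs [xss [Sx nx]]]] := solution_exists dx dv ha nv comp.
have [A hA] := acceleration_chain dx dv ha; exists x, xs, xss; split=> //; split=> // y ys yss Sy.
exact: (solution_unique hA Sx Sy).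
Qed.
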